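(* Let $u \in \mathscr{S}'(\mathbb{R}^d)$, $m,s \in \mathbb{R}$ and $a \in G^m$. Then $$\mathrm{WF}_{Q^{s-m}}(a^w(x,D) u) \subseteq \mathrm{WF}_{Q^{s}}(u)\subseteq \mathrm{WF}_{Q^{s-m}}(a^w(x,D)u) \cup \operatorname{char}(a)$$ and $$\mathrm{WF}_{Q^{s-m}}(A_a u) \subseteq \mathrm{WF}_{Q^{s}}(u)\subseteq \mathrm{WF}_{Q^{s-m}}(A_au) \cup \operatorname{char}(a).$$
   Context: Notation: $\langle z\rangle = \sqrt{1+|z|^2}$; $T^*\mathbb{R}^d$ is identified with $\mathbb{R}^{2d}$, with points $z=(x,\xi)$, and $T^*\mathbb{R}^d\setminus 0 = \mathbb{R}^{2d}\setminus\{0\}$. A set is conic (a cone) if it is invariant under multiplication by positive scalars. $(\cdot,\cdot)$ is the $L^2$ inner product, conjugate linear in the second argument, extended to the pairing of $\mathscr{S}'$ with $\mathscr{S}$. Shubin symbols: for $m \in \mathbb{R}$, $G^m$ is the set of $a \in C^\infty(\mathbb{R}^{2d})$ such that for all $\alpha \in \mathbb{N}^{2d}$ there is $C_\alpha>0$ with $|\partial^\alpha a(z)| \le C_\alpha \langle z\rangle^{m-|\alpha|}$ for all $z \in \mathbb{R}^{2d}$. Characteristic set: for $a \in G^m$, $\operatorname{char}(a)\subseteq T^*\mathbb{R}^d\setminus 0$ (relative to the order $m$) is defined by: $z_0\notin\operatorname{char}(a)$ iff there are an open conic set $\Gamma\subseteq T^*\mathbb{R}^d\setminus 0$ containing $z_0$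 and constants $C, A>0$, $C_\alpha>0$ ($\alpha\in\mathbb{N}^{2d}$) such that $|a(z)|\ge C\langle z\rangle^{m}$ and $|\partial^\alpha a(z)|\le C_\alpha|a(z)|\langle z\rangle^{-|\alpha|}$ for all $\alpha$ and all $z\in\Gamma$ with $|z|\ge A$. Weyl quantization: $a^w(x,D)u(x) = (2\pi)^{-d}\int_{\mathbb{R}^{2d}} e^{i(x-y)\cdot\xi}\, a((x+y)/2,\xi)\,u(y)\,dy\,d\xi$ for $u \in \mathscr{S}(\mathbb{R}^d)$ (as an oscillatory integral); for $a \in G^m$ it is continuous on $\mathscr{S}(\mathbb{R}^d)$ and extends by duality to a continuous operator on $\mathscr{S}'(\mathbb{R}^d)$. Short-time Fourier transform: for $u \in \mathscr{S}'(\mathbb{R}^d)$ and $\varphi\in\mathscr{S}(\mathbb{R}^d)\setminus\{0\}$, $V_\varphi u(x,\xi) = (u, M_\xi T_x \varphi)$, where $M_\xi T_x\varphi(y) = e^{iy\cdot\xi}\varphi(y-x)$. Localization operator: with $\psi_0(y) = \pi^{-d/4}e^{-|y|^2/2}$, $A_a$ is defined weakly by $(A_a f,g) = (2\pi)^{-d}(a V_{\psi_0}f, V_{\psi_0}g)$ for $g \in \mathscr{S}(\mathbb{R}^d)$; for $a \in G^m$ it acts on $f\in\mathscr{S}'(\mathbb{R}^d)$. Sobolev–Gabor wave front set: fix any $\varphi \in \mathscr{S}(\mathbb{R}^d)\setminus\{0\}$ (the definition does not depend on this choice). For $u\in\mathscr{S}'(\mathbb{R}^d)$ and $s\in\mathbb{R}$,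 $\mathrm{WF}_{Q^s}(u)\subseteq T^*\mathbb{R}^d\setminus 0$ is defined by: $z_0 \in T^*\mathbb{R}^d\setminus 0$ satisfies $z_0\notin \mathrm{WF}_{Q^s}(u)$ iff there is an open cone $\Gamma \subseteq \mathbb{R}^{2d}\setminus 0$ containing $z_0$ with $\int_\Gamma \langle z\rangle^{2s}|V_\varphi u(z)|^2\,dz<\infty$. *)

(* Defs.v *)
From HB Require Import structures.
From mathcomp Require Import all_boot all_order all_algebra.
From mathcomp Require Import all_classical all_reals all_analysis.
From mathcomp Require Import complex.

Set Implicit Arguments.
Unset Strict Implicit.
Unset Printing Implicit Defensive.

Import Order.TTheory GRing.Theory Num.Theory.
Import numFieldNormedType.Exports.

Local Open Scope classical_set_scope.
Local Open Scope ring_scope.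

(* Points of R^n are row vectors.  The norm of the library on 'rV[R]_n is the
   sup norm, hence the separate Euclidean norm [enorm].
   T^*R^d = R^(2d) is 'rV[R]_(d + d), with z = row_mx x xi. *)
Section Euclidean.
Context {R : realType}.

Definition dotv n (x y : 'rV[R]_n) : R := \sum_i x 0 i * y 0 i.

Definition enorm n (x : 'rV[R]_n) : R := Num.sqrt (dotv x x).

Definition bracket n (x : 'rV[R]_n) : R := Num.sqrt (1 + enorm x ^+ 2).

(* e^{i theta} *)
Definition expi (theta : R) : R[i] := Complex (cos theta) (sin theta).

Definition conjf n (f : 'rV[R]_n -> R[i]) : 'rV[R]_n -> R[i] :=
  fun x => conjc (f x).

Definition conic n (Gamma : set 'rV[R]_n) : Prop :=
  forall (t : R) z, 0 < t -> Gamma z -> Gamma (t *: z).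

Definition open_cone n (Gamma : set 'rV[R]_n) : Prop :=
  [/\ open Gamma, conic Gamma & Gamma `<=` [set z | z <> 0]].

End Euclidean.

Section SigmaFiniteCons.
Context {R : realType} {d : measure_display} {T : measurableType d}.

Lemma sigma_finite_cons n (l : {sigma_finite_measure set T -> \bar R})
    (mu : {sigma_finite_measure set (n.-tuple T) -> \bar R}) :
  exists nu : {sigma_finite_measure set (n.+1.-tuple T) -> \bar R},
    pushforward (l \x mu)%E (fun p : T * n.-tuple T => [tuple of p.1 :: p.2])
    = nu :> (set (n.+1.-tuple T) -> \bar R).
Proof.
pose c (p : T * n.-tuple T) : n.+1.-tuple T := [tuple of p.1 :: p.2].
have mc : measurable_fun [set: (T * n.-tuple T)%type] c.
  by apply: measurable_cons => //=; exact: measurable_snd.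
pose nu : set (n.+1.-tuple T) -> \bar R := pushforward (l \x mu)%E c.
have nu0 : nu set0 = 0%E by rewrite /nu /pushforward preimage_set0 measure0.
have nuge A : (0 <= nu A)%E by exact: measure_ge0.
have nusa : semi_sigma_additive nu.
  move=> F mF tF mUF; rewrite /nu /pushforward preimage_bigcup.
  apply: measure_semi_sigma_additive.
  - by move=> k; rewrite -[X in measurable X]setTI; exact: mc.
  - apply/trivIsetP => /= i j _ _ ij; rewrite -preimage_setI.
    by move/trivIsetP: tF => -> //; rewrite preimage_set0.
  - by rewrite -preimage_bigcup -[X in measurable X]setTI; exact: mc.
pose M := isMeasure.Build _ _ _ nu nu0 nuge nusa.
pose nu1 : {measure set (n.+1.-tuple T) -> \bar R} := HB.pack nu M.
pose g (t : n.+1.-tuple T) : T * n.-tuple T := (thead t, [tuple of behead t]).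
have mg : measurable_fun [set: n.+1.-tuple T] g.
  by apply: measurable_fun_pair; [exact: measurable_tnth|exact: measurable_behead].
have cg p : g (c p) = p.
  by case: p => x t; rewrite /g /c /=; congr pair; apply/val_inj.
have nus : sigma_finite setT nu1.
  have [F FT Fm] : sigma_finite setT (l \x mu)%E.
    have /sigma_finiteP[F [TF ndF Foo]] := sigma_finiteT l.
    have /sigma_finiteP[G [TG ndG Goo]] := sigma_finiteT mu.
    exists (fun n => F n `*` G n).
     rewrite -setXTT TF TG predeqE => -[x y]; split.
        move=> [/= [k1 _ Fnx] [k _ Gky]]; exists (maxn k1 k) => //; split.
        - by move: x Fnx; exact/subsetPset/ndF/leq_maxl.
        - by move: y Gky; exact/subsetPset/ndG/leq_maxr.
      by move=> [k1 _ []/= ? ?]; split; exists k1.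
    move=> k; have [? ?] := Foo k; have [? ?] := Goo k.
    split; first exact: measurableX.
    by rewrite product_measure1E// lte_mul_pinfty// ge0_fin_numE.
  exists (fun k => g @^-1` F k).
    by rewrite -preimage_bigcup -FT preimage_setT.
  move=> k; have [mF Foo] := Fm k; split.
    by rewrite -[X in measurable X]setTI; exact: mg.
  rewrite /nu1 /= /nu /pushforward (_ : c @^-1` _ = F k) //.
  by apply/seteqP; split => p /=; rewrite cg.
pose H := Measure_isSigmaFinite.Build _ _ _ nu1 nus.
by exists (HB.pack nu M H : {sigma_finite_measure set (n.+1.-tuple T) -> \bar R}).
Qed.

End SigmaFiniteCons.

(* Lebesgue measure on R^n, on the Borel sets of n.-tuple R:
   leb 0 is the unit mass at the only point and leb n.+1 is the product of the
   Lebesgue measure on R with leb n, transported by (x, t) |-> x :: t. *)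
Section Integration.
Context {R : realType}.

Fixpoint leb (n : nat) : set (n.-tuple (measurableTypeR R)) -> \bar R :=
  match n with
  | 0 => dirac [tuple]
  | n'.+1 => pushforward (@lebesgue_measure R \x @leb n')%E
      (fun p : measurableTypeR R * n'.-tuple (measurableTypeR R) =>
         [tuple of p.1 :: p.2])
  end.

Lemma leb_sigma_finite n :
  exists mu : {sigma_finite_measure set (n.-tuple (measurableTypeR R)) -> \bar R},
    @leb n = mu :> (set (n.-tuple (measurableTypeR R)) -> \bar R).
Proof.
elim: n => [|n [mu IH]] /=.
  by exists (dirac [tuple] : {sigma_finite_measure set (0.-tuple (measurableTypeR R)) -> \bar R}).
rewrite IH; exact: (sigma_finite_cons lebesgue_measure mu).
Qed.

Section LebInstance.
Variable n : nat.

Let leb0 : @leb n set0 = 0%E.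
Proof. by have [mu ->] := leb_sigma_finite n; exact: measure0. Qed.

Let leb_ge0 A : (0 <= @leb n A)%E.
Proof. by have [mu ->] := leb_sigma_finite n; exact: measure_ge0. Qed.

Let leb_semi_sigma_additive : semi_sigma_additive (@leb n).
Proof.
by have [mu ->] := leb_sigma_finite n; exact: measure_semi_sigma_additive.
Qed.

HB.instance Definition _ := isMeasure.Build _ _ _ (@leb n)
  leb0 leb_ge0 leb_semi_sigma_additive.

Let leb_sigma_finiteT : sigma_finite setT (@leb n).
Proof. by have [mu ->] := leb_sigma_finite n; exact: sigma_finiteT. Qed.

HB.instance Definition _ := Measure_isSigmaFinite.Build _ _ _ (@leb n)
  leb_sigma_finiteT.

End LebInstance.

Definition row_of n (t : n.-tuple (measurableTypeR R)) : 'rV[R]_n :=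
  \row_i tnth t i.

Definition integralV n (D : set 'rV[R]_n) (f : 'rV[R]_n -> \bar R) : \bar R :=
  (\int[@leb n]_(t in @row_of n @^-1` D) f (row_of t))%E.

Definition integralC n (f : 'rV[R]_n -> R[i]) : R[i] :=
  Complex (fine (integralV setT (fun x => (complex.Re (f x))%:E)))
          (fine (integralV setT (fun x => (complex.Im (f x))%:E))).

End Integration.

Section Calculus.
Context {R : realType} {n : nat}.
Implicit Types (f : 'rV[R]_n -> R[i]) (alpha : 'I_n -> nat).

Definition partial (i : 'I_n) f : 'rV[R]_n -> R[i] :=
  fun x => Complex ('D_(delta_mx 0 i) (fun y => complex.Re (f y)) x)
                   ('D_(delta_mx 0 i) (fun y => complex.Im (f y)) x).

Definition partials (s : seq 'I_n) f := foldr partial f s.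

Definition smooth f : Prop :=
  forall s : seq 'I_n,
    [/\ continuous (fun y => complex.Re (partials s f y)),
        continuous (fun y => complex.Im (partials s f y)) &
        forall (i : 'I_n) x,
          derivable (fun y => complex.Re (partials s f y)) x (delta_mx 0 i) /\
          derivable (fun y => complex.Im (partials s f y)) x (delta_mx 0 i)].

Definition mlen alpha : nat := (\sum_i alpha i)%N.

Definition mpow alpha (x : 'rV[R]_n) : R := \prod_i x 0 i ^+ alpha i.

Definition mpartial alpha f : 'rV[R]_n -> R[i] :=
  foldr (fun i g => iter (alpha i) (partial i) g) f (enum 'I_n).

Definition schwartz f : Prop :=
  smooth f /\
  forall alpha beta : 'I_n -> nat, exists C : R,
    forall x, `|mpow alpha x| * Normc.normc (mpartial beta f x) <= C.

(* Tempered distributions are linear forms on the Schwartz space that are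
   bounded by finitely many Schwartz seminorms.  A distribution is represented
   by a function on all of R^n -> C whose values outside the Schwartz space are
   irrelevant. *)
Definition tempered (u : ('rV[R]_n -> R[i]) -> R[i]) : Prop :=
  (forall (c : R[i]) f g, schwartz f -> schwartz g ->
     u (fun x => c * f x + g x) = c * u f + u g) /\
  exists (k : nat) (M : R), forall f, schwartz f -> forall B : R,
    (forall alpha beta : 'I_n -> nat, (mlen alpha <= k)%N -> (mlen beta <= k)%N ->
       forall x, `|mpow alpha x| * Normc.normc (mpartial beta f x) <= B) ->
    Normc.normc (u f) <= M * B.

(* (u, g), conjugate linear in g. *)
Definition pairing (u : ('rV[R]_n -> R[i]) -> R[i]) (g : 'rV[R]_n -> R[i]) : R[i] :=
  u (conjf g).

Definition dist_of (f : 'rV[R]_n -> R[i]) : ('rV[R]_n -> R[i]) -> R[i] :=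
  fun g => integralC (fun x => f x * g x).

(* The oscillatory integral of F is the common limit, as eps -> 0+, of the
   absolutely convergent integrals of chi(eps x) F(x), for all Schwartz cutoffs
   chi with chi(0) = 1; it defaults to 0 if there is no such limit. *)
Definition osc_integral (F : 'rV[R]_n -> R[i]) : R[i] :=
  xget 0 [set l : R[i] | forall chi, schwartz chi -> chi 0 = 1 ->
    let I (eps : R) := integralC (fun x => chi (eps *: x) * F x) in
    complex.Re (I eps) @[eps --> 0^'+] --> complex.Re l /\
    complex.Im (I eps) @[eps --> 0^'+] --> complex.Im l].

End Calculus.

Section Symbols.
Context {R : realType} {d : nat}.
Implicit Types (a : 'rV[R]_(d + d) -> R[i]).

Definition shubin (m : R) a : Prop :=
  smooth a /\
  forall alpha : 'I_(d + d) -> nat, exists2 C : R, 0 < C &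
    forall z, Normc.normc (mpartial alpha a z)
              <= C * bracket z `^ (m - (mlen alpha)%:R).

Definition noncharacteristic (m : R) a (z0 : 'rV[R]_(d + d)) : Prop :=
  exists (Gamma : set 'rV[R]_(d + d)) (C A : R)
         (Cd : ('I_(d + d) -> nat) -> R),
  [/\ open_cone Gamma, Gamma z0, 0 < C, 0 < A &
   (forall alpha, 0 < Cd alpha) /\
   forall z, Gamma z -> A <= enorm z ->
     C * bracket z `^ m <= Normc.normc (a z) /\
     forall alpha, Normc.normc (mpartial alpha a z)
       <= Cd alpha * Normc.normc (a z) * bracket z `^ (- (mlen alpha)%:R)].

Definition char_set (m : R) a : set 'rV[R]_(d + d) :=
  [set z0 | z0 <> 0 /\ ~ noncharacteristic m a z0].

End Symbols.

Section Operators.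
Context {R : realType} {d : nat}.
Implicit Types (a : 'rV[R]_(d + d) -> R[i]) (f g : 'rV[R]_d -> R[i])
  (u : ('rV[R]_d -> R[i]) -> R[i]) (z : 'rV[R]_(d + d)).

Definition two_pi_pow : R[i] := ((2 * pi : R) ^- d)%:C%C.

(* The integration variable is w = (y, xi). *)
Definition weyl_schwartz a f : 'rV[R]_d -> R[i] := fun x =>
  two_pi_pow * osc_integral (fun w : 'rV[R]_(d + d) =>
    let y := lsubmx w in let xi := rsubmx w in
    expi (dotv (x - y) xi) * a (row_mx (2^-1 *: (x + y)) xi) * f y).

(* Extension by duality: the formal adjoint of a^w is the Weyl quantization of
   the conjugate symbol, so (a^w u, g) = (u, (conj a)^w g); the linear form
   evaluated at g is the pairing with conj g. *)
Definition weyl a u : ('rV[R]_d -> R[i]) -> R[i] :=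
  fun g => pairing u (weyl_schwartz (conjf a) (conjf g)).

(* M_xi T_x phi *)
Definition tf_shift z f : 'rV[R]_d -> R[i] :=
  fun y => expi (dotv y (rsubmx z)) * f (y - lsubmx z).

Definition stft f u : 'rV[R]_(d + d) -> R[i] := fun z => pairing u (tf_shift z f).

Definition psi0 : 'rV[R]_d -> R[i] :=
  fun y => ((pi : R) `^ (- (d%:R / 4)) * expR (- (enorm y ^+ 2 / 2)))%:C%C.

(* (A_a u, conj g) = (2 pi)^-d (a V u, V (conj g)) *)
Definition localization a u : ('rV[R]_d -> R[i]) -> R[i] := fun g =>
  two_pi_pow * integralC (fun z : 'rV[R]_(d + d) =>
    a z * stft psi0 u z * conjc (stft psi0 (dist_of (conjf g)) z)).

Definition WF (phi : 'rV[R]_d -> R[i]) (s : R) u : set 'rV[R]_(d + d) :=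
  [set z0 | z0 <> 0 /\
    ~ exists Gamma : set 'rV[R]_(d + d),
      [/\ open_cone Gamma, Gamma z0 &
        (integralV Gamma (fun z =>
           (bracket z `^ (2 * s) * Normc.normc (stft phi u z) ^+ 2)%:E)
         < +oo)%E]].

End Operators.

(* Main.v *)
(* Proof idea.  Write V for the short-time Fourier transform of u with window phi and W for
   that of a^w u, resp. A_a u.  The inversion formula for the transform gives, for kernels
   decaying faster than any power of <z - w>, the two estimates
     |W(z)| <= C <z>^m int <z-w>^-N |V(w)| dw,
     |W(z) - c a(z) V(z)| <= C <z>^(m-1) int <z-w>^-N |V(w)| dw
   with a constant c <> 0; for the Weyl quantization they follow from
   (conj a)^w (pi(z) phi) = pi(z) (conj a(. + z))^w phi and the Taylor expansion of order one
   of a at z.  (For A_a one first passes to the window psi_0.)  Convolution with such kernels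
   preserves weighted square integrability on cones, up to shrinking the cone, which gives
   the first inclusion.  Where a is elliptic the second estimate bounds <z>^m |V| by |W| plus
   an error of order m - 1; as V has polynomial growth, it is regular at some very negative
   order, and each application gains one order until order s is reached.  No parametrix is
   needed. *)

Require Import Defs.
From HB Require Import structures.
From mathcomp Require Import all_boot all_order all_algebra.
From mathcomp Require Import all_classical all_reals all_analysis.
From mathcomp Require Import measurable_realfun complex ring lra.
Import Order.TTheory GRing.Theory Num.Theory.
Import numFieldNormedType.Exports.
Local Open Scope classical_set_scope.
Local Open Scope ring_scope.

Set Implicit Arguments.
Unset Strict Implicit.
Unset Printing Implicit Defensive.

Local Notation Re := complex.Re.
Local Notation Im := complex.Im.

(** * Measurability and integration on R^n *)

Section Rounding.
Context {R : realType}.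
Notation T n := (n.-tuple (measurableTypeR R)).

(** The kernel bounds must be uniform in the phase space point [z], while the symbol acting on the
    window changes with [z]. Smooth and Schwartz functions are therefore treated as families with
    joint control of all derivatives ([dbd], [sfam]), and these classes are closed under the
    operations of the proof, the Weyl integral included. A distribution is a bare function, known
    only to be linear and bounded by seminorms on the Schwartz space; that it commutes with an
    integral of test functions has to be proved, and the inversion formula for [u] depends on it.
    The transform of [u] is continuous, but that of its image under an operator is not shown to be
    measurable. It only enters monotone comparisons of integrals, and constants are always moved to
    a measurable function. The error for the localization operator is governed by the transform with
    window [psi0] although regularity is measured with [phi]; hence the bootstrap carries a function
    [U] besides [V] and [W]. The inversion constants matter only through being nonzero and are not
    evaluated. *)

Definition tup_of n (x : 'rV[R]_n) : T n := [tuple x 0 i | i < n].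

Lemma row_ofE n (t : T n) i : row_of t 0 i = tnth t i.
Proof. by rewrite mxE. Qed.

Lemma tup_ofK n : cancel (@tup_of n) (@row_of R n).
Proof. by move=> x; apply/rowP => i; rewrite row_ofE tnth_mktuple. Qed.

(** The topology is that of row vectors, the sigma-algebra that of tuples, so measurability is
    tested on the pullback along [row_of]. *)
Definition mble n (f : 'rV[R]_n -> R) : Prop :=
  measurable_fun [set: T n] (fun t => f (row_of t)).

Lemma mble_coord n i : mble (fun x : 'rV[R]_n => x 0 i).
Proof.
rewrite /mble; under eq_fun do rewrite row_ofE.
exact: (@measurable_tnth _ (measurableTypeR R) n i).
Qed.

(** Rounding down to a grid of mesh [1 / N.+1], clamped to [[-N, N]]. Monotonicity makes it Borel,
    the clamping makes its range finite. *)
Definition rnd (N : nat) (r : R) : R :=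
  Num.max (- N%:R) (Num.min N%:R ((Num.floor (r * N.+1%:R))%:~R / N.+1%:R)).

Lemma rnd_homo N : {homo rnd N : x y / x <= y}.
Proof.
move=> x y xy; rewrite /rnd; apply: le_max2 => //; apply: le_min2 => //.
by rewrite ler_pM2r ?invr_gt0 ?ltr0n// ler_int le_floor// ler_pM2r ?ltr0n.
Qed.

Lemma rnd_near N r : `|r| <= N%:R -> `|r - rnd N r| <= N.+1%:R^-1.
Proof.
rewrite ler_norml => /andP[h1 h2].
have N0 : 0 < N.+1%:R :> R by rewrite ltr0n.
set z := Num.floor (r * N.+1%:R).
have zl : z%:~R <= r * N.+1%:R by exact: floor_le_tmp.
have zr : r * N.+1%:R < z%:~R + 1 by rewrite -[1]/(1%:~R) -intrD floorD1_gt.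
have a1 : z%:~R / N.+1%:R <= r by rewrite ler_pdivrMr.
have a2 : r < z%:~R / N.+1%:R + N.+1%:R^-1.
  by rewrite -[X in _ + X]mul1r -mulrDl ltr_pdivlMr.
have a3 : - N%:R <= z%:~R / N.+1%:R :> R.
  rewrite ler_pdivlMr// mulNr -natrM pmulrn -mulrNz ler_int /z floor_ge_int mulrNz.
  by rewrite -pmulrn natrM -mulNr ler_pM2r.
have E : rnd N r = z%:~R / N.+1%:R.
  by rewrite /rnd -/z min_r ?(le_trans a1)// max_r.
rewrite E ger0_norm ?subr_ge0//.
by rewrite lerBlDl ltW.
Qed.

Lemma rnd_bound N r : `|rnd N r| <= `|r| + 1.
Proof.
have [h|h] := leP `|r| N%:R.
  have := rnd_near h; rewrite distrC => h'.
  rewrite -[rnd N r](subrK r) addrC (le_trans (ler_normD _ _))// lerD2l.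
  by rewrite (le_trans h')// invf_le1 ?ltr0n// ler1n.
apply: (@le_trans _ _ N%:R); last by rewrite (le_trans (ltW h))// lerDl.
rewrite ler_norml /rnd le_max lexx/= ge_max ge_min lexx /= andbT.
by rewrite (@le_trans _ _ 0)// oppr_le0.
Qed.

Definition rnd_vals (N : nat) : seq R :=
  [seq (k%:R - (N * N.+1)%:R) / N.+1%:R | k <- iota 0 (2 * (N * N.+1)).+1].

Lemma rnd_valsP N r : rnd N r \in rnd_vals N.
Proof.
have N0 : 0 < N.+1%:R :> R by rewrite ltr0n.
suff [z [z1 z2 ->]] : exists z : int, [/\ - ((N * N.+1)%:Z) <= z,
    z <= (N * N.+1)%:Z & rnd N r = z%:~R / N.+1%:R].
  apply/mapP; exists (absz (z + (N * N.+1)%:Z)).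
    rewrite mem_iota add0n ltnS /=.
    rewrite -lez_nat gez0_abs; last by rewrite -lerBlDr sub0r.
    by rewrite mulSn mul1n PoszD lerD2r.
  congr (_ / _); rewrite pmulrn gez0_abs; last by rewrite -lerBlDr sub0r.
  by rewrite intrD -pmulrn addrK.
(* The clamping values [N] and [- N] are grid points themselves. *)
have NE : N%:R = (N * N.+1)%:Z%:~R / N.+1%:R :> R.
  by rewrite -pmulrn natrM mulfK ?gt_eqF.
set z := Num.floor (r * N.+1%:R).
rewrite /rnd -/z.
case: (leP N%:R (z%:~R / N.+1%:R)) => h.
  exists (N * N.+1)%:Z; split => //.
    by rewrite (@le_trans _ _ 0)// oppr_le0.
  by rewrite max_r// (@le_trans _ _ 0)// oppr_le0.
case: (leP (- N%:R) (z%:~R / N.+1%:R)) => h'.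
  exists z; split => //.
    by move: h'; rewrite NE -mulNr ler_pM2r ?invr_gt0// -mulrNz ler_int.
  by move: (ltW h); rewrite NE ler_pM2r ?invr_gt0// ler_int.
exists (- (N * N.+1)%:Z); split => //.
  by rewrite (@le_trans _ _ 0)// oppr_le0.
by rewrite NE mulrNz mulNr.
Qed.

(* Rounding to a finite grid.  Since [qv N] has finitely many values and tends to the
   identity, [f \o qv N] is a simple function approximating a continuous [f]. *)
Definition qv n (N : nat) (x : 'rV[R]_n) : 'rV[R]_n := \row_i rnd N (x 0 i).

Definition qvals n (N : nat) : seq 'rV[R]_n :=
  undup [seq \row_i (rnd_vals N)`_(f i) |
    f : {ffun 'I_n -> 'I_(size (rnd_vals N))}].

Lemma qvalsP n N (x : 'rV[R]_n) : qv N x \in qvals n N.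
Proof.
rewrite mem_undup; apply/mapP.
have h i : (index (rnd N (x 0%R i)) (rnd_vals N) < size (rnd_vals N))%N.
  by rewrite index_mem rnd_valsP.
exists [ffun i => Ordinal (h i)]; first by rewrite mem_enum.
by apply/rowP => i; rewrite !mxE ffunE/= nth_index ?rnd_valsP.
Qed.

(** Each value occurs once in [qvals], thanks to [undup], so exactly one term survives. The ring is
    general because both real and complex integrands are rounded. *)
Lemma qv_sum (S : pzRingType) n N (f : 'rV[R]_n -> S) (x : 'rV[R]_n) :
  f (qv N x) = \sum_(v <- qvals n N) f v * (qv N x == v)%:R.
Proof.
rewrite (bigD1_seq (qv N x)) ?undup_uniq ?qvalsP//= eqxx mulr1 big1 ?addr0//.
by move=> v vq; rewrite eq_sym (negbTE vq) mulr0.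
Qed.

Lemma mble_qv_eq n N (v : 'rV[R]_n) : mble (fun x => (qv N x == v)%:R).
Proof.
have -> : (fun x : 'rV[R]_n => (qv N x == v)%:R) =
    (fun x => \prod_i (rnd N (x 0 i) == v 0 i)%:R) :> ('rV[R]_n -> R).
  apply/funext => x; case: eqVneq => [<-|nE].
    by rewrite big1// => i _; rewrite mxE eqxx.
  have [i hi] : exists i, rnd N (x 0 i) != v 0 i.
    apply/existsP; rewrite -negb_forall; apply: contra nE => /forallP h.
    by apply/eqP/rowP => i; rewrite mxE; exact/eqP.
  by rewrite (bigD1 i)//= (negbTE hi) mul0r.
apply: measurable_prod => i _ /=.
have mq : measurable_fun [set: T n] (fun t => rnd N (row_of t 0 i)).
  apply: (measurableT_comp _ (@mble_coord n i)).
  apply: nondecreasing_measurable => //.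
  by move=> *; exact: rnd_homo.
have mb := measurable_fun_eqr mq (@measurable_cst _ _ _ _ setT (v 0 i)).
rewrite (_ : (fun _ => _) = (\1_[set t : T n | rnd N (row_of t 0 i) == v 0 i])).
  apply/measurable_indicP.
  have := mb measurableT [set true] I; rewrite setTI.
  by congr measurable; apply/seteqP; split => t /=.
by apply/funext => t; rewrite indicE mem_setE.
Qed.

(** The function [f] is arbitrary: composed with [qv N] it is a finite combination of indicators of
    the measurable sets on which [qv N] is constant. *)
Lemma mble_qv n N (f : 'rV[R]_n -> R) : mble (fun x => f (qv N x)).
Proof.
rewrite (_ : (fun x => _) =
  (fun x => \sum_(v <- qvals n N) f v * (qv N x == v)%:R)); last first.
  by apply/funext => x; exact: qv_sum.
apply: measurable_sum => v; apply: measurable_funM => //.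
exact: mble_qv_eq.
Qed.

Lemma norm_rV_le n (x : 'rV[R]_n) c :
  0 <= c -> (forall i, `|x 0 i| <= c) -> `|x| <= c.
Proof.
move=> c0 h; rewrite /Num.norm/= mx_normE.
have -> : c = (NngNum c0)%:num by [].
rewrite num_le; apply/bigmax_leP; split => [|[i j] _]; rewrite -num_le//=.
by rewrite ord1.
Qed.

Lemma norm_coord n (x : 'rV[R]_n) i : `|x 0 i| <= `|x|.
Proof.
rewrite {2}/Num.norm/= mx_normE.
have -> : `|x 0 i| = (`|x (0 : 'I_1, i).1 (0 : 'I_1, i).2|%:nng)%:num by [].
by rewrite num_le; exact: (le_bigmax _ (fun ij : 'I_1 * 'I_n => `|x ij.1 ij.2|%:nng)).
Qed.

Lemma qv_near n N (x : 'rV[R]_n) :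
  `|x| <= N%:R -> `|x - qv N x| <= N.+1%:R^-1.
Proof.
move=> xN; apply: norm_rV_le => // i; rewrite !mxE.
by apply: rnd_near; rewrite (le_trans (norm_coord x i)).
Qed.

Lemma qv_bound n N (x : 'rV[R]_n) : `|qv N x| <= `|x| + 1.
Proof.
apply: norm_rV_le => [|i]; first by rewrite addr_ge0.
by rewrite mxE (le_trans (rnd_bound _ _))// lerD2r norm_coord.
Qed.

Lemma qv_cvg n (x : 'rV[R]_n) : qv N x @[N --> \oo] --> x.
Proof.
apply/cvgrPdist_le => e e0.
near=> N.
apply: (@le_trans _ _ N.+1%:R^-1).
  apply: qv_near; near: N; exact: nbhs_infty_ger.
rewrite invf_ple ?posrE ?ltr0n//.
by rewrite (@le_trans _ _ N%:R) ?ler_nat//; near: N; exact: nbhs_infty_ger.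
Unshelve. all: by end_near. Qed.

Lemma mble_cvg n (h : nat -> 'rV[R]_n -> R) f :
  (forall k, mble (h k)) -> (forall x, h k x @[k --> \oo] --> f x) -> mble f.
Proof.
move=> mh hf; apply: (@measurable_fun_cvg _ _ _ _ (fun k t => h k (row_of t))).
  exact: mh.
by move=> t _; exact: hf.
Qed.

Lemma continuous_mble n (f : 'rV[R]_n -> R) : continuous f -> mble f.
Proof.
move=> cf; apply: (mble_cvg (fun N => mble_qv N f)) => x.
exact: (continuous_cvg _ (cf x) (@qv_cvg n x)).
Qed.

(** A point lies in the open set [G] exactly if, for some [k], its roundings eventually have their
    ball of radius [1 / k.+1] inside [G]. For each single rounding this is a measurable condition,
    because [qv N] has finitely many values. *)
Lemma open_mble n (G : set 'rV[R]_n) : open G ->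
  measurable (@row_of R n @^-1` G).
Proof.
move=> oG.
pose Gk (k : nat) := [set x | ball x k.+1%:R^-1 `<=` G].
have mQ k N : measurable [set t : T n | Gk k (qv N (row_of t))].
  have := mble_qv N (fun x => (x \in Gk k)%:R : R).
  move=> /(_ measurableT [set 1]) => /(_ (measurable_set1 _)); rewrite setTI.
  congr measurable; apply/seteqP; split => t /=.
    by case: (boolP (_ \in _)) => [/set_mem//|_ /eqP]; rewrite eq_sym oner_eq0.
  by move=> h; rewrite mem_set.
rewrite (_ : _ @^-1` _ = \bigcup_k \bigcup_M \bigcap_(N in [set N | (M <= N)%N])
    [set t : T n | Gk k (qv N (row_of t))]).
  apply: bigcupT_measurable => k; apply: bigcupT_measurable => M.
  apply: bigcap_measurable => [|N _]; last exact: mQ.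
  by exists M => /=.
apply/seteqP; split => t /=.
  move=> Gt.
  have /nbhs_ballP[e e0 eG] : nbhs (row_of t) G by exact: open_nbhs_nbhs.
  have [k _ /(_ _ (leqnn _)) hk] : \forall k \near \oo, 2 / e <= k%:R.
    exact: nbhs_infty_ger.
  have ke : k.+1%:R^-1 <= e / 2.
    rewrite -[e / 2]invrK lef_pV2 ?posrE ?ltr0n ?invr_gt0 ?divr_gt0//.
    by rewrite invf_div (le_trans hk)// ler_nat.
  have := @qv_cvg n (row_of t) => /cvgrPdist_lt /(_ (e / 2)).
  rewrite divr_gt0// => /(_ isT)[M _ hM].
  exists k => //; exists M => //= N MN y.
  rewrite -ball_normE /= => hy; apply: eG; rewrite -ball_normE /=.
  rewrite -(subrKA (qv N (row_of t))) (le_lt_trans (ler_normD _ _))//.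
  rewrite [e]splitr ltrD ?(lt_le_trans hy)//.
  exact: hM.
move=> [k _ [M _ h]].
have := @qv_cvg n (row_of t) => /cvgrPdist_lt /(_ (k.+1%:R^-1)).
rewrite invr_gt0 ltr0n => /(_ isT)[M' _ hM'].
apply: (h (maxn M M')); first exact: leq_maxl.
by rewrite -ball_normE /= distrC; apply: hM'; exact: leq_maxr.
Qed.

End Rounding.

(** * Lebesgue measure on R^n: iterated integrals and affine substitutions *)

Section LebesgueRn.
Context {R : realType}.
Notation T n := (n.-tuple (measurableTypeR R)).
Notation lam := (@lebesgue_measure R).
Local Open Scope ereal_scope.

Definition pushm d1 d2 (T1 : measurableType d1) (T2 : measurableType d2)
    (m : {measure set T1 -> \bar R}) (f : T1 -> T2) (mf : measurable_fun setT f) :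
    {measure set T2 -> \bar R} :=
  measure_function_pushforward__canonical__measure_function_Measure m mf.

Lemma measurable_consP n :
  measurable_fun [set: (measurableTypeR R * T n)%type]
    (fun p => [tuple of p.1 :: p.2] : T n.+1).
Proof. by apply: measurable_cons => //=; exact: measurable_snd. Qed.

Lemma ge0_int_cons n (f : T n.+1 -> \bar R) :
  measurable_fun setT f -> (forall t, 0 <= f t) ->
  \int[@leb R n.+1]_t f t = \int[lam]_x \int[@leb R n]_t f [tuple of x :: t].
Proof.
move=> mf f0.
transitivity (\int[pushforward (lam \x @leb R n)
    (fun p => [tuple of p.1 :: p.2] : T n.+1)]_t f t).
  by [].
rewrite ge0_integral_pushforward//; last exact: measurable_consP.
rewrite preimage_setT fubini_tonelli1//.
  exact: (measurableT_comp mf (@measurable_consP n)).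
by move=> p; exact: f0.
Qed.

Lemma measurable_catP n m :
  measurable_fun [set: (T n * T m)%type] (fun p => cat_tuple p.1 p.2 : T (n + m)).
Proof.
apply/measurable_fun_tnthP => i; rewrite -(fintype.splitK i); case: (fintype.split i) => j /=.
  rewrite (_ : _ \o _ = fun p : T n * T m => tnth p.1 j).
    apply: (@measurableT_comp _ _ _ _ _ _ (fun x => tnth x j)) => //=.
    exact: measurable_tnth.
  by apply/funext => p /=; rewrite tnth_lshift.
rewrite (_ : _ \o _ = fun p : T n * T m => tnth p.2 j).
  apply: (@measurableT_comp _ _ _ _ _ _ (fun x => tnth x j)) => //=.
  exact: measurable_tnth.
by apply/funext => p /=; rewrite tnth_rshift.
Qed.

(** Induction on [n]: [leb] peels off one coordinate at a time, so splitting a vector into two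
    blocks amounts to repeated use of Tonelli. *)
Lemma ge0_int_cat n m (f : T (n + m) -> \bar R) :
  measurable_fun setT f -> (forall t, 0 <= f t) ->
  \int[@leb R (n + m)]_t f t =
  \int[@leb R n]_t \int[@leb R m]_s f (cat_tuple t s).
Proof.
elim: n f => [|n IH] f mf f0.
  transitivity (\int[dirac ([tuple] : T 0)]_t \int[@leb R m]_s f (cat_tuple t s)).
    rewrite integral_dirac//.
      rewrite diracT mul1e; apply: eq_integral => t _; congr (f _).
      exact/val_inj.
    apply: (@measurable_fun_fubini_tonelli_F _ _ _ _ _ (@leb R m) (f \o
      (fun p : T 0 * T m => cat_tuple p.1 p.2))) => //.
      by apply: (measurableT_comp mf); exact: (@measurable_catP 0 m).
    by move=> p; exact: f0.
  by [].
have mfc := measurableT_comp mf (@measurable_catP n.+1 m).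
rewrite [LHS](@ge0_int_cons (n + m) f)//.
rewrite [RHS](@ge0_int_cons n (fun t => \int[@leb R m]_s f (cat_tuple t s)))//;
  last 2 first.
- apply: (@measurable_fun_fubini_tonelli_F _ _ _ _ _ (@leb R m) (f \o
      (fun p : T n.+1 * T m => cat_tuple p.1 p.2))) => //.
  by move=> p; exact: f0.
- by move=> t; exact: integral_ge0.
apply: eq_integral => x _.
rewrite (IH (fun t => f [tuple of x :: t]))//; last first.
  have mfc2 := measurableT_comp mf (@measurable_consP (n + m)).
  apply: (measurableT_comp mfc2 (measurable_fun_pair _ _)) => //.
apply: eq_integral => t _; apply: eq_integral => s _; congr (f _).
exact/val_inj.
Qed.

Lemma leb_cat n m (A : set (T (n + m))) : measurable A ->
  @leb R (n + m) A = pushforward (@leb R n \x @leb R m)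
    (fun p => cat_tuple p.1 p.2 : T (n + m)) A.
Proof.
move=> mA.
have mC : measurable ((fun p : T n * T m => cat_tuple p.1 p.2 : T (n + m)) @^-1` A).
  by rewrite -[X in measurable X]setTI; exact: measurable_catP.
rewrite /pushforward -[LHS]mul1e -[RHS]mul1e -(integral_cst _ mA) -(integral_cst _ mC).
rewrite integral_mkcond [RHS]integral_mkcond ge0_int_cat//; last 2 first.
- by apply/(measurable_restrictT _ _).1 => //; exact: measurable_cst.
- by move=> t; rewrite erestrict_ge0.
rewrite fubini_tonelli1//.
- apply/(measurable_restrictT _ _).1 => //; exact: measurable_cst.
- by move=> t; rewrite erestrict_ge0.
Qed.

(** Lebesgue measure is determined by its values on half-open intervals, and there the rescaled
    push-forward agrees with it. *)
Lemma lebesgue_affine (c v : R) (A : set (measurableTypeR R)) : (0 < c)%R ->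
  measurable A ->
  lam A = c%:E * lam ((fun x => c * x + v)%R @^-1` A).
Proof.
move=> c0 mA.
have mf : measurable_fun [set: measurableTypeR R]
    ((fun x => c * x + v)%R : measurableTypeR R -> measurableTypeR R).
  by apply: measurable_funD => //; exact: mulrl_measurable.
pose mu := mscale (NngNum (ltW c0)) (pushm lam mf).
rewrite (lebesgue_measure_unique (mu := mu : {measure set _ -> \bar R}))// => _ [[a b]] _ <-.
rewrite /mu/= /mscale/= /pushforward/=.
rewrite (_ : _ @^-1` _ = `](a - v) / c, (b - v) / c]%classic)%R; last first.
  apply/seteqP; split => x /=; rewrite !in_itv/= ltr_pdivrMr// ler_pdivlMr//;
  by rewrite mulrC ltrBlDr lerBrDr.
rewrite !lebesgue_measure_itv/= !lte_fin ltr_pM2r ?invr_gt0// ltrD2r.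
case: ifPn => ab; last by rewrite mule0.
by rewrite -EFinB -EFinM -mulrBl opprD addrACA subrr addr0 mulrC mulfVK ?gt_eqF.
Qed.

Lemma ge0_int_affine1 (c v : R) (f : R -> \bar R) : (0 < c)%R ->
  measurable_fun setT f -> (forall t, 0 <= f t) ->
  c%:E * \int[lam]_x f (c * x + v)%R = \int[lam]_x f x.
Proof.
move=> c0 mf f0.
have ma : measurable_fun [set: measurableTypeR R]
    ((fun x => c * x + v)%R : measurableTypeR R -> measurableTypeR R).
  by apply: measurable_funD => //; exact: mulrl_measurable.
transitivity (\int[mscale (NngNum (ltW c0)) (pushm lam ma)]_x f x).
  rewrite ge0_integral_mscale//; congr (_ * _).
  by rewrite [RHS]ge0_integral_pushforward.
apply: eq_measure_integral => A mA _.
exact/esym/lebesgue_affine.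
Qed.

Definition afft n (c : R) (v t : T n) : T n :=
  [tuple (c * tnth t i + tnth v i)%R | i < n].

Lemma measurable_afft n c (v : T n) : measurable_fun setT (afft c v).
Proof.
apply/measurable_fun_tnthP => i.
rewrite (_ : _ \o _ = fun t : T n => (c * tnth t i + tnth v i)%R).
  apply: measurable_funD => //; apply: measurable_funM => //.
  exact: (@measurable_tnth _ (measurableTypeR R) n i).
by apply/funext => t /=; rewrite tnth_mktuple.
Qed.

Lemma ge0_int_afft n (c : R) (v : T n) (f : T n -> \bar R) : (0 < c)%R ->
  measurable_fun setT f -> (forall t, 0 <= f t) ->
  (c ^+ n)%:E * \int[@leb R n]_t f (afft c v t) = \int[@leb R n]_t f t.
Proof.
move=> c0; elim: n v f => [|n IH] v f mf f0.
  rewrite expr0 mul1e; apply: eq_integral => t _; congr (f _).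
  by rewrite [LHS]tuple0 [RHS]tuple0.
have E (x : R) (t : T n) : afft c v [tuple of x :: t] =
    [tuple of (c * x + thead v)%R :: afft c [tuple of behead v] t].
  apply: eq_from_tnth => i; rewrite tnth_mktuple.
  case: (unliftP ord0 i) => [j|] ->.
    by rewrite !tnthS tnth_mktuple; congr (_ + _)%R; rewrite [v in LHS]tuple_eta tnthS.
  by rewrite !tnth0.
rewrite ge0_int_cons//; last exact: measurableT_comp (@measurable_afft _ _ _).
under eq_integral do under eq_integral do rewrite E.
have mfc := measurableT_comp mf (@measurable_consP n).
have mfx (x : R) : measurable_fun setT (fun t : T n => f [tuple of x :: t]).
  exact: (measurableT_comp mfc (measurable_fun_pair _ _)).
have mF : measurable_fun setT (fun x => \int[@leb R n]_t f [tuple of x :: t]).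
  apply: (@measurable_fun_fubini_tonelli_F _ _ _ _ _ (@leb R n) _ mfc).
  by move=> p; exact: f0.
rewrite [in RHS](ge0_int_cons mf f0).
have F0 (x : R) : 0 <= \int[@leb R n]_t f [tuple of x :: t].
  exact: integral_ge0.
rewrite -(ge0_int_affine1 (thead v) c0 mF F0).
rewrite exprS EFinM -muleA; congr (_ * _).
rewrite -ge0_integralZl//; last 3 first.
- apply: (@measurable_fun_fubini_tonelli_F _ _ _ _ _ (@leb R n)
   (fun p : measurableTypeR R * T n => f [tuple of (c * p.1 + thead v)%R ::
     afft c [tuple of behead v] p.2])) => //.
  apply: (measurableT_comp mf).
  apply: (@measurable_cons _ _ _ _ (fun p : measurableTypeR R * T n => (c * p.1 + thead v)%R : measurableTypeR R)) => /=.
    have ma : measurable_fun [set: measurableTypeR R]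
        ((fun x => c * x + thead v)%R : measurableTypeR R -> measurableTypeR R).
      by apply: measurable_funD => //; exact: mulrl_measurable.
    by apply: (measurableT_comp ma); exact: measurable_fst.
  by apply: (measurableT_comp (measurable_afft c _)); exact: measurable_snd.
- by move=> x _; exact: integral_ge0.
- by rewrite lee_fin exprn_ge0// ltW.
apply: eq_integral => x _.
exact: (IH [tuple of behead v] (fun t => f [tuple of (c * x + thead v)%R :: t])).
Qed.

Lemma ge0_int_prod n (g : 'I_n -> R -> R) :
  (forall i, measurable_fun setT (g i)) -> (forall i x, (0 <= g i x)%R) ->
  \int[@leb R n]_t (\prod_i g i (tnth t i))%:E =
  \prod_i \int[lam]_x (g i x)%:E.
Proof.
elim: n g => [|n IH] g mg g0.
  rewrite big_ord0.
  transitivity (\int[dirac ([tuple] : T 0)]_t (1 : \bar R)).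
    by apply: eq_integral => t _; rewrite big_ord0.
  by rewrite integral_dirac// diracT mul1e.
have mp m (h : 'I_m -> R -> R) : (forall i, measurable_fun setT (h i)) ->
    measurable_fun setT (fun t : T m => (\prod_i h i (tnth t i))%R).
  move=> mh; apply: measurable_prod => i _.
  apply: (measurableT_comp (mh i)).
  exact: (@measurable_tnth _ (measurableTypeR R) m i).
rewrite ge0_int_cons//; last 2 first.
- by apply/measurable_EFinP; exact: mp.
- by move=> t; rewrite lee_fin prodr_ge0.
rewrite big_ord_recl muleC -ge0_integralZl//; last 3 first.
- by apply/measurable_EFinP; exact: mg.
- by move=> x _; rewrite lee_fin.
- by rewrite prode_ge0// => i _; apply: integral_ge0 => x _; rewrite lee_fin.
apply: eq_integral => x _; rewrite -IH// muleC -ge0_integralZl//; last 3 first.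
- by apply/measurable_EFinP; exact: (mp _ (fun i => g (lift ord0 i))).
- by move=> t _; rewrite lee_fin prodr_ge0.
- by rewrite lee_fin.
apply: eq_integral => t _; rewrite -EFinM big_ord_recl tnth0; congr (_ * _)%:E.
by apply: eq_bigr => i _; rewrite tnthS.
Qed.

(* The integral of a nonnegative function is a supremum over simple minorants, so it is
   monotone even on nonmeasurable functions. *)
Lemma le_integral_nomeas d (S : measurableType d)
    (mu : {measure set S -> \bar R}) (D : set S) (f g : S -> \bar R) :
  (forall x, D x -> 0 <= f x) -> (forall x, D x -> f x <= g x) ->
  \int[mu]_(x in D) f x <= \int[mu]_(x in D) g x.
Proof.
move=> f0 fg.
have g0 x : D x -> 0 <= g x by move=> Dx; exact: le_trans (f0 _ Dx) (fg _ Dx).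
rewrite !ge0_integralE// ge_ereal_sup// => _ [h /= hf <-].
apply: ereal_sup_ubound; exists h => // x; apply: (le_trans (hf x)).
by rewrite /patch; case: ifPn => // /set_mem; exact: fg.
Qed.

Lemma int_oneDsqr_lty : \int[lam]_x ((1 + x ^+ 2)^-1)%:E < +oo.
Proof.
have mo : measurable_fun [set: R] (fun x : R => ((1 + x ^+ 2)^-1)%R).
  apply: continuous_measurable_fun; exact: continuous_oneDsqrV.
have fin0 : \int[lam]_(x in `[0%R, +oo[) ((1 + x ^+ 2)^-1)%:E < +oo.
  by have := @integral0y_oneDsqr R; rewrite /oneDsqr => ->; rewrite ltry.
rewrite -(setUv `[0%R, +oo[%classic) ge0_integral_setU//=; last 4 first.
- by apply: measurableC.
- by rewrite setUv; exact/measurable_EFinP.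
- by move=> x _; rewrite lee_fin invr_ge0 addr_ge0 ?sqr_ge0.
- by rewrite disj_set2E setICr.
rewrite lte_add_pinfty// (le_lt_trans _ fin0)//.
(* Reflection reduces the negative half-line to the positive one, where the value is known. *)
rewrite ge0_integration_by_substitution0; last 2 first.
- exact/measurable_EFinP.
- by move=> x; rewrite lee_fin invr_ge0 addr_ge0 ?sqr_ge0.
under [leRHS]eq_integral do rewrite sqrrN.
apply: ge0_subset_integral => //=.
- by apply: measurableC.
- by apply: measurable_funTS; exact/measurable_EFinP.
- by move=> x _; rewrite lee_fin invr_ge0 addr_ge0 ?sqr_ge0.
- by move=> x /=; rewrite !in_itv/= andbT => /negP; rewrite -ltNge => /ltW.
Qed.

End LebesgueRn.

(** * Integration of real functions on R^n *)

Section RealIntegral.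
Context {R : realType}.
Notation T n := (n.-tuple (measurableTypeR R)).

Definition eint n (f : 'rV[R]_n -> \bar R) : \bar R :=
  (\int[@leb R n]_t f (row_of t))%E.

Definition emble n (f : 'rV[R]_n -> \bar R) : Prop :=
  measurable_fun [set: T n] (fun t => f (row_of t)).

Definition intg n (f : 'rV[R]_n -> R) : Prop :=
  (@leb R n).-integrable setT (fun t => (f (row_of t))%:E).

Definition rint n (f : 'rV[R]_n -> R) : R := fine (eint (fun x => (f x)%:E)).

Lemma integralVTE n (f : 'rV[R]_n -> \bar R) : integralV setT f = eint f.
Proof. by rewrite /integralV preimage_setT. Qed.

Lemma row_of_cat n m (t : T n) (s : T m) :
  row_of (cat_tuple t s) = row_mx (row_of t) (row_of s).
Proof.
apply/rowP => i; rewrite row_ofE mxE; case: fintype.splitP => j ij.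
  by rewrite row_ofE (_ : i = lshift m j) ?tnth_lshift//; exact/val_inj.
by rewrite row_ofE (_ : i = rshift n j) ?tnth_rshift//; exact/val_inj.
Qed.

Lemma row_of_afft n (c : R) (v : 'rV[R]_n) (t : T n) :
  row_of (afft c (tup_of v) t) = c *: row_of t + v.
Proof. by apply/rowP => i; rewrite !mxE !tnth_mktuple. Qed.

Lemma mble_emble n (f : 'rV[R]_n -> R) : mble f -> emble (fun x => (f x)%:E).
Proof. by move=> mf; apply/measurable_EFinP. Qed.

Lemma emble_mble n (f : 'rV[R]_n -> R) : emble (fun x => (f x)%:E) -> mble f.
Proof. by move=> mf; apply/measurable_EFinP. Qed.

Lemma intg_mble n (f : 'rV[R]_n -> R) : intg f -> mble f.
Proof. by move=> /integrableP[/measurable_EFinP]. Qed.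

Lemma le_eint n (f g : 'rV[R]_n -> \bar R) :
  (forall x, 0 <= f x)%E -> (forall x, f x <= g x)%E -> (eint f <= eint g)%E.
Proof. by move=> f0 fg; apply: le_integral_nomeas. Qed.

Lemma eint_ge0 n (f : 'rV[R]_n -> \bar R) :
  (forall x, 0 <= f x)%E -> (0 <= eint f)%E.
Proof. by move=> f0; apply: integral_ge0. Qed.

Lemma eintZl n (k : R) (f : 'rV[R]_n -> \bar R) :
  emble f -> (forall x, 0 <= f x)%E -> 0 <= k ->
  eint (fun x => k%:E * f x)%E = (k%:E * eint f)%E.
Proof. by move=> mf f0 k0; apply: ge0_integralZl. Qed.

Lemma eintD n (f g : 'rV[R]_n -> \bar R) :
  emble f -> emble g -> (forall x, 0 <= f x)%E -> (forall x, 0 <= g x)%E ->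
  eint (fun x => f x + g x)%E = (eint f + eint g)%E.
Proof. by move=> mf mg f0 g0; apply: ge0_integralD. Qed.

Lemma affine_emble n (c : R) (v : 'rV[R]_n) (f : 'rV[R]_n -> \bar R) :
  emble f -> emble (fun x => f (c *: x + v)).
Proof.
move=> mf; have := measurableT_comp mf (measurable_afft c (tup_of v)).
by rewrite /emble; congr measurable_fun; apply/funext => t /=; rewrite row_of_afft.
Qed.

Lemma affine_mble n (c : R) (v : 'rV[R]_n) (f : 'rV[R]_n -> R) :
  mble f -> mble (fun x => f (c *: x + v)).
Proof. by move=> /mble_emble /(affine_emble c v) /emble_mble. Qed.

Lemma eint_affine n (c : R) (v : 'rV[R]_n) (f : 'rV[R]_n -> \bar R) : 0 < c ->
  emble f -> (forall x, 0 <= f x)%E ->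
  ((c ^+ n)%:E * eint (fun x : 'rV[R]_n => f (c *: x + v)%R) = eint f)%E.
Proof.
move=> c0 mf f0; rewrite -[RHS](ge0_int_afft (tup_of v) c0 mf)//.
by congr (_ * _)%E; apply: eq_integral => t _; rewrite row_of_afft.
Qed.

Lemma intgE n (f : 'rV[R]_n -> R) :
  intg f <-> mble f /\ (eint (fun x => `|f x|%:E) < +oo)%E.
Proof.
split=> [/integrableP[/measurable_EFinP mf h]|[mf h]]; first by split.
by apply/integrableP; split => //; apply/measurable_EFinP.
Qed.

Lemma rint_EFin n (f : 'rV[R]_n -> R) : intg f ->
  (rint f)%:E = eint (fun x => (f x)%:E).
Proof. by move=> fi; rewrite fineK//; exact: integrable_fin_num. Qed.

Lemma le_intg n (f g : 'rV[R]_n -> R) : mble f -> (forall x, `|f x| <= g x) ->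
  intg g -> intg f.
Proof.
move=> mf fg; apply: le_integrable => //; first exact/measurable_EFinP.
by move=> t _ /=; rewrite lee_fin (le_trans (fg _))// ler_norm.
Qed.

Lemma intgD n (f g : 'rV[R]_n -> R) : intg f -> intg g ->
  intg (fun x => f x + g x).
Proof. by move=> fi gi; apply: (integrableD measurableT fi gi). Qed.

Lemma intgZ n (c : R) (f : 'rV[R]_n -> R) : intg f -> intg (fun x => c * f x).
Proof. by move=> fi; apply: (integrableZl measurableT c fi). Qed.

Lemma intgN n (f : 'rV[R]_n -> R) : intg f -> intg (fun x => - f x).
Proof. by move=> /(intgZ (-1)); under eq_fun do rewrite mulN1r. Qed.

Lemma intg_norm n (f : 'rV[R]_n -> R) : intg f -> intg (fun x => `|f x|).
Proof.
move=> /intgE[mf fy]; apply/intgE; split; first exact: measurableT_comp.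
by under eq_fun do rewrite normr_id.
Qed.

Lemma rintD n (f g : 'rV[R]_n -> R) : intg f -> intg g ->
  rint (fun x => f x + g x) = rint f + rint g.
Proof. by move=> fi gi; apply: (RintegralD measurableT fi gi). Qed.

Lemma rintZ n (c : R) (f : 'rV[R]_n -> R) : intg f ->
  rint (fun x => c * f x) = c * rint f.
Proof. by move=> fi; apply: (RintegralZl c measurableT fi). Qed.

Lemma rintN n (f : 'rV[R]_n -> R) : intg f -> rint (fun x => - f x) = - rint f.
Proof.
by move=> /(rintZ (-1)); rewrite mulN1r => <-; congr rint; apply/funext => x; rewrite mulN1r.
Qed.

Lemma rint_ge0 n (f : 'rV[R]_n -> R) : (forall x, 0 <= f x) -> 0 <= rint f.
Proof. by move=> f0; apply: fine_ge0; apply: eint_ge0 => x; rewrite lee_fin. Qed.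

Lemma le_rint n (f g : 'rV[R]_n -> R) : intg f -> intg g ->
  (forall x, f x <= g x) -> rint f <= rint g.
Proof. by move=> fi gi fg; apply: (le_Rintegral measurableT fi gi). Qed.

Lemma norm_rint_le n (f g : 'rV[R]_n -> R) : mble f ->
  (forall x, `|f x| <= g x) -> intg g -> `|rint f| <= rint g.
Proof.
move=> mf fg gi; have fi := le_intg mf fg gi.
rewrite ler_norml -rintN//; apply/andP; split; apply: le_rint => //.
- exact: intgN.
- by move=> x; have := fg x; rewrite ler_norml => /andP[].
- by move=> x; rewrite (le_trans (ler_norm _)).
Qed.

Lemma rint_affine n (c : R) (v : 'rV[R]_n) (f : 'rV[R]_n -> R) : 0 < c ->
  intg f -> intg (fun x => f (c *: x + v)) /\
  c ^+ n * rint (fun x => f (c *: x + v)) = rint f.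
Proof.
move=> c0 fi; have /intgE[mf fy] := fi.
have cn0 : 0 < c ^+ n by rewrite exprn_gt0.
(* Nonnegative functions come first, from the substitution rule for [eint]; the signed case is then
   split into positive and negative parts by [Ef]. *)
have ei (g : 'rV[R]_n -> R) : (forall x, 0 <= g x) -> mble g ->
    (eint (fun x => (g x)%:E) < +oo)%E ->
    (eint (fun x => (g (c *: x + v))%:E) < +oo)%E /\
    c ^+ n * rint (fun x => g (c *: x + v)) = rint g.
  move=> g0 mg gy.
  have E : ((c ^+ n)%:E * eint (fun x => (g (c *: x + v))%:E) = eint (fun x => (g x)%:E))%E.
    by apply: (eint_affine v c0 (mble_emble mg)) => x; rewrite lee_fin.
  have e0 : (0 <= eint (fun x => (g (c *: x + v))%:E))%E.
    by apply: eint_ge0 => x; rewrite lee_fin.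
  have y : (eint (fun x => (g (c *: x + v))%:E) < +oo)%E.
    rewrite ltNge leye_eq; apply/negP => /eqP h; move: gy.
    by rewrite -E h gt0_muley ?lte_fin.
  split => //; rewrite /rint -E fineM// ge0_fin_numE//.
have i1 : intg (fun x => f (c *: x + v)).
  apply/intgE; split; first exact: affine_mble.
  apply: (proj1 (ei (fun x => `|f x|) _ _ _)) => //.
  exact: measurableT_comp.
split => //.
have Ef g : intg g -> rint g = rint (fun x => Num.max (g x) 0) - rint (fun x => Num.max (- g x) 0).
  move=> gi.
  have p1 : intg (fun x => Num.max (g x) 0).
    apply: (le_intg (g := fun x => `|g x|)).
    - by apply: measurable_maxr => //; exact: intg_mble.
    - move=> x; rewrite ger0_norm ?le_max ?lexx ?orbT//.
      by rewrite ge_max ler_norm normr_ge0.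
    - exact: intg_norm.
  have p2 : intg (fun x => Num.max (- g x) 0).
    apply: (le_intg (g := fun x => `|g x|)).
    - by apply: measurable_maxr => //; apply: measurable_funN; exact: intg_mble.
    - move=> x; rewrite ger0_norm ?le_max ?lexx ?orbT//.
      by rewrite ge_max -normrN ler_norm normr_ge0.
    - exact: intg_norm.
  rewrite -rintN// -rintD//; last exact: intgN.
  congr rint; apply/funext => x.
  by case: (leP (g x) 0) => h; [rewrite max_l ?oppr_ge0// opprK add0r|
    rewrite max_r ?oppr_le0 ?ltW// subr0].
rewrite (Ef _ _ i1) (Ef _ _ fi) mulrBr; congr (_ - _).
  apply: (proj2 (ei (fun x => Num.max (f x) 0) _ _ _)).
  - by move=> x; rewrite le_max lexx orbT.
  - exact: measurable_maxr.
  - apply: (le_lt_trans _ fy); apply: le_eint => x; rewrite lee_fin.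
      by rewrite le_max lexx orbT.
    by rewrite ge_max ler_norm normr_ge0.
apply: (proj2 (ei (fun x => Num.max (- f x) 0) _ _ _)).
- by move=> x; rewrite le_max lexx orbT.
- by apply: measurable_maxr => //; exact: measurable_funN.
- apply: (le_lt_trans _ fy); apply: le_eint => x; rewrite lee_fin.
    by rewrite le_max lexx orbT.
  by rewrite ge_max -normrN ler_norm normr_ge0.
Qed.

Lemma rint_dct n (f_ : nat -> 'rV[R]_n -> R) (f g : 'rV[R]_n -> R) :
  (forall k, mble (f_ k)) -> (forall x, f_ k x @[k --> \oo] --> f x) ->
  intg g -> (forall k x, `|f_ k x| <= g x) ->
  intg f /\ rint (f_ k) @[k --> \oo] --> rint f.
Proof.
move=> mf cf gi fg.
have mff : mble f := mble_cvg mf cf.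
have fi : intg f.
  apply: (le_intg mff _ gi) => x.
  apply: (ler_cvg_to (cvg_norm (cf x)) (@cvg_cst _ (g x) _ _ _)).
  by near=> k; exact: fg.
split => //; apply: fine_cvg; rewrite rint_EFin//.
apply: (dominated_cvg measurableT (g := fun t => (g (row_of t))%:E)) => //.
- by move=> k; apply/measurable_EFinP; exact: mf.
- by move=> t _; apply: cvg_EFin; [near=> k|exact: cf].
- by move=> k t _; rewrite lee_fin.
Unshelve. all: by end_near. Qed.

Section TwoVariables.
Variables (n m : nat).
Implicit Types f : 'rV[R]_n -> 'rV[R]_m -> R.

Definition unc (S : Type) (f : 'rV[R]_n -> 'rV[R]_m -> S) : 'rV[R]_(n + m) -> S :=
  fun w => f (lsubmx w) (rsubmx w).

Lemma uncE S (f : 'rV[R]_n -> 'rV[R]_m -> S) t s :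
  unc f (row_of (cat_tuple t s)) = f (row_of t) (row_of s).
Proof. by rewrite /unc row_of_cat row_mxKl row_mxKr. Qed.

Lemma unc_pair (f : 'rV[R]_n -> 'rV[R]_m -> \bar R) : emble (unc f) ->
  measurable_fun [set: (T n * T m)%type] (fun p => f (row_of p.1) (row_of p.2)).
Proof.
move=> mf; have := measurableT_comp mf (@measurable_catP R n m).
by congr measurable_fun; apply/funext => p /=; rewrite uncE.
Qed.

Lemma eint_split (f : 'rV[R]_n -> 'rV[R]_m -> \bar R) : emble (unc f) ->
  (forall x y, 0 <= f x y)%E ->
  eint (unc f) = eint (fun x => eint (f x)).
Proof.
move=> mf f0; rewrite /eint (ge0_int_cat mf (fun t => f0 _ _)).
by apply: eq_integral => t _; apply: eq_integral => s _; rewrite uncE.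
Qed.

Lemma eint_swap (f : 'rV[R]_n -> 'rV[R]_m -> \bar R) : emble (unc f) ->
  (forall x y, 0 <= f x y)%E ->
  eint (fun x => eint (f x)) = eint (fun y => eint (f^~ y)).
Proof.
move=> mf f0.
exact: (@fubini_tonelli _ _ _ _ R (@leb R n) (@leb R m)
  (fun p => f (row_of p.1) (row_of p.2)) (unc_pair mf) (fun p => f0 _ _)).
Qed.

Lemma emble_eint (f : 'rV[R]_n -> 'rV[R]_m -> \bar R) : emble (unc f) ->
  (forall x y, 0 <= f x y)%E -> emble (fun x => eint (f x)).
Proof.
move=> mf f0.
exact: (@measurable_fun_fubini_tonelli_F _ _ _ _ R (@leb R m)
  (fun p => f (row_of p.1) (row_of p.2)) (unc_pair mf) (fun p => f0 _ _)).
Qed.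

Lemma emble_sec (f : 'rV[R]_n -> 'rV[R]_m -> \bar R) x : emble (unc f) -> emble (f x).
Proof.
move=> /unc_pair mf.
have := measurableT_comp mf (@measurable_pair1 _ _ (T n) (T m) (tup_of x)).
by rewrite /emble; congr measurable_fun; apply/funext => t /=; rewrite tup_ofK.
Qed.

Lemma mble_sec f x : mble (unc f) -> mble (f x).
Proof.
by move=> /mble_emble h; exact: (emble_mble (@emble_sec (fun x y => (f x y)%:E) x h)).
Qed.

Lemma mble_secr f y : mble (unc f) -> mble (f^~ y).
Proof.
move=> /mble_emble h; apply: emble_mble.
have := measurableT_comp (@unc_pair (fun x y => (f x y)%:E) h)
  (@measurable_pair2 _ _ (T n) (T m) (tup_of y)).
by rewrite /emble; congr measurable_fun; apply/funext => t /=; rewrite tup_ofK.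
Qed.

(** The integral is the difference of the integrals of the positive and the negative part, and each
    of these is measurable in [x] by Tonelli. *)
Lemma mble_rint f : mble (unc f) -> mble (fun x => rint (f x)).
Proof.
move=> mf.
have h (g : 'rV[R]_n -> 'rV[R]_m -> \bar R) : emble (unc g) ->
    (forall x y, 0 <= g x y)%E -> emble (fun x => eint (g x)) := @emble_eint g.
apply: measurableT_comp => //.
rewrite (_ : (fun _ => _) = (fun t : T n =>
   eint (fun y => (Num.max (f (row_of t) y) 0)%:E) -
   eint (fun y => (Num.max (- f (row_of t) y) 0)%:E))%E); last first.
  apply/funext => t; rewrite [LHS]integralE; congr (_ - _)%E.
    by apply: eq_integral => s _; rewrite funeposE -EFin_max.
  by apply: eq_integral => s _; rewrite funenegE -EFinN -EFin_max.
apply: emeasurable_funB.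
  apply: (h (fun x y => (Num.max (f x y) 0)%:E)).
    by apply: mble_emble; exact: measurable_maxr.
  by move=> x y; rewrite lee_fin le_max lexx orbT.
apply: (h (fun x y => (Num.max (- f x y) 0)%:E)).
  by apply: mble_emble; apply: measurable_maxr => //; exact: measurable_funN.
by move=> x y; rewrite lee_fin le_max lexx orbT.
Qed.

(** Integrability is asked of every section, so that each inner integral is finite and [rint] agrees
    with the extended integral at every point. The integral over R^(n+m) is carried to the product
    measure by [leb_cat]. *)
Lemma rint_fubini f : intg (unc f) -> (forall x, intg (f x)) ->
  (forall y, intg (f^~ y)) ->
  rint (unc f) = rint (fun x => rint (f x)) /\
  rint (unc f) = rint (fun y => rint (f^~ y)).
Proof.
move=> fi fx fy.
have mC := @measurable_catP R n m.
have mf := unc_pair (f := fun x y => (f x y)%:E) (mble_emble (intg_mble fi)).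
have fi2 : (@leb R n \x @leb R m)%E.-integrable setT
    (fun p => (f (row_of p.1) (row_of p.2))%:E).
  apply/(integrable12ltyP (@leb R n) (@leb R m) mf).
  have /intgE[ma] := fi; rewrite (eint_split (f := fun x y => `|f x y|%:E))//.
  by apply: mble_emble; exact: measurableT_comp.
have E : eint (fun w => (unc f w)%:E) =
    (\int[(@leb R n \x @leb R m)]_p (f (row_of p.1) (row_of p.2))%:E)%E.
  transitivity (\int[pushm (@leb R n \x @leb R m)%E mC]_t (unc f (row_of t))%:E)%E.
    by apply: eq_measure_integral => A mA _; exact: leb_cat.
  rewrite integral_pushforward//.
  - by rewrite preimage_setT; apply: eq_integral => p _; rewrite /= uncE.
  - by apply/measurable_EFinP; exact: intg_mble.
  - rewrite preimage_setT; apply: eq_integrable fi2 => // p _.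
    by rewrite /= uncE.
split; rewrite /rint E; congr fine.
  rewrite -(integral12_prod_meas1 fi2); apply: eq_integral => t _.
  by rewrite -/(rint (f (row_of t))) rint_EFin.
rewrite -(integral21_prod_meas1 fi2); apply: eq_integral => t _.
by rewrite -/(rint (f^~ (row_of t))) rint_EFin.
Qed.

End TwoVariables.

Lemma mble_comp_lsub n m (f : 'rV[R]_n -> R) :
  mble f -> mble (fun w : 'rV[R]_(n + m) => f (lsubmx w)).
Proof.
move=> mf; pose h (w : T (n + m)) : T n := [tuple tnth w (lshift m i) | i < n].
have mh : measurable_fun setT h.
  apply/measurable_fun_tnthP => i.
  rewrite (_ : _ \o _ = fun w : T (n + m) => tnth w (lshift m i)).
    exact: (@measurable_tnth _ (measurableTypeR R) (n + m)).
  by apply/funext => w /=; rewrite tnth_mktuple.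
have := measurableT_comp mf mh; rewrite /mble; congr measurable_fun.
apply/funext => w /=; congr f; apply/rowP => i.
by rewrite !mxE tnth_mktuple.
Qed.

Lemma mble_comp_rsub n m (f : 'rV[R]_m -> R) :
  mble f -> mble (fun w : 'rV[R]_(n + m) => f (rsubmx w)).
Proof.
move=> mf; pose h (w : T (n + m)) : T m := [tuple tnth w (rshift n i) | i < m].
have mh : measurable_fun setT h.
  apply/measurable_fun_tnthP => i.
  rewrite (_ : _ \o _ = fun w : T (n + m) => tnth w (rshift n i)).
    exact: (@measurable_tnth _ (measurableTypeR R) (n + m)).
  by apply/funext => w /=; rewrite tnth_mktuple.
have := measurableT_comp mf mh; rewrite /mble; congr measurable_fun.
apply/funext => w /=; congr f; apply/rowP => i.
by rewrite !mxE tnth_mktuple.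
Qed.

Lemma intg_prod n m (f : 'rV[R]_n -> R) (g : 'rV[R]_m -> R) : intg f -> intg g ->
  intg (unc (fun x y => f x * g y)).
Proof.
move=> fi gi; have /intgE[mf fy] := fi; have /intgE[mg gy] := gi.
have mfg : mble (unc (fun x y => f x * g y)).
  by apply: measurable_funM; [exact: mble_comp_lsub|exact: mble_comp_rsub].
apply/intgE; split => //.
rewrite (eint_split (f := fun x y => `|f x * g y|%:E))//; last first.
  by apply: mble_emble; exact: measurableT_comp.
have E x : eint (fun y => `|f x * g y|%:E) =
    ((rint (fun y => `|g y|))%:E * `|f x|%:E)%E.
  rewrite rint_EFin; last exact: intg_norm.
  rewrite muleC -eintZl//.
    by congr eint; apply/funext => y; rewrite normrM EFinM.
  by apply: mble_emble; exact: measurableT_comp.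
under [X in eint X]eq_fun do rewrite E.
rewrite eintZl//; last 2 first.
- by apply: mble_emble; exact: measurableT_comp.
- exact: rint_ge0.
by rewrite -(@rint_EFin n (fun x => `|f x|)) ?ltry//; exact: intg_norm.
Qed.

End RealIntegral.

(** * Integration of complex functions *)

Section ComplexIntegral.
Context {R : realType}.
Notation C := R[i].
Notation nc := (@Normc.normc R).

Lemma nc_ge0 (z : C) : 0 <= nc z.
Proof. by case: z => a b; exact: sqrtr_ge0. Qed.

Lemma ncD (x y : C) : nc (x + y) <= nc x + nc y.
Proof. exact: le_normcD. Qed.

Lemma ncN (x : C) : nc (- x) = nc x.
Proof. exact: normcN. Qed.

Lemma ncB (x y : C) : nc (x - y) <= nc x + nc y.
Proof. by rewrite -[nc y]ncN ncD. Qed.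

Lemma ncM (x y : C) : nc (x * y) = nc x * nc y.
Proof. exact: Normc.normcM. Qed.

Lemma nc_conj (x : C) : nc (conjc x) = nc x.
Proof. by case: x => a b /=; rewrite sqrrN. Qed.

Lemma nc_Re (z : C) : `|Re z| <= nc z.
Proof.
case: z => a b /=; rewrite -(@ger0_norm _ (Num.sqrt _)) ?sqrtr_ge0//.
by rewrite -ler_sqr ?nnegrE// !real_normK ?num_real// sqr_sqrtr ?addr_ge0 ?sqr_ge0// lerDl sqr_ge0.
Qed.

Lemma nc_Im (z : C) : `|Im z| <= nc z.
Proof.
case: z => a b /=; rewrite -(@ger0_norm _ (Num.sqrt _)) ?sqrtr_ge0//.
by rewrite -ler_sqr ?nnegrE// !real_normK ?num_real// sqr_sqrtr ?addr_ge0 ?sqr_ge0// lerDr sqr_ge0.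
Qed.

Lemma nc_real (x : R) : nc x%:C%C = `|x|.
Proof. by rewrite /= expr0n/= addr0 sqrtr_sqr. Qed.

Lemma nc_imag (x : R) : nc (Complex 0 x) = `|x|.
Proof. by rewrite /= expr0n/= add0r sqrtr_sqr. Qed.

Lemma nc_le (z : C) : nc z <= `|Re z| + `|Im z|.
Proof.
have -> : z = (Re z)%:C%C + Complex 0 (Im z) by case: z => a b; simpc.
by rewrite (le_trans (ncD _ _))// nc_real nc_imag /= addr0 add0r.
Qed.

Lemma nc_expi (t : R) : nc (expi t) = 1.
Proof. by rewrite /expi /= cos2Dsin2 sqrtr1. Qed.

Lemma nc0 : nc 0 = 0. Proof. exact: Normc.normc0. Qed.
Lemma nc1 : nc 1 = 1. Proof. exact: Normc.normc1. Qed.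

Lemma nc_eq0 (z : C) : nc z = 0 -> z = 0.
Proof. exact: Normc.eq0_normc. Qed.

Lemma ncX (z : C) k : nc (z ^+ k) = nc z ^+ k.
Proof. by elim: k => [|k IH]; rewrite ?expr0 ?nc1// !exprS ncM IH. Qed.

Lemma ReD (x y : C) : Re (x + y) = Re x + Re y.
Proof. by case: x y => [a b] [c d]. Qed.
Lemma ImD (x y : C) : Im (x + y) = Im x + Im y.
Proof. by case: x y => [a b] [c d]. Qed.
Lemma ReN (x : C) : Re (- x) = - Re x. Proof. by case: x. Qed.
Lemma ImN (x : C) : Im (- x) = - Im x. Proof. by case: x. Qed.
Lemma ReM (x y : C) : Re (x * y) = Re x * Re y - Im x * Im y.
Proof. by case: x y => [a b] [c d]. Qed.
Lemma ImM (x y : C) : Im (x * y) = Re x * Im y + Im x * Re y.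
Proof. by case: x y => [a b] [c d]. Qed.
Lemma ReJ (x : C) : Re (conjc x) = Re x. Proof. by case: x. Qed.
Lemma ImJ (x : C) : Im (conjc x) = - Im x. Proof. by case: x. Qed.

Lemma complexP (x y : C) : Re x = Re y -> Im x = Im y -> x = y.
Proof. by case: x y => [a b] [c d] /= -> ->. Qed.

Definition cmble n (f : 'rV[R]_n -> C) : Prop :=
  mble (fun x => Re (f x)) /\ mble (fun x => Im (f x)).

Definition ccont n (f : 'rV[R]_n -> C) : Prop :=
  continuous (fun x => Re (f x)) /\ continuous (fun x => Im (f x)).

Definition cintg n (f : 'rV[R]_n -> C) : Prop :=
  cmble f /\ intg (fun x => nc (f x)).

Definition ccvg (u : nat -> C) (l : C) : Prop :=
  Re (u k) @[k --> \oo] --> Re l /\ Im (u k) @[k --> \oo] --> Im l.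

Lemma ccont_cmble n (f : 'rV[R]_n -> C) : ccont f -> cmble f.
Proof. by move=> [h1 h2]; split; exact: continuous_mble. Qed.

Lemma cmble_cst n (c : C) : cmble (fun _ : 'rV[R]_n => c).
Proof. by split; exact: measurable_cst. Qed.

Lemma cmbleD n (f g : 'rV[R]_n -> C) : cmble f -> cmble g ->
  cmble (fun x => f x + g x).
Proof.
move=> [f1 f2] [g1 g2]; split.
  by under eq_fun do rewrite ReD; exact: measurable_funD.
by under eq_fun do rewrite ImD; exact: measurable_funD.
Qed.

Lemma cmbleM n (f g : 'rV[R]_n -> C) : cmble f -> cmble g ->
  cmble (fun x => f x * g x).
Proof.
move=> [f1 f2] [g1 g2]; split.
  under eq_fun do rewrite ReM.
  by apply: measurable_funB; exact: measurable_funM.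
under eq_fun do rewrite ImM.
by apply: measurable_funD; exact: measurable_funM.
Qed.

Lemma cmbleJ n (f : 'rV[R]_n -> C) : cmble f -> cmble (fun x => conjc (f x)).
Proof.
move=> [f1 f2]; split; first by under eq_fun do rewrite ReJ.
by under eq_fun do rewrite ImJ; exact: measurable_funN.
Qed.

Lemma cmble_nc n (f : 'rV[R]_n -> C) : cmble f -> mble (fun x => nc (f x)).
Proof.
move=> [f1 f2].
have -> : (fun x => nc (f x)) = (fun x => Num.sqrt (Re (f x) ^+ 2 + Im (f x) ^+ 2)).
  by apply/funext => x; case: (f x).
apply: (measurableT_comp (f := @Num.sqrt R)).
  by apply: continuous_measurable_fun => x; exact: sqrt_continuous.
by apply: measurable_funD; exact: measurable_funX.
Qed.

Lemma cintg_Re n (f : 'rV[R]_n -> C) : cintg f -> intg (fun x => Re (f x)).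
Proof.
by move=> [[f1 f2] fi]; apply: (le_intg f1 _ fi) => x; exact: nc_Re.
Qed.

Lemma cintg_Im n (f : 'rV[R]_n -> C) : cintg f -> intg (fun x => Im (f x)).
Proof.
by move=> [[f1 f2] fi]; apply: (le_intg f2 _ fi) => x; exact: nc_Im.
Qed.

Lemma le_cintg n (f : 'rV[R]_n -> C) g : cmble f -> (forall x, nc (f x) <= g x) ->
  intg g -> cintg f.
Proof.
move=> mf fg gi; split => //; apply: (le_intg (cmble_nc mf) _ gi) => x.
by rewrite ger0_norm ?nc_ge0.
Qed.

Lemma integralCE n (f : 'rV[R]_n -> C) :
  integralC f = Complex (rint (fun x => Re (f x))) (rint (fun x => Im (f x))).
Proof. by rewrite /integralC !integralVTE. Qed.

Lemma eq_integralC n (f g : 'rV[R]_n -> C) : f =1 g -> integralC f = integralC g.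
Proof. by move=> /funext ->. Qed.

Lemma cintgD n (f g : 'rV[R]_n -> C) : cintg f -> cintg g ->
  cintg (fun x => f x + g x).
Proof.
move=> [mf fi] [mg gi]; apply: (le_cintg _ _ (intgD fi gi)); first exact: cmbleD.
by move=> x; exact: ncD.
Qed.

Lemma cintgZ n (c : C) (f : 'rV[R]_n -> C) : cintg f -> cintg (fun x => c * f x).
Proof.
move=> [mf fi]; apply: (le_cintg _ _ (intgZ (nc c) fi)).
  by apply: cmbleM => //; exact: cmble_cst.
by move=> x; rewrite ncM.
Qed.

Lemma cintgJ n (f : 'rV[R]_n -> C) : cintg f -> cintg (fun x => conjc (f x)).
Proof.
move=> [mf fi]; apply: (le_cintg (cmbleJ mf) _ fi) => x.
by rewrite nc_conj.
Qed.

Lemma integralCD n (f g : 'rV[R]_n -> C) : cintg f -> cintg g ->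
  integralC (fun x => f x + g x) = integralC f + integralC g.
Proof.
move=> fi gi; rewrite !integralCE; apply: complexP => /=.
  under eq_fun do rewrite ReD.
  by rewrite rintD//; exact: cintg_Re.
under eq_fun do rewrite ImD.
by rewrite rintD//; exact: cintg_Im.
Qed.

Lemma integralCZ n (c : C) (f : 'rV[R]_n -> C) : cintg f ->
  integralC (fun x => c * f x) = c * integralC f.
Proof.
move=> fi; have h1 := cintg_Re fi; have h2 := cintg_Im fi.
rewrite !integralCE; case: c => a b; apply: complexP => /=.
  under eq_fun do rewrite ReM /=.
  by rewrite (rintD (intgZ a h1) (intgN (intgZ b h2))) (rintN (intgZ b h2)) !rintZ.
under eq_fun do rewrite ImM /=.
by rewrite rintD ?rintZ//; exact: intgZ.
Qed.

Lemma integralCN n (f : 'rV[R]_n -> C) : cintg f ->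
  integralC (fun x => - f x) = - integralC f.
Proof.
move=> fi; rewrite -mulN1r -integralCZ//.
by apply: eq_integralC => x; rewrite mulN1r.
Qed.

Lemma integralC0 n : integralC (fun _ : 'rV[R]_n => 0 : C) = 0.
Proof.
rewrite integralCE /=.
have -> : rint (fun _ : 'rV[R]_n => 0 : R) = 0 by rewrite /rint /eint integral0.
by [].
Qed.

Lemma cintg0 n : cintg (fun _ : 'rV[R]_n => 0 : C).
Proof.
split; first exact: cmble_cst.
by under eq_fun do rewrite nc0; exact: integrable0.
Qed.

Lemma cintg_sum n (I : Type) (s : seq I) (F : I -> 'rV[R]_n -> C) :
  (forall i, cintg (F i)) -> cintg (fun x => \sum_(i <- s) F i x) /\
  integralC (fun x => \sum_(i <- s) F i x) = \sum_(i <- s) integralC (F i).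
Proof.
move=> h; elim: s => [|i s [IH1 IH2]].
  under eq_fun do rewrite big_nil.
  by rewrite big_nil; split; [exact: cintg0|exact: integralC0].
under eq_fun do rewrite big_cons.
by split; [exact: cintgD|rewrite integralCD// IH2 big_cons].
Qed.

Lemma integralCJ n (f : 'rV[R]_n -> C) : cintg f ->
  integralC (fun x => conjc (f x)) = conjc (integralC f).
Proof.
move=> fi; rewrite !integralCE /=; congr Complex.
  by under eq_fun do rewrite ReJ.
under eq_fun do rewrite ImJ.
by rewrite rintN//; exact: cintg_Im.
Qed.

(** Real and imaginary parts are estimated separately, whence the factor 2. *)
Lemma nc_integralC n (f : 'rV[R]_n -> C) g : cmble f ->
  (forall x, nc (f x) <= g x) -> intg g -> nc (integralC f) <= 2 * rint g.
Proof.
move=> [f1 f2] fg gi; rewrite integralCE (le_trans (nc_le _))//= mulr2n mulrDl mul1r.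
apply: lerD; apply: norm_rint_le => // x.
  exact: le_trans (nc_Re _) (fg _).
exact: le_trans (nc_Im _) (fg _).
Qed.

Lemma integralC_dct n (f_ : nat -> 'rV[R]_n -> C) (f : 'rV[R]_n -> C) g :
  (forall k, cmble (f_ k)) -> (forall x, ccvg (f_^~ x) (f x)) ->
  intg g -> (forall k x, nc (f_ k x) <= g x) ->
  cintg f /\ ccvg (fun k => integralC (f_ k)) (integralC f).
Proof.
move=> mf cf gi fg.
have [i1 c1] : intg (fun x => Re (f x)) /\
    rint (fun x => Re (f_ k x)) @[k --> \oo] --> rint (fun x => Re (f x)).
  apply: (rint_dct (f_ := fun k x => Re (f_ k x)) _ _ gi).
  - by move=> k; exact: (mf k).1.
  - by move=> x; exact: (cf x).1.
  - by move=> k x; exact: le_trans (nc_Re _) (fg _ _).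
have [i2 c2] : intg (fun x => Im (f x)) /\
    rint (fun x => Im (f_ k x)) @[k --> \oo] --> rint (fun x => Im (f x)).
  apply: (rint_dct (f_ := fun k x => Im (f_ k x)) _ _ gi).
  - by move=> k; exact: (mf k).2.
  - by move=> x; exact: (cf x).2.
  - by move=> k x; exact: le_trans (nc_Im _) (fg _ _).
split.
  apply: (le_cintg _ _ (intgD (intg_norm i1) (intg_norm i2))).
    by split; exact: intg_mble.
  by move=> x; exact: nc_le.
by split; [exact: c1|exact: c2].
Qed.

Lemma integralC_affine n (c : R) (v : 'rV[R]_n) (f : 'rV[R]_n -> C) : 0 < c ->
  cintg f -> cintg (fun x => f (c *: x + v)) /\
  (c ^+ n)%:C%C * integralC (fun x => f (c *: x + v)) = integralC f.
Proof.
move=> c0 fi; have [_ h1] := rint_affine v c0 (cintg_Re fi).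
have [_ h2] := rint_affine v c0 (cintg_Im fi).
have [h3 _] := rint_affine v c0 fi.2.
split.
  by split => //; split; [have := affine_mble c v fi.1.1|have := affine_mble c v fi.1.2].
rewrite !integralCE; apply: complexP => /=.
  by rewrite mul0r subr0 h1.
by rewrite mul0r addr0 h2.
Qed.

Lemma integralC_shift n (v : 'rV[R]_n) (f : 'rV[R]_n -> C) : cintg f ->
  cintg (fun x => f (x + v)) /\ integralC (fun x => f (x + v)) = integralC f.
Proof.
move=> /(integralC_affine v ltr01); under eq_fun do rewrite scale1r.
by rewrite expr1n mul1r.
Qed.

Section TwoVariables.
Variables (n m : nat).
Implicit Types f : 'rV[R]_n -> 'rV[R]_m -> C.

Lemma cmble_integralC f : cmble (unc f) -> cmble (fun x => integralC (f x)).
Proof.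
move=> [f1 f2]; split; under eq_fun do rewrite integralCE /=.
  exact: (mble_rint (f := fun x y => Re (f x y))).
exact: (mble_rint (f := fun x y => Im (f x y))).
Qed.

Lemma integralC_fubini f : cintg (unc f) -> (forall x, cintg (f x)) ->
  (forall y, cintg (f^~ y)) ->
  integralC (unc f) = integralC (fun x => integralC (f x)) /\
  integralC (unc f) = integralC (fun y => integralC (f^~ y)).
Proof.
move=> fi fx fy.
have [a1 a2] := @rint_fubini _ n m (fun x y => Re (f x y)) (cintg_Re fi)
  (fun x => cintg_Re (fx x)) (fun y => cintg_Re (fy y)).
have [b1 b2] := @rint_fubini _ n m (fun x y => Im (f x y)) (cintg_Im fi)
  (fun x => cintg_Im (fx x)) (fun y => cintg_Im (fy y)).
split; rewrite !integralCE; congr Complex.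
- by rewrite a1; congr rint; apply/funext => t; rewrite integralCE.
- by rewrite b1; congr rint; apply/funext => t; rewrite integralCE.
- by rewrite a2; congr rint; apply/funext => t; rewrite integralCE.
- by rewrite b2; congr rint; apply/funext => t; rewrite integralCE.
Qed.

End TwoVariables.

End ComplexIntegral.

(** * Partial derivatives and families of smooth functions *)

Section PartialDerivatives.
Context {R : realType}.
Notation C := R[i].
Notation nc := (@Normc.normc R).

Definition unitv n (i : 'I_n) : 'rV[R]_n := delta_mx 0 i.

(** Restriction to a line turns a directional derivative into an ordinary one, which gives access to
    the mean value theorem and the chain rule in one variable. *)
Lemma is_derive_line n (f : 'rV[R]_n -> R) (x v : 'rV[R]_n) (s l : R) :
  is_derive (s *: v + x) v f l <->
  is_derive s (1 : R) (fun r : R => f (r *: v + x)) l.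
Proof.
have E : (fun h : R => h^-1 *: ((f \o shift (s *: v + x)) (h *: v) - f (s *: v + x))) =
    (fun h : R => h^-1 *: (((fun r : R => f (r *: v + x)) \o shift s) (h *: (1 : R)) -
       f (s *: v + x))).
  apply/funext => h /=; congr (_ *: (f _ - _)).
  by rewrite addrA -scalerDl; congr (_ *: _ + _); rewrite [h *: 1]mulr1.
by split=> -[h1 h2]; apply: DeriveDef;
  rewrite /derivable /derive in h1 h2 *; rewrite ?E// -E.
Qed.

(** Relational form of a complex partial derivative: existence and value are one statement, so the
    rules of calculus compose without separate differentiability conditions. *)
Definition cid n (i : 'I_n) (f : 'rV[R]_n -> C) (x : 'rV[R]_n) (l : C) : Prop :=
  is_derive x (unitv i) (fun y => Re (f y)) (Re l) /\
  is_derive x (unitv i) (fun y => Im (f y)) (Im l).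

Lemma cid_partial n (i : 'I_n) (f : 'rV[R]_n -> C) x l :
  cid i f x l -> partial i f x = l.
Proof. by move=> [h1 h2]; apply: complexP => /=; exact: derive_val. Qed.

Lemma cid_eq n (i : 'I_n) (f : 'rV[R]_n -> C) x l l' : cid i f x l -> l = l' -> cid i f x l'.
Proof. by move=> h <-. Qed.

Lemma cid_cst n (i : 'I_n) (c : C) x : cid i (fun _ => c) x 0.
Proof. by split; exact: is_derive_cst. Qed.

Lemma cidD n (i : 'I_n) (f g : 'rV[R]_n -> C) x k l : cid i f x k -> cid i g x l ->
  cid i (fun y => f y + g y) x (k + l).
Proof.
move=> [f1 f2] [g1 g2]; split.
  by rewrite ReD; under eq_fun do rewrite ReD; exact: is_deriveD.
by rewrite ImD; under eq_fun do rewrite ImD; exact: is_deriveD.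
Qed.

Lemma is_deriveM' n (f g : 'rV[R]_n -> R) x v (df dg : R) :
  is_derive x v f df -> is_derive x v g dg ->
  is_derive x v (fun y => f y * g y) (df * g x + f x * dg).
Proof.
move=> hf hg; apply: (@is_derive_eq _ _ _ _ x v _ _ (is_deriveM hf hg)).
by rewrite addrC; congr (_ + _); exact: mulrC.
Qed.

Lemma cidM n (i : 'I_n) (f g : 'rV[R]_n -> C) x k l : cid i f x k -> cid i g x l ->
  cid i (fun y => f y * g y) x (k * g x + f x * l).
Proof.
move=> [f1 f2] [g1 g2]; split.
  under eq_fun do rewrite ReM.
  apply: (@is_derive_eq _ _ _ _ _ _ _ _ (is_deriveB (is_deriveM' f1 g1) (is_deriveM' f2 g2))).
  by rewrite ReD !ReM; ring.
under eq_fun do rewrite ImM.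
apply: (@is_derive_eq _ _ _ _ _ _ _ _ (is_deriveD (is_deriveM' f1 g2) (is_deriveM' f2 g1))).
by rewrite ImD !ImM; ring.
Qed.

Lemma cidZ n (i : 'I_n) (c : C) (f : 'rV[R]_n -> C) x l : cid i f x l ->
  cid i (fun y => c * f y) x (c * l).
Proof.
by move=> h; apply: (cid_eq (cidM (cid_cst i c x) h)); rewrite mul0r add0r.
Qed.

Lemma cidJ n (i : 'I_n) (f : 'rV[R]_n -> C) x l : cid i f x l ->
  cid i (fun y => conjc (f y)) x (conjc l).
Proof.
move=> [f1 f2]; split; first by rewrite ReJ; under eq_fun do rewrite ReJ.
by rewrite ImJ; under eq_fun do rewrite ImJ; exact: is_deriveN.
Qed.

Lemma is_derive_affine1 (c d s : R) : is_derive s (1 : R) (fun r => r * c + d) c.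
Proof.
have -> : (fun r => r * c + d) = (c \*: @id R) + cst d.
  by apply/funext => r; change (r * c + d = c * r + d); rewrite mulrC.
apply: (@is_derive_eq _ _ _ _ _ _ _ _ (is_deriveD (is_deriveZ c (is_derive_id s (1 : R))) (is_derive_cst d s (1 : R)))).
by rewrite addr0 [_ *: _]mulr1.
Qed.

Lemma is_derive_affine n k (i : 'I_n) (j : 'I_k) (h : 'rV[R]_n -> 'rV[R]_k) (c : R)
    (g : 'rV[R]_k -> R) t l :
  (forall (x : 'rV[R]_n) (r : R), h (r *: unitv i + x) = (r * c) *: unitv j + h x) ->
  is_derive (h t) (unitv j) g l ->
  is_derive t (unitv i) (fun x => g (h x)) (c * l).
Proof.
move=> hh hg; rewrite -[t]add0r -(scale0r (unitv i)); apply/is_derive_line.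
under eq_fun do rewrite hh.
have h1 := is_derive_affine1 c 0 0.
have h2 : is_derive ((fun r => r * c + 0) 0) (1 : R) (fun r => g (r *: unitv j + h t)) l.
  by apply/is_derive_line; rewrite mul0r add0r scale0r add0r.
rewrite mulrC.
have := @is_derive1_comp R (fun r => g (r *: unitv j + h t)) (fun r => r * c + 0) 0 _ _ h2 h1.
by congr is_derive; apply/funext => r /=; rewrite addr0.
Qed.

Lemma cid_affine n k (i : 'I_n) (j : 'I_k) (h : 'rV[R]_n -> 'rV[R]_k) (c : R)
    (g : 'rV[R]_k -> C) t l :
  (forall (x : 'rV[R]_n) (r : R), h (r *: unitv i + x) = (r * c) *: unitv j + h x) ->
  cid j g (h t) l -> cid i (fun x => g (h x)) t (c%:C%C * l).
Proof.
move=> hh [g1 g2]; split.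
  by rewrite ReM /= mul0r subr0; exact: is_derive_affine hh g1.
by rewrite ImM /= mul0r addr0; exact: is_derive_affine hh g2.
Qed.

Lemma dotv_unit n (r : R) (i : 'I_n) (x y : 'rV[R]_n) :
  dotv (r *: unitv i + x) y = r * y 0 i + dotv x y.
Proof.
rewrite /dotv; under eq_bigr do rewrite !mxE eqxx /= mulrDl.
rewrite big_split/=; congr (_ + _).
rewrite (bigD1 i)//= eqxx mulr1 big1 ?addr0// => j ji.
by rewrite (negbTE ji) mulr0 mul0r.
Qed.

Lemma is_derive_comp_affine n (f : 'rV[R]_n -> R) (i : 'I_n) (x : 'rV[R]_n)
    (F : R -> R) (a dF : R) :
  (forall r y, f (r *: unitv i + y) = r * a + f y) ->
  is_derive (f x) (1 : R) F dF ->
  is_derive x (unitv i) (fun y => F (f y)) (dF * a).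
Proof.
move=> hf hF; rewrite -[x]add0r -(scale0r (unitv i)); apply/is_derive_line.
under eq_fun do rewrite hf.
have h1 := is_derive_affine1 a (f x) 0.
have hF' : is_derive ((fun r => r * a + f x) 0) (1 : R) F dF.
  by rewrite mul0r add0r.
exact: (@is_derive1_comp R F (fun r => r * a + f x) 0 _ _ hF' h1).
Qed.

Lemma cid_expi n (i : 'I_n) (xi x : 'rV[R]_n) :
  cid i (fun y => expi (dotv y xi)) x (Complex 0 (xi 0 i) * expi (dotv x xi)).
Proof.
have h r (y : 'rV[R]_n) : dotv (r *: unitv i + y) xi = r * xi 0 i + dotv y xi.
  exact: dotv_unit.
split => /=.
  apply: (@is_derive_eq _ _ _ _ _ _ _ _ (is_derive_comp_affine h (is_derive_cos _))).
  by ring.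
apply: (@is_derive_eq _ _ _ _ _ _ _ _ (is_derive_comp_affine h (is_derive_sin _))).
by ring.
Qed.

Lemma cid_coord n (i j : 'I_n) (x : 'rV[R]_n) :
  cid i (fun y : 'rV[R]_n => (y 0 j)%:C%C) x (j == i)%:R.
Proof.
split => /=; last by case: (j == i); exact: is_derive_cst.
have h r (y : 'rV[R]_n) : (r *: unitv i + y) 0 j = r * (j == i)%:R + y 0 j.
  by rewrite !mxE eqxx.
apply: (@is_derive_eq _ _ _ _ _ _ _ _ (is_derive_comp_affine h (is_derive_id _ _))).
by rewrite mul1r; case: (j == i).
Qed.

Lemma MVT_line n (f : 'rV[R]_n -> R) (i : 'I_n) (x : 'rV[R]_n) (r : R) :
  (forall y, derivable f y (unitv i)) ->
  exists2 s, `|s| <= `|r| &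
    f (r *: unitv i + x) - f x = r * 'D_(unitv i) f (s *: unitv i + x).
Proof.
move=> df.
pose g (s : R) := f (s *: unitv i + x).
have dg s : is_derive s (1 : R) g ('D_(unitv i) f (s *: unitv i + x)).
  by apply/is_derive_line; apply: DeriveDef.
have cg : continuous g.
  move=> s; apply: differentiable_continuous; apply/derivable1_diffP.
  exact: (@ex_derive _ _ _ _ _ _ _ (dg s)).
have g0 : g 0 = f x by rewrite /g scale0r add0r.
case: (leP 0 r) => r0.
  have [s] := MVT_segment r0 (fun s _ => dg s) (continuous_subspaceT cg).
  rewrite in_itv/= => /andP[s0 sr]; rewrite g0 subr0 mulrC => E.
  by exists s => //; rewrite !ger0_norm.
have [s] := MVT_segment (ltW r0) (fun s _ => dg s) (continuous_subspaceT cg).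
rewrite in_itv/= => /andP[s0 sr]; rewrite g0 sub0r mulrN => E.
exists s; first by rewrite !ler0_norm ?(ltW r0)// lerN2.
by apply: oppr_inj; rewrite opprB E mulrC.
Qed.

(** The passage from [x] to [x + v] changes one coordinate at a time; all intermediate points stay
    in the box spanned by [v], where the derivatives are bounded by [M]. *)
Lemma MVT_box n (f : 'rV[R]_n -> R) (x v : 'rV[R]_n) (M : R) :
  (forall i y, derivable f y (unitv i)) ->
  (forall i (w : 'rV[R]_n), (forall j, `|w 0 j| <= `|v 0 j|) ->
    `|'D_(unitv i) f (x + w)| <= M) ->
  `|f (x + v) - f x| <= M * \sum_i `|v 0 i|.
Proof.
move=> df hM.
pose w (k : nat) : 'rV[R]_n := \row_i (if (i < k)%N then v 0 i else 0).
have wS (k : 'I_n) : w k.+1 = v 0 k *: unitv k + w k.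
  apply/rowP => i; rewrite !mxE eqxx /= ltnS leq_eqVlt.
  case: (ltngtP i k) => [ik|ki|/val_inj ->] /=.
  - by rewrite (negbTE (_ : i != k)) ?mulr0 ?add0r// -val_eqE ltn_eqF.
  - by rewrite (negbTE (_ : i != k)) ?mulr0 ?add0r// -val_eqE gtn_eqF.
  - by rewrite eqxx mulr1 addr0.
have step (k : 'I_n) : `|f (x + w k.+1) - f (x + w k)| <= M * `|v 0 k|.
  rewrite wS addrCA.
  have [s sv ->] := MVT_line (x + w k) (v 0 k) (df k).
  rewrite normrM mulrC ler_wpM2r//.
  rewrite addrCA; apply: hM => j; rewrite !mxE eqxx /=.
  case: (ltngtP j k) => [jk|kj|/val_inj ->] /=.
  - by rewrite (negbTE (_ : j != k)) ?mulr0 ?add0r// -val_eqE ltn_eqF.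
  - by rewrite (negbTE (_ : j != k)) ?mulr0 ?add0r ?normr0// -val_eqE gtn_eqF.
  - by rewrite eqxx mulr1 addr0.
have tot (k : nat) (kn : (k <= n)%N) :
    `|f (x + w k) - f x| <= M * \sum_(i < n | (i < k)%N) `|v 0 i|.
  elim: k kn => [_|k IH kn].
    rewrite (_ : w 0%N = 0) ?addr0 ?subrr ?normr0 ?big_pred0 ?mulr0//.
    by apply/rowP => i; rewrite !mxE.
  rewrite -(subrKA (f (x + w k))) (le_trans (ler_normD _ _))//.
  rewrite (bigD1 (Ordinal kn))//= mulrDr lerD//; first exact: (step (Ordinal kn)).
  rewrite (le_trans (IH (ltnW kn)))// le_eqVlt; apply/orP; left; apply/eqP.
  congr (_ * _); apply: eq_bigl => i; rewrite ltnS -val_eqE/=.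
  by case: (ltngtP i k).
have := tot n (leqnn n); rewrite (_ : w n = v); last first.
  by apply/rowP => i; rewrite !mxE ltn_ord.
by under eq_bigl do rewrite ltn_ord.
Qed.

Lemma MVT_norm n (f : 'rV[R]_n -> R) (x v : 'rV[R]_n) (M : R) :
  (forall i y, derivable f y (unitv i)) ->
  (forall i w, `|w| <= `|v| -> `|'D_(unitv i) f (x + w)| <= M) ->
  `|f (x + v) - f x| <= M * (n%:R * `|v|).
Proof.
case: n f x v => [|n] f x v df hM.
  by rewrite (_ : v = 0) ?addr0 ?subrr ?normr0 ?mulr0//; apply/rowP => -[].
have M0 : 0 <= M.
  by apply: le_trans (hM ord0 0 _); rewrite ?normr0.
apply: (le_trans (MVT_box (M := M) df _)).
  move=> i w hw; apply: hM; apply: norm_rV_le => // j.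
  exact: le_trans (hw j) (norm_coord v j).
rewrite ler_wpM2l// (le_trans (ler_sum _ (fun i _ => norm_coord v i)))//.
by rewrite sumr_const card_ord mulr_natl.
Qed.

Lemma continuous_rVP n (f : 'rV[R]_n -> R) : continuous f <->
  forall (x : 'rV[R]_n) (e : R), 0 < e -> exists2 d : R, 0 < d &
    forall y : 'rV[R]_n, `|y - x| < d -> `|f x - f y| <= e.
Proof.
have FF (x : 'rV[R]_n) : Filter (nbhs x) := @nbhs_filter ('rV[R]_n : topologicalType) x.
split=> [cf x e e0|h x].
  have /cvgrPdist_le /(_ e e0) := cf x.
  move/(@nbhs_ballP R ('rV[R]_n : pseudoMetricType R) x) => [d d0 hd]; exists d => // y yx; apply: hd.
  by rewrite -ball_normE /= distrC.
apply/cvgrPdist_le => e e0; apply/(@nbhs_ballP R ('rV[R]_n : pseudoMetricType R) x).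
have [d d0 hd] := h x e e0; exists d => // y.
by rewrite -ball_normE /= distrC; exact: hd.
Qed.

Lemma rcontD n (f g : 'rV[R]_n -> R) : continuous f -> continuous g ->
  continuous (fun x => f x + g x).
Proof.
move=> cf cg x.
exact: (@cvgD _ _ ('rV[R]_n : topologicalType) _ (nbhs_filter x) _ _ _ _ (cf x) (cg x)).
Qed.

Lemma rcontM n (f g : 'rV[R]_n -> R) : continuous f -> continuous g ->
  continuous (fun x => f x * g x).
Proof.
move=> cf cg x.
exact: (@cvgM _ ('rV[R]_n : topologicalType) _ (nbhs_filter x) _ _ _ _ (cf x) (cg x)).
Qed.

Lemma rcontN n (f : 'rV[R]_n -> R) : continuous f -> continuous (fun x => - f x).
Proof.
move=> cf x.
exact: (@cvgN _ _ ('rV[R]_n : topologicalType) _ (nbhs_filter x) _ _ (cf x)).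
Qed.

Lemma rcontB n (f g : 'rV[R]_n -> R) : continuous f -> continuous g ->
  continuous (fun x => f x - g x).
Proof. by move=> cf cg; apply: rcontD => //; exact: rcontN. Qed.

Lemma rcont_cst n (a : R) : continuous (fun _ : 'rV[R]_n => a).
Proof.
move=> x; exact: (@cvg_cst (R : topologicalType) a 'rV[R]_n _ (nbhs_filter (x : 'rV[R]_n))).
Qed.

Lemma rcont_comp n (f : 'rV[R]_n -> R) (g : R -> R) : continuous f -> continuous g ->
  continuous (fun x => g (f x)).
Proof. by move=> cf cg x; apply: continuous_comp; [exact: cf|exact: cg]. Qed.

Lemma rcont_norm n : continuous (fun x : 'rV[R]_n => `|x|).
Proof.
by apply/continuous_rVP => x e e0; exists e => // y yx; rewrite (le_trans (ler_dist_dist _ _))// distrC ltW.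
Qed.

Lemma rcont_coord n i : continuous (fun x : 'rV[R]_n => x 0 i).
Proof.
apply/continuous_rVP => x e e0; exists e => // y yx.
rewrite distrC (le_trans _ (ltW yx))//.
by have := norm_coord (y - x) i; rewrite !mxE.
Qed.

(** Locally bounded partial derivatives give a local Lipschitz estimate by the mean value
    inequality. The continuity demanded by [smooth] is thereby reduced to bounds on derivatives. *)
Lemma derivable_continuous n (f : 'rV[R]_n -> R) :
  (forall i y, derivable f y (unitv i)) ->
  (forall x, exists M, forall i w, `|w| <= 1 -> `|'D_(unitv i) f (x + w)| <= M) ->
  continuous f.
Proof.
move=> df h; apply/continuous_rVP => x e e0; have [M hM] := h x; have {}hM : forall i w, `|w| <= 1 -> `|'D_(unitv i) f (x + w)| <= `|M|.
  by move=> i w w1; rewrite (le_trans (hM i w w1))// ler_norm.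
pose K := `|M| * n%:R + 1; have K0 : 0 < K by rewrite ltr_wpDl// mulr_ge0.
exists (Num.min 1 (e / K)); first by rewrite lt_min ltr01 divr_gt0.
move=> y; rewrite lt_min => /andP[h1 h2].
rewrite -(subrKC x y) distrC.
apply: (le_trans (MVT_norm (M := `|M|) df _)).
  by move=> i w wy; apply: hM; exact: le_trans wy (ltW h1).
move: h2; rewrite ltr_pdivlMr// => /ltW; apply: le_trans.
by rewrite mulrA [leRHS]mulrC ler_wpM2r// lerDl.
Qed.

End PartialDerivatives.

(** * The weight 1 + |x| and its integrable powers *)

Section Weights.
Context {R : realType}.
Notation C := R[i].
Notation nc := (@Normc.normc R).

(* Equivalent to [bracket], but with Peetre's inequality in the form [omD]. *)
Definition om n (x : 'rV[R]_n) : R := 1 + `|x|.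

Lemma om_ge1 n (x : 'rV[R]_n) : 1 <= om x.
Proof. by rewrite lerDl. Qed.

Lemma om_gt0 n (x : 'rV[R]_n) : 0 < om x.
Proof. exact: lt_le_trans ltr01 (om_ge1 x). Qed.

Lemma om_ge0 n (x : 'rV[R]_n) : 0 <= om x.
Proof. exact: ltW (om_gt0 x). Qed.

Lemma omX_gt0 n (x : 'rV[R]_n) N : 0 < om x ^+ N.
Proof. by rewrite exprn_gt0 ?om_gt0. Qed.

Lemma omX_ge1 n (x : 'rV[R]_n) N : 1 <= om x ^+ N.
Proof. by rewrite exprn_ege1 ?om_ge1. Qed.

Lemma omV_ge0 n (x : 'rV[R]_n) N : 0 <= om x ^- N.
Proof. by rewrite invr_ge0 ltW ?omX_gt0. Qed.

Lemma omV_le1 n (x : 'rV[R]_n) N : om x ^- N <= 1.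
Proof. by rewrite invf_le1 ?omX_gt0 ?omX_ge1. Qed.

Lemma omV_homo n (x : 'rV[R]_n) M N : (M <= N)%N -> om x ^- N <= om x ^- M.
Proof.
by move=> MN; rewrite lef_pV2 ?posrE ?omX_gt0// ler_weXn2l ?om_ge1.
Qed.

Lemma omD n (x y : 'rV[R]_n) : om (x + y) <= om x * om y.
Proof.
rewrite /om mulrDl mul1r mulrDr mulr1 -addrA lerD2l addrA.
by rewrite (le_trans (ler_normD _ _))// [_ + `|x|]addrC lerDl mulr_ge0.
Qed.

Lemma omN n (x : 'rV[R]_n) : om (- x) = om x.
Proof. by rewrite /om normrN. Qed.

Lemma omB n (x y : 'rV[R]_n) : om x <= om (x - y) * om y.
Proof. by rewrite -{1}(subrK y x) omD. Qed.

Lemma om_coord n (x : 'rV[R]_n) i : `|x 0 i| <= om x.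
Proof. by rewrite (le_trans (norm_coord x i))// lerDr. Qed.

Lemma om_scale n (c : R) (x : 'rV[R]_n) : `|c| <= 1 -> om (c *: x) <= om x.
Proof. by move=> c1; rewrite lerD2l normrZ ler_piMl. Qed.

Lemma norm_row_mx n m (x : 'rV[R]_n) (y : 'rV[R]_m) :
  `|row_mx x y| = Num.max `|x| `|y|.
Proof.
apply/eqP; rewrite eq_le; apply/andP; split.
  apply: norm_rV_le => [|i]; first by rewrite le_max normr_ge0.
  rewrite mxE; case: fintype.split => j; rewrite le_max norm_coord ?orbT//.
rewrite ge_max; apply/andP; split; apply: norm_rV_le => // i.
  by rewrite -(row_mxEl x y) norm_coord.
by rewrite -(row_mxEr x y) norm_coord.
Qed.

Lemma om_row_l n m (x : 'rV[R]_n) (y : 'rV[R]_m) : om x <= om (row_mx x y).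
Proof. by rewrite lerD2l norm_row_mx le_max lexx. Qed.

Lemma om_row_r n m (x : 'rV[R]_n) (y : 'rV[R]_m) : om y <= om (row_mx x y).
Proof. by rewrite lerD2l norm_row_mx le_max lexx orbT. Qed.

Lemma om_row n m (x : 'rV[R]_n) (y : 'rV[R]_m) : om (row_mx x y) <= om x * om y.
Proof.
rewrite /om norm_row_mx mulrDl mul1r mulrDr mulr1 -addrA lerD2l.
by rewrite ge_max lerDl addr_ge0 ?mulr_ge0//= addrCA lerDl addr_ge0 ?mulr_ge0.
Qed.

(** The sup norm is attained at some coordinate. Decay of order [N] is thereby reduced to [n + 1]
    bounds: on the function and on its products with the pure powers of single coordinates. *)
Lemma omX_sum n (x : 'rV[R]_n) N :
  om x ^+ N <= 2 ^+ N * (1 + \sum_i `|x 0 i| ^+ N).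
Proof.
have S0 : 0 <= \sum_i `|x 0 i| ^+ N by rewrite sumr_ge0// => i _; rewrite exprn_ge0.
have [h|h] := leP `|x| 1.
  rewrite (@le_trans _ _ (2 ^+ N))//; last by rewrite ler_peMr ?exprn_ge0// lerDl.
  by rewrite lerXn2r ?nnegrE ?om_ge0// /om -[2]/(1 + 1) lerD2l.
have [[i0 i] Ei] : exists i : 'I_1 * 'I_n, `|x| = `|x i.1 i.2|.
  by apply: mx_norm_neq0; rewrite -[mx_norm x]/`|x| gt_eqF// (lt_trans ltr01 h).
rewrite (@le_trans _ _ ((2 * `|x|) ^+ N))//.
  rewrite lerXn2r ?nnegrE ?om_ge0 ?mulr_ge0//.
  by rewrite mulrDl mul1r lerD2r ltW.
rewrite exprMn ler_wpM2l ?exprn_ge0// Ei /= ord1 (bigD1 i)//=.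
by rewrite addrCA lerDl addr_ge0// sumr_ge0// => j _; rewrite exprn_ge0.
Qed.

Lemma intg_prodV n : intg (fun x : 'rV[R]_n => \prod_i (1 + x 0 i ^+ 2)^-1).
Proof.
have p0 (x : 'rV[R]_n) : 0 <= \prod_i (1 + x 0 i ^+ 2)^-1.
  by rewrite prodr_ge0// => i _; rewrite invr_ge0 addr_ge0 ?sqr_ge0.
have m1 : measurable_fun [set: R] (fun x : R => (1 + x ^+ 2)^-1).
  by apply: continuous_measurable_fun; exact: continuous_oneDsqrV.
apply/intgE; split.
  apply: measurable_prod => i _; apply: (measurableT_comp m1).
  exact: mble_coord.
under eq_fun do rewrite ger0_norm//.
rewrite /eint.
under eq_integral do under eq_bigr do rewrite row_ofE.
rewrite (ge0_int_prod (g := fun i x => (1 + x ^+ 2)^-1))//; last first.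
  by move=> i x; rewrite invr_ge0 addr_ge0 ?sqr_ge0.
have i0 : (0 <= \int[@lebesgue_measure R]_x ((1 + x ^+ 2)^-1)%:E)%E.
  by apply: integral_ge0 => x _; rewrite lee_fin invr_ge0 addr_ge0 ?sqr_ge0.
have [r ->] : exists r : R, (\int[@lebesgue_measure R]_x ((1 + x ^+ 2)^-1)%:E = r%:E)%E.
  exists (fine (\int[@lebesgue_measure R]_x ((1 + x ^+ 2)^-1)%:E)%E).
  by rewrite fineK// ge0_fin_numE//; exact: int_oneDsqr_lty.
by rewrite prodEFin ltry.
Qed.

(** With the sup norm, each factor [1 + x_i ^+ 2] is at most [om x ^+ 2]. This is the source of the
    exponent [2 * n] in the integrability conditions. *)
Lemma om_prodV n (x : 'rV[R]_n) : om x ^- (2 * n) <= \prod_i (1 + x 0 i ^+ 2)^-1.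
Proof.
rewrite prodfV lef_pV2 ?posrE ?omX_gt0//; last first.
  by apply: prodr_gt0 => i _; rewrite ltr_wpDr ?sqr_ge0.
rewrite exprM -[X in _ ^+ X]card_ord -prodr_const; apply: ler_prod => i _.
rewrite addr_ge0 ?sqr_ge0//= /om sqrrD expr1n mul1r -addrA lerD2l.
rewrite -[leLHS]add0r lerD ?mulrn_wge0//.
by rewrite -real_normK ?num_real// lerXn2r ?nnegrE// norm_coord.
Qed.

Lemma rcont_om n : continuous (@om n).
Proof. by apply: rcontD; [exact: rcont_cst|exact: rcont_norm]. Qed.

Lemma mble_om n : mble (@om n).
Proof. by apply: continuous_mble; exact: (@rcont_om n). Qed.

Lemma mble_omV n N : mble (fun x : 'rV[R]_n => om x ^- N).
Proof.
(* The inner absolute value keeps the denominator positive for every real argument, so that the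
   outer function is continuous on all of R. *)
have m1 : mble (fun x : 'rV[R]_n => (1 + `| `|x| |)^-1).
  apply: continuous_mble.
  apply: (@rcont_comp _ _ (fun x => `|x|) (fun r => (1 + `|r|)^-1)); first exact: rcont_norm.
  move=> r; apply: (@cvgV _ _ _ _ (fun r => 1 + `|r|)).
    by rewrite gt_eqF// ltr_wpDr.
  by apply: cvgD; [exact: cvg_cst|exact: norm_continuous].
have -> : (fun x : 'rV[R]_n => om x ^- N) = (fun x => (1 + `| `|x| |)^-1 ^+ N).
  by apply/funext => x; rewrite normr_id exprVn.
exact: measurable_funX.
Qed.

Lemma intg_omV n N : (2 * n <= N)%N -> intg (fun x : 'rV[R]_n => om x ^- N).
Proof.
move=> nN; apply: (le_intg (mble_omV _) _ (intg_prodV n)) => x.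
by rewrite ger0_norm ?omV_ge0// (le_trans (omV_homo _ nN))// om_prodV.
Qed.

End Weights.

(** * Families of smooth functions with uniform derivative bounds *)

Section DerivativeBounds.
Context {R : realType}.
Notation C := R[i].
Notation nc := (@Normc.normc R).

Lemma partials_rcons n (s : seq 'I_n) i (f : 'rV[R]_n -> C) :
  partials (rcons s i) f = partials s (partial i f).
Proof. by rewrite /partials foldr_rcons. Qed.

Lemma smooth_ccont n (f : 'rV[R]_n -> C) : smooth f -> ccont f.
Proof. by move=> /(_ [::]) [h1 h2 _]. Qed.

Lemma smooth_cid n (f : 'rV[R]_n -> C) i x : smooth f -> cid i f x (partial i f x).
Proof. by move=> /(_ [::]) [_ _ /(_ i x)[h1 h2]]; split; exact: (@DeriveDef _ _ _ _ _ _ _ _ erefl). Qed.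

Lemma smooth_partial n (f : 'rV[R]_n -> C) i : smooth f -> smooth (partial i f).
Proof. by move=> sf s; have := sf (rcons s i); rewrite partials_rcons. Qed.

Lemma smooth_partials n (f : 'rV[R]_n -> C) s : smooth f -> smooth (partials s f).
Proof.
by move=> sf s'; have := sf (s' ++ s); rewrite /partials foldr_cat.
Qed.

(** The Leibniz rule leads out of a class of products, but not out of the finite sums of its
    members; hence this closure. *)
Inductive fspan T n (P : (T -> 'rV[R]_n -> C) -> Prop) :
    (T -> 'rV[R]_n -> C) -> Prop :=
| fspan_base F : P F -> fspan P F
| fspan_add F G : fspan P F -> fspan P G -> fspan P (fun t x => F t x + G t x).

Lemma ccontD n (f g : 'rV[R]_n -> C) : ccont f -> ccont g -> ccont (fun x => f x + g x).
Proof.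
move=> [f1 f2] [g1 g2]; split.
  by under eq_fun do rewrite ReD; exact: rcontD.
by under eq_fun do rewrite ImD; exact: rcontD.
Qed.

Lemma ccontM n (f g : 'rV[R]_n -> C) : ccont f -> ccont g -> ccont (fun x => f x * g x).
Proof.
move=> [f1 f2] [g1 g2]; split.
  by under eq_fun do rewrite ReM; apply: rcontB; exact: rcontM.
by under eq_fun do rewrite ImM; apply: rcontD; exact: rcontM.
Qed.

Lemma ccontJ n (f : 'rV[R]_n -> C) : ccont f -> ccont (fun x => conjc (f x)).
Proof.
move=> [f1 f2]; split; first by under eq_fun do rewrite ReJ.
by under eq_fun do rewrite ImJ; exact: rcontN.
Qed.

Lemma ccont_cst n (c : C) : ccont (fun _ : 'rV[R]_n => c).
Proof. by split; exact: rcont_cst. Qed.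

Lemma ccont_comp n k (h : 'rV[R]_n -> 'rV[R]_k) (f : 'rV[R]_k -> C) :
  (forall x y, `|h y - h x| <= `|y - x|) -> ccont f -> ccont (fun x => f (h x)).
Proof.
by move=> hh [f1 f2]; split; apply/continuous_rVP => x e e0;
 [have [d d0 hd] := (continuous_rVP _).1 f1 (h x) e e0
 |have [d d0 hd] := (continuous_rVP _).1 f2 (h x) e e0];
 exists d => // y yx; apply: hd; exact: le_lt_trans (hh _ _) yx.
Qed.

Lemma cid_ccont n (f : 'rV[R]_n -> C) (g : 'I_n -> 'rV[R]_n -> C) :
  (forall i x, cid i f x (g i x)) ->
  (forall x, exists M, forall i w, `|w| <= 1 -> nc (g i (x + w)) <= M) ->
  ccont f.
Proof.
move=> df h; split; apply: derivable_continuous.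
- by move=> i y; exact: (@ex_derive _ _ _ _ _ _ _ (df i y).1).
- move=> x; have [M hM] := h x; exists M => i w w1.
  by rewrite (@derive_val _ _ _ _ _ _ _ (df i (x + w)).1) (le_trans (nc_Re _))// hM.
- by move=> i y; exact: (@ex_derive _ _ _ _ _ _ _ (df i y).2).
- move=> x; have [M hM] := h x; exists M => i w w1.
  by rewrite (@derive_val _ _ _ _ _ _ _ (df i (x + w)).2) (le_trans (nc_Im _))// hM.
Qed.

(* It suffices to exhibit a class [P] of families whose first derivatives are finite sums
   of members of [P]. *)
Lemma fspan_smooth T n (P B : (T -> 'rV[R]_n -> C) -> Prop) :
  (forall F G, B F -> B G -> B (fun t x => F t x + G t x)) ->
  (forall F, P F -> [/\ forall t, ccont (F t), B F &
     forall i, exists2 G, fspan P G & forall t x, cid i (F t) x (G t x)]) ->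
  forall F, fspan P F ->
    (forall t, smooth (F t)) /\ forall s, B (fun t => partials s (F t)).
Proof.
move=> BD hP.
have hS F : fspan P F -> [/\ forall t, ccont (F t), B F &
     forall i, exists2 G, fspan P G & forall t x, cid i (F t) x (G t x)].
  elim=> [|{}F G _ [f1 f2 f3] _ [g1 g2 g3]]; first exact: hP.
  split; [by move=> t; exact: ccontD|exact: BD|] => i.
  have [F' PF' F'E] := f3 i; have [G' PG' G'E] := g3 i.
  exists (fun t x => F' t x + G' t x); first exact: fspan_add.
  by move=> t x; exact: cidD.
have hs s F : fspan P F -> exists2 G, fspan P G & forall t, partials s (F t) = G t.
  move=> PF; elim: s => [|i s [G PG GE]]; first by exists F.
  have [_ _ /(_ i)[G' PG' G'E]] := hS _ PG.
  exists G' => // t; rewrite -[LHS]/(partial i (partials s (F t))) GE.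
  by apply/funext => x; exact: cid_partial.
move=> F PF; split.
  move=> t s; have [G PG /(_ t) ->] := hs s _ PF.
  have [/(_ t)[c1 c2] _ h] := hS _ PG; split=> // i x.
  have [G' _ /(_ t x)[d1 d2]] := h i.
  by split; [exact: (@ex_derive _ _ _ _ _ _ _ d1)|exact: (@ex_derive _ _ _ _ _ _ _ d2)].
move=> s; have [G PG E] := hs s _ PF.
have [_ BG _] := hS _ PG.
by rewrite (_ : (fun t => _) = G)//; apply/funext.
Qed.

(** Constant and exponent are uniform in [t] and [x]. The weight [W] records the size that matters,
    the power of [oT] an unspecified polynomial loss in the parameter. *)
Definition bdd T n (oT : T -> R) (W : T -> 'rV[R]_n -> R)
    (F : T -> 'rV[R]_n -> C) : Prop :=
  exists (K0 : R) (K : nat), 0 <= K0 /\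
    forall t x, nc (F t x) <= K0 * oT t ^+ K * W t x.

(* Families of smooth functions all of whose derivatives are bounded by the
   weight [W], up to constants and powers of the growth parameter [oT]. *)
Definition dbd T n (oT : T -> R) (W : T -> 'rV[R]_n -> R)
    (F : T -> 'rV[R]_n -> C) : Prop :=
  (forall t, smooth (F t)) /\ forall s, bdd oT W (fun t => partials s (F t)).

Lemma bddD T n (oT : T -> R) W (F G : T -> 'rV[R]_n -> C) :
  (forall t, 1 <= oT t) -> (forall t x, 0 <= W t x) ->
  bdd oT W F -> bdd oT W G -> bdd oT W (fun t x => F t x + G t x).
Proof.
move=> o1 W0 [a [k [a0 ha]]] [b [l [b0 hb]]].
exists (a + b), (k + l)%N; split; first exact: addr_ge0.
move=> t x; rewrite (le_trans (ncD _ _))// 2!mulrDl lerD//.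
  rewrite (le_trans (ha t x))// ler_wpM2r// ler_wpM2l//.
  by rewrite ler_weXn2l// leq_addr.
rewrite (le_trans (hb t x))// ler_wpM2r// ler_wpM2l//.
by rewrite ler_weXn2l// leq_addl.
Qed.

Lemma bddM T n (oT : T -> R) W1 W2 (F G : T -> 'rV[R]_n -> C) :
  bdd oT W1 F -> bdd oT W2 G ->
  bdd oT (fun t x => W1 t x * W2 t x) (fun t x => F t x * G t x).
Proof.
move=> [a [k [a0 ha]]] [b [l [b0 hb]]].
exists (a * b), (k + l)%N; split; first exact: mulr_ge0.
move=> t x; rewrite ncM (le_trans (ler_pM (nc_ge0 _) (nc_ge0 _) (ha t x) (hb t x)))//.
by rewrite exprD le_eqVlt; apply/orP; left; apply/eqP; ring.
Qed.

Lemma bdd_weaken T n (oT oT' : T -> R) W W' (F : T -> 'rV[R]_n -> C) (c : R) (k : nat) :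
  (forall t, 1 <= oT t) -> (forall t, oT t <= oT' t) -> 0 <= c ->
  (forall t x, W t x <= c * oT' t ^+ k * W' t x) ->
  bdd oT W F -> bdd oT' W' F.
Proof.
move=> o1 oo c0 hW [a [l [a0 ha]]].
have o0 t : 0 <= oT t := le_trans ler01 (o1 t).
have o'0 t : 0 <= oT' t := le_trans (o0 t) (oo t).
exists (a * c), (l + k)%N; split; first exact: mulr_ge0.
move=> t x; rewrite (le_trans (ha t x))//.
apply: (@le_trans _ _ (a * oT' t ^+ l * W t x)).
  have [W0|W0] := leP 0 (W t x).
    by rewrite ler_wpM2r// ler_wpM2l// lerXn2r ?nnegrE.
  (* The bound is on a modulus, so a negative weight is possible only if the constant [a]
     vanishes. *)
  have := nc_ge0 (F t x); move/le_trans/(_ (ha t x)).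
  rewrite nmulr_lge0// => h.
  have -> : a * oT t ^+ l = 0.
    by apply/eqP; rewrite eq_le h mulr_ge0 ?exprn_ge0.
  move: h; rewrite pmulr_lle0 ?exprn_gt0 ?(lt_le_trans ltr01)// => h.
  by rewrite (_ : a = 0) ?mul0r//; apply/eqP; rewrite eq_le h.
apply: (@le_trans _ _ (a * oT' t ^+ l * (c * oT' t ^+ k * W' t x))).
  by rewrite ler_wpM2l ?mulr_ge0 ?exprn_ge0.
by rewrite exprD le_eqVlt; apply/orP; left; apply/eqP; ring.
Qed.

Lemma dbd_weaken T n (oT oT' : T -> R) W W' (F : T -> 'rV[R]_n -> C) (c : R) (k : nat) :
  (forall t, 1 <= oT t) -> (forall t, oT t <= oT' t) -> 0 <= c ->
  (forall t x, W t x <= c * oT' t ^+ k * W' t x) ->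
  dbd oT W F -> dbd oT' W' F.
Proof.
move=> o1 oo c0 hW [sF h]; split => // s; exact: bdd_weaken o1 oo c0 hW (h s).
Qed.

Lemma dbd_partial T n (oT : T -> R) W (F : T -> 'rV[R]_n -> C) i :
  dbd oT W F -> dbd oT W (fun t => partial i (F t)).
Proof.
move=> [sF h]; split; first by move=> t; exact: smooth_partial.
by move=> s; have := h (rcons s i); under eq_fun do rewrite partials_rcons.
Qed.

Lemma dbd_bdd T n (oT : T -> R) W (F : T -> 'rV[R]_n -> C) : dbd oT W F -> bdd oT W F.
Proof. by move=> [_ /(_ [::])]. Qed.

Lemma dbd_reindex T T' n (rho : T' -> T) (oT : T -> R) W (F : T -> 'rV[R]_n -> C) :
  dbd oT W F -> dbd (oT \o rho) (fun t => W (rho t)) (fun t => F (rho t)).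
Proof.
move=> [sF h]; split; first by move=> t; exact: sF.
move=> s; have [a [k [a0 ha]]] := h s; exists a, k; split => // t x; exact: ha.
Qed.

Section Families.
Variables (T : Type) (n : nat) (oT : T -> R).
Hypothesis oT1 : forall t, 1 <= oT t.

Lemma dbdD W (F G : T -> 'rV[R]_n -> C) : (forall t x, 0 <= W t x) ->
  dbd oT W F -> dbd oT W G -> dbd oT W (fun t x => F t x + G t x).
Proof.
move=> W0 dF dG.
apply: (@fspan_smooth T n (dbd oT W) (bdd oT W)).
- by move=> ? ?; exact: bddD.
- move=> H dH; split; [by move=> t; exact: smooth_ccont (dH.1 t)|exact: dbd_bdd|].
  move=> i; exists (fun t => partial i (H t)).
    by apply: fspan_base; exact: dbd_partial.
  by move=> t x; apply: smooth_cid; exact: dH.1.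
- by apply: fspan_add; apply: fspan_base.
Qed.

Lemma dbdM W1 W2 (F G : T -> 'rV[R]_n -> C) :
  (forall t x, 0 <= W1 t x) -> (forall t x, 0 <= W2 t x) ->
  dbd oT W1 F -> dbd oT W2 G ->
  dbd oT (fun t x => W1 t x * W2 t x) (fun t x => F t x * G t x).
Proof.
move=> W10 W20 dF dG.
apply: (@fspan_smooth T n (fun H => exists F G, [/\ dbd oT W1 F, dbd oT W2 G &
   H = fun t x => F t x * G t x])).
- by move=> ? ?; apply: bddD => // t x; exact: mulr_ge0.
- move=> _ [{}F [{}G [{}dF {}dG ->]]]; split.
  + by move=> t; apply: ccontM; apply: smooth_ccont; [exact: dF.1|exact: dG.1].
  + by apply: bddM; exact: dbd_bdd.
  + move=> i; exists (fun t x => partial i (F t) x * G t x + F t x * partial i (G t) x).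
      apply: fspan_add; apply: fspan_base.
        by exists (fun t => partial i (F t)), G; split => //; exact: dbd_partial.
      by exists F, (fun t => partial i (G t)); split => //; exact: dbd_partial.
    by move=> t x; apply: cidM; apply: smooth_cid; [exact: dF.1|exact: dG.1].
- by apply: fspan_base; exists F, G.
Qed.

Lemma dbd_cst (a : T -> C) W : bdd oT W (fun t (_ : 'rV[R]_n) => a t) ->
  (forall t x, 0 <= W t x) -> dbd oT W (fun t (_ : 'rV[R]_n) => a t).
Proof.
move=> ha W0.
apply: (@fspan_smooth T n (fun H => exists2 a : T -> C, bdd oT W (fun t (_ : 'rV[R]_n) => a t) & H = fun t _ => a t)).
- by move=> ? ?; exact: bddD.
- move=> _ [{}a {}ha ->]; split => //; first by move=> t; exact: ccont_cst.
  move=> i; exists (fun t _ => 0); last by move=> t x; exact: cid_cst.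
  apply: fspan_base; exists (fun=> 0) => //; exists 0, 0%N; split => // t x.
  by rewrite nc0 !mul0r.
- by apply: fspan_base; exists a.
Qed.

Lemma dbdJ W (F : T -> 'rV[R]_n -> C) : (forall t x, 0 <= W t x) ->
  dbd oT W F -> dbd oT W (fun t x => conjc (F t x)).
Proof.
move=> W0 dF.
apply: (@fspan_smooth T n (fun H => exists2 F, dbd oT W F & H = fun t x => conjc (F t x))).
- by move=> ? ?; exact: bddD.
- move=> _ [{}F {}dF ->]; split.
  + by move=> t; apply: ccontJ; apply: smooth_ccont; exact: dF.1.
  + have [a [k [a0 ha]]] := dbd_bdd dF; exists a, k; split => // t x.
    by rewrite nc_conj.
  + move=> i; exists (fun t x => conjc (partial i (F t) x)).
      by apply: fspan_base; exists (fun t => partial i (F t)) => //; exact: dbd_partial.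
    by move=> t x; apply: cidJ; apply: smooth_cid; exact: dF.1.
- by apply: fspan_base; exists F.
Qed.

(** This covers translations, dilations and the midpoint map. Each derivative produces a factor
    [c t]; as [|c t| <= 1], the accumulated factor [e] in the class below stays bounded by 1. *)
Lemma dbd_comp k (h : T -> 'rV[R]_n -> 'rV[R]_k) (c : T -> R) (sg : 'I_n -> 'I_k)
    W (F : T -> 'rV[R]_k -> C) :
  (forall t i x r, h t (r *: unitv i + x) = (r * c t) *: unitv (sg i) + h t x) ->
  (forall t x y, `|h t y - h t x| <= `|y - x|) ->
  (forall t, `|c t| <= 1) -> (forall t x, 0 <= W t x) ->
  dbd oT W F -> dbd oT (fun t x => W t (h t x)) (fun t x => F t (h t x)).
Proof.
move=> hh hc c1 W0 dF.
apply: (@fspan_smooth T n (fun H => exists F (e : T -> C), [/\ dbd oT W F,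
   (forall t, nc (e t) <= 1) & H = fun t x => e t * F t (h t x)])).
- by move=> ? ?; exact: bddD.
- move=> _ [{}F [e [{}dF e1 ->]]]; split.
  + move=> t; apply: ccontM; first exact: ccont_cst.
    by apply: ccont_comp; [exact: hc|exact: smooth_ccont (dF.1 t)].
  + have [a [l [a0 ha]]] := dbd_bdd dF; exists a, l; split => // t x.
    by rewrite ncM (le_trans _ (ha t _))// ler_piMl ?nc_ge0.
  + move=> i; exists (fun t x => (e t * (c t)%:C%C) * partial (sg i) (F t) (h t x)).
      apply: fspan_base; exists (fun t => partial (sg i) (F t)), (fun t => e t * (c t)%:C%C).
      split => //; first exact: dbd_partial.
      by move=> t; rewrite ncM nc_real mulr_ile1 ?nc_ge0.
    move=> t x; rewrite -mulrA; apply: cidZ.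
    apply: (cid_affine (fun x r => hh t i x r)).
    by apply: smooth_cid; exact: dF.1.
- apply: fspan_base; exists F, (fun=> 1); split => //; first by move=> t; rewrite nc1.
  by apply/funext => t; apply/funext => x; rewrite mul1r.
Qed.

(** Each derivative brings out a coordinate of [xi t], which is absorbed by one more power of
    [oT]. *)
Lemma dbd_expi (xi : T -> 'rV[R]_n) : (forall t, om (xi t) <= oT t) ->
  dbd oT (fun _ _ => 1) (fun t x => expi (dotv x (xi t))).
Proof.
move=> hxi.
apply: (@fspan_smooth T n (fun H => exists2 a : T -> C, bdd oT (fun _ _ => 1) (fun t (_ : 'rV[R]_n) => a t) &
   H = fun t x => a t * expi (dotv x (xi t)))).
- by move=> ? ?; apply: bddD.
- move=> _ [a [K0 [K [K00 ha]]] ->]; split.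
  + move=> t; apply: (cid_ccont (g := fun i x => a t * (Complex 0 (xi t 0 i) * expi (dotv x (xi t))))).
      by move=> i x; apply: cidZ; exact: cid_expi.
    move=> x; exists (nc (a t) * om (xi t)) => i w _.
    by rewrite !ncM nc_expi mulr1 nc_imag ler_wpM2l ?nc_ge0// om_coord.
  + by exists K0, K; split => // t x; rewrite ncM nc_expi mulr1; exact: (ha t x).
  + move=> i; exists (fun t x => (a t * Complex 0 (xi t 0 i)) * expi (dotv x (xi t))).
      apply: fspan_base; exists (fun t => a t * Complex 0 (xi t 0 i)) => //.
      exists K0, K.+1; split => // t x; rewrite ncM nc_imag mulr1 exprSr mulrA.
      apply: ler_pM => //; first exact: nc_ge0.
        by have := ha t x; rewrite mulr1.
      exact: le_trans (om_coord _ _) (hxi t).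
    by move=> t x; rewrite -mulrA; apply: cidZ; exact: cid_expi.
- apply: fspan_base; exists (fun=> 1).
    by exists 1, 0%N; split => // t x; rewrite nc1 expr0 !mulr1.
  by apply/funext => t; apply/funext => x; rewrite mul1r.
Qed.

Lemma dbd_coord j : dbd oT (fun _ x => om x) (fun (_ : T) (x : 'rV[R]_n) => (x 0 j)%:C%C).
Proof.
have o0 t : 0 <= oT t := le_trans ler01 (oT1 t).
have ccj : ccont (fun x : 'rV[R]_n => (x 0 j)%:C%C).
  by split; [exact: rcont_coord|exact: rcont_cst].
apply: (@fspan_smooth T n (fun H => H = (fun _ x => (x 0 j)%:C%C) \/
   exists2 a : C, nc a <= 1 & H = fun _ _ => a)).
- by move=> ? ?; apply: bddD => // t x; exact: om_ge0.
- move=> _ [->|[a ha ->]]; split => //.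
  + exists 1, 0%N; split => // t x; rewrite nc_real expr0 !mul1r; exact: om_coord.
  + move=> i; exists (fun _ _ => (j == i)%:R); last by move=> t x; exact: cid_coord.
    apply: fspan_base; right; exists (j == i)%:R => //.
    by case: (j == i); rewrite ?nc1 ?nc0.
  + by move=> t; exact: ccont_cst.
  + exists 1, 0%N; split => // t x; rewrite expr0 !mul1r.
    exact: le_trans ha (om_ge1 _).
  + move=> i; exists (fun _ _ => 0); last by move=> t x; exact: cid_cst.
    by apply: fspan_base; right; exists 0 => //; rewrite nc0.
- by apply: fspan_base; left.
Qed.

End Families.

End DerivativeBounds.

(** * Differentiation under the integral and decay of Fourier transforms *)

Section UnderIntegral.
Context {R : realType}.
Notation C := R[i].
Notation nc := (@Normc.normc R).

Lemma is_derive_rint n k (f g : 'rV[R]_n -> 'rV[R]_k -> R) (i : 'I_n) x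
    (H : 'rV[R]_k -> R) :
  (forall y w, is_derive y (unitv i) (f^~ w) (g y w)) ->
  (forall y, intg (f y)) -> intg H ->
  (forall r w, `|r| <= 1 -> `|g (r *: unitv i + x) w| <= H w) ->
  is_derive x (unitv i) (fun y => rint (f y)) (rint (g x)).
Proof.
move=> df fi Hi gH.
pose f1 (r : R) (t : k.-tuple (measurableTypeR R)) := f (r *: unitv i + x) (row_of t).
have df1 r t : is_derive r (1 : R) (f1 ^~ t) (g (r *: unitv i + x) (row_of t)).
  by apply/(is_derive_line (f ^~ (row_of t))); exact: df.
have d1E r t : partial1of2 f1 r t = g (r *: unitv i + x) (row_of t).
  by rewrite partial1of2E; exact: derive_val.
have H0 w : 0 <= H w.
  by rewrite (le_trans _ (gH 0 w _)) ?normr0.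
have I0 : [set` `](-1 : R), 1[] 0 by rewrite /= in_itv/= ltr01 oppr_lt0 ltr01.
have hyp1 r : [set` `](-1 : R), 1[] r ->
    (@leb R k).-integrable setT (EFin \o f1 r) by move=> _; exact: fi.
have hyp2 r t : [set` `](-1 : R), 1[] r -> setT t -> derivable (f1 ^~ t) r 1.
  by move=> _ _; exact: (@ex_derive _ _ _ _ _ _ _ (df1 r t)).
have hyp3 r t : [set` `](-1 : R), 1[] r -> setT t -> `|partial1of2 f1 r t| <= H (row_of t).
  rewrite /= in_itv/= => /andP[r1 r2] _; rewrite d1E; apply: gH.
  by rewrite ler_norml !ltW.
have D1 := derivable_under_integral measurableT I0 hyp1 hyp2 (fun t => H0 (row_of t)) Hi hyp3.
have D2 := differentiation_under_integral measurableT I0 hyp1 hyp2 (fun t => H0 (row_of t)) Hi hyp3.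
rewrite -[x]add0r -(scale0r (unitv i)); apply/is_derive_line.
rewrite derive1E in D2.
apply: (@is_derive_eq _ _ _ _ _ _ _ _ (DeriveDef D1 D2)).
by congr fine; apply: eq_integral => t _; rewrite d1E.
Qed.

Lemma cid_integralC n k (f g : 'rV[R]_n -> 'rV[R]_k -> C) (i : 'I_n) x
    (H : 'rV[R]_k -> R) :
  (forall y w, cid i (f^~ w) y (g y w)) ->
  (forall y, cintg (f y)) -> intg H ->
  (forall r w, `|r| <= 1 -> nc (g (r *: unitv i + x) w) <= H w) ->
  cid i (fun y => integralC (f y)) x (integralC (g x)).
Proof.
move=> df fi Hi gH; split.
  apply: (is_derive_rint (H := H) (f := fun y w => Re (f y w)) (g := fun y w => Re (g y w))) => //.
  - by move=> y w; exact: (df y w).1.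
  - by move=> y; exact: cintg_Re.
  - by move=> r w r1; rewrite (le_trans (nc_Re _))// gH.
apply: (is_derive_rint (H := H) (f := fun y w => Im (f y w)) (g := fun y w => Im (g y w))) => //.
- by move=> y w; exact: (df y w).2.
- by move=> y; exact: cintg_Im.
- by move=> r w r1; rewrite (le_trans (nc_Im _))// gH.
Qed.

Lemma is_derive_cvg n (f : 'rV[R]_n -> R) x v l : is_derive x v f l ->
  k.+1%:R * (f (k.+1%:R^-1 *: v + x) - f x) @[k --> \oo] --> l.
Proof.
move=> [h1 h2]; have {h1 h2} : h^-1 *: ((f \o shift x) (h *: v) - f x) @[h --> 0^'] --> l.
  by rewrite -h2; exact: h1.
move=> /cvgr_dnbhsP h.
have := h (fun k => k.+1%:R^-1) (conj _ (@cvg_harmonic R)).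
have k0 k : k.+1%:R^-1 != 0 :> R by rewrite invr_eq0 pnatr_eq0.
move=> /(_ k0); apply: cvg_trans; rewrite (_ : (fun k => k.+1%:R * _) =
  (fun k => (k.+1%:R^-1)^-1 *: ((f \o shift x) (k.+1%:R^-1 *: v) - f x)))//.
by apply/funext => k; rewrite invrK.
Qed.

(** A derivative is the pointwise limit of difference quotients with steps [1 / k.+1], and limits
    preserve measurability. *)
Lemma cmble_cid n k (f g : 'rV[R]_n -> 'rV[R]_k -> C) (i : 'I_n) x :
  (forall w, cid i (f^~ w) x (g x w)) -> (forall y, cmble (f y)) -> cmble (g x).
Proof.
move=> df mf; split.
  apply: (mble_cvg (h := fun j w => j.+1%:R * (Re (f (j.+1%:R^-1 *: unitv i + x) w) - Re (f x w)))).
    by move=> j; apply: measurable_funM => //; apply: measurable_funB; [exact: (mf _).1|exact: (mf _).1].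
  by move=> w; exact: (is_derive_cvg (df w).1).
apply: (mble_cvg (h := fun j w => j.+1%:R * (Im (f (j.+1%:R^-1 *: unitv i + x) w) - Im (f x w)))).
  by move=> j; apply: measurable_funM => //; apply: measurable_funB; [exact: (mf _).2|exact: (mf _).2].
by move=> w; exact: (is_derive_cvg (df w).2).
Qed.

Lemma cmble_shift n (v : 'rV[R]_n) (f : 'rV[R]_n -> C) :
  cmble f -> cmble (fun x => f (x + v)).
Proof.
move=> [f1 f2]; split.
  by have := affine_mble 1 v f1; under eq_fun do rewrite scale1r.
by have := affine_mble 1 v f2; under eq_fun do rewrite scale1r.
Qed.

Lemma norm_unitv n (i : 'I_n) : `|unitv i : 'rV[R]_n| <= 1.
Proof.
apply: norm_rV_le => // j; rewrite !mxE eqxx /=.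
by case: (_ == _); rewrite ?normr1 ?normr0.
Qed.

Lemma om_unitv n (i : 'I_n) r (x : 'rV[R]_n) : `|r| <= 1 ->
  om (r *: unitv i + x) <= 2 * om x.
Proof.
move=> r1; rewrite (le_trans (omD _ _))// ler_wpM2r ?om_ge0// /om -[2]/(1 + 1) lerD2l.
by rewrite normrZ mulr_ile1// norm_unitv.
Qed.

Lemma omV_unitv n (i : 'I_n) r (x : 'rV[R]_n) N : `|r| <= 1 ->
  om (r *: unitv i + x) ^- N <= 2 ^+ N * om x ^- N.
Proof.
move=> r1; rewrite -ler_pdivrMl ?exprn_gt0// -invfM lef_pV2 ?posrE ?mulr_gt0 ?exprn_gt0 ?om_gt0//.
rewrite -exprMn lerXn2r ?nnegrE ?mulr_ge0 ?om_ge0//.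
have := @om_unitv n i (- r) (r *: unitv i + x).
by rewrite normrN scaleNr addKr; exact.
Qed.

Lemma omV_shift n (x y : 'rV[R]_n) N : om (x + y) ^- N <= om y ^+ N * om x ^- N.
Proof.
rewrite -ler_pdivrMl ?omX_gt0// -invfM lef_pV2 ?posrE ?mulr_gt0 ?omX_gt0//.
rewrite -exprMn lerXn2r ?nnegrE ?mulr_ge0 ?om_ge0//.
by rewrite mulrC -(omN y) -{1}(addrK y x) omD.
Qed.

(** Translation invariance makes the integral of [H (w + y)] over [w] constant in [y], and its
    derivative at 0 is the integral of [H']. All integrations by parts below come from this. *)
Lemma integralC_partial0 n (H H' : 'rV[R]_n -> C) (i : 'I_n) (K : R) N :
  (2 * n <= N)%N -> (forall x, cid i H x (H' x)) -> cmble H ->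
  (forall x, nc (H x) <= K * om x ^- N) -> (forall x, nc (H' x) <= K * om x ^- N) ->
  cintg H' /\ integralC H' = 0.
Proof.
move=> nN dH mH bH bH'.
have K0 : 0 <= K.
  have := le_trans (nc_ge0 _) (bH 0); rewrite pmulr_lge0// invr_gt0 omX_gt0 //.
have iH : cintg H by apply: (le_cintg mH bH); apply: intgZ; exact: intg_omV.
have ds y w : cid i (fun y => H (w + y)) y (H' (w + y)).
  apply: (cid_eq (cid_affine (c := 1) (j := i) (h := fun y => w + y) _ (dH (w + y)))).
    by move=> x r; rewrite mulr1 addrCA.
  by rewrite mul1r.
have iH' : cintg H'.
  apply: (le_cintg _ bH'); last by apply: intgZ; exact: intg_omV.
  have := @cmble_cid n n (fun y w => H (w + y)) (fun y w => H' (w + y)) i 0.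
  under [X in _ -> _ -> cmble X]eq_fun do rewrite addr0; apply => [w|y]; first exact: ds.
  exact: cmble_shift.
split => //.
have iK : intg (fun w : 'rV[R]_n => K * 2 ^+ N * om w ^- N).
  by apply: intgZ; exact: intg_omV.
have iHs y : cintg (fun w => H (w + y)) := (integralC_shift y iH).1.
have hb r w : `|r| <= 1 -> nc (H' (w + (r *: unitv i + 0))) <= K * 2 ^+ N * om w ^- N.
  move=> r1; rewrite (le_trans (bH' _))// -mulrA ler_wpM2l//.
  by rewrite addr0 addrC; exact: omV_unitv.
have D := @cid_integralC n n (fun y w => H (w + y)) (fun y w => H' (w + y)) i 0 _
  (fun y w => ds y w) iHs iK hb.
have E : (fun y : 'rV[R]_n => integralC (fun w => H (w + y))) = (fun=> integralC H).
  by apply/funext => y; exact: (integralC_shift y iH).2.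
move: D; rewrite E => D.
have := cid_partial D; rewrite (cid_partial (cid_cst i (integralC H) 0)) => ->.
by apply: eq_integralC => w; rewrite addr0.
Qed.

(** The phase carries a plus sign and there is no normalizing factor, so the usual transform at [xi]
    is [ft G (- xi)]. *)
Definition ft n (G : 'rV[R]_n -> C) (xi : 'rV[R]_n) : C :=
  integralC (fun t => expi (dotv t xi) * G t).

Lemma ccont_expi n (xi : 'rV[R]_n) : ccont (fun t : 'rV[R]_n => expi (dotv t xi)).
Proof.
apply: (cid_ccont (g := fun i t => Complex 0 (xi 0 i) * expi (dotv t xi))).
  by move=> i x; exact: cid_expi.
by move=> x; exists (om xi) => i w _; rewrite ncM nc_expi mulr1 nc_imag om_coord.
Qed.

Lemma cintg_ft n (G : 'rV[R]_n -> C) g xi : cmble G -> (forall t, nc (G t) <= g t) ->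
  intg g -> cintg (fun t => expi (dotv t xi) * G t).
Proof.
move=> mG Gg gi; apply: (le_cintg _ _ gi).
  by apply: cmbleM => //; apply: ccont_cmble; exact: ccont_expi.
by move=> t; rewrite ncM nc_expi mul1r.
Qed.

Lemma nc_ft n (G : 'rV[R]_n -> C) g xi : cmble G -> (forall t, nc (G t) <= g t) ->
  intg g -> nc (ft G xi) <= 2 * rint g.
Proof.
move=> mG Gg gi; apply: nc_integralC => //.
  by apply: cmbleM => //; apply: ccont_cmble; exact: ccont_expi.
by move=> t; rewrite ncM nc_expi mul1r.
Qed.

Lemma ft_partial n (G : 'rV[R]_n -> C) (i : 'I_n) (K : R) N xi :
  (2 * n <= N)%N -> smooth G ->
  (forall x, nc (G x) <= K * om x ^- N) ->
  (forall x, nc (partial i G x) <= K * om x ^- N) ->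
  ft (partial i G) xi = - Complex 0 (xi 0 i) * ft G xi.
Proof.
move=> nN sG bG bG'.
have K0 : 0 <= K.
  by have := le_trans (nc_ge0 _) (bG 0); rewrite pmulr_lge0// invr_gt0 omX_gt0.
have giN : intg (fun w : 'rV[R]_n => K * om w ^- N) by apply: intgZ; exact: intg_omV.
have mG : cmble G by apply: ccont_cmble; exact: smooth_ccont.
have mG' : cmble (partial i G).
  by apply: ccont_cmble; apply: smooth_ccont; exact: smooth_partial.
pose H' t := Complex 0 (xi 0 i) * expi (dotv t xi) * G t + expi (dotv t xi) * partial i G t.
have dH x : cid i (fun t => expi (dotv t xi) * G t) x (H' x).
  by apply: cidM; [exact: cid_expi|exact: smooth_cid].
have [] := @integralC_partial0 n _ _ i ((om xi + 1) * K) N nN dH.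
- by apply: cmbleM => //; apply: ccont_cmble; exact: ccont_expi.
- move=> x; rewrite ncM nc_expi mul1r (le_trans (bG x))// ler_wpM2r ?omV_ge0//.
  by rewrite ler_peMl// lerDr om_ge0.
- move=> x; rewrite /H' (le_trans (ncD _ _))// !ncM nc_expi mulr1 mul1r nc_imag.
  rewrite 2!mulrDl mul1r lerD// -mulrA; apply: ler_pM => //; first exact: nc_ge0.
  exact: om_coord.
move=> _.
have -> : H' = (fun t => Complex 0 (xi 0 i) * (expi (dotv t xi) * G t) + expi (dotv t xi) * partial i G t).
  by apply/funext => t; rewrite /H' mulrA.
rewrite integralCD; last 2 first.
- by apply: cintgZ; exact: cintg_ft mG bG giN.
- exact: cintg_ft mG' bG' giN.
rewrite integralCZ; last exact: cintg_ft mG bG giN.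
by move/eqP; rewrite addrC addr_eq0 -mulNr => /eqP.
Qed.

(** Integrating by parts [N] times in one variable turns the factor [xi_i ^+ N] into a derivative of
    [G t], and pure powers are enough by [omX_sum]. The bound depends on [t] only through [oT] and
    [Th]. *)
Lemma ft_decay T n (oT : T -> R) (Th : T -> R) M (G : T -> 'rV[R]_n -> C) :
  (forall t, 1 <= oT t) -> (forall t, 0 <= Th t) -> (2 * n <= M)%N ->
  dbd oT (fun t x => Th t * om x ^- M) G ->
  forall N, exists (K0 : R) (K : nat), 0 <= K0 /\
    forall t xi, nc (ft (G t) xi) <= K0 * oT t ^+ K * Th t * om xi ^- N.
Proof.
move=> o1 Th0 nM [sG bG] N.
have o0 t : 0 <= oT t := le_trans ler01 (o1 t).
have iter_ft (i : 'I_n) k t xi :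
    nc (ft (partials (nseq k i) (G t)) xi) = `|xi 0 i| ^+ k * nc (ft (G t) xi).
  elim: k => [|k IH]; first by rewrite expr0 mul1r.
  have [a [k1 [a0 ha]]] := bG (nseq k i); have [b [k2 [b0 hb]]] := bG (nseq k.+1 i).
  rewrite -[partials _ _]/(partial i (partials (nseq k i) (G t))).
  rewrite (ft_partial (K := a * oT t ^+ k1 * Th t + b * oT t ^+ k2 * Th t) (N := M))//.
  - by rewrite ncM ncN nc_imag IH exprS mulrA.
  - exact: smooth_partials.
  - move=> x; rewrite (le_trans (ha t x))// mulrDl mulrA lerDl.
    by rewrite !mulr_ge0 ?exprn_ge0 ?omV_ge0.
  - move=> x; rewrite (le_trans (hb t x))// mulrDl mulrA lerDr.
    by rewrite !mulr_ge0 ?exprn_ge0 ?omV_ge0.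
have bd (s : seq 'I_n) : exists (K0 : R) (K : nat), 0 <= K0 /\
    forall t xi, nc (ft (partials s (G t)) xi) <= K0 * oT t ^+ K * Th t.
  have [a [k1 [a0 ha]]] := bG s.
  exists (2 * (a * rint (fun x : 'rV[R]_n => om x ^- M))), k1; split.
    by rewrite !mulr_ge0// rint_ge0// => x; exact: omV_ge0.
  move=> t xi.
  apply: (le_trans (nc_ft (g := fun x => (a * oT t ^+ k1 * Th t) * om x ^- M) _ _ _ _)).
  - by apply: ccont_cmble; apply: smooth_ccont; exact: smooth_partials.
  - by move=> x; rewrite (le_trans (ha t x))// mulrA.
  - by apply: intgZ; exact: intg_omV.
  - rewrite rintZ; last exact: intg_omV.
    by rewrite le_eqVlt; apply/orP; left; apply/eqP; ring.
(* [None] stands for the summand 1 and [Some i] for the summand with [xi_i ^+ N] in [omX_sum]. *)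
pose A (j : option 'I_n) := if j is Some i then nseq N i else [::].
have hA j := bd (A j).
have /choice[a ha] : forall j : option 'I_n, exists aK : R * nat, 0 <= aK.1 /\
    forall t xi, nc (ft (partials (A j) (G t)) xi) <= aK.1 * oT t ^+ aK.2 * Th t.
  by move=> j; have [K0 [K h]] := hA j; exists (K0, K).
pose S1 := (a None).1 + \sum_i (a (Some i)).1.
pose S2 := ((a None).2 + \sum_i (a (Some i)).2)%N.
exists (2 ^+ N * S1), S2; split.
  rewrite mulr_ge0 ?exprn_ge0// addr_ge0//; first by have [] := ha None.
  by rewrite sumr_ge0// => j _; have [] := ha (Some j).
move=> t xi; rewrite ler_pdivlMr ?omX_gt0// mulrC.
apply: (@le_trans _ _ (2 ^+ N * (1 + \sum_i `|xi 0 i| ^+ N) * nc (ft (G t) xi))).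
  by rewrite ler_wpM2r ?nc_ge0// omX_sum.
rewrite -!mulrA ler_wpM2l ?exprn_ge0// mulrDl mul1r mulr_suml.
have key j : nc (ft (partials (A j) (G t)) xi) <=
    (a j).1 * (oT t ^+ S2 * Th t).
  have [aj0 h] := ha j; rewrite (le_trans (h t xi))// -mulrA ler_wpM2l//.
  rewrite ler_wpM2r// ler_weXn2l// /S2; case: (j) => [i|]; last exact: leq_addr.
  by rewrite (bigD1 i)//= addnCA leq_addr.
rewrite mulrDl mulr_suml; apply: lerD; first exact: (key None).
apply: ler_sum => i _; rewrite -iter_ft; exact: (key (Some i)).
Qed.

End UnderIntegral.

(** * Mixed partials, multi-indices and Schwartz seminorms *)

Section MixedPartials.
Context {R : realType}.
Notation C := R[i].
Notation nc := (@Normc.normc R).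

(** The mixed second difference with step [d] does not depend on the order of the two steps, and by
    the mean value theorem it is [d ^+ 2] times a value of either mixed derivative near [x].
    Symmetry identifies derivatives along arbitrary sequences with the ordered ones in
    [mpartial]. *)
Lemma clairaut n (f fi fj fij fji : 'rV[R]_n -> R) (i j : 'I_n) x :
  (forall y, is_derive y (unitv i) f (fi y)) ->
  (forall y, is_derive y (unitv j) f (fj y)) ->
  (forall y, is_derive y (unitv j) fi (fij y)) ->
  (forall y, is_derive y (unitv i) fj (fji y)) ->
  continuous fij -> continuous fji -> fij x = fji x.
Proof.
have mvt2 (g gi gij : 'rV[R]_n -> R) (a b : 'I_n) (d : R) :
    (forall y, is_derive y (unitv a) g (gi y)) ->
    (forall y, is_derive y (unitv b) gi (gij y)) ->
    exists2 p : 'rV[R]_n, `|p - x| <= `|d| + `|d| &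
      (g (d *: unitv b + (d *: unitv a + x)) - g (d *: unitv a + x)) -
      (g (d *: unitv b + x) - g x) = d * (d * gij p).
  move=> dg dgi.
  pose ph y := g (d *: unitv b + y) - g y.
  have dph y : is_derive y (unitv a) ph (gi (d *: unitv b + y) - gi y).
    apply: is_deriveB.
    have := @is_derive_affine R n n a a (fun y => d *: unitv b + y) 1 g y _ _ (dg (d *: unitv b + y)).
    by rewrite mul1r; apply => z r; rewrite mulr1 addrCA.
  have [s sd E1] := @MVT_line R n ph a x d (fun y => @ex_derive _ _ _ _ _ _ _ (dph y)).
  have [s' s'd E2] := @MVT_line R n gi b (s *: unitv a + x) d
     (fun y => @ex_derive _ _ _ _ _ _ _ (dgi y)).
  exists (s' *: unitv b + (s *: unitv a + x)).
    rewrite addrA addrK (le_trans (ler_normD _ _))// !normrZ.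
    apply: lerD; [rewrite -[leRHS]mulr1|rewrite -[leRHS]mulr1];
      by apply: ler_pM => //; exact: norm_unitv.
  rewrite -/(ph (d *: unitv a + x)) -/(ph x) E1 (@derive_val _ _ _ _ _ _ _ (dph _)) E2.
  by rewrite (@derive_val _ _ _ _ _ _ _ (dgi _)).
move=> di dj dij dji /continuous_rVP cij /continuous_rVP cji.
apply/eqP; rewrite -subr_eq0 -normr_le0; apply/ler_addgt0Pr => e e0.
rewrite add0r.
have e20 : 0 < e / 2 by rewrite divr_gt0.
have [d1 d10 h1] := cij x _ e20; have [d2 d20 h2] := cji x _ e20.
pose d := Num.min d1 d2 / 3.
have d0 : 0 < d by rewrite divr_gt0// lt_min d10 d20.
have dd : `|d| + `|d| < Num.min d1 d2.
  rewrite gtr0_norm// /d; have : 0 < Num.min d1 d2 by rewrite lt_min d10.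
  by move=> h; lra.
have [p px Ep] := mvt2 f fi fij i j d di dij.
have [q qx Eq] := mvt2 f fj fji j i d dj dji.
have E : fij p = fji q.
  apply: (mulfI (lt0r_neq0 d0)); apply: (mulfI (lt0r_neq0 d0)).
  rewrite -Ep -Eq addrCA; set A := f (_ + (_ + x)); ring.
have -> : fij x - fji x = (fij x - fij p) - (fji x - fji q) by rewrite E; ring.
rewrite (le_trans (ler_normB _ _))// [e]splitr lerD//.
  by apply: h1; rewrite (le_lt_trans px)// (lt_le_trans dd)// ge_min lexx.
by apply: h2; rewrite (le_lt_trans qx)// (lt_le_trans dd)// ge_min lexx orbT.
Qed.

Lemma partialC n (f : 'rV[R]_n -> C) i j : smooth f ->
  partial j (partial i f) = partial i (partial j f).
Proof.
move=> sf; have si := smooth_partial i sf; have sj := smooth_partial j sf.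
have [c1 c2] := smooth_ccont (smooth_partial j si).
have [c3 c4] := smooth_ccont (smooth_partial i sj).
apply/funext => x; apply: complexP.
  exact: (@clairaut n _ (fun y => Re (partial i f y)) (fun y => Re (partial j f y)) _ _ i j x
    (fun y => (smooth_cid i y sf).1) (fun y => (smooth_cid j y sf).1)
    (fun y => (smooth_cid j y si).1) (fun y => (smooth_cid i y sj).1) c1 c3).
exact: (@clairaut n _ (fun y => Im (partial i f y)) (fun y => Im (partial j f y)) _ _ i j x
  (fun y => (smooth_cid i y sf).2) (fun y => (smooth_cid j y sf).2)
  (fun y => (smooth_cid j y si).2) (fun y => (smooth_cid i y sj).2) c2 c4).
Qed.

Lemma partials_cons_rcons n (f : 'rV[R]_n -> C) i s : smooth f ->
  partials (i :: s) f = partials (rcons s i) f.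
Proof.
move=> sf; elim: s => [//|j s IH] /=.
rewrite partialC; last exact: smooth_partials.
by rewrite -[partial i _]/(partials (i :: s) f) IH.
Qed.

Lemma partials_perm n (f : 'rV[R]_n -> C) s s' : smooth f -> perm_eq s s' ->
  partials s f = partials s' f.
Proof.
move=> sf; elim: s s' => [|i s IH] s' ss'.
  by move: ss'; rewrite perm_sym => /perm_nilP ->.
have : i \in s' by rewrite -(perm_mem ss') mem_head.
move=> is'; case/splitPr: is' ss' => s1 s2 ss'.
have {}ss' : perm_eq s (s1 ++ s2).
  rewrite -(perm_cons i) (perm_trans ss')//.
  by rewrite -cat1s perm_catCA.
rewrite {2}/partials foldr_cat -/(partials s1 _) -/(partials (i :: s2) f).
rewrite -[partials (i :: s2) f]/(partial i (partials s2 f)) -partials_rcons.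
rewrite -partials_cons_rcons; last exact: smooth_partials.
rewrite -[LHS]/(partial i (partials s f)) (IH _ ss').
by rewrite {1}/partials foldr_cat.
Qed.

Definition mseq n (alpha : 'I_n -> nat) : seq 'I_n :=
  flatten [seq nseq (alpha i) i | i <- enum 'I_n].

Lemma mpartialE n (f : 'rV[R]_n -> C) alpha :
  mpartial alpha f = partials (mseq alpha) f.
Proof.
rewrite /mpartial /mseq; elim: (enum 'I_n) => [//|i l IH] /=.
rewrite IH /partials foldr_cat; move: (foldr _ f _) => g.
by elim: (alpha i) => [//|k IHk] /=; rewrite IHk.
Qed.

Lemma partials_mpartial n (f : 'rV[R]_n -> C) s : smooth f ->
  partials s f = mpartial (fun i => count_mem i s) f.
Proof.
move=> sf; rewrite mpartialE; apply: partials_perm => //.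
apply/allP => j _ /=; rewrite /mseq count_flatten -map_comp sumnE big_map.
rewrite big_enum/= (bigD1 j)//= count_nseq /= eqxx mul1n big1 ?addn0//.
by move=> i ij; rewrite count_nseq /= (negbTE ij) mul0n.
Qed.

Lemma mlen_count n (s : seq 'I_n) : mlen (fun i => count_mem i s) = size s.
Proof.
rewrite /mlen; elim: s => [|i s IH] /=; first by rewrite big1.
rewrite big_split/= IH (bigD1 i)//= eqxx big1 ?addn0//.
by move=> j ji; rewrite eq_sym (negbTE ji).
Qed.

Lemma mpow_le n (alpha : 'I_n -> nat) (x : 'rV[R]_n) :
  `|mpow alpha x| <= om x ^+ mlen alpha.
Proof.
rewrite /mpow normr_prod /mlen expr_sum; apply: ler_prod => i _.
by rewrite normr_ge0/= normrX lerXn2r ?nnegrE ?om_ge0// om_coord.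
Qed.

(** A family of Schwartz functions all of whose seminorms are of size [Th t], up to constants and
    powers of [oT t]. In the applications [Th] is the order of a symbol at a point or the distance
    of two points. *)
Definition sfam T n (oT Th : T -> R) (F : T -> 'rV[R]_n -> C) : Prop :=
  forall N, dbd oT (fun t x => Th t * om x ^- N) F.

Lemma schwartz_sfam n (f : 'rV[R]_n -> C) : schwartz f ->
  sfam (fun _ : unit => 1) (fun=> 1) (fun=> f).
Proof.
move=> [sf h] N; split => // s.
(* The monomials 1 and [x_i ^+ N] are enough, by [omX_sum]. *)
pose al (j : option 'I_n) : 'I_n -> nat :=
  if j is Some i then (fun k => if k == i then N else 0%N) else fun=> 0%N.
have /choice[c hc] : forall j, exists c : R, forall x,
   `|mpow (al j) x| * nc (partials s f x) <= c.
  by move=> j; rewrite partials_mpartial//; exact: h.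
have c0 j : 0 <= c j.
  by apply: le_trans (hc j 0); rewrite mulr_ge0 ?nc_ge0.
exists (2 ^+ N * (c None + \sum_i c (Some i))), 0%N; split.
  by rewrite mulr_ge0 ?exprn_ge0// addr_ge0// sumr_ge0.
move=> _ x; rewrite expr0 mulr1 mul1r ler_pdivlMr ?omX_gt0// mulrC.
rewrite (le_trans (ler_wpM2r (nc_ge0 _) (omX_sum x N)))//.
rewrite -mulrA ler_wpM2l ?exprn_ge0// mulrDl mul1r mulr_suml lerD//.
  by have := hc None x; rewrite /mpow big1 ?normr1 ?mul1r// => i _; rewrite expr0.
apply: ler_sum => i _; have := hc (Some i) x.
rewrite /mpow (bigD1 i)//= eqxx big1 ?mulr1 ?normrX//.
by move=> j ji; rewrite (negbTE ji) expr0.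
Qed.

Lemma sfam_seminorm T n (oT Th : T -> R) (F : T -> 'rV[R]_n -> C) alpha beta :
  sfam oT Th F -> exists (K0 : R) (K : nat), 0 <= K0 /\ forall t x,
   `|mpow alpha x| * nc (mpartial beta (F t) x) <= K0 * oT t ^+ K * Th t.
Proof.
move=> /(_ (mlen alpha)) [_ /(_ (mseq beta)) [a [k [a0 ha]]]].
exists a, k; split => // t x; rewrite mpartialE.
apply: (@le_trans _ _ (om x ^+ mlen alpha * (a * oT t ^+ k * (Th t * om x ^- mlen alpha)))).
  by apply: ler_pM => //; [exact: nc_ge0|exact: mpow_le].
rewrite le_eqVlt; apply/orP; left; apply/eqP.
by rewrite mulrCA; congr (_ * _); rewrite mulrC mulfVK ?gt_eqF ?omX_gt0.
Qed.

Lemma sfam_schwartz T n (oT Th : T -> R) (F : T -> 'rV[R]_n -> C) t :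
  sfam oT Th F -> schwartz (F t).
Proof.
move=> hF; split; first by have [h _] := hF 0%N; exact: h.
move=> alpha beta; have [a [k [a0 ha]]] := sfam_seminorm alpha beta hF.
by exists (a * oT t ^+ k * Th t) => x; exact: ha.
Qed.

(* Only finitely many seminorms matter, hence any class [E] of bounds that is closed under
   addition can be used. *)
Lemma tempered_bound n (u : ('rV[R]_n -> C) -> C) T (E : (T -> R) -> Prop)
    (F : T -> 'rV[R]_n -> C) : tempered u ->
  E (fun=> 0) -> (forall e e', E e -> E e' -> E (fun t => e t + e' t)) ->
  (forall e t, E e -> 0 <= e t) -> (forall t, schwartz (F t)) ->
  (forall alpha beta, exists2 e, E e & forall t x,
     `|mpow alpha x| * nc (mpartial beta (F t) x) <= e t) ->
  exists (M : R) e, [/\ 0 <= M, E e & forall t, nc (u (F t)) <= M * e t].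
Proof.
move=> [_ [k [M hM]]] E0 ED Ege sF hF.
pose I := ({ffun 'I_n -> 'I_k.+1} * {ffun 'I_n -> 'I_k.+1})%type.
pose nf (g : {ffun 'I_n -> 'I_k.+1}) : 'I_n -> nat := fun i => g i.
have /choice[e he] : forall ab : I, exists e : T -> R, E e /\ forall t x,
   `|mpow (nf ab.1) x| * nc (mpartial (nf ab.2) (F t) x) <= e t.
  by move=> ab; have [e Ee h] := hF (nf ab.1) (nf ab.2); exists e.
have Es (s : seq I) : E (fun t => \sum_(ab <- s) e ab t).
  elim: s => [|ab s IH]; first by under eq_fun do rewrite big_nil.
  under eq_fun do rewrite big_cons; apply: ED => //; exact: (he ab).1.
exists `|M|, (fun t => \sum_(ab : I) e ab t); split => // t.
have B0 : 0 <= \sum_(ab : I) e ab t by rewrite sumr_ge0// => ab _; apply: Ege; exact: (he ab).1.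
apply: (@le_trans _ _ (M * \sum_(ab : I) e ab t)); last by rewrite ler_wpM2r// ler_norm.
apply: hM => // alpha beta al be x.
(* Multi-indices of length at most [k] have entries at most [k], so they occur among the finitely
   many elements of [I]. *)
have nfE (al' : 'I_n -> nat) : (mlen al' <= k)%N -> exists g, nf g = al'.
  move=> h; exists [ffun i => inord (al' i)]; apply/funext => i; rewrite /nf ffunE inordK//.
  by rewrite ltnS (leq_trans _ h)// /mlen (bigD1 i)//= leq_addr.
have [g1 <-] := nfE _ al; have [g2 <-] := nfE _ be.
rewrite (le_trans ((he (g1, g2)).2 t x))// (bigD1 (g1, g2))//= lerDl.
by rewrite sumr_ge0// => ab _; apply: Ege; exact: (he ab).1.
Qed.

Lemma tempered_sfam n (u : ('rV[R]_n -> C) -> C) T (oT Th : T -> R)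
    (F : T -> 'rV[R]_n -> C) : tempered u ->
  (forall t, 1 <= oT t) -> (forall t, 0 <= Th t) -> sfam oT Th F ->
  exists (K0 : R) (K : nat), 0 <= K0 /\
    forall t, nc (u (F t)) <= K0 * oT t ^+ K * Th t.
Proof.
move=> tu o1 Th0 hF.
have o0 t : 0 <= oT t := le_trans ler01 (o1 t).
have := @tempered_bound n u T (fun e => (forall t, 0 <= e t) /\ exists (K0 : R) (K : nat), 0 <= K0 /\
  forall t, e t <= K0 * oT t ^+ K * Th t) F tu.
case.
- by split => //; exists 0, 0%N; split => // t; rewrite !mul0r.
- move=> e e' [e0 [a [k [a0 ha]]]] [e'0 [b [l [b0 hb]]]]; split.
    by move=> t; exact: addr_ge0.
  exists (a + b), (k + l)%N; split; first exact: addr_ge0.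
  move=> t; rewrite 2!mulrDl; apply: lerD.
    rewrite (le_trans (ha t))// ler_wpM2r// ler_wpM2l//.
    by rewrite ler_weXn2l// leq_addr.
  rewrite (le_trans (hb t))// ler_wpM2r// ler_wpM2l//.
  by rewrite ler_weXn2l// leq_addl.
- by move=> e t [].
- by move=> t; exact: sfam_schwartz hF.
- move=> alpha beta; have [a [k [a0 ha]]] := sfam_seminorm alpha beta hF.
  exists (fun t => a * oT t ^+ k * Th t) => //; split.
    by move=> t; rewrite !mulr_ge0 ?exprn_ge0.
  by exists a, k.
move=> M [e [M0 [e0 [a [k [a0 ha]]]] h]].
exists (M * a), k; split; first exact: mulr_ge0.
by move=> t; rewrite (le_trans (h t))// -!mulrA ler_wpM2l// mulrA ha.
Qed.

Lemma schwartz_smooth n (f : 'rV[R]_n -> C) : schwartz f -> smooth f.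
Proof. by case. Qed.

Lemma schwartz_cmble n (f : 'rV[R]_n -> C) : schwartz f -> cmble f.
Proof. by move=> /schwartz_smooth/smooth_ccont/ccont_cmble. Qed.

Lemma schwartz_bound n (f : 'rV[R]_n -> C) N : schwartz f ->
  exists2 K : R, 0 <= K & forall x, nc (f x) <= K * om x ^- N.
Proof.
move=> /schwartz_sfam/(_ N)/dbd_bdd[a [k [a0 ha]]]; exists a => // x.
by have := ha tt x; rewrite expr1n mulr1 mul1r.
Qed.

Lemma sfam_reindex T T' n (rho : T' -> T) (oT Th : T -> R) (F : T -> 'rV[R]_n -> C) :
  sfam oT Th F -> sfam (oT \o rho) (Th \o rho) (fun t => F (rho t)).
Proof. by move=> hF N; exact: (dbd_reindex rho (hF N)). Qed.

Lemma sfam_weaken T n (oT oT' Th Th' : T -> R) (F : T -> 'rV[R]_n -> C) (c : R) (k : nat) :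
  (forall t, 1 <= oT t) -> (forall t, oT t <= oT' t) -> 0 <= c ->
  (forall t, Th t <= c * oT' t ^+ k * Th' t) ->
  sfam oT Th F -> sfam oT' Th' F.
Proof.
move=> o1 oo c0 h hF N; apply: (dbd_weaken (c := c) (k := k) o1 oo c0 _ (hF N)) => t x.
by rewrite mulrA ler_wpM2r ?omV_ge0.
Qed.

Lemma schwartz_sfamT T n (f : 'rV[R]_n -> C) : schwartz f ->
  sfam (fun _ : T => 1) (fun=> 1) (fun=> f).
Proof. by move=> /schwartz_sfam h; exact: (sfam_reindex (fun=> tt) h). Qed.

Lemma sfam1_schwartz n (f : 'rV[R]_n -> C) :
  sfam (fun _ : unit => 1) (fun=> 1) (fun=> f) -> schwartz f.
Proof. by move=> h; exact: (sfam_schwartz tt h). Qed.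

End MixedPartials.

(** * Fourier inversion *)

Section Gaussian.
Context {R : realType}.
Notation C := R[i].
Notation nc := (@Normc.normc R).

Lemma dotv_ge0 n (x : 'rV[R]_n) : 0 <= dotv x x.
Proof. by apply: sumr_ge0 => i _; rewrite -expr2 sqr_ge0. Qed.

Lemma enorm_sqr n (x : 'rV[R]_n) : enorm x ^+ 2 = dotv x x.
Proof. by rewrite sqr_sqrtr// dotv_ge0. Qed.

Lemma dotvC n (x y : 'rV[R]_n) : dotv x y = dotv y x.
Proof. by apply: eq_bigr => i _; rewrite mulrC. Qed.

Lemma dotvDl n (x y z : 'rV[R]_n) : dotv (x + y) z = dotv x z + dotv y z.
Proof. by rewrite -big_split; apply: eq_bigr => i _; rewrite mxE mulrDl. Qed.

Lemma dotvZl n (c : R) (x z : 'rV[R]_n) : dotv (c *: x) z = c * dotv x z.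
Proof. by rewrite mulr_sumr; apply: eq_bigr => i _; rewrite mxE mulrA. Qed.

Lemma dotvNl n (x z : 'rV[R]_n) : dotv (- x) z = - dotv x z.
Proof. by rewrite -scaleN1r dotvZl mulN1r. Qed.

Lemma dotvDr n (x y z : 'rV[R]_n) : dotv z (x + y) = dotv z x + dotv z y.
Proof. by rewrite dotvC dotvDl !(dotvC z). Qed.

Lemma dotvZr n (c : R) (x z : 'rV[R]_n) : dotv z (c *: x) = c * dotv z x.
Proof. by rewrite dotvC dotvZl dotvC. Qed.

Lemma dotvNr n (x z : 'rV[R]_n) : dotv z (- x) = - dotv z x.
Proof. by rewrite dotvC dotvNl dotvC. Qed.

Lemma norm_sqr_le n (x : 'rV[R]_n) : `|x| ^+ 2 <= dotv x x.
Proof.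
have [->|x0] := eqVneq x 0; first by rewrite normr0 expr0n/= dotv_ge0.
have [[i0 i] Ei] : exists i : 'I_1 * 'I_n, `|x| = `|x i.1 i.2|.
  by apply: mx_norm_neq0; rewrite -[mx_norm x]/`|x| normr_eq0.
rewrite Ei /= ord1 real_normK ?num_real// /dotv (bigD1 i)//= expr2 lerDl.
by apply: sumr_ge0 => j _; rewrite -expr2 sqr_ge0.
Qed.

Definition gauss n (b : R) (x : 'rV[R]_n) : R := expR (- (b * dotv x x)).

Lemma gauss_gt0 n b (x : 'rV[R]_n) : 0 < gauss b x.
Proof. exact: expR_gt0. Qed.

(** The inequality [1 + y <= expR y] with [y = b / N.+1 * dotv x x], raised to the power [N.+1],
    gives the decay. The constant [c] is chosen so that [c * y = dotv x x]. *)
Lemma gauss_le n b (x : 'rV[R]_n) : 0 < b -> forall N, exists2 K : R, 0 <= K &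
  forall x : 'rV[R]_n, gauss b x <= K * om x ^- N.
Proof.
move=> b0 N.
pose c := (b / N.+1%:R)^-1.
have c0 : 0 < c by rewrite invr_gt0 divr_gt0// ltr0n.
exists ((2 + c) ^+ N.+1) => [|{}x]; first by rewrite exprn_ge0// addr_ge0// ltW.
rewrite ler_pdivlMr ?omX_gt0//.
apply: (@le_trans _ _ (gauss b x * om x ^+ N.+1)).
  by rewrite ler_wpM2l ?(ltW (gauss_gt0 _ _))// ler_weXn2l ?om_ge1.
rewrite -ler_pdivlMl ?gauss_gt0// /gauss -expRN opprK mulrC.
have -> : expR (b * dotv x x) = expR (b / N.+1%:R * dotv x x) ^+ N.+1.
  by rewrite -expRM_natl; congr expR; rewrite mulrA [_ * (b / _)]mulrC divfK ?pnatr_eq0.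
rewrite -exprMn lerXn2r ?nnegrE ?om_ge0 ?mulr_ge0 ?expR_ge0 ?addr_ge0 ?(ltW c0)//.
apply: (@le_trans _ _ ((2 + c) * (1 + b / N.+1%:R * dotv x x))); last first.
  by rewrite ler_wpM2l ?expR_ge1Dx ?addr_ge0 ?(ltW c0)//.
have h1 := norm_sqr_le x.
have h2 : 0 <= (`|x| - 1) ^+ 2 by exact: sqr_ge0.
have h3 : c * (b / N.+1%:R * dotv x x) = dotv x x.
  by rewrite mulrA /c mulVf ?mul1r// mulf_neq0 ?gt_eqF// invr_gt0 ltr0n.
have h4 : 0 <= b / N.+1%:R * dotv x x by rewrite !mulr_ge0 ?dotv_ge0// ltW.
rewrite mulrDl !mulrDr h3 /om.
have gen (s D p q : R) : s ^+ 2 <= D -> 0 <= (s - 1) ^+ 2 -> 0 <= p -> 0 < q ->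
    1 + s <= 2 * 1 + 2 * p + (q * 1 + D) by move=> *; nra.
exact: gen.
Qed.

Lemma cid_gauss n b i (x : 'rV[R]_n) :
  cid i (fun y => (gauss b y)%:C%C) x ((- (2 * b)) %:C%C * ((x 0 i)%:C%C * (gauss b x)%:C%C)).
Proof.
split; last first.
  rewrite !(ImM, ReM) /= !(mulr0, mul0r, addr0, subr0); exact: is_derive_cst.
rewrite !(ImM, ReM) /= !(mulr0, mul0r, addr0, subr0).
rewrite -[X in is_derive X]add0r -(scale0r (unitv i)); apply/is_derive_line.
(* On a line the exponent is a quadratic polynomial in the parameter. *)
pose h (r : R) := r * (r * (- b) + - (2 * b * x 0 i)) + - (b * dotv x x).
have hE : (fun r : R => gauss b (r *: unitv i + x)) = expR \o h.
  apply/funext => r; rewrite /gauss /h /=; congr expR.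
  rewrite dotv_unit dotvC dotv_unit !mxE !eqxx /= mulr1.
  by ring.
have dh : is_derive (0 : R) (1 : R) h (- (2 * b * x 0 i)).
  apply: (@is_derive_eq _ _ _ _ _ _ _ _ (is_deriveD (is_deriveM
    (is_derive_id (0 : R) (1 : R)) (is_derive_affine1 (- b) (- (2 * b * x 0 i)) 0))
    (is_derive_cst (- (b * dotv x x)) (0 : R) (1 : R)))).
  rewrite /= mul0r add0r addr0 scale0r add0r; exact: mulr1.
have de : is_derive (h 0) (1 : R) expR (expR (h 0)) by exact: is_derive_expR.
have D : is_derive (0 : R) (1 : R) (fun r : R => gauss b (r *: unitv i + x))
    (expR (h 0) * - (2 * b * x 0 i)).
  by rewrite hE; exact: (@is_derive1_comp R expR h 0 _ _ de dh).
apply: (@is_derive_eq _ _ _ _ _ _ _ _ D).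
by rewrite /h /gauss mul0r add0r; ring.
Qed.

Lemma gauss_le1 n b (x : 'rV[R]_n) : 0 < b -> gauss b x <= 1.
Proof. by move=> b0; rewrite /gauss expR_le1 oppr_le0 mulr_ge0 ?dotv_ge0// ltW. Qed.

Lemma ccont_gauss n b : 0 < b -> ccont (fun y : 'rV[R]_n => (gauss b y)%:C%C).
Proof.
move=> b0.
apply: (cid_ccont (g := fun i x => (- (2 * b)) %:C%C * ((x 0 i)%:C%C * (gauss b x)%:C%C))).
  by move=> i x; exact: cid_gauss.
move=> x; exists (2 * b * ((om x * 2) * 1)) => i w w1.
rewrite !ncM !nc_real normrN (ger0_norm (_ : 0 <= 2 * b)) ?mulr_ge0 ?(ltW b0)//.
rewrite ler_wpM2l ?mulr_ge0 ?(ltW b0)//; apply: ler_pM => //.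
  rewrite (le_trans (om_coord _ _))// (le_trans (omD _ _))// ler_wpM2l ?om_ge0//.
  by rewrite /om -[2]/(1 + 1) lerD2l.
by rewrite gtr0_norm ?gauss_gt0// gauss_le1.
Qed.

Lemma schwartz_gauss n b : 0 < b -> schwartz (fun y : 'rV[R]_n => (gauss b y)%:C%C).
Proof.
move=> b0; apply: sfam1_schwartz => N.
(* Derivatives of the Gaussian are the Gaussian times factors [q] of polynomial growth; each
   derivative raises the order [M] by at most one. *)
pose P (H : unit -> 'rV[R]_n -> C) := exists M (q : unit -> 'rV[R]_n -> C),
   dbd (fun=> 1) (fun _ x => om x ^+ M) q /\ H = fun t x => q t x * (gauss b x)%:C%C.
apply: (@fspan_smooth R unit n P).
- by move=> F G; apply: bddD => // t x; rewrite mul1r omV_ge0.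
- move=> _ [M [q [dq ->]]]; split.
  + by move=> t; apply: ccontM; [exact: smooth_ccont (dq.1 t)|exact: ccont_gauss].
  + have [a [k [a0 ha]]] := dbd_bdd dq.
    have [c c0 hc] := gauss_le (0 : 'rV[R]_n) b0 (M + N)%N.
    exists (a * c), 0%N; split; first exact: mulr_ge0.
    move=> t x; rewrite ncM nc_real gtr0_norm ?gauss_gt0// expr0 mulr1 mul1r.
    apply: (@le_trans _ _ (a * om x ^+ M * (c * om x ^- (M + N)))).
      apply: ler_pM => //; [exact: nc_ge0|exact: ltW (gauss_gt0 _ _)|].
      by have := ha t x; rewrite expr1n mulr1.
    rewrite exprD invfM le_eqVlt; apply/orP; left; apply/eqP.
    by field; rewrite !gt_eqF ?omX_gt0.
  + move=> i.
    exists (fun t x => partial i (q t) x * (gauss b x)%:C%C +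
       ((- (2 * b))%:C%C * (q t x * (x 0 i)%:C%C)) * (gauss b x)%:C%C).
      apply: fspan_add; apply: fspan_base.
        by exists M, (fun t => partial i (q t)); split => //; exact: dbd_partial.
      exists M.+1, (fun t x => (- (2 * b))%:C%C * (q t x * (x 0 i)%:C%C)); split => //.
      have h : dbd (fun _ : unit => 1 : R) (fun _ x => om x ^+ M * om x) (fun t (x : 'rV[R]_n) => q t x * (x 0 i)%:C%C).
        by apply: dbdM => //; [move=> t x; rewrite ltW ?omX_gt0|move=> t x; exact: om_ge0|exact: dbd_coord].
      have hc : dbd (fun _ : unit => 1 : R) (fun _ _ => 1) (fun _ (_ : 'rV[R]_n) => (- (2 * b))%:C%C).
        apply: dbd_cst => //; exists (2 * b), 0%N; split; first by rewrite mulr_ge0// ltW.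
        by move=> t x; rewrite nc_real normrN ger0_norm ?mulr_ge0 ?(ltW b0)// expr0 !mulr1.
      apply: (@dbd_weaken R _ _ (fun=> 1) _ (fun _ x => 1 * (om x ^+ M * om x)) _ _ 1 0) => //.
        by move=> t x; rewrite expr0 !mul1r -exprSr.
      apply: dbdM => // t x.
      by rewrite mulr_ge0 ?om_ge0 ?ltW ?omX_gt0.
    move=> t x; apply: (cid_eq (cidM (smooth_cid i x (dq.1 t)) (cid_gauss b i x))).
    by congr (_ + _); rewrite !mulrA; congr (_ * _ * _); rewrite mulrC.
- apply: fspan_base; exists 0%N, (fun _ _ => 1); split.
    apply: dbd_cst => //; exists 1, 0%N; split => // t x.
    by rewrite nc1 !expr0 !mulr1.
  by apply/funext => t; apply/funext => x; rewrite mul1r.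
Qed.

(** Comparison with [d] times the indicator of a cube, whose integral factorizes over the
    coordinates. *)
Lemma rint_gt0 n (f : 'rV[R]_n -> R) (x0 : 'rV[R]_n) (r d : R) :
  (forall x, 0 <= f x) -> intg f -> 0 < r -> 0 < d ->
  (forall x : 'rV[R]_n, (forall i, `|x 0 i - x0 0 i| < r) -> d <= f x) ->
  0 < rint f.
Proof.
move=> f0 fi r0 d0 h.
pose g (i : 'I_n) (y : R) : R := \1_(ball (x0 0 i) r) y.
have g0 i y : 0 <= g i y by rewrite /g indicE.
have mg i : measurable_fun setT (g i).
  by apply: measurable_indic; exact: measurable_ball.
have I : eint (fun x : 'rV[R]_n => (\prod_i g i (x 0 i))%:E) = ((r *+ 2) ^+ n)%:E.
  rewrite /eint; under eq_integral do under eq_bigr do rewrite row_ofE.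
  rewrite (ge0_int_prod mg g0).
  rewrite (eq_bigr (fun=> (r *+ 2)%:E)); last first.
    move=> i _; rewrite /g integral_indic//; last exact: measurable_ball.
    by rewrite setIT; exact: (lebesgue_measure_ball _ (ltW r0)).
  by rewrite prodEFin prodr_const card_ord.
rewrite -lte_fin rint_EFin//.
have P0 (x : 'rV[R]_n) : 0 <= \prod_i g i (x 0 i) :> R by rewrite prodr_ge0.
apply: (@lt_le_trans _ _ (eint (fun x : 'rV[R]_n => d%:E * (\prod_i g i (x 0 i))%:E)%E)).
  rewrite eintZl//.
  - by rewrite I lte_fin mulr_gt0// exprn_gt0// mulrn_wgt0.
  - apply: mble_emble; apply: measurable_prod => i _.
    by apply: (measurableT_comp (mg i)); exact: mble_coord.
  - exact: ltW.
apply: le_eint => x; first by rewrite lee_fin mulr_ge0// ltW.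
rewrite lee_fin.
have [hx|hx] := pselect (forall i, `|x 0 i - x0 0 i| < r).
  rewrite (le_trans _ (h x hx))// ler_piMr ?(ltW d0)//.
  rewrite prodr_ile1// => i _; rewrite g0/= /g indicE; by case: (_ \in _).
have [i hi] : exists i, ~ `|x 0 i - x0 0 i| < r by apply/existsNP.
rewrite (bigD1 i)//= {1}/g indicE memNset ?mul0r ?mulr0//.
by rewrite -ball_normE /= distrC.
Qed.

Lemma ft_cid n (G : 'rV[R]_n -> C) (K : R) N i xi : (2 * n <= N)%N -> cmble G ->
  (forall x, nc (G x) <= K * om x ^- N.+1) ->
  cid i (ft G) xi (ft (fun t => Complex 0 (t 0 i) * G t) xi).
Proof.
move=> nN mG bG.
have K0 : 0 <= K.
  by have := le_trans (nc_ge0 _) (bG 0); rewrite pmulr_lge0// invr_gt0 omX_gt0.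
have iK : intg (fun w : 'rV[R]_n => K * om w ^- N) by apply: intgZ; exact: intg_omV.
rewrite /ft.
have -> : (fun t : 'rV[R]_n => expi (dotv t xi) * (Complex 0 (t 0 i) * G t)) =
  (fun t => Complex 0 (t 0 i) * expi (dotv xi t) * G t).
  by apply/funext => t; rewrite mulrA [expi _ * _]mulrC dotvC.
apply: (@cid_integralC R n n (fun xi t => expi (dotv t xi) * G t)
  (fun xi t => Complex 0 (t 0 i) * expi (dotv xi t) * G t) i xi (fun w => K * om w ^- N)) => //.
- move=> y w; under eq_fun do rewrite dotvC.
  apply: (cid_eq (cidM (cid_expi i w y) (cid_cst i (G w) y))).
  by rewrite mulr0 addr0.
- move=> y; apply: (cintg_ft y mG _ iK) => x.
  by rewrite (le_trans (bG x))// ler_wpM2l// omV_homo.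
- move=> r w _; rewrite !ncM nc_expi mulr1 nc_imag.
  apply: (@le_trans _ _ (om w * (K * om w ^- N.+1))).
    by apply: ler_pM => //; [exact: nc_ge0|exact: om_coord].
  rewrite exprSr invfM le_eqVlt; apply/orP; left; apply/eqP.
  by field; rewrite !gt_eqF ?omX_gt0 ?om_gt0.
Qed.

End Gaussian.

(** * Continuity of phases and compositions, sequences of complex numbers *)

Section Lipschitz.
Context {R : realType}.
Notation C := R[i].
Notation nc := (@Normc.normc R).

(** The arguments of symbols, windows and phases are affine maps assembled from coordinate blocks.
    This class contains them, is closed under their formation and preserves continuity. *)
Definition lip n k (h : 'rV[R]_n -> 'rV[R]_k) : Prop :=
  exists2 L : R, 0 <= L & forall x y, `|h y - h x| <= L * `|y - x|.

Lemma lip_id n : lip (fun x : 'rV[R]_n => x).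
Proof. by exists 1 => // x y; rewrite mul1r. Qed.

Lemma lip_cst n k (a : 'rV[R]_k) : lip (fun _ : 'rV[R]_n => a).
Proof. by exists 0 => // x y; rewrite subrr normr0 mul0r. Qed.

Lemma lipD n k (g h : 'rV[R]_n -> 'rV[R]_k) : lip g -> lip h -> lip (fun x => g x + h x).
Proof.
move=> [a a0 ha] [b b0 hb]; exists (a + b) => [|x y]; first exact: addr_ge0.
by rewrite opprD addrACA mulrDl (le_trans (ler_normD _ _))// lerD.
Qed.

Lemma lipZ n k (c : R) (h : 'rV[R]_n -> 'rV[R]_k) : lip h -> lip (fun x => c *: h x).
Proof.
move=> [a a0 ha]; exists (`|c| * a) => [|x y]; first exact: mulr_ge0.
by rewrite -scalerBr normrZ -mulrA ler_wpM2l.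
Qed.

Lemma lipN n k (h : 'rV[R]_n -> 'rV[R]_k) : lip h -> lip (fun x => - h x).
Proof. by move=> /(lipZ (-1)); under eq_fun do rewrite scaleN1r. Qed.

Lemma norm_lsubmx n m (w : 'rV[R]_(n + m)) : `|lsubmx w| <= `|w|.
Proof. by apply: norm_rV_le => // i; rewrite mxE norm_coord. Qed.

Lemma norm_rsubmx n m (w : 'rV[R]_(n + m)) : `|rsubmx w| <= `|w|.
Proof. by apply: norm_rV_le => // i; rewrite mxE norm_coord. Qed.

Lemma lip_lsubmx n m : lip (fun w : 'rV[R]_(n + m) => lsubmx w).
Proof. by exists 1 => // x y; rewrite mul1r -linearB norm_lsubmx. Qed.

Lemma lip_rsubmx n m : lip (fun w : 'rV[R]_(n + m) => rsubmx w).
Proof. by exists 1 => // x y; rewrite mul1r -linearB norm_rsubmx. Qed.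

Lemma lip_row_mx n k l (g : 'rV[R]_n -> 'rV[R]_k) (h : 'rV[R]_n -> 'rV[R]_l) :
  lip g -> lip h -> lip (fun x => row_mx (g x) (h x)).
Proof.
move=> [a a0 ha] [b b0 hb]; exists (a + b) => [|x y]; first exact: addr_ge0.
rewrite opp_row_mx add_row_mx norm_row_mx ge_max mulrDl; apply/andP; split.
  by rewrite (le_trans (ha _ _))// lerDl mulr_ge0.
by rewrite (le_trans (hb _ _))// lerDr mulr_ge0.
Qed.

Lemma rcont_lip n k (h : 'rV[R]_n -> 'rV[R]_k) (f : 'rV[R]_k -> R) :
  lip h -> continuous f -> continuous (fun x => f (h x)).
Proof.
move=> [L L0 hL] /continuous_rVP cf; apply/continuous_rVP => x e e0.
have [d d0 hd] := cf (h x) e e0.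
have L1 : 0 < L + 1 by rewrite ltr_wpDl.
exists (d / (L + 1)); first by rewrite divr_gt0.
move=> y; rewrite ltr_pdivlMr// => yx; apply: hd; rewrite (le_lt_trans (hL _ _))//.
by rewrite (le_lt_trans _ yx)// mulrC ler_wpM2l// lerDl.
Qed.

Lemma ccont_lip n k (h : 'rV[R]_n -> 'rV[R]_k) (f : 'rV[R]_k -> C) :
  lip h -> ccont f -> ccont (fun x => f (h x)).
Proof.
move=> lh [f1 f2]; split.
  exact: (rcont_lip (f := fun z => Re (f z))).
exact: (rcont_lip (f := fun z => Im (f z))).
Qed.

Lemma rcont_dotv n k (g h : 'rV[R]_n -> 'rV[R]_k) : lip g -> lip h ->
  continuous (fun x => dotv (g x) (h x)).
Proof.
move=> lg lh; rewrite /dotv.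
elim: (index_enum _) => [|i s IH].
  by under eq_fun do rewrite big_nil; exact: rcont_cst.
under eq_fun do rewrite big_cons; apply: rcontD => //; apply: rcontM.
  exact: (rcont_lip (f := fun z => z 0 i) lg (@rcont_coord R k i)).
exact: (rcont_lip (f := fun z => z 0 i) lh (@rcont_coord R k i)).
Qed.

Lemma ccont_expi_dotv n k (g h : 'rV[R]_n -> 'rV[R]_k) : lip g -> lip h ->
  ccont (fun x => expi (dotv (g x) (h x))).
Proof.
move=> lg lh; have cd := rcont_dotv lg lh.
by split; apply: (rcont_comp cd); [exact: continuous_cos|exact: continuous_sin].
Qed.

Lemma expiD (a b : R) : expi (a + b) = expi a * expi b.
Proof. by rewrite /expi cosD sinD; simpc; congr Complex; rewrite addrC. Qed.

Lemma expi0 : expi (0 : R) = 1.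
Proof. by rewrite /expi cos0 sin0. Qed.

Lemma expiN (a : R) : expi (- a) = conjc (expi a).
Proof. by rewrite /expi cosN sinN. Qed.

Lemma expi_conjK (a : R) : conjc (expi a) * expi a = 1.
Proof. by rewrite -expiN -expiD addNr expi0. Qed.

Lemma mulc_conj (z : C) : z * conjc z = (nc z ^+ 2)%:C%C.
Proof.
case: z => a b /=; rewrite sqr_sqrtr ?addr_ge0 ?sqr_ge0//; simpc.
by congr Complex; rewrite -?expr2 //; ring.
Qed.

Lemma ccvg_unique (u : nat -> C) l l' : ccvg u l -> ccvg u l' -> l = l'.
Proof.
move=> [a b] [c d]; apply: complexP.
  exact: (cvg_unique (F := Re (u k) @[k --> \oo]) _ a c).
exact: (cvg_unique (F := Im (u k) @[k --> \oo]) _ b d).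
Qed.

Lemma ccvgM (u v : nat -> C) l l' : ccvg u l -> ccvg v l' -> ccvg (fun k => u k * v k) (l * l').
Proof.
move=> [a b] [c d]; split.
  by rewrite ReM; under eq_fun do rewrite ReM; apply: cvgB; apply: cvgM.
by rewrite ImM; under eq_fun do rewrite ImM; apply: cvgD; apply: cvgM.
Qed.

Lemma ccvg_cst (c : C) : ccvg (fun=> c) c.
Proof. by split; exact: cvg_cst. Qed.

Lemma ccont_ccvg n (f : 'rV[R]_n -> C) (x : nat -> 'rV[R]_n) y : ccont f ->
  `|x k - y| @[k --> \oo] --> 0 -> ccvg (fun k => f (x k)) (f y).
Proof.
move=> [/continuous_rVP f1 /continuous_rVP f2] xy.
split; apply/cvgrPdist_le => e e0.
  have [d d0 hd] := f1 y e e0; near=> k; apply: hd.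
  near: k; have /cvgrPdist_lt /(_ d d0) := xy.
  by apply: filterS => k; rewrite sub0r normrN normr_id.
have [d d0 hd] := f2 y e e0; near=> k; apply: hd.
near: k; have /cvgrPdist_lt /(_ d d0) := xy.
by apply: filterS => k; rewrite sub0r normrN normr_id.
Unshelve. all: by end_near. Qed.

Lemma rint_gt0_continuous n (f : 'rV[R]_n -> R) (x0 : 'rV[R]_n) :
  (forall x, 0 <= f x) -> intg f -> continuous f -> 0 < f x0 -> 0 < rint f.
Proof.
move=> f0 fi /continuous_rVP cf fx0.
have [d d0 hd] := cf x0 (f x0 / 2) (divr_gt0 fx0 (ltr0Sn R 1)).
apply: (@rint_gt0 R n f x0 (d / 2) (f x0 / 2)) => //.
- by rewrite divr_gt0.
- by rewrite divr_gt0.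
- move=> x hx.
  have : `|x - x0| <= d / 2.
    apply: norm_rV_le => [|i]; first by rewrite ltW// divr_gt0.
    by rewrite !mxE ltW// hx.
  move=> h; have {}h : `|x - x0| < d by rewrite (le_lt_trans h)// ltr_pdivrMr// ltr_pMr// ltr1n.
  have := hd _ h; rewrite ler_norml => /andP[_]; lra.
Qed.

End Lipschitz.

(** * The inversion theorem for Schwartz functions *)

Section FourierInversion.
Context {R : realType}.
Notation C := R[i].
Notation nc := (@Normc.normc R).

Lemma schwartz_intg n (f : 'rV[R]_n -> C) : schwartz f -> cintg f.
Proof.
move=> sf; have [K K0 hK] := schwartz_bound (2 * n) sf.
by apply: (le_cintg (schwartz_cmble sf) hK); apply: intgZ; exact: intg_omV.
Qed.

Lemma ft_bound n (G : 'rV[R]_n -> C) N : schwartz G ->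
  exists2 K : R, 0 <= K & forall xi, nc (ft G xi) <= K * om xi ^- N.
Proof.
move=> sG.
have [a [k [a0 ha]]] := ft_decay (fun=> lexx 1) (fun=> ler01) (leqnn _)
  (schwartz_sfam sG (2 * n)) N.
by exists a => // xi; have := ha tt xi; rewrite expr1n !mulr1.
Qed.

Lemma ccont_ft n (G : 'rV[R]_n -> C) : schwartz G -> ccont (ft G).
Proof.
move=> sG; have [K K0 hK] := schwartz_bound (2 * n).+1 sG.
have mG := schwartz_cmble sG.
apply: (cid_ccont (g := fun i xi => ft (fun t => Complex 0 (t 0 i) * G t) xi)).
  by move=> i xi; exact: (ft_cid i xi (leqnn _) mG hK).
move=> x; exists (2 * rint (fun t : 'rV[R]_n => K * om t ^- (2 * n))) => i w _.
apply: nc_ft; last by apply: intgZ; exact: intg_omV.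
  apply: cmbleM => //; apply: ccont_cmble; split; last exact: rcont_coord.
  exact: rcont_cst.
move=> t; rewrite ncM nc_imag.
apply: (@le_trans _ _ (om t * (K * om t ^- (2 * n).+1))).
  by apply: ler_pM => //; [exact: nc_ge0|exact: om_coord].
rewrite exprSr invfM le_eqVlt; apply/orP; left; apply/eqP.
by field; rewrite !gt_eqF ?omX_gt0 ?om_gt0.
Qed.

(** A single product bound yields the three integrability conditions of [integralC_fubini]. *)
Lemma cintg_unc_bound n m (f : 'rV[R]_n -> 'rV[R]_m -> C) (K : R) (N M : nat) :
  (2 * n <= N)%N -> (2 * m <= M)%N -> cmble (unc f) ->
  (forall x y, nc (f x y) <= K * (om x ^- N * om y ^- M)) ->
  [/\ cintg (unc f), forall x, cintg (f x) & forall y, cintg (f^~ y)].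
Proof.
move=> nN mM mf fb.
have K0 : 0 <= K.
  have := le_trans (nc_ge0 _) (fb 0 0); rewrite pmulr_lge0// mulr_gt0// invr_gt0 omX_gt0 //.
split.
- apply: (@le_cintg R _ _ (fun w => K * unc (fun x y => om x ^- N * om y ^- M) w)) => //.
    by move=> w; exact: fb.
  by apply: intgZ; apply: intg_prod; exact: intg_omV.
- move=> x; apply: (@le_cintg R _ _ (fun y => K * om x ^- N * om y ^- M)).
  + by split; [exact: (mble_sec (f := fun x y => Re (f x y)) x mf.1)|exact: (mble_sec (f := fun x y => Im (f x y)) x mf.2)].
  + by move=> y; rewrite -mulrA.
  + by apply: intgZ; exact: intg_omV.
- move=> y; apply: (@le_cintg R _ _ (fun x => K * om y ^- M * om x ^- N)).
  + by split; [exact: (mble_secr (f := fun x y => Re (f x y)) y mf.1)|exact: (mble_secr (f := fun x y => Im (f x y)) y mf.2)].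
  + by move=> x; rewrite -mulrA [om y ^- M * _]mulrC.
  + by apply: intgZ; exact: intg_omV.
Qed.

Lemma eq_cintg n (f g : 'rV[R]_n -> C) : f =1 g -> cintg f -> cintg g.
Proof. by move=> /funext ->. Qed.

Lemma om_scaleV n N (e : R) : 0 < e ->
  exists2 K : R, 0 <= K & forall x : 'rV[R]_n, om (e *: x) ^- N <= K * om x ^- N.
Proof.
move=> e0; exists ((1 + e^-1) ^+ N) => [|x].
  by rewrite exprn_ge0// addr_ge0// invr_ge0 ltW.
rewrite -[leRHS]invrK invfM invrK lef_pV2 ?posrE ?omX_gt0 ?divr_gt0 ?omX_gt0//; last first.
  by rewrite mulr_gt0 ?omX_gt0// invr_gt0 exprn_gt0// addr_gt0// invr_gt0.
rewrite mulrC ler_pdivrMr ?exprn_gt0 ?addr_gt0 ?invr_gt0// -exprMn.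
apply: lerXn2r; rewrite ?nnegrE ?mulr_ge0 ?om_ge0 ?addr_ge0 ?invr_ge0 ?(ltW e0)//.
rewrite /om normrZ gtr0_norm//.
have := normr_ge0 x; set y := `|x| => y0; have ei : 0 < e^-1 by rewrite invr_gt0.
have : e * e^-1 = 1 by rewrite divff ?gt_eqF.
nra.
Qed.

Lemma integralC_real n (f : 'rV[R]_n -> R) :
  integralC (fun x => (f x)%:C%C) = (rint f)%:C%C.
Proof.
rewrite integralCE /=; congr Complex.
by have := congr1 (@complex.Re R) (integralC0 n); rewrite integralCE /=.
Qed.

Lemma conjc_real (x : R) : conjc (x%:C%C) = x%:C%C.
Proof. by apply: complexP => //=; rewrite oppr0. Qed.

(* [|ft f|^2] is the transform of the autocorrelation of [f], and the autocorrelation of a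
   Gaussian is again Gaussian: this gives a kernel with nonnegative, integrable transform
   without computing the transform of a Gaussian. *)
Lemma fourier_gauss n : exists kap : R, 0 < kap /\ forall s : 'rV[R]_n,
  kap%:C%C * integralC (fun xi => expi (dotv s (- xi)) * (gauss 4^-1 xi)%:C%C) =
  (nc (ft (fun y => (gauss 2^-1 y)%:C%C) (- s)) ^+ 2)%:C%C.
Proof.
pose f (y : 'rV[R]_n) : C := (gauss 2^-1 y)%:C%C.
pose k (y : 'rV[R]_n) : C := (gauss 4^-1 y)%:C%C.
have sf : schwartz f by apply: schwartz_gauss.
have sg1 : schwartz (fun y : 'rV[R]_n => (gauss 1 y)%:C%C) by apply: schwartz_gauss.
have ig1 : intg (fun y : 'rV[R]_n => gauss 1 y) := cintg_Re (schwartz_intg sg1).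
exists (rint (fun y : 'rV[R]_n => gauss 1 y)); split.
  apply: (rint_gt0_continuous (x0 := 0)) => //.
  - by move=> x; exact: ltW (gauss_gt0 _ _).
  - exact: (ccont_gauss n ltr01).1.
  - exact: gauss_gt0.
move=> s; rewrite -mulc_conj mulrC.
have fs := schwartz_intg sf.
have ie x : cintg (fun y => expi (dotv y x) * f y).
  have [K K0 hK] := schwartz_bound (2 * n) sf.
  by apply: (cintg_ft x (schwartz_cmble sf) hK); apply: intgZ; exact: intg_omV.
(* Integrated in [xi] first, this gives the squared modulus of [ft f (- s)]; integrated in [y]
   first, the transform of the autocorrelation of [f]. *)
pose Phi (xi y : 'rV[R]_n) : C := expi (dotv xi (- s)) * (f y * f (xi + y)).
have [K1 K10 hK1] := schwartz_bound (2 * n) sf.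
have [K2 K20 hK2] := schwartz_bound (2 * n + 2 * n) sf.
have [cPhi cPhi1 cPhi2] : [/\ cintg (unc Phi), forall x, cintg (Phi x) & forall y, cintg (Phi^~ y)].
  apply: (@cintg_unc_bound n n Phi (K1 * K2) (2 * n) (2 * n)) => //.
    apply: ccont_cmble; apply: ccontM; last apply: ccontM.
    - by apply: ccont_expi_dotv; [exact: lip_lsubmx|exact: lip_cst].
    - by apply: ccont_lip; [exact: lip_rsubmx|exact: smooth_ccont (schwartz_smooth sf)].
    - apply: (ccont_lip (h := fun w => lsubmx w + rsubmx w)).
        by apply: lipD; [exact: lip_lsubmx|exact: lip_rsubmx].
      exact: smooth_ccont (schwartz_smooth sf).
  move=> x y; rewrite /Phi !ncM nc_expi mul1r.
  apply: (@le_trans _ _ (K2 * om y ^- (2 * n + 2 * n) * (K1 * om (x + y) ^- (2 * n)))).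
    by apply: ler_pM; rewrite ?nc_ge0.
  apply: (@le_trans _ _ (K2 * om y ^- (2 * n + 2 * n) * (K1 * (om y ^+ (2 * n) * om x ^- (2 * n))))).
    by rewrite !ler_wpM2l ?mulr_ge0 ?omV_ge0// omV_shift.
  rewrite exprD invfM le_eqVlt; apply/orP; left; apply/eqP.
  by field; rewrite !gt_eqF ?omX_gt0.
have sk : schwartz k by apply: schwartz_gauss; rewrite invr_gt0.
have [K4 _ hK4] := schwartz_bound (2 * n) sk.
have [Fub1 Fub2] := integralC_fubini cPhi cPhi1 cPhi2.
have E1 y : integralC (Phi^~ y) = conjc (expi (dotv y (- s)) * f y) * ft f (- s).
  rewrite -[ft f (- s)](integralC_shift y (ie (- s))).2 -integralCZ; last first.
    exact: (integralC_shift y (ie (- s))).1.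
  apply: eq_integralC => xi; rewrite /Phi dotvDl expiD.
  have -> : conjc (expi (dotv y (- s)) * f y) = conjc (expi (dotv y (- s))) * f y.
    by rewrite rmorphM; congr (_ * _); exact: conjc_real.
  rewrite -[LHS]mul1r -(expi_conjK (dotv y (- s))); ring.
have E2 xi : integralC (Phi xi) =
    (rint (fun y : 'rV[R]_n => gauss 1 y))%:C%C * (expi (dotv s (- xi)) * k xi).
  (* Completing the square: [|y|^2 / 2 + |xi + y|^2 / 2 = |xi|^2 / 4 + |y + xi / 2|^2]. *)
  have ec y : Phi xi y = (expi (dotv s (- xi)) * k xi) * (gauss 1 (y + 2^-1 *: xi))%:C%C.
    rewrite /Phi /f /k -mulrA; congr (_ * _); first by rewrite dotvNr dotvC dotvNr.
    rewrite -!rmorphM; congr (_%:C%C); rewrite /gauss -!expRD; congr expR.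
    rewrite !(dotvDl, dotvDr, dotvZl, dotvZr) (dotvC y xi); by field.
  rewrite (eq_integralC ec) integralCZ; last first.
    exact: (integralC_shift (2^-1 *: xi) (schwartz_intg sg1)).1.
  rewrite (integralC_shift (2^-1 *: xi) (schwartz_intg sg1)).2 mulrC; congr (_ * _).
  exact: integralC_real.
transitivity (integralC (fun xi => integralC (Phi xi))).
  rewrite (eq_integralC E2) integralCZ; first by rewrite [RHS]mulrC.
  apply: (@le_cintg R n _ (fun x => K4 * om x ^- (2 * n))).
  - apply: ccont_cmble; apply: ccontM; last exact: smooth_ccont (schwartz_smooth sk).
    by apply: ccont_expi_dotv; [exact: lip_cst|apply: lipN; exact: lip_id].
  - by move=> x; rewrite ncM nc_expi mul1r; exact: hK4.
  - by apply: intgZ; exact: intg_omV.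
rewrite -Fub1 Fub2 (eq_integralC E1).
transitivity (integralC (fun y => ft f (- s) * conjc (expi (dotv y (- s)) * f y))).
  by apply: eq_integralC => y; rewrite mulrC.
rewrite integralCZ; last exact: cintgJ.
by rewrite integralCJ.
Qed.

(* The constant is (2 pi)^n. *)
Theorem fourier_inversion n : exists c : C, c <> 0 /\
  forall G : 'rV[R]_n -> C, schwartz G ->
    cintg (fun xi => ft G (- xi)) /\ integralC (fun xi => ft G (- xi)) = c * G 0.
Proof.
pose f (y : 'rV[R]_n) : C := (gauss 2^-1 y)%:C%C.
pose k (y : 'rV[R]_n) : C := (gauss 4^-1 y)%:C%C.
have sf : schwartz f by apply: schwartz_gauss.
have sk : schwartz k by apply: schwartz_gauss.
pose K s := integralC (fun xi => expi (dotv s (- xi)) * k xi).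
have [kap [kap0 hK]] := fourier_gauss n.
have KE s : K s = (kap^-1 * nc (ft f (- s)) ^+ 2)%:C%C.
  have -> : (kap^-1 * nc (ft f (- s)) ^+ 2)%:C%C = (kap^-1)%:C%C * (kap%:C%C * K s).
    by rewrite rmorphM; congr (_ * _); rewrite /K; exact: esym (hK s).
  by rewrite mulrA -rmorphM mulVf ?gt_eqF// rmorph1 mul1r.
have lipNid : lip (fun x : 'rV[R]_n => - x) by apply: lipN; exact: lip_id.
have cft : ccont (fun s => ft f (- s)) by apply: ccont_lip => //; exact: ccont_ft.
have cK : ccont K.
  have -> : K = (fun s => (kap^-1)%:C%C * (ft f (- s) * conjc (ft f (- s)))).
    by apply/funext => s; rewrite KE rmorphM mulc_conj.
  by apply: ccontM; [exact: ccont_cst|apply: ccontM => //; exact: ccontJ].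
have [B B0 hB] := ft_bound (2 * n) sf.
have iomn (c : R) : intg (fun w : 'rV[R]_n => c * om w ^- (2 * n)).
  by apply: intgZ; exact: intg_omV.
have bK s : nc (K s) <= kap^-1 * B * B * om s ^- (2 * n).
  rewrite KE nc_real ger0_norm; last first.
    by rewrite mulr_ge0 ?invr_ge0 ?(ltW kap0)// exprn_ge0 ?nc_ge0.
  rewrite -!mulrA ler_wpM2l ?invr_ge0 ?(ltW kap0)// expr2 -(omN s).
  apply: ler_pM; rewrite ?nc_ge0//.
  by rewrite (le_trans (hB _))// ler_piMr// omV_le1.
have iK : cintg K by apply: (le_cintg (ccont_cmble cK) bK).
(* The constant is the integral of [K], which is nonnegative by [KE], continuous, and positive at
   0. *)
exists (integralC K); split.
  suff : 0 < rint (fun s => Re (K s)).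
    by rewrite integralCE => h [h0 _]; rewrite h0 ltxx in h.
  apply: (rint_gt0_continuous (x0 := 0)).
  - by move=> s; rewrite KE /= mulr_ge0 ?invr_ge0 ?(ltW kap0)// exprn_ge0 ?nc_ge0.
  - exact: cintg_Re.
  - exact: cK.1.
  - suff : 0 < nc (ft f (- 0)) by move=> h; rewrite KE; apply: mulr_gt0; rewrite ?invr_gt0// exprn_gt0.
    rewrite lt_neqAle nc_ge0 andbT eq_sym; apply/eqP => /nc_eq0.
    rewrite oppr0 /ft (_ : (fun t => _) = f); last first.
      apply/funext => t; rewrite (_ : dotv t 0 = 0) ?expi0 ?mul1r//.
      by rewrite /dotv big1// => i _; rewrite mxE mulr0.
    rewrite integralCE => -[h0 _].
    have : 0 < rint (fun y => Re (f y)).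
      apply: (rint_gt0_continuous (x0 := 0)).
      + by move=> x; exact: ltW (gauss_gt0 _ _).
      + exact: cintg_Re (schwartz_intg sf).
      + exact: (smooth_ccont (schwartz_smooth sf)).1.
      + exact: gauss_gt0.
    by rewrite h0 ltxx.
move=> G sG.
have cG := smooth_ccont (schwartz_smooth sG).
have [D D0 hD] := ft_bound (2 * n) sG.
have [E E0 hE] := schwartz_bound (2 * n) sG.
have cfG : ccont (fun xi => ft G (- xi)) by apply: ccont_lip => //; exact: ccont_ft.
have bfG xi : nc (ft G (- xi)) <= D * om xi ^- (2 * n) by rewrite -(omN xi).
have ifG : cintg (fun xi => ft G (- xi)) by apply: (le_cintg (ccont_cmble cfG) bfG).
split => //.
have k1 xi : nc (k xi) <= 1.
  by rewrite nc_real gtr0_norm ?gauss_gt0// gauss_le1.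
(* The Gaussian factor [k (e *: xi)] makes Fubini applicable, and rescaling moves [e] into the
   argument of [G]. As [e] tends to 0, the left side tends to the integral of [ft G (- xi)] and the
   right side to [G 0] times the integral of [K]. *)
have main (e : R) : 0 < e ->
    integralC (fun xi => k (e *: xi) * ft G (- xi)) = integralC (fun s => K s * G (e *: s)).
  move=> e0.
  pose Psi (xi t : 'rV[R]_n) : C := k (e *: xi) * (expi (dotv t (- xi)) * G t).
  have lipe : lip (fun x : 'rV[R]_n => e *: x) by apply: lipZ; exact: lip_id.
  have [K4 K40 hK4] := schwartz_bound (2 * n) sk.
  have [e1 e10 he1] := @om_scaleV n (2 * n) _ e0.
  have [cPsi cPsi1 cPsi2] : [/\ cintg (unc Psi), forall x, cintg (Psi x) & forall y, cintg (Psi^~ y)].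
    apply: (@cintg_unc_bound n n Psi (K4 * e1 * E) (2 * n) (2 * n)) => //.
      apply: ccont_cmble; apply: ccontM; last apply: ccontM.
      - apply: (ccont_lip (h := fun w => e *: lsubmx w)); last exact: smooth_ccont (schwartz_smooth sk).
        by apply: lipZ; exact: lip_lsubmx.
      - by apply: ccont_expi_dotv; [exact: lip_rsubmx|apply: lipN; exact: lip_lsubmx].
      - by apply: ccont_lip; [exact: lip_rsubmx|].
    move=> x y; rewrite /Psi !ncM nc_expi mul1r.
    have -> : K4 * e1 * E * (om x ^- (2 * n) * om y ^- (2 * n)) =
       K4 * (e1 * om x ^- (2 * n)) * (E * om y ^- (2 * n)) by ring.
    apply: ler_pM; rewrite ?nc_ge0//; apply: (le_trans (hK4 _)).
    by rewrite ler_wpM2l.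
  have [Fub1 Fub2] := integralC_fubini cPsi cPsi1 cPsi2.
  transitivity (integralC (fun xi => integralC (Psi xi))).
    apply: eq_integralC => xi; rewrite /Psi integralCZ //.
    apply: (@le_cintg R n _ (fun x => E * om x ^- (2 * n))).
    - by apply: cmbleM; [apply: ccont_cmble; exact: ccont_expi|exact: ccont_cmble].
    - by move=> x; rewrite ncM nc_expi mul1r; exact: hE.
    - exact: iomn.
  rewrite -Fub1 Fub2.
  have en0 : ((e ^+ n)%:C%C : C) != 0.
    by apply/eqP => /(congr1 (@complex.Re R)) /= /eqP; rewrite gt_eqF// exprn_gt0.
  apply: (mulfI en0).
  have ike (s : 'rV[R]_n) : cintg (fun xi => expi (dotv s (- xi)) * k xi).
    apply: (@le_cintg R n _ (fun x => K4 * om x ^- (2 * n))).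
    - apply: ccont_cmble; apply: ccontM; last exact: smooth_ccont (schwartz_smooth sk).
      by apply: ccont_expi_dotv; [exact: lip_cst|exact: lipNid].
    - by move=> x; rewrite ncM nc_expi mul1r; exact: hK4.
    - exact: iomn.
  have aff t : (e ^+ n)%:C%C * integralC (Psi^~ t) = K (e^-1 *: t) * G t.
    have -> : integralC (Psi^~ t) = integralC (fun xi => G t *
       (fun xi => expi (dotv (e^-1 *: t) (- xi)) * k xi) (e *: xi + 0)).
      apply: eq_integralC => xi; rewrite /Psi addr0.
      have -> : dotv (e^-1 *: t) (- (e *: xi)) = dotv t (- xi).
        by rewrite !dotvNr dotvZl dotvZr mulrA mulVf ?gt_eqF// mul1r.
      by ring.
    have [i1 i2] := integralC_affine 0 e0 (ike (e^-1 *: t)).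
    by rewrite integralCZ// mulrCA i2 mulrC.
  have ei : 0 < e^-1 by rewrite invr_gt0.
  have iKG : cintg (fun s => K s * G (e *: s)).
    apply: (@le_cintg R n _ (fun s => kap^-1 * B * B * E * om s ^- (2 * n))) => //.
      by apply: ccont_cmble; apply: ccontM => //; exact: ccont_lip.
    move=> x; rewrite ncM.
    have -> w : kap^-1 * B * B * E * w = kap^-1 * B * B * w * E by ring.
    apply: ler_pM (nc_ge0 _) (nc_ge0 _) (bK _) _.
    by rewrite (le_trans (hE _))// ler_piMr// omV_le1.
  have [i1 i2] := integralC_affine 0 ei iKG.
  rewrite -i2 mulrA -rmorphM -exprMn divff ?gt_eqF// expr1n rmorph1 mul1r.
  rewrite -integralCZ; last first.
    suff : cintg (fun t => (e ^- n)%:C%C * (K (e^-1 *: t) * G t)).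
      apply: eq_cintg => t; rewrite -aff mulrA -rmorphM mulVf ?rmorph1 ?mul1r//.
      by rewrite gt_eqF// exprn_gt0.
    apply: cintgZ; apply: eq_cintg i1 => t.
    by rewrite addr0 scalerA divff ?gt_eqF// scale1r.
  apply: eq_integralC => t; rewrite aff addr0 scalerA divff ?gt_eqF// scale1r //.
pose e (j : nat) : R := j.+1%:R^-1.
have e0 j : 0 < e j by rewrite invr_gt0 ltr0n.
have eto (x : 'rV[R]_n) : `|e j *: x - 0| @[j --> \oo] --> 0.
  under eq_fun do rewrite subr0 normrZ gtr0_norm//.
  have h : e j * `|x| @[j --> \oo] --> 0 * `|x|.
    by apply: cvgM; [exact: cvg_harmonic|exact: cvg_cst].
  by rewrite mul0r in h.
have k0 : k 0 = 1.
  by rewrite /k /gauss (_ : dotv 0 0 = 0) ?mulr0 ?oppr0 ?expR0// /dotv big1// => i _; rewrite mxE mulr0.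
have ck := smooth_ccont (schwartz_smooth sk).
have lipe r : lip (fun x : 'rV[R]_n => r *: x) by apply: lipZ; exact: lip_id.
have [_ c1] : cintg (fun xi => ft G (- xi)) /\
    ccvg (fun j => integralC (fun xi => k (e j *: xi) * ft G (- xi)))
         (integralC (fun xi => ft G (- xi))).
  apply: (@integralC_dct R n _ _ (fun w => D * om w ^- (2 * n))) => //.
  - by move=> j; apply: ccont_cmble; apply: ccontM => //; exact: ccont_lip.
  - move=> x; have := ccvgM (ccont_ccvg ck (eto x)) (ccvg_cst (ft G (- x))).
    by rewrite k0 mul1r.
  - by move=> j x; rewrite ncM -[leRHS]mul1r; apply: ler_pM; rewrite ?nc_ge0.
have [i2 c2] : cintg (fun s => K s * G 0) /\
    ccvg (fun j => integralC (fun s => K s * G (e j *: s))) (integralC (fun s => K s * G 0)).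
  apply: (@integralC_dct R n _ _ (fun s => kap^-1 * B * B * E * om s ^- (2 * n))) => //.
  - by move=> j; apply: ccont_cmble; apply: ccontM => //; exact: ccont_lip.
  - by move=> x; exact: ccvgM (ccvg_cst _) (ccont_ccvg cG (eto x)).
  - move=> j x; rewrite ncM.
    have -> w : kap^-1 * B * B * E * w = kap^-1 * B * B * w * E by ring.
    apply: ler_pM (nc_ge0 _) (nc_ge0 _) (bK _) _.
    by rewrite (le_trans (hE _))// ler_piMr// omV_le1.
have := ccvg_unique c1 (_ : ccvg _ (integralC (fun s => K s * G 0))) => -> //; last first.
  by have -> : (fun j => integralC (fun xi => k (e j *: xi) * ft G (- xi))) =
     (fun j => integralC (fun s => K s * G (e j *: s))) by apply/funext => j; exact: main.
rewrite mulrC -integralCZ//; apply: eq_integralC => x; exact: mulrC.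
Qed.

End FourierInversion.

(** * Time-frequency shifts and the short-time Fourier transform *)

Section TimeFrequency.
Context {R : realType}.
Notation C := R[i].
Notation nc := (@Normc.normc R).

Lemma ler_om_homo n m (x : 'rV[R]_n) (y : 'rV[R]_m) : `|x| <= `|y| -> om x <= om y.
Proof. by rewrite /om lerD2l. Qed.

Lemma om_lsubmx n m (w : 'rV[R]_(n + m)) : om (lsubmx w) <= om w.
Proof. by apply: ler_om_homo; exact: norm_lsubmx. Qed.

Lemma om_rsubmx n m (w : 'rV[R]_(n + m)) : om (rsubmx w) <= om w.
Proof. by apply: ler_om_homo; exact: norm_rsubmx. Qed.

Lemma om_le_split n m (w : 'rV[R]_(n + m)) : om w <= om (lsubmx w) * om (rsubmx w).
Proof. by rewrite -{1}(hsubmxK w); exact: om_row. Qed.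

Section Families.
Variables (T : Type) (n : nat) (oT : T -> R).
Hypothesis oT1 : forall t, 1 <= oT t.

Let oT0 t : 0 <= oT t. Proof. exact: le_trans (oT1 t). Qed.

Lemma sfamD Th (F G : T -> 'rV[R]_n -> C) : (forall t, 0 <= Th t) ->
  sfam oT Th F -> sfam oT Th G -> sfam oT Th (fun t x => F t x + G t x).
Proof.
by move=> Th0 hF hG N; apply: dbdD => // t x; rewrite mulr_ge0 ?omV_ge0.
Qed.

Lemma sfamJ Th (F : T -> 'rV[R]_n -> C) : (forall t, 0 <= Th t) ->
  sfam oT Th F -> sfam oT Th (fun t x => conjc (F t x)).
Proof. by move=> Th0 hF N; apply: dbdJ => // t x; rewrite mulr_ge0 ?omV_ge0. Qed.

(** The decay of [G] is of every order, so it can spare [L] powers to absorb the growth of [F]. *)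
Lemma sfam_mul W Th L (F G : T -> 'rV[R]_n -> C) :
  (forall t, 0 <= W t) -> (forall t, 0 <= Th t) ->
  dbd oT (fun t x => W t * om x ^+ L) F -> sfam oT Th G ->
  sfam oT (fun t => W t * Th t) (fun t x => F t x * G t x).
Proof.
move=> W0 Th0 hF hG N.
apply: (@dbd_weaken R _ _ oT oT (fun t x => (W t * om x ^+ L) * (Th t * om x ^- (L + N)))
  _ _ 1 0) => //.
  move=> t x; rewrite expr0 !mul1r exprD invfM le_eqVlt; apply/orP; left; apply/eqP.
  by field; rewrite !gt_eqF ?omX_gt0.
apply: dbdM => //.
- by move=> t x; rewrite mulr_ge0 // ltW// omX_gt0.
- by move=> t x; rewrite mulr_ge0 ?omV_ge0.
Qed.

(** Decay around [y t] becomes decay around 0 at the cost of [om (y t) ^+ N], hence of a power of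
    [oT]. *)
Lemma sfam_translate (Th : T -> R) (y : T -> 'rV[R]_n) (F : T -> 'rV[R]_n -> C) :
  (forall t, 0 <= Th t) -> (forall t, om (y t) <= oT t) ->
  sfam oT Th F -> sfam oT Th (fun t x => F t (x - y t)).
Proof.
move=> Th0 yo hF N.
apply: (@dbd_weaken R _ _ oT oT (fun t x => Th t * om (x - y t) ^- N) _ _ 1 N) => //.
  move=> t x; rewrite mul1r mulrCA ler_wpM2l//.
  rewrite (le_trans (omV_shift _ _ _))// ler_wpM2r ?omV_ge0//.
  by rewrite omN; apply: lerXn2r; rewrite ?nnegrE ?om_ge0.
have := @dbd_comp _ _ _ _ oT1 n (fun t x => x - y t) (fun=> 1) id
  (fun t x => Th t * om x ^- N) F; apply => //.
- by move=> t i x r; rewrite mulr1 addrA.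
- by move=> t x x'; rewrite opprB addrA subrK.
- by move=> t; rewrite normr1.
- by move=> t x; rewrite mulr_ge0 ?omV_ge0.
Qed.

End Families.

(** By the mean value inequality; the derivatives are differences of the same form, with
    [partial i psi] in place of [psi]. *)
Lemma sfam_translate_sub T n (oT : T -> R) (y y' : T -> 'rV[R]_n) (psi : 'rV[R]_n -> C) :
  (forall t, om (y t) <= oT t) -> (forall t, om (y' t) <= oT t) -> schwartz psi ->
  sfam oT (fun t => `|y t - y' t|) (fun t x => psi (x - y t) - psi (x - y' t)).
Proof.
move=> yo yo' spsi N.
have oT1 t : 1 <= oT t := le_trans (om_ge1 _) (yo t).
pose P (H : T -> 'rV[R]_n -> C) :=
  exists2 psi, schwartz psi & H = fun t x => psi (x - y t) - psi (x - y' t).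
apply: (@fspan_smooth R T n P); last by apply: fspan_base; exists psi.
  by move=> F G; apply: bddD => // t x; rewrite mulr_ge0 ?omV_ge0.
move=> _ {psi spsi} [psi sp ->]; have cp := smooth_ccont (schwartz_smooth sp).
have lipt t : lip (fun x : 'rV[R]_n => x - t) by apply: lipD; [exact: lip_id|exact: lip_cst].
have spi i : schwartz (partial i psi).
  by apply: sfam1_schwartz => M; apply: dbd_partial; exact: schwartz_sfam.
split.
- move=> t; apply: ccontD; first exact: ccont_lip.
  have -> : (fun x => - psi (x - y' t)) = fun x => (-1) * psi (x - y' t).
    by apply/funext => x; rewrite mulN1r.
  by apply: ccontM; [exact: ccont_cst|exact: ccont_lip].
- have /choice[K hK] : forall i, exists K : R, 0 <= K /\ forall x, nc (partial i psi x) <= K * om x ^- N.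
    by move=> i; have [K K0 hK] := schwartz_bound N (spi i); exists K.
  pose S := \sum_i K i.
  have S0 : 0 <= S by apply: sumr_ge0 => i _; exact: (hK i).1.
  have hS i x : nc (partial i psi x) <= S * om x ^- N.
    rewrite (le_trans ((hK i).2 x))// ler_wpM2r ?omV_ge0// /S (bigD1 i)//= lerDl.
    by apply: sumr_ge0 => j _; exact: (hK j).1.
  (* For [|w| <= |y t - y' t|] one has [om (w - y t) <= om (y t) * (om (y t) * om (y' t)) <= oT t ^+
     3], whence the exponent. *)
  exists (2 * (S * n%:R)), (3 * N)%N; split; first by rewrite !mulr_ge0.
  move=> t x.
  have bd i w : `|w| <= `|y t - y' t| -> nc (partial i psi (x - y t + w)) <=
      S * (oT t ^+ (3 * N) * om x ^- N).
    move=> hw; rewrite (le_trans (hS _ _))// ler_wpM2l// -addrA.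
    rewrite (le_trans (omV_shift _ _ _))// ler_wpM2r ?omV_ge0// exprM.
    apply: lerXn2r; rewrite ?nnegrE ?om_ge0 ?exprn_ge0 ?(le_trans _ (oT1 t))//.
    rewrite (le_trans (omD _ _))// omN exprS; apply: ler_pM; rewrite ?om_ge0//.
    rewrite (le_trans (ler_om_homo hw))// (le_trans (omD _ _))// omN expr2.
    by apply: ler_pM; rewrite ?om_ge0.
  have e1 : x - y' t = x - y t + (y t - y' t) by rewrite addrA subrK.
  have mvt (g : C -> R) : (forall z, `|g z| <= nc z) ->
     (forall i z, is_derive z (unitv i) (fun z => g (psi z)) (g (partial i psi z))) ->
     `|g (psi (x - y' t)) - g (psi (x - y t))| <=
       S * (oT t ^+ (3 * N) * om x ^- N) * (n%:R * `|y t - y' t|).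
    move=> gnc dg; rewrite e1; apply: (MVT_norm (f := fun z => g (psi z))) => [i z|i w hw].
      by case: (dg i z).
    by rewrite (@derive_val _ _ _ _ _ _ _ (dg i _)) (le_trans (gnc _))// bd.
  have c1 := mvt (@complex.Re R) nc_Re (fun i z => (smooth_cid i z (schwartz_smooth sp)).1).
  have c2 := mvt (@complex.Im R) nc_Im (fun i z => (smooth_cid i z (schwartz_smooth sp)).2).
  rewrite -opprB ncN (le_trans (nc_le _))// ReD ReN ImD ImN (le_trans (lerD c1 c2))//.
  rewrite le_eqVlt; apply/orP; left; apply/eqP; ring.
- move=> i; exists (fun t x => partial i psi (x - y t) - partial i psi (x - y' t)).
    by apply: fspan_base; exists (partial i psi).
  move=> t x.
  have aff (z : 'rV[R]_n) : cid i (fun x => psi (x - z)) x (partial i psi (x - z)).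
    have /cid_eq : cid i (fun x => psi (x - z)) x (1%:C%C * partial i psi (x - z)).
      apply: (@cid_affine R n n i i (fun x => x - z) 1 psi).
        by move=> x' r; rewrite mulr1 addrA.
      exact: smooth_cid (schwartz_smooth sp).
    by apply; rewrite mul1r.
  apply: cidD => //.
  have := cidZ (-1) (aff (y' t)); rewrite mulN1r.
  by have -> : (fun y0 => -1 * psi (y0 - y' t)) = (fun y0 => - psi (y0 - y' t))
    by apply/funext => z; rewrite mulN1r.
Qed.

Lemma expi_sub_le (a b : R) : nc (expi a - expi b) <= 2 * `|a - b|.
Proof.
have h (f df : R -> R) : (forall x, is_derive x (1 : R) f (df x)) -> (forall x, `|df x| <= 1) ->
    `|f a - f b| <= `|a - b|.
  move=> hf hd; have cf c d : {within `[c, d], continuous f}.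
    apply: derivable_within_continuous => x _; by case: (hf x).
  wlog ab : a b / b < a.
    move=> H; have [/H //|ab|->] := ltgtP b a; last by rewrite !subrr normr0.
    by rewrite distrC [leRHS]distrC H.
  have [c _ ->] := MVT ab (fun x _ => hf x) (cf b a).
  by rewrite normrM ler_piMl.
rewrite (le_trans (nc_le _))// mulr_natl mulr2n ReD ReN ImD ImN lerD//=.
  apply: (h cos (fun x => - sin x)) => x.
  by rewrite normrN ler_norml sin_geN1 sin_le1.
by apply: (h sin cos) => x; rewrite ler_norml cos_geN1 cos_le1.
Qed.

Lemma dotv_le n (x y : 'rV[R]_n) : `|dotv x y| <= n%:R * (`|x| * `|y|).
Proof.
rewrite /dotv (le_trans (ler_norm_sum _ _ _))//.
rewrite (_ : n%:R * _ = \sum_(i < n) (`|x| * `|y|)); last first.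
  by rewrite sumr_const card_ord mulr_natl.
by apply: ler_sum => i _; rewrite normrM; apply: ler_pM; rewrite ?norm_coord.
Qed.

(** A derivative of the difference consists of [i (xi - xi')] times the first exponential and
    [i xi'] times the difference itself. The class [P] couples these two kinds of terms and is
    closed under differentiation, keeping the small factor on the first kind. *)
Lemma dbd_expi_sub T n (oT : T -> R) (xi xi' : T -> 'rV[R]_n) :
  (forall t, om (xi t) <= oT t) -> (forall t, om (xi' t) <= oT t) ->
  dbd oT (fun t x => `|xi t - xi' t| * om x)
    (fun t x => expi (dotv x (xi t)) - expi (dotv x (xi' t))).
Proof.
move=> xo xo'.
have oT1 t : 1 <= oT t := le_trans (om_ge1 _) (xo t).
have oT0 t : 0 <= oT t := le_trans ler01 (oT1 t).
pose W := fun t (x : 'rV[R]_n) => `|xi t - xi' t| * om x.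
have W0 t x : 0 <= W t x by rewrite mulr_ge0 ?om_ge0.
pose P (H : T -> 'rV[R]_n -> C) := exists a b : T -> C,
  [/\ bdd oT (fun t _ => `|xi t - xi' t|) (fun t (_ : 'rV[R]_n) => a t),
      bdd oT (fun _ _ => 1) (fun t (_ : 'rV[R]_n) => b t) &
   H = fun t x => a t * expi (dotv x (xi t)) +
         b t * (expi (dotv x (xi t)) - expi (dotv x (xi' t)))].
apply: (@fspan_smooth R T n P).
- by move=> ? ?; apply: bddD.
- move=> _ [a [b [ha hb ->]]].
  have dd t i x : cid i (fun x => a t * expi (dotv x (xi t)) +
         b t * (expi (dotv x (xi t)) - expi (dotv x (xi' t)))) x
     (a t * (Complex 0 (xi t 0 i) * expi (dotv x (xi t))) +
      b t * (Complex 0 (xi t 0 i) * expi (dotv x (xi t)) -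
             Complex 0 (xi' t 0 i) * expi (dotv x (xi' t)))).
    apply: cidD; first by apply: cidZ; exact: cid_expi.
    apply: cidZ; apply: cidD; first exact: cid_expi.
    have := cidZ (-1) (cid_expi i (xi' t) x); rewrite mulN1r.
    by have -> : (fun y => -1 * expi (dotv y (xi' t))) = (fun y => - expi (dotv y (xi' t)))
      by apply/funext => z; rewrite mulN1r.
  split.
  + move=> t; have ce (z : 'rV[R]_n) : ccont (fun x : 'rV[R]_n => expi (dotv x z)) by exact: ccont_expi.
    apply: ccontD; first by apply: ccontM; [exact: ccont_cst|].
    apply: ccontM; first exact: ccont_cst.
    apply: ccontD => //.
    have -> : (fun x => - expi (dotv x (xi' t))) = fun x => (-1) * expi (dotv x (xi' t)).
      by apply/funext => x; rewrite mulN1r.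
    by apply: ccontM; [exact: ccont_cst|].
  + apply: bddD => //.
      apply: (@bdd_weaken R T n oT oT (fun t x => `|xi t - xi' t| * 1) _ _ 1 0) => //.
        by move=> t x; rewrite expr0 !mul1r ler_wpM2l// om_ge1.
      apply: bddM ha _; exists 1, 0%N; split => // t x.
      by rewrite nc_expi expr0 !mulr1.
    apply: (@bdd_weaken R T n oT oT (fun t x => 1 * W t x) _ _ 1 0) => //.
      by move=> t x; rewrite expr0 !mul1r.
    apply: bddM hb _; exists (2 * n%:R), 0%N; split; first by rewrite mulr_ge0.
    move=> t x; rewrite expr0 mulr1 (le_trans (expi_sub_le _ _))// -mulrA ler_wpM2l//.
    rewrite -dotvNr -dotvDr (le_trans (dotv_le _ _))// ler_wpM2l// /W mulrC ler_wpM2l//.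
    by rewrite /om lerDr.
  + move=> i; exists (fun t x =>
      (a t * Complex 0 (xi t 0 i) + b t * Complex 0 ((xi t - xi' t) 0 i)) * expi (dotv x (xi t)) +
      (b t * Complex 0 (xi' t 0 i)) * (expi (dotv x (xi t)) - expi (dotv x (xi' t)))).
      apply: fspan_base; exists (fun t => a t * Complex 0 (xi t 0 i) + b t * Complex 0 ((xi t - xi' t) 0 i)),
        (fun t => b t * Complex 0 (xi' t 0 i)); split => //.
        apply: bddD => //.
          apply: (@bdd_weaken R T n oT oT (fun t x => `|xi t - xi' t| * oT t) _ _ 1 1) => //.
            by move=> t x; rewrite expr1 mul1r mulrC.
          apply: bddM ha _; exists 1, 0%N; split => // t x.
          by rewrite nc_imag expr0 !mul1r (le_trans (om_coord _ _)).
        apply: (@bdd_weaken R T n oT oT (fun t x => 1 * `|xi t - xi' t|) _ _ 1 0) => //.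
          by move=> t x; rewrite expr0 !mul1r.
        apply: bddM hb _; exists 1, 0%N; split => // t x.
        by rewrite nc_imag expr0 !mul1r norm_coord.
      apply: (@bdd_weaken R T n oT oT (fun t x => 1 * oT t) _ _ 1 1) => //.
        by move=> t x; rewrite expr1 mul1r mulr1.
      apply: bddM hb _; exists 1, 0%N; split => // t x.
      by rewrite nc_imag expr0 !mul1r (le_trans (om_coord _ _)).
    move=> t x; apply: (cid_eq (dd t i x)).
    have -> : Complex 0 ((xi t - xi' t) 0 i) = Complex 0 (xi t 0 i) - Complex 0 (xi' t 0 i) :> C.
      by apply: complexP; rewrite /= ?subr0// !mxE.
    ring.
- apply: fspan_base; exists (fun=> 0), (fun=> 1); split.
  + by exists 0, 0%N; split => // t x; rewrite nc0 !mul0r.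
  + by exists 1, 0%N; split => // t x; rewrite nc1 expr0 !mulr1.
  + by apply/funext => t; apply/funext => x; rewrite mul0r add0r mul1r.
Qed.

Lemma sfam_tf T d (oT : T -> R) (w : T -> 'rV[R]_(d + d)) (phi : 'rV[R]_d -> C) :
  (forall t, om (w t) <= oT t) -> schwartz phi ->
  sfam oT (fun=> 1) (fun t => tf_shift (w t) phi).
Proof.
move=> wo sphi.
have oT1 t : 1 <= oT t := le_trans (om_ge1 _) (wo t).
have h : sfam oT (fun=> 1) (fun t x => phi (x - lsubmx (w t))).
  apply: (@sfam_translate T d oT oT1 (fun=> 1) (fun t => lsubmx (w t)) (fun=> phi)) => //.
    by move=> t; exact: le_trans (om_lsubmx _) (wo t).
  apply: (@sfam_weaken R T d (fun=> 1) oT (fun=> 1) (fun=> 1) _ 1 0) => //.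
    by move=> t; rewrite expr0 !mulr1.
  exact: schwartz_sfamT.
have := @sfam_mul T d oT oT1 (fun=> 1) (fun=> 1) 0 (fun t x => expi (dotv x (rsubmx (w t)))) _
  (fun=> ler01) (fun=> ler01) _ h.
have -> : (fun _ : T => 1 * 1) = (fun=> 1 : R) by apply/funext => t; rewrite mulr1.
apply.
apply: (@dbd_weaken R T d oT oT (fun _ _ => 1) _ _ 1 0) => //.
  by move=> t x; rewrite !expr0 !mulr1.
by apply: dbd_expi => // t; exact: le_trans (om_rsubmx _) (wo t).
Qed.

(** The difference splits into a change of modulation and a change of translation. The bound serves
    twice: for the continuity of the transform and for the rounding error in [tempered_integral]. *)
Lemma sfam_tf_sub T d (oT : T -> R) (w v : T -> 'rV[R]_(d + d)) (phi : 'rV[R]_d -> C) :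
  (forall t, om (w t) <= oT t) -> (forall t, om (v t) <= oT t) -> schwartz phi ->
  sfam oT (fun t => `|w t - v t|) (fun t x => tf_shift (w t) phi x - tf_shift (v t) phi x).
Proof.
move=> wo vo sphi.
have oT1 t : 1 <= oT t := le_trans (om_ge1 _) (wo t).
pose y t := lsubmx (w t). pose y' t := lsubmx (v t).
pose xi t := rsubmx (w t). pose xi' t := rsubmx (v t).
have yo t : om (y t) <= oT t := le_trans (om_lsubmx _) (wo t).
have yo' t : om (y' t) <= oT t := le_trans (om_lsubmx _) (vo t).
have xo t : om (xi t) <= oT t := le_trans (om_rsubmx _) (wo t).
have xo' t : om (xi' t) <= oT t := le_trans (om_rsubmx _) (vo t).
have -> : (fun t x => tf_shift (w t) phi x - tf_shift (v t) phi x) = (fun t x =>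
    (expi (dotv x (xi t)) - expi (dotv x (xi' t))) * phi (x - y t) +
    expi (dotv x (xi' t)) * (phi (x - y t) - phi (x - y' t))).
  by apply/funext => t; apply/funext => x; rewrite /tf_shift -/(xi t) -/(xi' t) -/(y t) -/(y' t); ring.
apply: sfamD => //.
- have h : sfam oT (fun=> 1) (fun t x => phi (x - y t)).
    apply: (@sfam_translate T d oT oT1 (fun=> 1) y (fun=> phi)) => //.
    apply: (@sfam_weaken R T d (fun=> 1) oT (fun=> 1) (fun=> 1) _ 1 0) => //.
      by move=> t; rewrite expr0 !mulr1.
    exact: schwartz_sfamT.
  apply: (@sfam_weaken R T d oT oT (fun t => `|xi t - xi' t| * 1) _ _ 1 0) => //.
    by move=> t; rewrite expr0 !mul1r mulr1 /xi /xi' -linearB norm_rsubmx.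
  apply: (@sfam_mul T d oT oT1 (fun t => `|xi t - xi' t|) (fun=> 1) 1) => //.
  exact: dbd_expi_sub.
- apply: (@sfam_weaken R T d oT oT (fun t => 1 * `|y t - y' t|) _ _ 1 0) => //.
    by move=> t; rewrite expr0 !mul1r /y /y' -linearB norm_lsubmx.
  apply: (@sfam_mul T d oT oT1 (fun=> 1) _ 0) => //.
    apply: (@dbd_weaken R T d oT oT (fun _ _ => 1) _ _ 1 0) => //.
      by move=> t x; rewrite !expr0 !mulr1.
    exact: dbd_expi.
  exact: sfam_translate_sub.
Qed.

Lemma temperedB n (u : ('rV[R]_n -> C) -> C) f g : tempered u -> schwartz f -> schwartz g ->
  u (fun x => f x - g x) = u f - u g.
Proof.
move=> [ul _] sf sg.
have -> : (fun x => f x - g x) = (fun x => -1 * g x + f x).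
  by apply/funext => x; rewrite mulN1r addrC.
by rewrite ul// mulN1r addrC.
Qed.

Lemma tf_schwartz d (w : 'rV[R]_(d + d)) (phi : 'rV[R]_d -> C) :
  schwartz phi -> schwartz (tf_shift w phi).
Proof.
move=> sphi.
exact: (sfam_schwartz tt (@sfam_tf unit d (fun=> om w) (fun=> w) phi (fun=> lexx _) sphi)).
Qed.

Lemma schwartz_conjf n (f : 'rV[R]_n -> C) : schwartz f -> schwartz (conjf f).
Proof.
move=> sf; apply: sfam1_schwartz; apply: (@sfamJ unit n (fun=> 1)) => //.
exact: schwartz_sfam.
Qed.

Lemma stft_bound d (u : ('rV[R]_d -> C) -> C) (phi : 'rV[R]_d -> C) :
  tempered u -> schwartz phi ->
  exists2 K : R, 0 <= K & exists k, forall z, nc (stft phi u z) <= K * om z ^+ k.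
Proof.
move=> tu sphi.
have hf : sfam (@om R (d + d)) (fun=> 1) (fun z => conjf (tf_shift z phi)).
  apply: (@sfamJ _ d (@om R (d + d))) => //; first by move=> z; exact: om_ge1.
  by apply: sfam_tf.
have [K [k [K0 hK]]] := tempered_sfam tu (@om_ge1 R _) (fun=> ler01) hf.
by exists K => //; exists k => z; have := hK z; rewrite mulr1.
Qed.

Lemma stft_sub_bound d (u : ('rV[R]_d -> C) -> C) (phi : 'rV[R]_d -> C) :
  tempered u -> schwartz phi ->
  exists2 K : R, 0 <= K & exists k, forall z w,
    nc (stft phi u z - stft phi u w) <= K * (om z * om w) ^+ k * `|z - w|.
Proof.
move=> tu sphi.
pose oT (p : 'rV[R]_(d + d) * 'rV[R]_(d + d)) := om p.1 * om p.2.
have o1 p : om p.1 <= oT p by rewrite /oT ler_peMr ?om_ge0 ?om_ge1.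
have o2 p : om p.2 <= oT p by rewrite /oT ler_peMl ?om_ge0 ?om_ge1.
have oT1 p : 1 <= oT p := le_trans (om_ge1 _) (o1 p).
have hf := @sfamJ _ d oT oT1 _ _ (fun=> normr_ge0 _)
  (@sfam_tf_sub _ d oT (fun p => p.1) (fun p => p.2) phi o1 o2 sphi).
have [K [k [K0 hK]]] := tempered_sfam tu oT1 (fun=> normr_ge0 _) hf.
exists K => //; exists k => z w; have := hK (z, w); rewrite /oT /=; congr (nc _ <= _).
rewrite /stft /pairing -temperedB//; try exact: schwartz_conjf (tf_schwartz _ _).
by congr u; apply/funext => x; rewrite /conjf rmorphB.
Qed.

Lemma ccont_stft d (u : ('rV[R]_d -> C) -> C) (phi : 'rV[R]_d -> C) :
  tempered u -> schwartz phi -> ccont (stft phi u).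
Proof.
move=> tu sphi; have [K K0 [k hK]] := stft_sub_bound tu sphi.
have key z e : 0 < e -> exists2 r : R, 0 < r &
    forall w, `|w - z| < r -> nc (stft phi u z - stft phi u w) <= e.
  move=> e0; pose B := (K + 1) * (om z * (om z + 1)) ^+ k.
  have B0 : 0 < B.
    by rewrite mulr_gt0 ?ltr_wpDl// exprn_gt0// mulr_gt0 ?om_gt0// addr_gt0 ?om_gt0.
  exists (Num.min 1 (e / B)); first by rewrite lt_min ltr01 divr_gt0.
  move=> w; rewrite lt_min => /andP[w1 w2].
  rewrite (le_trans (hK z w))// (@le_trans _ _ (B * `|w - z|))//.
    rewrite distrC ler_wpM2r// /B ler_pM ?exprn_ge0 ?mulr_ge0 ?om_ge0 ?lerDl//.
    apply: lerXn2r; rewrite ?nnegrE ?mulr_ge0 ?om_ge0 ?addr_ge0 ?om_ge0//.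
    rewrite ler_wpM2l ?om_ge0// /om -addrA lerD2l.
    have := ler_normD (w - z) z; rewrite subrK => /le_trans; apply.
    by rewrite [leRHS]addrC lerD2r ltW.
  by rewrite mulrC -ler_pdivlMr// ltW.
split; apply/continuous_rVP => z e e0; have [r r0 hr] := key z e e0; exists r => // w wz.
  by have := le_trans (nc_Re _) (hr w wz); rewrite ReD ReN.
by have := le_trans (nc_Im _) (hr w wz); rewrite ImD ImN.
Qed.

Lemma tempered_dist_of n (g : 'rV[R]_n -> C) : schwartz g -> tempered (dist_of g).
Proof.
move=> sg; have mg := schwartz_cmble sg; have ig := schwartz_intg sg.
have ifg f : schwartz f -> cintg (fun x => g x * f x).
  move=> sf; have [K K0 hK] := schwartz_bound 0 sf.
  apply: (@le_cintg R n _ (fun x => K * nc (g x))).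
  - by apply: cmbleM => //; exact: schwartz_cmble.
  - by move=> x; rewrite ncM mulrC ler_wpM2r ?nc_ge0//; have := hK x; rewrite expr0 invr1 mulr1.
  - by apply: intgZ; exact: ig.2.
split.
  move=> c f h sf sh; rewrite /dist_of.
  transitivity (integralC (fun x => c * (g x * f x) + g x * h x)).
    by apply: eq_integralC => x; ring.
  rewrite integralCD ?integralCZ //; try exact: ifg.
  exact: cintgZ (ifg _ sf).
(* The seminorm with both multi-indices zero, the sup norm of the test function, suffices. *)
exists 0%N, (2 * rint (fun x => nc (g x))) => f sf B hB.
have fB x : nc (f x) <= B.
  have := hB (fun=> 0%N) (fun=> 0%N) _ _ x.
  rewrite /mlen !big1// => /(_ isT isT).
  rewrite /mpow big1 ?normr1 ?mul1r//.
  by rewrite mpartialE (_ : mseq _ = [::])// /mseq; elim: (enum _).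
have B0 : 0 <= B := le_trans (nc_ge0 _) (fB 0).
rewrite -mulrA [_ * B]mulrC -rintZ; last exact: ig.2.
apply: nc_integralC; [exact: (ifg _ sf).1| |by apply: intgZ; exact: ig.2].
by move=> x; rewrite ncM mulrC ler_wpM2r ?nc_ge0.
Qed.

End TimeFrequency.

(** * Distributions under the integral, inversion and Moyal's identity *)

Section Moyal.
Context {R : realType}.
Notation C := R[i].
Notation nc := (@Normc.normc R).

Lemma ccvgD (u v : nat -> C) l l' : ccvg u l -> ccvg v l' -> ccvg (fun k => u k + v k) (l + l').
Proof.
move=> [a b] [c d]; split.
  by rewrite ReD; under eq_fun do rewrite ReD; apply: cvgD.
by rewrite ImD; under eq_fun do rewrite ImD; apply: cvgD.
Qed.

Lemma ccvg0_le (u : nat -> C) (e : nat -> R) : (forall k, nc (u k) <= e k) ->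
  e k @[k --> \oo] --> 0 -> ccvg u 0.
Proof.
move=> ue e0.
have h (v : nat -> R) : (forall k, `|v k| <= nc (u k)) -> v k @[k --> \oo] --> 0.
  move=> vu; apply/cvgrPdist_le => eps eps0.
  have /cvgrPdist_le /(_ eps eps0) := e0; apply: filterS => k.
  rewrite !sub0r !normrN => /(le_trans (ler_norm _)) h.
  exact: le_trans (vu k) (le_trans (ue k) h).
by split; apply: h => k; [exact: nc_Re|exact: nc_Im].
Qed.

(** Differentiation under the integral. The bound keeps the weighted integral of the kernel instead
    of a constant, because in [tempered_integral] exactly these integrals tend to 0. *)
Lemma integral_family T n k (kap : 'rV[R]_k -> C) (oT Th : T -> 'rV[R]_k -> R)
    (H : T -> 'rV[R]_k -> 'rV[R]_n -> C) :
  (forall t w, 1 <= oT t w) -> (forall t w, 0 <= Th t w) ->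
  sfam (fun p : T * 'rV[R]_k => oT p.1 p.2) (fun p => Th p.1 p.2) (fun p => H p.1 p.2) ->
  (forall t K, intg (fun w => nc (kap w) * (oT t w ^+ K * Th t w))) ->
  (forall t x, cmble (fun w => kap w * H t w x)) ->
  let F t x := integralC (fun w => kap w * H t w x) in
  (forall t, smooth (F t)) /\ forall s N, exists (A : R) (K : nat), 0 <= A /\
    forall t x, nc (partials s (F t) x) <=
      A * rint (fun w => nc (kap w) * (oT t w ^+ K * Th t w)) * om x ^- N.
Proof.
move=> o1 Th0 sH iw mH F.
have o0 t w : 0 <= oT t w := le_trans ler01 (o1 t w).
pose I K t := rint (fun w => nc (kap w) * (oT t w ^+ K * Th t w)).
have I0 K t : 0 <= I K t.
  by apply: rint_ge0 => w; rewrite !mulr_ge0 ?nc_ge0 ?exprn_ge0.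
have IK K K' t : (K <= K')%N -> I K t <= I K' t.
  move=> KK; apply: le_rint => // w; rewrite ler_wpM2l ?nc_ge0// ler_wpM2r//.
  exact: ler_weXn2l.
pose P (F : T -> 'rV[R]_n -> C) := exists H : T -> 'rV[R]_k -> 'rV[R]_n -> C,
  [/\ sfam (fun p : T * 'rV[R]_k => oT p.1 p.2) (fun p => Th p.1 p.2) (fun p => H p.1 p.2),
     forall t x, cmble (fun w => kap w * H t w x) &
     F = fun t x => integralC (fun w => kap w * H t w x)].
pose B (F : T -> 'rV[R]_n -> C) := forall N, exists (A : R) (K : nat), 0 <= A /\
    forall t x, nc (F t x) <= A * I K t * om x ^- N.
suff : (forall t, smooth (F t)) /\ forall s, B (fun t => partials s (F t)) by [].
apply: (@fspan_smooth R T n P B); last by apply: fspan_base; exists H.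
  move=> F1 F2 h1 h2 N; have [A1 [K1 [A10 h1N]]] := h1 N; have [A2 [K2 [A20 h2N]]] := h2 N.
  exists (A1 + A2), (maxn K1 K2); split; first exact: addr_ge0.
  move=> t x; rewrite (le_trans (ncD _ _))// !mulrDl lerD//.
    by rewrite (le_trans (h1N t x))// ler_wpM2r ?omV_ge0// ler_wpM2l// IK ?leq_maxl.
  by rewrite (le_trans (h2N t x))// ler_wpM2r ?omV_ge0// ler_wpM2l// IK ?leq_maxr.
move=> _ {H F sH mH} [H [sH mH ->]].
have bnd N : exists (A : R) (K : nat), 0 <= A /\ forall t w x,
    nc (kap w * H t w x) <= A * om x ^- N * (nc (kap w) * (oT t w ^+ K * Th t w)).
  have [A [K [A0 h]]] := dbd_bdd (sH N); exists A, K; split => // t w x.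
  rewrite ncM (le_trans (ler_wpM2l (nc_ge0 _) (h (t, w) x)))// le_eqVlt.
  by apply/orP; left; apply/eqP => /=; ring.
have iH t x : cintg (fun w => kap w * H t w x).
  have [A [K [A0 h]]] := bnd 0%N.
  apply: (le_cintg (mH t x) (fun w => h t w x)).
  by apply: intgZ; exact: iw.
pose H' i t w x := partial i (H t w) x.
have sH' i : sfam (fun p : T * 'rV[R]_k => oT p.1 p.2) (fun p => Th p.1 p.2)
    (fun p => H' i p.1 p.2) by move=> N; exact: dbd_partial.
have dH' i t w x : cid i (fun x => kap w * H t w x) x (kap w * H' i t w x).
  by apply: cidZ; apply: smooth_cid; exact: (sH 0%N).1 (t, w).
have mH' i t x : cmble (fun w => kap w * H' i t w x).
  by apply: (cmble_cid (f := fun x w => kap w * H t w x)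
    (g := fun x w => kap w * H' i t w x) (i := i)) => // w.
have bnd' i N : exists (A : R) (K : nat), 0 <= A /\ forall t w x,
    nc (kap w * H' i t w x) <= A * om x ^- N * (nc (kap w) * (oT t w ^+ K * Th t w)).
  have [A [K [A0 h]]] := dbd_bdd (sH' i N); exists A, K; split => // t w x.
  rewrite ncM (le_trans (ler_wpM2l (nc_ge0 _) (h (t, w) x)))// le_eqVlt.
  by apply/orP; left; apply/eqP => /=; ring.
have dF i t x : cid i (fun x => integralC (fun w => kap w * H t w x)) x
    (integralC (fun w => kap w * H' i t w x)).
  have [A [K [A0 h]]] := bnd' i 0%N.
  apply: (cid_integralC (f := fun x w => kap w * H t w x)
    (g := fun x w => kap w * H' i t w x)
    (H := fun w => A * (nc (kap w) * (oT t w ^+ K * Th t w)))) => //.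
    by apply: intgZ; exact: iw.
  by move=> r w _; have := h t w (r *: unitv i + x); rewrite expr0 invr1 mulr1.
split.
- move=> t; have /choice[A hA] : forall i, exists A : R, 0 <= A /\
     forall x, nc (integralC (fun w => kap w * H' i t w x)) <= A.
    move=> i; have [A [K [A0 h]]] := bnd' i 0%N; exists (2 * (A * I K t)); split.
      by rewrite !mulr_ge0.
    move=> x; rewrite /I -rintZ//; apply: nc_integralC => //; last exact: intgZ.
    by move=> w; have := h t w x; rewrite expr0 invr1 mulr1.
  apply: (cid_ccont (g := fun i x => integralC (fun w => kap w * H' i t w x))) => //.
  move=> x; exists (\sum_i A i) => i w _; rewrite (le_trans ((hA i).2 _))//.
  by rewrite (bigD1 i)//= lerDl; apply: sumr_ge0 => j _; exact: (hA j).1.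
- move=> N; have [A [K [A0 h]]] := bnd N; exists (2 * A), K; split; first exact: mulr_ge0.
  move=> t x.
  have -> : 2 * A * I K t * om x ^- N = 2 * (A * om x ^- N * I K t) by ring.
  by rewrite /I -rintZ//; apply: nc_integralC => //; exact: intgZ.
- move=> i; exists (fun t x => integralC (fun w => kap w * H' i t w x)) => //.
  by apply: fspan_base; exists (H' i).
Qed.

Lemma schwartz0 n : schwartz (fun _ : 'rV[R]_n => 0 : C).
Proof.
apply: sfam1_schwartz => N; apply: (@dbd_cst R unit n (fun=> 1) (fun=> lexx 1) (fun=> 0)) => [|t x].
  by exists 0, 0%N; split => // t x; rewrite nc0 !mul0r.
by rewrite mul1r omV_ge0.
Qed.

Lemma tempered0 n (u : ('rV[R]_n -> C) -> C) : tempered u -> u (fun=> 0) = 0.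
Proof.
move=> [ul _].
have s0 := @schwartz0 n.
have h := ul (-1) _ _ s0 s0.
transitivity (u (fun x : 'rV[R]_n => -1 * 0 + 0)); last by rewrite h mulN1r addNr.
by congr u; apply/funext => x; rewrite mulr0 addr0.
Qed.

Lemma tempered_sum n (u : ('rV[R]_n -> C) -> C) (I : Type) (s : seq I) (c : I -> C)
    (f : I -> 'rV[R]_n -> C) : tempered u -> (forall i, schwartz (f i)) ->
  schwartz (fun x => \sum_(i <- s) c i * f i x) /\
  u (fun x => \sum_(i <- s) c i * f i x) = \sum_(i <- s) c i * u (f i).
Proof.
move=> tu sf.
have s0 := @schwartz0 n.
elim: s => [|i s [IH1 IH2]].
  rewrite big_nil (_ : (fun x => _) = fun=> 0); last by apply/funext => x; rewrite big_nil.
  by split => //; exact: tempered0.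
rewrite (_ : (fun x => _) = fun x => c i * f i x + \sum_(i <- s) c i * f i x); last first.
  by apply/funext => x; rewrite big_cons.
split; last by rewrite big_cons tu.1// IH2.
apply: sfam1_schwartz; apply: (@sfamD R unit n (fun=> 1)) => //; last exact: schwartz_sfam.
have := @sfam_mul R unit n (fun=> 1) (fun=> lexx 1) (fun=> nc (c i)) (fun=> 1) 0
  (fun _ _ => c i) (fun=> f i) (fun=> nc_ge0 _) (fun=> ler01) _ (schwartz_sfam (sf i)).
move=> h; apply: (@sfam_weaken R unit n (fun=> 1) (fun=> 1) (fun=> nc (c i) * 1) (fun=> 1) _
   (nc (c i)) 0 (fun=> lexx 1) (fun=> lexx 1) (nc_ge0 _)) => [_|].
  by rewrite expr0 !mulr1.
apply: h; apply: (@dbd_cst R unit n (fun=> 1) (fun=> lexx 1)) => [|t x].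
  by exists 1, 0%N; split => // t x; rewrite !expr0 !mulr1 mul1r.
by rewrite expr0 mulr1 nc_ge0.
Qed.

Lemma schwartzB n (f g : 'rV[R]_n -> C) : schwartz f -> schwartz g ->
  schwartz (fun x => f x - g x).
Proof.
move=> sf sg.
have -> : (fun x => f x - g x) = fun x => \sum_(b : bool) (if b then 1 else -1) * (if b then f else g) x.
  by apply/funext => x; rewrite big_bool mul1r mulN1r.
have sfg (b : bool) : schwartz (if b then f else g) by case: b.
exact: (tempered_sum (index_enum bool) (fun b : bool => if b then 1 else -1)
  (tempered_dist_of (@schwartz0 n)) sfg).1.
Qed.

(* Replacing [w] by [qv N w] turns the integral into a finite sum; the error is an integral
   of differences of time-frequency shifts, whose seminorms tend to 0 by dominated
   convergence. *)
Lemma tempered_integral d (u : ('rV[R]_d -> C) -> C) (phi G : 'rV[R]_d -> C)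
    (kap : 'rV[R]_(d + d) -> C) : tempered u -> schwartz phi -> schwartz G -> cmble kap ->
  (forall N, exists2 K : R, 0 <= K & forall w, nc (kap w) <= K * om w ^- N) ->
  (forall x, G x = integralC (fun w => kap w * conjf (tf_shift w phi) x)) ->
  cintg (fun w => kap w * stft phi u w) /\
  u G = integralC (fun w => kap w * stft phi u w).
Proof.
move=> tu sphi sG mkap hkap GE.
pose E w := conjf (tf_shift w phi).
have sE w : schwartz (E w) by apply: schwartz_conjf; exact: tf_schwartz.
have cE x : ccont (fun w => E w x).
  apply: ccontJ; apply: ccontM.
    by apply: ccont_expi_dotv; [exact: lip_cst|exact: lip_rsubmx].
  apply: (ccont_lip (h := fun w : 'rV[R]_(d + d) => x - lsubmx w)).
    by apply: lipD; [exact: lip_cst|apply: lipN; exact: lip_lsubmx].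
  exact: smooth_ccont (schwartz_smooth sphi).
have mqv N (f : 'rV[R]_(d + d) -> C) : cmble (fun w => f (qv N w)).
  by split; [exact: (mble_qv N (fun w => Re (f w)))|exact: (mble_qv N (fun w => Im (f w)))].
have omqv N (w : 'rV[R]_(d + d)) : om (qv N w) <= 2 * om w.
  by have := qv_bound N w; have := normr_ge0 w; rewrite /om; lra.
have kapint j : intg (fun w => nc (kap w) * om w ^+ j).
  have [K K0 hK] := hkap (j + 2 * (d + d))%N.
  apply: (@le_intg R _ _ (fun w => K * om w ^- (2 * (d + d)))).
  - by rewrite /mble; apply: measurable_funM; [exact: (cmble_nc mkap)|apply: measurable_funX; exact: mble_om].
  - move=> w; rewrite ger0_norm; last by rewrite mulr_ge0 ?nc_ge0 ?exprn_ge0 ?om_ge0.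
    rewrite (le_trans (ler_wpM2r (ltW (omX_gt0 w j)) (hK w)))//.
    rewrite exprD invfM le_eqVlt; apply/orP; left; apply/eqP.
    by field; rewrite !gt_eqF ?omX_gt0.
  - by apply: intgZ; exact: intg_omV.
pose V := stft phi u.
have cV : ccont V := ccont_stft tu sphi.
have [KV KV0 [kV hV]] := stft_bound tu sphi.
have ikap : cintg kap.
  by split => //; have := kapint 0%N; congr intg; apply/funext => w; rewrite expr0 mulr1.
have iqv N v : cintg (fun w => kap w * (qv N w == v)%:R).
  apply: (@le_cintg R _ _ (fun w => nc (kap w))).
  - by apply: cmbleM => //; exact: (mqv N (fun w => (w == v)%:R)).
  - by move=> w; rewrite ncM; case: (_ == _); rewrite ?nc1 ?nc0 ?mulr1 ?mulr0 ?nc_ge0.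
  - exact: ikap.2.
(* The mass that [kap] puts on the cell rounded to [v]. *)
pose c N v := integralC (fun w => kap w * (qv N w == v)%:R).
have sumE N (f : 'rV[R]_(d + d) -> C) : \sum_(v <- qvals (d + d) N) c N v * f v =
    integralC (fun w => kap w * f (qv N w)).
  transitivity (integralC (fun w => \sum_(v <- qvals (d + d) N) f v * (kap w * (qv N w == v)%:R))).
    rewrite (cintg_sum (qvals (d + d) N) (fun v => cintgZ (f v) (iqv N v))).2.
    by apply: eq_bigr => v _; rewrite integralCZ// mulrC.
  apply: eq_integralC => w; rewrite (qv_sum N f) mulr_sumr.
  by apply: eq_bigr => v _; ring.
have iV : cintg (fun w => kap w * V w).
  apply: (@le_cintg R _ _ (fun w => KV * (nc (kap w) * om w ^+ kV))).
  - by apply: cmbleM => //; exact: ccont_cmble.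
  - by move=> w; rewrite ncM mulrCA ler_wpM2l ?nc_ge0.
  - by apply: intgZ; exact: kapint.
split => //.
have cqv x (f : 'rV[R]_(d + d) -> C) : ccont f -> ccvg (fun N => f (qv N x)) (f x).
  move=> cf; apply: (ccont_ccvg cf).
  apply/cvgrPdist_le => e e0; have /cvgrPdist_le /(_ e e0) := @qv_cvg R _ x.
  by apply: filterS => N; rewrite sub0r normrN normr_id distrC.
have [_ cvV] : cintg (fun w => kap w * V w) /\
    ccvg (fun N => integralC (fun w => kap w * V (qv N w))) (integralC (fun w => kap w * V w)).
  apply: (@integralC_dct R _ _ _ (fun w => KV * 2 ^+ kV * (nc (kap w) * om w ^+ kV))).
  - by move=> N; apply: cmbleM => //; exact: mqv.
  - by move=> w; apply: ccvgM; [exact: ccvg_cst|exact: cqv].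
  - by apply: intgZ; exact: kapint.
  - move=> N w; rewrite ncM mulrCA ler_wpM2l ?nc_ge0// (le_trans (hV _))// -mulrA.
    rewrite ler_wpM2l// -exprMn; apply: lerXn2r; rewrite ?nnegrE ?om_ge0 ?mulr_ge0 ?om_ge0//.
pose D N x := integralC (fun w => kap w * (E w x - E (qv N w) x)).
pose S N x := \sum_(v <- qvals (d + d) N) c N v * E v x.
have iE x : cintg (fun w => kap w * E w x).
  have [K K0 hK] := schwartz_bound 0 sphi.
  apply: (@le_cintg R _ _ (fun w => K * nc (kap w))).
  - by apply: cmbleM => //; exact: ccont_cmble.
  - move=> w; rewrite ncM mulrC ler_wpM2r ?nc_ge0// nc_conj ncM nc_expi mul1r.
    by have := hK (x - lsubmx w); rewrite expr0 invr1 mulr1.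
  - by apply: intgZ; exact: ikap.2.
have iEq N x : cintg (fun w => kap w * E (qv N w) x).
  have [K K0 hK] := schwartz_bound 0 sphi.
  apply: (@le_cintg R _ _ (fun w => K * nc (kap w))).
  - by apply: cmbleM => //; exact: (mqv N (fun w => E w x)).
  - move=> w; rewrite ncM mulrC ler_wpM2r ?nc_ge0// nc_conj ncM nc_expi mul1r.
    by have := hK (x - lsubmx (qv N w)); rewrite expr0 invr1 mulr1.
  - by apply: intgZ; exact: ikap.2.
have DE N x : D N x = G x - S N x.
  rewrite GE /S (sumE N (fun v => E v x)) -integralCN// -integralCD//.
  - by apply: eq_integralC => w; rewrite mulrBr.
  - exact: iE.
  have := cintgZ (-1) (iEq N x); apply: eq_cintg => w; exact: mulN1r.
have sS N := @tempered_sum d u _ (qvals (d + d) N) (c N) E tu sE.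
(* [S N] is a finite combination of time-frequency shifts, so [u] can be applied to it by linearity
   alone. *)
have uD N : u (D N) = u G - integralC (fun w => kap w * V (qv N w)).
  have -> : D N = fun x => G x - S N x by apply/funext.
  rewrite temperedB//; last exact: (sS N).1.
  congr (_ - _); rewrite (sS N).2; exact: (sumE N V).
pose oT (N : nat) (w : 'rV[R]_(d + d)) := om w * om (qv N w).
pose Th (N : nat) (w : 'rV[R]_(d + d)) := `|w - qv N w|.
have o1 N w : om w <= oT N w by rewrite /oT ler_peMr ?om_ge0 ?om_ge1.
have o2 N w : om (qv N w) <= oT N w by rewrite /oT ler_peMl ?om_ge0 ?om_ge1.
have oT1 N w : 1 <= oT N w := le_trans (om_ge1 _) (o1 N w).
have thb N w : Th N w <= 3 * om w.
  rewrite /Th (le_trans (ler_normB _ _))//; have := qv_bound N w; have := normr_ge0 w; rewrite /om; lra.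
have ob N w K : oT N w ^+ K <= 2 ^+ K * om w ^+ (2 * K).
  rewrite exprM -exprMn; apply: lerXn2r; rewrite ?nnegrE ?mulr_ge0 ?om_ge0 ?exprn_ge0 ?om_ge0//.
  by rewrite /oT mulrC (_ : 2 * om w ^+ 2 = 2 * om w * om w) ?ler_wpM2r ?om_ge0// expr2; ring.
have domw N K w : nc (kap w) * (oT N w ^+ K * Th N w) <=
    2 ^+ K * 3 * (nc (kap w) * om w ^+ (2 * K).+1).
  rewrite [leRHS]mulrCA ler_wpM2l ?nc_ge0// exprSr.
  have -> : 2 ^+ K * 3 * (om w ^+ (2 * K) * om w) = (2 ^+ K * om w ^+ (2 * K)) * (3 * om w) by ring.
  apply: ler_pM (ob _ _ _) (thb _ _); last exact: normr_ge0.
  by apply: exprn_ge0; exact: le_trans ler01 (oT1 N w).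
have pos N K w : 0 <= nc (kap w) * (oT N w ^+ K * Th N w).
  apply: mulr_ge0; first exact: nc_ge0.
  apply: mulr_ge0; last exact: normr_ge0.
  by apply: exprn_ge0; exact: le_trans ler01 (oT1 N w).
have mo N K : mble (fun w => nc (kap w) * (oT N w ^+ K * Th N w)).
  apply: measurable_funM; first exact: (cmble_nc mkap).
  apply: measurable_funM.
    apply: measurable_funX; apply: measurable_funM; first exact: mble_om.
    exact: (mble_qv N (fun w => om w)).
  rewrite (_ : (fun t => _) = fun t => \sum_(v <- qvals (d + d) N)
      (`|row_of t - v| * (qv N (row_of t) == v)%:R)); last first.
    by apply/funext => t; rewrite -(qv_sum N (fun v => `|row_of t - v|)).
  apply: measurable_sum => v; apply: measurable_funM; last exact: mble_qv_eq.
  have := @affine_mble R _ 1 (- v) _ (continuous_mble (@rcont_norm R _)).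
  by rewrite /mble; under eq_fun do rewrite scale1r.
have iw N K : intg (fun w => nc (kap w) * (oT N w ^+ K * Th N w)).
  apply: (@le_intg R _ _ (fun w => 2 ^+ K * 3 * (nc (kap w) * om w ^+ (2 * K).+1))) => //.
    by move=> w; rewrite ger0_norm.
  by apply: intgZ; exact: kapint.
pose I K N := rint (fun w => nc (kap w) * (oT N w ^+ K * Th N w)).
have I0 K N : 0 <= I K N by apply: rint_ge0.
have Icvg K : I K N @[N --> \oo] --> 0.
  have -> : (0 : R) = rint (fun _ : 'rV[R]_(d + d) => 0).
    by have := congr1 (@complex.Re R) (@integralC0 R (d + d)); rewrite integralCE.
  apply: (@rint_dct R _ _ _ (fun w => 2 ^+ K * 3 * (nc (kap w) * om w ^+ (2 * K).+1)) _ _ _ _).2 => //.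
  - move=> w; apply/cvgrPdist_le => e e0.
    pose B := nc (kap w) * (om w * (2 * om w)) ^+ K + 1.
    have B0 : 0 < B by rewrite ltr_wpDl// mulr_ge0 ?nc_ge0 ?exprn_ge0// mulr_ge0 ?mulr_ge0 ?om_ge0.
    have /cvgrPdist_le /(_ (e / B) (divr_gt0 e0 B0)) := @qv_cvg R _ w.
    apply: filterS => N h; rewrite sub0r normrN ger0_norm//.
    rewrite (@le_trans _ _ (B * Th N w))//; last by rewrite mulrC -ler_pdivlMr.
    rewrite mulrA ler_wpM2r ?normr_ge0// /B ler_wpDr// ler_wpM2l ?nc_ge0//.
    apply: lerXn2r; rewrite ?nnegrE ?mulr_ge0 ?om_ge0 ?mulr_ge0 ?om_ge0//.
    by rewrite /oT ler_wpM2l ?om_ge0.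
  - by apply: intgZ; exact: kapint.
  - by move=> N w; rewrite ger0_norm.
have sH : sfam (fun p : nat * 'rV[R]_(d + d) => oT p.1 p.2) (fun p => Th p.1 p.2)
    (fun p x => E p.2 x - E (qv p.1 p.2) x).
  have := @sfamJ _ _ d (fun p : nat * 'rV[R]_(d + d) => oT p.1 p.2) (fun p => oT1 p.1 p.2) _ _
   (fun p => normr_ge0 _)
   (@sfam_tf_sub R _ d (fun p : nat * 'rV[R]_(d + d) => oT p.1 p.2) (fun p => p.2)
     (fun p => qv p.1 p.2) phi (fun p => o1 p.1 p.2) (fun p => o2 p.1 p.2) sphi).
  congr sfam; apply/funext => p; apply/funext => x; rewrite rmorphB //.
have mD N x : cmble (fun w => kap w * (E w x - E (qv N w) x)).
  apply: cmbleM => //; have -> : (fun w => E w x - E (qv N w) x) = fun w => E w x + (-1) * E (qv N w) x.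
    by apply/funext => w; rewrite mulN1r.
  apply: cmbleD; first exact: ccont_cmble.
  by apply: cmbleM; [exact: cmble_cst|exact: (mqv N (fun w => E w x))].
have [smD bdD] := @integral_family nat d (d + d) kap oT Th (fun N w x => E w x - E (qv N w) x)
  oT1 (fun _ _ => normr_ge0 _) sH iw mD.
(* This is [tempered_bound] for the class of nonnegative null sequences: each seminorm of [D N] is
   at most a multiple of some [I K N]. *)
have bD : exists (M : R) (e : nat -> R), [/\ 0 <= M,
    (forall N, 0 <= e N) /\ e N @[N --> \oo] --> 0 & forall N, nc (u (D N)) <= M * e N].
  apply: (@tempered_bound R d u nat (fun e => (forall N, 0 <= e N) /\ e N @[N --> \oo] --> (0 : R)) D tu).
  - by split => //; exact: cvg_cst.
  - move=> e e' [p1 c1] [p2 c2]; split; first by move=> N; rewrite addr_ge0.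
    by rewrite -[0]addr0; exact: cvgD.
  - by move=> e N [].
  - move=> N; have -> : D N = fun x => G x - S N x by apply/funext.
    exact: schwartzB sG (sS N).1.
  - move=> al be; have [A [K [A0 hA]]] := bdD (mseq be) (mlen al).
    exists (fun N => A * I K N).
      split; first by move=> N; rewrite mulr_ge0.
      by rewrite -(mulr0 A); apply: cvgM => //; exact: cvg_cst.
    move=> N x; rewrite mpartialE.
    rewrite (le_trans (ler_wpM2l (normr_ge0 _) (hA N x)))//.
    rewrite mulrCA ler_piMr ?mulr_ge0//.
    - exact: I0.
    - by rewrite ler_pdivrMr ?omX_gt0// mul1r mpow_le.
have [M [e [M0 [e0 ecvg] hM]]] := bD.
have c0 : ccvg (fun N => u (D N)) 0.
  by apply: (ccvg0_le hM); rewrite -(mulr0 M); apply: cvgM => //; exact: cvg_cst.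
have := ccvgD c0 cvV.
rewrite add0r => c1; apply: (ccvg_unique _ c1).
have -> : (fun N => u (D N) + integralC (fun w => kap w * V (qv N w))) = (fun=> u G).
  by apply/funext => N; rewrite uD subrK.
exact: ccvg_cst.
Qed.

Lemma stft_dist_of d (phi g : 'rV[R]_d -> C) w :
  stft phi (dist_of g) w =
  ft (fun x => g x * conjc (phi (x - lsubmx w))) (- rsubmx w).
Proof.
apply: eq_integralC => x; rewrite /conjf /tf_shift rmorphM dotvNr expiN; ring.
Qed.

(** At [w = (y, eta)] the transform is a Fourier transform of [g(x) conj(phi(x - y))]. Smoothness of
    this product gives decay in [eta], uniformly in [y]; decay in [y] comes from
    [om y <= om x * om (x - y)], since both factors of the product decrease rapidly. *)
Lemma stft_decay T d (oT Th : T -> R) (g : T -> 'rV[R]_d -> C) (phi : 'rV[R]_d -> C) :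
  (forall t, 1 <= oT t) -> (forall t, 0 <= Th t) -> sfam oT Th g -> schwartz phi ->
  forall N, exists (K0 : R) (K : nat), 0 <= K0 /\ forall t w,
    nc (stft phi (dist_of (g t)) w) <= K0 * oT t ^+ K * Th t * om w ^- N.
Proof.
move=> oT1 Th0 sg sphi N.
pose G (p : T * 'rV[R]_d) (x : 'rV[R]_d) := g p.1 x * conjc (phi (x - p.2)).
pose oG (p : T * 'rV[R]_d) := oT p.1.
have oG1 p : 1 <= oG p by exact: oT1.
have d1 : dbd oG (fun p x => Th p.1 * om x ^- (N + 2 * d)) (fun p => g p.1).
  exact: (dbd_reindex (fun p : T * 'rV[R]_d => p.1) (sg (N + 2 * d)%N)).
have d2 : dbd oG (fun p x => om (x - p.2) ^- N) (fun p x => conjc (phi (x - p.2))).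
  apply: dbdJ => //; first by move=> t x; exact: omV_ge0.
  have := @dbd_comp _ _ _ _ oG1 d (fun p x => x - p.2) (fun=> 1) id
    (fun t x => om x ^- N) (fun=> phi); apply => //.
  - by move=> t i x r; rewrite mulr1 addrA.
  - by move=> t x x'; rewrite opprB addrA subrK.
  - by move=> t; rewrite normr1.
  - by move=> t x; exact: omV_ge0.
  - apply: (@dbd_weaken R _ d (fun=> 1) oG (fun t x => 1 * om x ^- N) _ _ 1 0) => //.
      by move=> t x; rewrite expr0 !mul1r.
    exact: schwartz_sfamT.
have dG : dbd oG (fun p x => (Th p.1 * om p.2 ^- N) * om x ^- (2 * d)) G.
  apply: (@dbd_weaken R _ d oG oG
    (fun p x => (Th p.1 * om x ^- (N + 2 * d)) * om (x - p.2) ^- N) _ _ 1 0) => //.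
    move=> [t y] x /=; rewrite expr0 !mul1r -!mulrA ler_wpM2l//.
    rewrite exprD invfM mulrAC ler_wpM2r ?omV_ge0//.
    rewrite -invfM lef_pV2 ?posrE ?mulr_gt0 ?omX_gt0// -exprMn.
    apply: lerXn2r; rewrite ?nnegrE ?mulr_ge0 ?om_ge0//.
    by rewrite -(omN (x - y)) opprB mulrC omB.
  apply: dbdM => //.
    by move=> p x; rewrite mulr_ge0 ?omV_ge0.
  by move=> p x; exact: omV_ge0.
have [K0 [K [K00 hK]]] := ft_decay oG1 (fun p => mulr_ge0 (Th0 p.1) (omV_ge0 p.2 N))
  (leqnn _) dG N.
exists K0, K; split => // t w; rewrite stft_dist_of.
have := hK (t, lsubmx w) (- rsubmx w) => /le_trans; apply => /=.
rewrite -!mulrA !ler_wpM2l ?exprn_ge0 ?(le_trans ler01 (oT1 t))// omN -invfM.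
rewrite lef_pV2 ?posrE ?mulr_gt0 ?omX_gt0// -exprMn.
by apply: lerXn2r; rewrite ?nnegrE ?mulr_ge0 ?om_ge0// om_le_split.
Qed.

Lemma stft_schwartz_decay d (g phi : 'rV[R]_d -> C) N : schwartz g -> schwartz phi ->
  exists2 K : R, 0 <= K & forall w, nc (stft phi (dist_of g) w) <= K * om w ^- N.
Proof.
move=> sg sphi.
have [K0 [K [K00 hK]]] := stft_decay (fun=> lexx 1) (fun=> ler01) (schwartz_sfam sg) sphi N.
by exists K0 => // w; have := hK tt w; rewrite expr1n !mulr1.
Qed.

Lemma ft_shift n (G : 'rV[R]_n -> C) x xi : schwartz G ->
  ft (fun s => G (s + x)) xi = expi (- dotv x xi) * ft G xi.
Proof.
move=> sG; have ie : cintg (fun t => expi (dotv t xi) * G t).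
  have [K K0 hK] := schwartz_bound (2 * n) sG.
  by apply: (cintg_ft xi (schwartz_cmble sG) hK); apply: intgZ; exact: intg_omV.
have [i1 i2] := integralC_shift x ie.
rewrite [X in _ * X](esym i2 : ft G xi = _) -integralCZ//; apply: eq_integralC => s.
by rewrite mulrA -expiD dotvDl addrCA addNr addr0.
Qed.

Lemma schwartz_shift n (G : 'rV[R]_n -> C) y : schwartz G -> schwartz (fun x => G (x - y)).
Proof.
move=> sG; have h : sfam (fun _ : unit => om y) (fun=> 1) (fun _ x => G (x - y)).
  apply: (@sfam_translate R unit n (fun=> om y) (fun=> om_ge1 y) (fun=> 1) (fun=> y) (fun=> G)) => //.
  apply: (@sfam_weaken R unit n (fun=> 1) (fun=> om y) (fun=> 1) (fun=> 1) _ 1 0) => //.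
    by move=> t; exact: om_ge1.
    by move=> t; rewrite expr0 !mulr1.
  exact: schwartz_sfam.
exact: (sfam_schwartz tt h).
Qed.

Lemma schwartzM n (f g : 'rV[R]_n -> C) : schwartz f -> schwartz g ->
  schwartz (fun x => f x * g x).
Proof.
move=> sf sg; apply: sfam1_schwartz.
have := @sfam_mul R unit n (fun=> 1) (fun=> lexx 1) (fun=> 1) (fun=> 1) 0 (fun=> f) (fun=> g)
  (fun=> ler01) (fun=> ler01) _ (schwartz_sfam sg).
have -> : (fun _ : unit => 1 * 1) = (fun=> 1 : R) by apply/funext => t; rewrite mulr1.
apply; apply: (@dbd_weaken R unit n (fun=> 1) (fun=> 1) (fun t x => 1 * om x ^- 0) _ _ 1 0) => //.
  by move=> t x; rewrite !expr0 invr1 !mulr1.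
exact: schwartz_sfam.
Qed.

Lemma omV_row n m (x : 'rV[R]_n) (y : 'rV[R]_m) N M :
  om (row_mx x y) ^- (N + M) <= om x ^- N * om y ^- M.
Proof.
rewrite exprD invfM; apply: ler_pM; rewrite ?omV_ge0// lef_pV2 ?posrE ?omX_gt0//;
  apply: lerXn2r; rewrite ?nnegrE ?om_ge0//.
  exact: om_row_l.
exact: om_row_r.
Qed.

Lemma cintg_stft_tf d (g phi : 'rV[R]_d -> C) x : schwartz g -> schwartz phi ->
  let f (y eta : 'rV[R]_d) :=
    stft phi (dist_of g) (row_mx y eta) * tf_shift (row_mx y eta) phi x in
  [/\ cintg (unc f), forall y, cintg (f y) & forall e, cintg (f^~ e)].
Proof.
move=> sg sphi f.
have cphi := smooth_ccont (schwartz_smooth sphi).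
have [B B0 hB] := schwartz_bound 0 sphi.
have cV : ccont (stft phi (dist_of g)) := ccont_stft (tempered_dist_of sg) sphi.
have uf : unc f = fun w => stft phi (dist_of g) w * tf_shift w phi x.
  by apply/funext => w; rewrite /unc /f hsubmxK.
have [K K0 hK] := stft_schwartz_decay (2 * d + 2 * d) sg sphi.
have mf : cmble (unc f).
  rewrite uf; apply: ccont_cmble; apply: (ccontM cV); apply: ccontM.
    by apply: ccont_expi_dotv; [exact: lip_cst|exact: lip_rsubmx].
  apply: (ccont_lip (h := fun w : 'rV[R]_(d + d) => x - lsubmx w) _ cphi).
  by apply: lipD; [exact: lip_cst|apply: lipN; exact: lip_lsubmx].
apply: (@cintg_unc_bound R d d f (K * B) (2 * d) (2 * d) (leqnn _) (leqnn _) mf).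
move=> y eta; rewrite /f ncM.
have {}hB : nc (tf_shift (row_mx y eta) phi x) <= B.
  rewrite ncM nc_expi mul1r.
  by have := hB (x - lsubmx (row_mx y eta)); rewrite expr0 invr1 mulr1.
have {}hK := le_trans (hK (row_mx y eta)) (ler_wpM2l K0 (omV_row y eta (2 * d) (2 * d))).
have := ler_pM (nc_ge0 _) (nc_ge0 _) hK hB => /le_trans; apply.
by rewrite mulrAC.
Qed.

(** For fixed [y] the integral over [eta] is Fourier inversion at 0 for
    [s |-> g(s + x) conj(phi(s + x - y))]. What remains is [g x] times the integral of
    [|phi(x - y)|^2] over [y], so the constant is the Fourier constant times the squared norm of
    [phi]. *)
Lemma stft_inversion d (phi : 'rV[R]_d -> C) : schwartz phi -> (exists x, phi x <> 0) ->
  exists2 c : C, c <> 0 & forall g : 'rV[R]_d -> C, schwartz g -> forall x,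
    integralC (fun w => stft phi (dist_of g) w * tf_shift w phi x) = c * g x.
Proof.
move=> sphi [x0 phix0].
have [cF [cF0 hF]] := @fourier_inversion R d.
have cphi := smooth_ccont (schwartz_smooth sphi).
pose h (v : 'rV[R]_d) := nc (phi (- v)) ^+ 2.
have lN : lip (fun v : 'rV[R]_d => - v) by apply: lipN; exact: lip_id.
have [B B0 hB] := schwartz_bound (2 * d) sphi.
have ch : ccont (fun v => (h v)%:C%C).
  have -> : (fun v => (h v)%:C%C) = fun v => phi (- v) * conjc (phi (- v)).
    by apply/funext => v; rewrite mulc_conj.
  have cN := ccont_lip lN cphi.
  by apply: ccontM => //; exact: ccontJ.
have ih : cintg (fun v => (h v)%:C%C).
  apply: (@le_cintg R _ _ (fun v => B * B * om v ^- (2 * d))).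
  - exact: ccont_cmble.
  - move=> v; rewrite nc_real ger0_norm ?exprn_ge0 ?nc_ge0// /h expr2 -mulrA -(omN v) mulrCA.
    apply: ler_pM; rewrite ?nc_ge0//.
    rewrite (le_trans (hB _))// ler_piMr// omV_le1 //.
  - by apply: intgZ; exact: intg_omV.
exists (cF * (rint h)%:C%C).
  move=> /eqP; rewrite mulf_eq0 => /orP[/eqP //|/eqP /(congr1 (@complex.Re R)) /= h0].
  have : 0 < rint h.
    apply: (rint_gt0_continuous (x0 := - x0)).
    - by move=> v; rewrite exprn_ge0// nc_ge0.
    - exact: cintg_Re ih.
    - exact: ch.1.
    - rewrite /h opprK exprn_gt0// lt_neqAle nc_ge0 andbT eq_sym.
      by apply/eqP => /nc_eq0.
  by rewrite h0 ltxx.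
move=> g sg x.
pose f (y eta : 'rV[R]_d) : C :=
  stft phi (dist_of g) (row_mx y eta) * tf_shift (row_mx y eta) phi x.
have [if0 if1 if2] := cintg_stft_tf x sg sphi; rewrite -/f in if0 if1 if2.
have uf : unc f = fun w => stft phi (dist_of g) w * tf_shift w phi x.
  by apply/funext => w; rewrite /unc /f hsubmxK.
have [Fub _] := integralC_fubini if0 if1 if2.
rewrite -uf Fub.
have inner y : integralC (f y) = (cF * g x) * (h (y - x))%:C%C.
  pose Gy t := g t * conjc (phi (t - y)).
  have sGy : schwartz Gy := schwartzM sg (schwartz_conjf (schwartz_shift y sphi)).
  have sGx : schwartz (fun s => Gy (s + x)).
    by have := schwartz_shift (- x) sGy; congr schwartz; apply/funext => s; rewrite opprK.
  have [i1 i2] := hF _ sGx.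
  transitivity (integralC (fun eta => phi (x - y) * ft (fun s => Gy (s + x)) (- eta))).
    apply: eq_integralC => eta; rewrite /f stft_dist_of row_mxKl row_mxKr ft_shift//.
    rewrite dotvNr opprK /tf_shift row_mxKl row_mxKr -/(Gy) /Gy; ring.
  rewrite integralCZ// i2 add0r /Gy /h opprB -mulc_conj; ring.
rewrite (eq_integralC inner).
have [j1 j2] := integralC_shift (- x) ih.
by rewrite integralCZ// j2 integralC_real; ring.
Qed.

(** By inversion, a multiple of [g] is an integral of time-frequency shifts of [phi] with rapidly
    decreasing coefficients; after conjugation, [tempered_integral] lets [u] act under this
    integral. *)
Theorem stft_moyal d (phi : 'rV[R]_d -> C) : schwartz phi -> (exists x, phi x <> 0) ->
  exists2 c : C, c <> 0 & forall u g, tempered u -> schwartz g ->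
    cintg (fun w => conjc (stft phi (dist_of g) w) * stft phi u w) /\
    integralC (fun w => conjc (stft phi (dist_of g) w) * stft phi u w) = c * pairing u g.
Proof.
move=> sphi phi0; have [c c0 hc] := stft_inversion sphi phi0.
exists (conjc c); first by move=> /(congr1 (@conjc R)); rewrite conjcK rmorph0.
move=> u g tu sg.
have cV : ccont (stft phi (dist_of g)) := ccont_stft (tempered_dist_of sg) sphi.
have sG : schwartz (fun x => conjc (c * g x)).
  have s1 : schwartz (fun _ : 'rV[R]_d => 0 : C) by exact: schwartz0.
  have := (@tempered_sum d u unit [:: tt] (fun=> conjc c) (fun=> conjf g) tu
    (fun=> schwartz_conjf sg)).1.
  by congr schwartz; apply/funext => x; rewrite big_seq1 rmorphM.
have hk N : exists2 K : R, 0 <= K &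
    forall w, nc (conjc (stft phi (dist_of g) w)) <= K * om w ^- N.
  have [K K0 hK] := stft_schwartz_decay N sg sphi.
  by exists K => // w; rewrite nc_conj.
have GE x : conjc (c * g x) = integralC (fun w =>
    conjc (stft phi (dist_of g) w) * conjf (tf_shift w phi) x).
  rewrite -hc// -integralCJ.
    by apply: eq_integralC => w; rewrite rmorphM.
  have [i0 _ _] := cintg_stft_tf x sg sphi.
  by apply: eq_cintg i0 => w; rewrite /unc hsubmxK.
have [i1 i2] := tempered_integral tu sphi sG (ccont_cmble (ccontJ cV)) hk GE.
split => //; rewrite -i2.
have := (tempered_sum [:: tt] (fun=> conjc c) tu (fun=> schwartz_conjf sg)).2.
rewrite big_seq1 /pairing => <-; congr u; apply/funext => x.
by rewrite big_seq1 rmorphM.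
Qed.

End Moyal.

(** * Weyl quantization *)

Section WeylKernel.
Context {R : realType}.
Notation C := R[i].
Notation nc := (@Normc.normc R).

Lemma cintgN n (f : 'rV[R]_n -> C) : cintg f -> cintg (fun x => - f x).
Proof. by move=> /(cintgZ (-1)); apply: eq_cintg => x; rewrite mulN1r. Qed.

Lemma schwartzZ n (c : C) (f : 'rV[R]_n -> C) : schwartz f -> schwartz (fun x => c * f x).
Proof.
move=> sf; have := (@tempered_sum R n _ unit [:: tt] (fun=> c) (fun=> f)
  (tempered_dist_of (@schwartz0 R n)) (fun=> sf)).1.
by congr schwartz; apply/funext => x; rewrite big_seq1.
Qed.

Lemma schwartz_coord n j (f : 'rV[R]_n -> C) : schwartz f ->
  schwartz (fun x => (x 0 j)%:C%C * f x).
Proof.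
move=> sf; apply: sfam1_schwartz.
have := @sfam_mul R unit n (fun=> 1) (fun=> lexx 1) (fun=> 1) (fun=> 1) 1
  (fun _ x => (x 0 j)%:C%C) (fun=> f)
  (fun=> ler01) (fun=> ler01) _ (schwartz_sfam sf).
have -> : (fun _ : unit => 1 * 1) = (fun=> 1 : R) by apply/funext => t; rewrite mulr1.
apply; apply: (@dbd_weaken R unit n (fun=> 1) (fun=> 1) (fun t x => om x) _ _ 1 0) => //.
  by move=> t x; rewrite expr0 !mul1r.
exact: dbd_coord.
Qed.

Lemma schwartz_partial n i (f : 'rV[R]_n -> C) : schwartz f -> schwartz (partial i f).
Proof. by move=> sf; apply: sfam1_schwartz => N; apply: dbd_partial; exact: schwartz_sfam. Qed.

(** One growth exponent serves all derivatives: the class is stable under differentiation and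
    sufficient for the convergence of the Weyl integral. The gain of order of a Shubin symbol is
    used only later, in the remainder of order [m - 1]. *)
Definition symb n (L : nat) (b : 'rV[R]_n -> C) : Prop :=
  dbd (fun _ : unit => 1) (fun _ w => om w ^+ L) (fun=> b).

Lemma symb_partial n L i (b : 'rV[R]_n -> C) : symb L b -> symb L (partial i b).
Proof. exact: dbd_partial. Qed.

Lemma symb_bound n L (b : 'rV[R]_n -> C) : symb L b ->
  exists2 K : R, 0 <= K & forall w, nc (b w) <= K * om w ^+ L.
Proof.
move=> /dbd_bdd [K0 [K [K00 h]]]; exists K0 => // w.
by have := h tt w; rewrite expr1n mulr1.
Qed.

Lemma symb_smooth n L (b : 'rV[R]_n -> C) : symb L b -> smooth b.
Proof. by move=> h; exact: h.1 tt. Qed.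

Lemma dbd_symb T n (oT Th : T -> R) L (b : T -> 'rV[R]_n -> C) t :
  1 <= oT t -> 0 <= Th t -> dbd oT (fun t w => Th t * om w ^+ L) b -> symb L (b t).
Proof.
move=> o1 Th0 [sb h]; split=> [_|s]; first exact: sb.
have [K0 [K [K00 hK]]] := h s; exists (K0 * oT t ^+ K * Th t), 0%N; split.
  by rewrite !mulr_ge0// exprn_ge0// (le_trans ler01).
by move=> _ w; rewrite expr0 mulr1 -mulrA; exact: hK.
Qed.

Variable d : nat.
Implicit Types (b : 'rV[R]_(d + d) -> C) (f : 'rV[R]_d -> C) (x xi s : 'rV[R]_d).

(* The integrand of the Weyl quantization at frequency [xi] and integration point [s].  Its
   integral [wq] in [s] decays rapidly in [xi], so that the iterated integral [wj]
   converges absolutely. *)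
Definition wint b f x xi s : C :=
  expi (dotv (x - s) xi) * b (row_mx (2^-1 *: (x + s)) xi) * f s.

Definition wq b f x xi : C := integralC (wint b f x xi).

Definition wj b f x : C := integralC (wq b f x).

Lemma row_mid_shift (i : 'I_d) (x s xi : 'rV[R]_d) (r : R) :
  row_mx (2^-1 *: (r *: unitv i + x + s)) xi =
  (r * 2^-1) *: unitv (lshift d i) + row_mx (2^-1 *: (x + s)) xi.
Proof.
apply/rowP => k; rewrite !mxE; case: splitP => l kl; rewrite ?mxE.
  have -> : (k == lshift d i) = (l == i) by rewrite -val_eqE /= kl.
  by rewrite !eqxx /=; ring.
have -> : (k == lshift d i) = false by rewrite -val_eqE /= kl gtn_eqF// ltn_addr.
by rewrite andbF mulr0 add0r.
Qed.

Lemma om_mid x xi s : om (row_mx (2^-1 *: (x + s)) xi) <= om x * om s * om xi.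
Proof.
rewrite (le_trans (om_row _ _))// ler_wpM2r ?om_ge0//.
rewrite (le_trans (om_scale _ _))// ?omD// ger0_norm ?invr_ge0//.
by rewrite invf_le1// ler1n.
Qed.

Lemma wint_bound L b f N : symb L b -> schwartz f -> exists2 K : R, 0 <= K &
  forall x xi s, nc (wint b f x xi s) <= K * (om x ^+ L * om xi ^+ L * om s ^- N).
Proof.
move=> sb sf; have [Kb Kb0 hb] := symb_bound sb.
have [Kf Kf0 hf] := schwartz_bound (L + N) sf.
exists (Kb * Kf) => [|x xi s]; first exact: mulr_ge0.
rewrite !ncM nc_expi mul1r.
apply: (@le_trans _ _ (Kb * (om x * om s * om xi) ^+ L * (Kf * om s ^- (L + N)))).
  apply: ler_pM (nc_ge0 _) (nc_ge0 _) _ (hf s).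
  apply: le_trans (hb _) _; apply: ler_wpM2l => //.
  by apply: lerXn2r; rewrite ?nnegrE ?mulr_ge0 ?om_ge0 ?om_mid.
rewrite !exprMn exprD invfM le_eqVlt; apply/orP; left; apply/eqP.
by field; rewrite !gt_eqF ?omX_gt0.
Qed.

Lemma ccont_wint b f L (x xi : 'rV[R]_d) : symb L b -> schwartz f -> ccont (wint b f x xi).
Proof.
move=> sb sf; apply: ccontM; last exact: smooth_ccont (schwartz_smooth sf).
apply: ccontM.
  apply: ccont_expi_dotv; last exact: lip_cst.
  by apply: lipD; [exact: lip_cst|apply: lipN; exact: lip_id].
apply: (ccont_lip (h := fun s => row_mx (2^-1 *: (x + s)) xi)).
  apply: lip_row_mx; last exact: lip_cst.
  by apply: lipZ; apply: lipD; [exact: lip_cst|exact: lip_id].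
exact: smooth_ccont (symb_smooth sb).
Qed.

Lemma cintg_wint b f L x xi : symb L b -> schwartz f -> cintg (wint b f x xi).
Proof.
move=> sb sf; have [K K0 hK] := wint_bound (2 * d) sb sf.
apply: (le_cintg (ccont_cmble (ccont_wint x xi sb sf)) (hK x xi)).
by apply: intgZ; apply: intgZ; exact: intg_omV.
Qed.

Lemma wqE b f x xi L : symb L b -> schwartz f -> wq b f x xi =
  expi (dotv x xi) * ft (fun s => b (row_mx (2^-1 *: (x + s)) xi) * f s) (- xi).
Proof.
move=> sb sf.
have e s : expi (dotv x xi) * (expi (dotv s (- xi)) *
    (b (row_mx (2^-1 *: (x + s)) xi) * f s)) = wint b f x xi s.
  by rewrite /wint dotvDl dotvNl dotvNr expiD !mulrA.
rewrite /ft -integralCZ; first by apply: eq_integralC => s; rewrite e.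
have := cintgZ (expi (- dotv x xi)) (cintg_wint x xi sb sf); apply: eq_cintg => s.
by rewrite -e mulrA -expiD addNr expi0 mul1r.
Qed.

(** Only derivatives in [s] are taken: [x] and [xi] belong to the parameter, and the growth of the
    symbol in [s] is absorbed by the decay of [f]. *)
Lemma wamp_dbd T (oT Th : T -> R) L (b : T -> 'rV[R]_(d + d) -> C) f M :
  (forall t, 1 <= oT t) -> (forall t, 0 <= Th t) ->
  dbd oT (fun t w => Th t * om w ^+ L) b -> schwartz f ->
  dbd (fun p : T * ('rV[R]_d * 'rV[R]_d) => oT p.1)
    (fun p s => Th p.1 * om p.2.1 ^+ L * om p.2.2 ^+ L * om s ^- M)
    (fun p s => b p.1 (row_mx (2^-1 *: (p.2.1 + s)) p.2.2) * f s).
Proof.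
move=> oT1 Th0 sb sf.
pose oG (p : T * ('rV[R]_d * 'rV[R]_d)) := oT p.1.
pose h (p : T * ('rV[R]_d * 'rV[R]_d)) (s : 'rV[R]_d) := row_mx (2^-1 *: (p.2.1 + s)) p.2.2.
have oG1 p : 1 <= oG p by exact: oT1.
have d1 : dbd oG (fun p s => Th p.1 * om (h p s) ^+ L) (fun p s => b p.1 (h p s)).
  have := @dbd_comp _ _ _ _ oG1 (d + d) h (fun=> 2^-1) (fun i => lshift d i)
    (fun p w => Th p.1 * om w ^+ L) (fun p => b p.1); apply.
  - by move=> p i s r; rewrite /h addrCA addrA row_mid_shift.
  - move=> p s s'; rewrite /h opp_row_mx add_row_mx subrr -scalerBr.
    rewrite norm_row_mx normr0 ge_max normr_ge0 andbT normrZ opprD addrACA subrr add0r.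
    by rewrite ler_piMl// ger0_norm ?invr_ge0// invf_le1// ler1n.
  - by move=> p; rewrite ger0_norm ?invr_ge0// invf_le1// ler1n.
  - by move=> p w; rewrite mulr_ge0 ?exprn_ge0 ?om_ge0.
  - exact: (dbd_reindex (fun p : T * ('rV[R]_d * 'rV[R]_d) => p.1) sb).
have d2 : dbd oG (fun p s => om s ^- (L + M)) (fun=> f).
  apply: (@dbd_weaken R _ d (fun=> 1) oG (fun t x => 1 * om x ^- (L + M)) _ _ 1 0) => //.
    by move=> t x; rewrite expr0 !mul1r.
  exact: schwartz_sfamT.
apply: (@dbd_weaken R _ d oG oG
  (fun p s => Th p.1 * om (h p s) ^+ L * om s ^- (L + M)) _ _ 1 0) => //.
  move=> [t [x xi]] s /=; rewrite expr0 !mul1r /h /=.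
  apply: (@le_trans _ _ (Th t * (om x * om s * om xi) ^+ L * om s ^- (L + M))).
    rewrite ler_wpM2r ?omV_ge0// ler_wpM2l//.
    by apply: lerXn2r; rewrite ?nnegrE ?mulr_ge0 ?om_ge0 ?om_mid.
  rewrite !exprMn exprD invfM le_eqVlt; apply/orP; left; apply/eqP.
  by field; rewrite !gt_eqF ?omX_gt0.
apply: dbdM => //.
  by move=> p s; rewrite mulr_ge0 ?exprn_ge0 ?om_ge0.
by move=> p s; exact: omV_ge0.
Qed.

(** Up to a phase, [wq] is a Fourier transform in [s] at the frequency [- xi]. It is estimated to
    the order [N + L] because the amplitude itself grows like [om xi ^+ L]. *)
Lemma wq_decay T (oT Th : T -> R) L (b : T -> 'rV[R]_(d + d) -> C) f :
  (forall t, 1 <= oT t) -> (forall t, 0 <= Th t) ->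
  dbd oT (fun t w => Th t * om w ^+ L) b -> schwartz f ->
  forall N, exists (K0 : R) (K : nat), 0 <= K0 /\ forall t x xi,
    nc (wq (b t) f x xi) <= K0 * oT t ^+ K * Th t * (om x ^+ L * om xi ^- N).
Proof.
move=> oT1 Th0 sb sf N.
have ThG0 (p : T * ('rV[R]_d * 'rV[R]_d)) : 0 <= Th p.1 * om p.2.1 ^+ L * om p.2.2 ^+ L.
  by rewrite !mulr_ge0 ?exprn_ge0 ?om_ge0.
have [K0 [K [K00 hK]]] := ft_decay (fun p => oT1 p.1) ThG0 (leqnn _)
  (wamp_dbd (2 * d) oT1 Th0 sb sf) (N + L).
exists K0, K; split => // t x xi.
rewrite (wqE x xi (dbd_symb (oT1 t) (Th0 t) sb) sf) ncM nc_expi mul1r.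
apply: le_trans (hK (t, (x, xi)) (- xi)) _.
rewrite /= omN exprD invfM le_eqVlt; apply/orP; left; apply/eqP.
by field; rewrite !gt_eqF ?omX_gt0.
Qed.

Lemma wq_decay1 L b f N : symb L b -> schwartz f -> exists2 K : R, 0 <= K &
  forall x xi, nc (wq b f x xi) <= K * (om x ^+ L * om xi ^- N).
Proof.
move=> sb sf.
have sb' : dbd (fun _ : unit => 1) (fun _ w => 1 * om w ^+ L) (fun=> b).
  by move: sb; congr dbd; apply/funext => t; apply/funext => w; rewrite mul1r.
have [K0 [K [K00 hK]]] := wq_decay (fun=> lexx 1) (fun=> ler01) sb' sf N.
by exists K0 => // x xi; have := hK tt x xi; rewrite expr1n !mulr1.
Qed.

Lemma wqZ b f L c x xi : symb L b -> schwartz f ->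
  wq b (fun s => c * f s) x xi = c * wq b f x xi.
Proof.
move=> sb sf; rewrite /wq -(integralCZ c (cintg_wint x xi sb sf)).
by apply: eq_integralC => s; rewrite /wint mulrCA.
Qed.

Lemma cid_mid_xi b L x xi s j : symb L b ->
  cid j (fun xi => b (row_mx (2^-1 *: (x + s)) xi)) xi
    (partial (rshift d j) b (row_mx (2^-1 *: (x + s)) xi)).
Proof.
move=> sb.
have := @cid_affine R d (d + d) j (rshift d j) (fun xi => row_mx (2^-1 *: (x + s)) xi) 1 b xi
  (partial (rshift d j) b (row_mx (2^-1 *: (x + s)) xi)).
rewrite mul1r; apply; last exact: smooth_cid (symb_smooth sb).
move=> y r; rewrite mulr1; apply/rowP => k; rewrite !mxE.
case: splitP => l kl; rewrite ?mxE.
  have -> : (k == rshift d j) = false.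
    by rewrite -val_eqE /= kl ltn_eqF// ltn_addr.
  by rewrite andbF mulr0 add0r.
by have -> : (k == rshift d j) = (l == j) by rewrite -val_eqE /= kl eqn_add2l.
Qed.

Lemma cid_mid_x b L x xi s i : symb L b ->
  cid i (fun x => b (row_mx (2^-1 *: (x + s)) xi)) x
    ((2^-1)%:C%C * partial (lshift d i) b (row_mx (2^-1 *: (x + s)) xi)).
Proof.
move=> sb; apply: (@cid_affine R d (d + d) i (lshift d i) (fun x => row_mx (2^-1 *: (x + s)) xi)).
  by move=> y r; exact: row_mid_shift.
exact: smooth_cid (symb_smooth sb).
Qed.

Lemma cid_mid_s b L x xi s i : symb L b ->
  cid i (fun s => b (row_mx (2^-1 *: (x + s)) xi)) s
    ((2^-1)%:C%C * partial (lshift d i) b (row_mx (2^-1 *: (x + s)) xi)).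
Proof.
move=> sb; apply: (@cid_affine R d (d + d) i (lshift d i) (fun s => row_mx (2^-1 *: (x + s)) xi)).
  by move=> y r; rewrite -row_mid_shift addrCA addrA.
exact: smooth_cid (symb_smooth sb).
Qed.

Lemma cid_phase_x x s xi i :
  cid i (fun x => expi (dotv (x - s) xi)) x (Complex 0 (xi 0 i) * expi (dotv (x - s) xi)).
Proof.
have := @cid_affine R d d i i (fun x => x - s) 1 (fun y => expi (dotv y xi)) x _ _ (cid_expi i xi (x - s)).
by rewrite mul1r; apply => y r; rewrite mulr1 addrA.
Qed.

Lemma cid_phase_s x s xi i :
  cid i (fun s => expi (dotv (x - s) xi)) s (- (Complex 0 (xi 0 i) * expi (dotv (x - s) xi))).
Proof.
have := @cid_affine R d d i i (fun s => x - s) (-1) (fun y => expi (dotv y xi)) s _ _ (cid_expi i xi (x - s)).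
rewrite (_ : (-1)%:C%C = -1 :> C) ?mulN1r; last by rewrite rmorphN rmorph1.
by apply => y r; rewrite mulrN1 scaleNr opprD addrCA.
Qed.

Lemma cid_phase_xi x s xi j :
  cid j (fun xi => expi (dotv (x - s) xi)) xi (Complex 0 ((x - s) 0 j) * expi (dotv (x - s) xi)).
Proof.
have := cid_expi j (x - s) xi; rewrite dotvC.
by under eq_fun do rewrite dotvC.
Qed.

Lemma complex_im0B (a c : R) : Complex 0 (a - c) = Complex 0 a - Complex 0 c :> C.
Proof. by apply: complexP; rewrite /= ?subr0. Qed.

(** The phase contributes [i (x_j - s_j)]: the part with [x_j] leaves the integral, the part with
    [s_j] changes [f], and the symbol contributes its own derivative. Integrated over [xi], this
    becomes [wj_coord]. *)
Lemma wq_cid_xi b f L x xi j : symb L b -> schwartz f ->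
  cid j (wq b f x) xi (Complex 0 (x 0 j) * wq b f x xi -
     wq b (fun s => Complex 0 (s 0 j) * f s) x xi + wq (partial (rshift d j) b) f x xi).
Proof.
move=> sb sf; pose b' := partial (rshift d j) b.
have sb' : symb L b' := symb_partial _ sb.
have sf' : schwartz (fun s => Complex 0 (s 0 j) * f s).
  have := schwartzZ (Complex 0 1) (schwartz_coord j sf); congr schwartz.
  by apply/funext => s; rewrite mulrA; congr (_ * _); simpc.
pose g xi s := Complex 0 (x 0 j) * wint b f x xi s -
  wint b (fun s => Complex 0 (s 0 j) * f s) x xi s + wint b' f x xi s.
have [K1 K10 h1] := wint_bound (2 * d) sb sf.
have [K2 K20 h2] := wint_bound (2 * d) sb sf'.
have [K3 K30 h3] := wint_bound (2 * d) sb' sf.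
have := @cid_integralC R d d (fun xi s => wint b f x xi s) g j xi
  (fun s => (om x * K1 + K2 + K3) * (om x ^+ L * (2 * om xi) ^+ L) * om s ^- (2 * d)).
move=> h; apply: (cid_eq (h _ _ _ _)) => {h}.
- move=> y s; apply: (cid_eq (cidM (cidM (cid_phase_xi x s y j) (cid_mid_xi x y s j sb)) (cid_cst _ (f s) _))).
  rewrite /g /wint -/b' !mxE complex_im0B; ring.
- by move=> y; exact: cintg_wint sb sf.
- by apply: intgZ; exact: intg_omV.
- move=> r s r1; set y := r *: unitv j + xi.
  apply: (@le_trans _ _ ((om x * K1 + K2 + K3) * (om x ^+ L * om y ^+ L * om s ^- (2 * d)))).
    rewrite [leRHS]mulrDl [X in X + _]mulrDl; apply: le_trans (ncD _ _) _.
    apply: lerD; last exact: h3.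
    apply: le_trans (ncB _ _) _; apply: lerD; last exact: h2.
    rewrite ncM nc_imag -[om x * K1 * _]mulrA; apply: ler_pM (h1 x y s) => //.
      exact: nc_ge0.
    exact: om_coord.
  rewrite -!mulrA ler_wpM2l ?addr_ge0 ?mulr_ge0 ?om_ge0// ler_wpM2l ?exprn_ge0 ?om_ge0//.
  rewrite ler_wpM2r ?omV_ge0//.
  by apply: lerXn2r; rewrite ?nnegrE ?mulr_ge0 ?om_ge0// om_unitv.
- have i1 := cintg_wint x xi sb sf; have i2 := cintg_wint x xi sb sf'.
  rewrite /g (integralCD (cintgD (cintgZ _ i1) (cintgN i2)) (cintg_wint x xi sb' sf)).
  by rewrite (integralCD (cintgZ _ i1) (cintgN i2)) (integralCZ _ i1) (integralCN i2).
Qed.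

Lemma imcoordE j f : (fun s => Complex 0 (s 0 j) * f s) =
  (fun s => Complex 0 1 * ((s 0 j)%:C%C * f s)).
Proof. by apply/funext => s; rewrite mulrA; congr (_ * _); simpc. Qed.

Lemma schwartz_imcoord j f : schwartz f -> schwartz (fun s => Complex 0 (s 0 j) * f s).
Proof. by move=> sf; rewrite imcoordE; apply: schwartzZ; exact: schwartz_coord. Qed.

(** Integration by parts in [s] trades the factor [i xi_i] for derivatives of the amplitude; the
    midpoint accounts for [2^-1]. *)
Lemma wq_byparts b f L x xi i : symb L b -> schwartz f ->
  Complex 0 (xi 0 i) * wq b f x xi =
  (2^-1)%:C%C * wq (partial (lshift d i) b) f x xi + wq b (partial i f) x xi.
Proof.
move=> sb sf; pose b' := partial (lshift d i) b.
have sb' : symb L b' := symb_partial _ sb.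
have sf' := schwartz_partial i sf.
have i1 := cintg_wint x xi sb sf; have i2 := cintg_wint x xi sb' sf.
have i3 := cintg_wint x xi sb sf'.
have [K1 K10 h1] := wint_bound (2 * d) sb sf.
have [K2 K20 h2] := wint_bound (2 * d) sb' sf.
have [K3 K30 h3] := wint_bound (2 * d) sb sf'.
pose g s := - Complex 0 (xi 0 i) * wint b f x xi s + (2^-1)%:C%C * wint b' f x xi s +
  wint b (partial i f) x xi s.
pose K := (K1 + nc (- Complex 0 (xi 0 i)) * K1 + nc (2^-1)%:C%C * K2 + K3) * (om x ^+ L * om xi ^+ L).
have w0 : 0 <= om x ^+ L * om xi ^+ L by rewrite mulr_ge0 ?exprn_ge0 ?om_ge0.
have dg s : cid i (wint b f x xi) s (g s).
  apply: (cid_eq (cidM (cidM (cid_phase_s x s xi i) (cid_mid_s x xi s i sb))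
    (smooth_cid i s (schwartz_smooth sf)))).
  rewrite /g /wint -/b'; ring.
have wK s : nc (wint b f x xi s) <= K * om s ^- (2 * d).
  apply: le_trans (h1 x xi s) _; rewrite mulrA ler_wpM2r ?omV_ge0// /K ler_wpM2r//.
  by rewrite -!addrA lerDl !addr_ge0 ?mulr_ge0 ?nc_ge0.
have gK s : nc (g s) <= K * om s ^- (2 * d).
  have := h1 x xi s; have := h2 x xi s; have := h3 x xi s.
  set w := om x ^+ L * om xi ^+ L * om s ^- (2 * d) => c3 c2 c1.
  have w1 : 0 <= w by rewrite mulr_ge0 ?omV_ge0.
  have := ler_wpM2l (nc_ge0 (- Complex 0 (xi 0 i))) c1; rewrite -ncM => d1.
  have := ler_wpM2l (nc_ge0 (2^-1)%:C%C) c2; rewrite -ncM => d2.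
  have := lerD (lerD d1 d2) c3.
  have -> : K * om s ^- (2 * d) = K1 * w + (nc (- Complex 0 (xi 0 i)) * (K1 * w) +
     nc (2^-1)%:C%C * (K2 * w) + K3 * w) by rewrite /K /w; ring.
  move=> dd; apply: le_trans (ncD _ _) _.
  apply: le_trans (lerD (ncD _ _) (lexx _)) _; apply: le_trans dd _.
  by rewrite ler_wpDl// mulr_ge0.
have [_] := integralC_partial0 (leqnn _) dg (ccont_cmble (ccont_wint x xi sb sf)) wK gK.
rewrite /g (integralCD (cintgD (cintgZ _ i1) (cintgZ _ i2)) i3).
rewrite (integralCD (cintgZ _ i1) (cintgZ _ i2)) (integralCZ _ i1) (integralCZ _ i2).
rewrite -addrA mulNr => /eqP; rewrite addrC subr_eq0 => /eqP h.
exact: esym h.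
Qed.

(** The phase contributes [i xi_i], which [wq_byparts] trades for derivatives. The two halves of the
    derivative of [b], one from the midpoint and one from the integration by parts, add up to the
    full derivative, so the result has the original form. *)
Lemma wq_cid_x b f L x xi i : symb L b -> schwartz f ->
  cid i (fun x => wq b f x xi) x
    (wq (partial (lshift d i) b) f x xi + wq b (partial i f) x xi).
Proof.
move=> sb sf; pose b' := partial (lshift d i) b.
have sb' : symb L b' := symb_partial _ sb.
have i1 y := cintg_wint y xi sb sf; have i2 := cintg_wint x xi sb' sf.
pose g x s := Complex 0 (xi 0 i) * wint b f x xi s + (2^-1)%:C%C * wint b' f x xi s.
have [K1 K10 h1] := wint_bound (2 * d) sb sf.
have [K2 K20 h2] := wint_bound (2 * d) sb' sf.
pose K := nc (Complex 0 (xi 0 i)) * K1 + nc (2^-1)%:C%C * K2.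
have K0 : 0 <= K by rewrite addr_ge0// mulr_ge0 ?nc_ge0.
have h := @cid_integralC R d d (fun x s => wint b f x xi s) g i x
  (fun s => K * ((2 * om x) ^+ L * om xi ^+ L) * om s ^- (2 * d)).
apply: (cid_eq (h _ i1 _ _)) => {h}.
- move=> y s; apply: (cid_eq (cidM (cidM (cid_phase_x y s xi i) (cid_mid_x y xi s i sb)) (cid_cst _ (f s) _))).
  rewrite /g /wint -/b'; ring.
- by apply: intgZ; exact: intg_omV.
- move=> r s r1; set y := r *: unitv i + x.
  apply: (@le_trans _ _ (K * (om y ^+ L * om xi ^+ L * om s ^- (2 * d)))).
    rewrite [leRHS]mulrDl; apply: le_trans (ncD _ _) _.
    by apply: lerD; rewrite ncM -mulrA; apply: ler_wpM2l; rewrite ?nc_ge0.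
  rewrite mulrA ler_wpM2r ?omV_ge0// ler_wpM2l// ler_wpM2r ?exprn_ge0 ?om_ge0//.
  by apply: lerXn2r; rewrite ?nnegrE ?mulr_ge0 ?om_ge0// om_unitv.
- rewrite /g (integralCD (cintgZ _ (i1 x)) (cintgZ _ i2)) (integralCZ _ (i1 x)) (integralCZ _ i2).
  rewrite -/(wq b f x xi) -/(wq b' f x xi) (wq_byparts x xi i sb sf) -/b' addrAC; congr (_ + _).
  rewrite -mulrDl -rmorphD (_ : 2^-1 + 2^-1 = 1) ?rmorph1 ?mul1r//.
  by field.
Qed.

Lemma ccont_wq b f L x : symb L b -> schwartz f -> ccont (wq b f x).
Proof.
move=> sb sf.
have sf' j := schwartz_imcoord j sf.
apply: (cid_ccont (g := fun j xi => Complex 0 (x 0 j) * wq b f x xi -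
     wq b (fun s => Complex 0 (s 0 j) * f s) x xi + wq (partial (rshift d j) b) f x xi)).
  by move=> j xi; exact: wq_cid_xi sb sf.
have [K1 K10 h1] := wq_decay1 0 sb sf.
have /choice[K2 h2] : forall j, exists K : R, 0 <= K /\ forall xi,
    nc (wq b (fun s => Complex 0 (s 0 j) * f s) x xi) <= K * om x ^+ L.
  move=> j; have [K K0 h] := wq_decay1 0 sb (sf' j); exists K; split => // xi.
  by have := h x xi; rewrite expr0 invr1 mulr1.
have /choice[K3 h3] : forall j, exists K : R, 0 <= K /\ forall xi,
    nc (wq (partial (rshift d j) b) f x xi) <= K * om x ^+ L.
  move=> j; have [K K0 h] := wq_decay1 0 (symb_partial (rshift d j) sb) sf; exists K; split => // xi.
  by have := h x xi; rewrite expr0 invr1 mulr1.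
have o0 : 0 <= om x ^+ L by rewrite exprn_ge0 ?om_ge0.
move=> xi; exists ((om x * K1 + \sum_j (K2 j + K3 j)) * om x ^+ L) => j w _.
rewrite mulrDl -addrA; apply: le_trans (ncD _ _) _; apply: lerD.
  rewrite ncM nc_imag -mulrA; apply: ler_pM => //; [exact: nc_ge0|exact: om_coord|].
  by have := h1 x (xi + w); rewrite expr0 invr1 mulr1.
rewrite addrC (bigD1 j)// [leRHS]mulrDl -[leLHS]addr0; apply: lerD; last first.
  by apply: mulr_ge0 => //; apply: sumr_ge0 => k _; rewrite addr_ge0//; [exact: (h2 k).1|exact: (h3 k).1].
apply: le_trans (ncB _ _) _; rewrite addrC mulrDl; apply: lerD; [exact: (h2 j).2|exact: (h3 j).2].
Qed.

Lemma cintg_wq b f L x : symb L b -> schwartz f -> cintg (wq b f x).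
Proof.
move=> sb sf; have [K K0 hK] := wq_decay1 (2 * d) sb sf.
apply: (le_cintg (ccont_cmble (ccont_wq x sb sf)) (hK x)).
by apply: intgZ; apply: intgZ; exact: intg_omV.
Qed.

(** Together with [wj_coord] this closes the functions [wj b f], up to finite sums, under
    derivatives and multiplication by coordinates. *)
Lemma wj_cid b f L x i : symb L b -> schwartz f ->
  cid i (wj b f) x (wj (partial (lshift d i) b) f x + wj b (partial i f) x).
Proof.
move=> sb sf.
have sb' := symb_partial (lshift d i) sb; have sf' := schwartz_partial i sf.
have [K1 K10 h1] := wq_decay1 (2 * d) sb' sf.
have [K2 K20 h2] := wq_decay1 (2 * d) sb sf'.
have h := @cid_integralC R d d (wq b f)
  (fun x xi => wq (partial (lshift d i) b) f x xi + wq b (partial i f) x xi) i x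
  (fun xi => (K1 + K2) * (2 * om x) ^+ L * om xi ^- (2 * d)).
apply: (cid_eq (h _ _ _ _)) => {h}.
- by move=> y xi; exact: wq_cid_x sb sf.
- by move=> y; exact: cintg_wq sb sf.
- by apply: intgZ; exact: intg_omV.
- move=> r xi r1; set y := r *: unitv i + x.
  apply: (@le_trans _ _ ((K1 + K2) * (om y ^+ L * om xi ^- (2 * d)))).
    by rewrite mulrDl; apply: le_trans (ncD _ _) _; apply: lerD; [exact: h1|exact: h2].
  rewrite -mulrA ler_wpM2l ?addr_ge0// ler_wpM2r ?omV_ge0//.
  by apply: lerXn2r; rewrite ?nnegrE ?mulr_ge0 ?om_ge0// om_unitv.
- exact: integralCD (cintg_wq x sb' sf) (cintg_wq x sb sf').
Qed.

Lemma wjZ b f L c x : symb L b -> schwartz f -> wj b (fun s => c * f s) x = c * wj b f x.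
Proof.
move=> sb sf; rewrite -(integralCZ c (cintg_wq x sb sf)).
by apply: eq_integralC => xi; exact: wqZ sb sf.
Qed.

Lemma imag_cancel (i x u v w : C) : i * i = -1 -> i * x * u - i * v + w = 0 ->
  x * u = v + i * w.
Proof.
move=> ii h.
have -> : x * u = v + i * w - i * (i * x * u - i * v + w) + (1 + i * i) * (x * u - v) by ring.
by rewrite h ii subrr mul0r mulr0 subr0 addr0.
Qed.

(* Integration by parts in [xi]. *)
Lemma wj_coord b f L x j : symb L b -> schwartz f ->
  (x 0 j)%:C%C * wj b f x = wj b (fun s => (s 0 j)%:C%C * f s) x +
     wj (partial (rshift d j) b) (fun s => Complex 0 1 * f s) x.
Proof.
move=> sb sf.
have sb' := symb_partial (rshift d j) sb; have sf' := schwartz_imcoord j sf.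
have i1 := cintg_wq x sb sf; have i2 := cintg_wq x sb sf'; have i3 := cintg_wq x sb' sf.
have [K1 K10 h1] := wq_decay1 (2 * d) sb sf.
have [K2 K20 h2] := wq_decay1 (2 * d) sb sf'.
have [K3 K30 h3] := wq_decay1 (2 * d) sb' sf.
pose K := (om x * K1 + (K2 + K3)) * om x ^+ L.
have o0 : 0 <= om x ^+ L by rewrite exprn_ge0 ?om_ge0.
have wK xi : nc (wq b f x xi) <= K * om xi ^- (2 * d).
  apply: le_trans (h1 x xi) _; rewrite mulrA ler_wpM2r ?omV_ge0// ler_wpM2r//.
  by rewrite ler_wpDr ?addr_ge0// ler_peMl// om_ge1.
have gK xi : nc (Complex 0 (x 0 j) * wq b f x xi -
     wq b (fun s => Complex 0 (s 0 j) * f s) x xi + wq (partial (rshift d j) b) f x xi) <=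
     K * om xi ^- (2 * d).
  rewrite /K -mulrA mulrDl -addrA; apply: le_trans (ncD _ _) _; apply: lerD.
    by rewrite ncM nc_imag -mulrA; apply: ler_pM (h1 x xi); rewrite ?nc_ge0// om_coord.
  apply: le_trans (ncD _ _) _; rewrite ncN mulrDl; apply: lerD; [exact: h2|exact: h3].
have [_] := integralC_partial0 (leqnn _) (fun xi => wq_cid_xi x xi j sb sf)
  (ccont_cmble (ccont_wq x sb sf)) wK gK.
rewrite (integralCD (cintgD (cintgZ _ i1) (cintgN i2)) i3).
rewrite (integralCD (cintgZ _ i1) (cintgN i2)) (integralCZ _ i1) (integralCN i2).
rewrite -/(wj b f x) -/(wj b (fun s => Complex 0 (s 0 j) * f s) x) -/(wj (partial (rshift d j) b) f x).
have -> : wj b (fun s => Complex 0 (s 0 j) * f s) x = Complex 0 1 * wj b (fun s => (s 0 j)%:C%C * f s) x.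
  by rewrite imcoordE (wjZ _ _ sb (schwartz_coord j sf)).
rewrite (wjZ _ _ sb' sf) (_ : Complex 0 (x 0 j) = Complex 0 1 * (x 0 j)%:C%C); last by simpc.
have ii : Complex 0 1 * Complex 0 1 = -1 :> C by simpc; apply: complexP.
set u := wj b f x; set v := wj b _ x; set w := wj _ f x => h.
exact: imag_cancel ii h.
Qed.

(* The direct estimate only gives growth of order [L] in [x]; multiplication by coordinates
   stays in the same class by [wj_coord] and yields the decay. *)
Lemma wj_sfam T (oT Th : T -> R) L (b : T -> 'rV[R]_(d + d) -> C) f :
  (forall t, 1 <= oT t) -> (forall t, 0 <= Th t) ->
  dbd oT (fun t w => Th t * om w ^+ L) b -> schwartz f ->
  sfam oT Th (fun t => wj (b t) f).
Proof.
move=> oT1 Th0 sb sf N.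
pose P (F : T -> 'rV[R]_d -> C) := exists (b : T -> 'rV[R]_(d + d) -> C) f,
  [/\ dbd oT (fun t w => Th t * om w ^+ L) b, schwartz f & F = fun t => wj (b t) f].
have sy (b' : T -> 'rV[R]_(d + d) -> C) t : dbd oT (fun t w => Th t * om w ^+ L) b' -> symb L (b' t) :=
  dbd_symb (oT1 t) (Th0 t).
have bw F : fspan P F -> bdd oT (fun t x => Th t * om x ^+ L) F.
  elim=> {F} [_ [b1 [f1 [sb1 sf1 ->]]]|F G _ h1 _ h2].
    have [K0 [K [K00 hK]]] := wq_decay oT1 Th0 sb1 sf1 (2 * d).
    pose I := rint (fun xi : 'rV[R]_d => om xi ^- (2 * d)).
    have I0 : 0 <= I by apply: rint_ge0 => xi; exact: omV_ge0.
    exists (2 * (K0 * I)), K; split; first by rewrite !mulr_ge0.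
    move=> t x.
    have -> : 2 * (K0 * I) * oT t ^+ K * (Th t * om x ^+ L) =
      2 * (K0 * oT t ^+ K * Th t * om x ^+ L * I) by ring.
    rewrite /I -rintZ; last exact: intg_omV.
    apply: nc_integralC; last by apply: intgZ; exact: intg_omV.
      exact: ccont_cmble (ccont_wq x (sy _ t sb1) sf1).
    by move=> xi; have := hK t x xi; rewrite -!mulrA.
  by apply: bddD => // t x; rewrite mulr_ge0// exprn_ge0// om_ge0.
have cl F j : fspan P F -> fspan P (fun t x => (x 0 j)%:C%C * F t x).
  elim=> {F} [_ [b1 [f1 [sb1 sf1 ->]]]|F G _ h1 _ h2].
    rewrite (_ : (fun t x => _) = fun t x => wj (b1 t) (fun s => (s 0 j)%:C%C * f1 s) x +
       wj (partial (rshift d j) (b1 t)) (fun s => Complex 0 1 * f1 s) x); last first.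
      by apply/funext => t; apply/funext => x; exact: wj_coord (sy _ t sb1) sf1.
    apply: fspan_add; apply: fspan_base.
      exists b1, (fun s => (s 0 j)%:C%C * f1 s).
      by split; [exact: sb1|exact: schwartz_coord|reflexivity].
    exists (fun t => partial (rshift d j) (b1 t)), (fun s => Complex 0 1 * f1 s).
    by split; [exact: dbd_partial|exact: schwartzZ|reflexivity].
  rewrite (_ : (fun t x => _) = fun t x => (x 0 j)%:C%C * F t x + (x 0 j)%:C%C * G t x).
    exact: fspan_add.
  by apply/funext => t; apply/funext => x; rewrite mulrDr.
have clX F j M : fspan P F -> fspan P (fun t x => (x 0 j)%:C%C ^+ M * F t x).
  move=> hF; elim: M => [|M IH].
    rewrite (_ : (fun t x => _) = F)//.
    by apply/funext => t; apply/funext => x; rewrite expr0 mul1r.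
  rewrite (_ : (fun t x => _) = fun t x => (x 0 j)%:C%C * ((x 0 j)%:C%C ^+ M * F t x)).
    exact: cl.
  by apply/funext => t; apply/funext => x; rewrite exprS mulrA.
have B F : fspan P F -> bdd oT (fun t x => Th t * om x ^- N) F.
  (* [L] of these powers compensate the growth in the direct estimate [bw]; the other [N] remain as
     decay. *)
  move=> hF; pose M := (L + N)%N.
  have [A [K [A0 hA]]] := bw _ hF.
  have /choice[A' hA'] : forall j, exists A : R, 0 <= A /\ exists K, forall t x,
      nc ((x 0 j)%:C%C ^+ M * F t x) <= A * oT t ^+ K * (Th t * om x ^+ L).
    by move=> j; have [A' [K' [A'0 h]]] := bw _ (clX F j M hF); exists A'; split => //; exists K'.
  have /choice[K' hK'] : forall j, exists K, forall t x,
      nc ((x 0 j)%:C%C ^+ M * F t x) <= A' j * oT t ^+ K * (Th t * om x ^+ L).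
    by move=> j; exact: (hA' j).2.
  pose KK := (K + \sum_j K' j)%N.
  have oo k t : (k <= KK)%N -> oT t ^+ k <= oT t ^+ KK by move=> kK; exact: ler_weXn2l.
  have W0 t (x : 'rV[R]_d) : 0 <= Th t * om x ^+ L by rewrite mulr_ge0// exprn_ge0// om_ge0.
  exists (2 ^+ M * (A + \sum_j A' j)), KK; split.
    by rewrite mulr_ge0 ?exprn_ge0// addr_ge0// sumr_ge0// => j _; exact: (hA' j).1.
  move=> t x.
  have : om x ^+ M * nc (F t x) <= 2 ^+ M * (A + \sum_j A' j) * oT t ^+ KK * (Th t * om x ^+ L).
    apply: le_trans (ler_wpM2r (nc_ge0 _) (omX_sum x M)) _.
    rewrite -!mulrA ler_wpM2l ?exprn_ge0// mulrDl mul1r mulr_suml mulrDl mulr_suml.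
    apply: lerD.
      apply: le_trans (hA t x) _; rewrite -mulrA ler_wpM2l// ler_wpM2r// oo// leq_addr//.
    apply: ler_sum => j _; have := hK' j t x; rewrite ncM ncX nc_real => /le_trans; apply.
    rewrite -mulrA ler_wpM2l ?(hA' j).1// ler_wpM2r// oo//.
    by rewrite /KK (bigD1 j)//= addnCA leq_addr.
  rewrite mulrC -ler_pdivlMr ?omX_gt0// => /le_trans; apply.
  have -> : om x ^+ M = om x ^+ L * om x ^+ N := exprD _ _ _.
  rewrite invfM le_eqVlt; apply/orP; left; apply/eqP.
  by field; rewrite !gt_eqF ?omX_gt0.
apply: (@fspan_smooth R T d P (bdd oT (fun t x => Th t * om x ^- N))).
- by move=> F G; apply: bddD => // t x; rewrite mulr_ge0// omV_ge0.
- move=> F PF; have hF := fspan_base PF; have := PF => -[b1 [f1 [sb1 sf1 FE]]].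
  have dF i : exists2 G, fspan P G & forall t x, cid i (F t) x (G t x).
    exists (fun t x => wj (partial (lshift d i) (b1 t)) f1 x + wj (b1 t) (partial i f1) x).
      apply: fspan_add; apply: fspan_base.
        exists (fun t => partial (lshift d i) (b1 t)), f1.
        by split; [exact: dbd_partial|exact: sf1|reflexivity].
      exists b1, (partial i f1).
      by split; [exact: sb1|exact: schwartz_partial|reflexivity].
    by move=> t x; rewrite FE; exact: wj_cid (sy _ t sb1) sf1.
  split => //; last exact: B.
  move=> t; have /choice[G hG] : forall i, exists G, fspan P G /\ forall t x, cid i (F t) x (G t x).
    by move=> i; have [G h1 h2] := dF i; exists G.
  have /choice[A hA] : forall i, exists A : R, 0 <= A /\ forall x, nc (G i t x) <= A.
    move=> i; have [A [K [A0 h]]] := B _ (hG i).1.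
    exists (A * oT t ^+ K * Th t); split; first by rewrite !mulr_ge0// exprn_ge0// (le_trans ler01).
    move=> x; apply: le_trans (h t x) _.
    by rewrite mulrA ler_piMr ?omV_le1// !mulr_ge0// exprn_ge0// (le_trans ler01).
  apply: (cid_ccont (g := fun i x => G i t x)) => [i x|x]; first exact: (hG i).2.
  exists (\sum_i A i) => i w _; rewrite (le_trans ((hA i).2 _))//.
  by rewrite (bigD1 i)//= lerDl; apply: sumr_ge0 => j _; exact: (hA j).1.
- by apply: fspan_base; exists b, f.
Qed.

End WeylKernel.

(** * The oscillatory integral, the constant symbol and covariance *)

Section WeylQuantization.
Context {R : realType}.
Notation C := R[i].
Notation nc := (@Normc.normc R).

(** Only the tails of the sequences matter, so their values may be taken at most 1. Dilations by
    such factors do not enlarge derivatives, which keeps the bounds for the cutoff uniform. *)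
Lemma cvg_right_seq (f : R -> R) (l : R) :
  (forall e : nat -> R, (forall k, 0 < e k) -> (forall k, e k <= 1) ->
     e k @[k --> \oo] --> 0 -> f (e k) @[k --> \oo] --> l) ->
  f e @[e --> 0^'+] --> l.
Proof.
move=> h; apply/cvg_at_rightP => u [u0 ucvg].
have h1 := h (fun k => Num.min (u k) 1).
have near1 : \forall k \near \oo, Num.min (u k) 1 = u k.
  have /cvgrPdist_lt /(_ 1 ltr01) := ucvg; apply: filterS => k.
  rewrite sub0r normrN => /(le_lt_trans (ler_norm _)) uk.
  by apply/min_idPl; exact: ltW.
have e0 : Num.min (u k) 1 @[k --> \oo] --> 0.
  apply: cvg_trans ucvg; apply: near_eq_cvg.
  by move: near1; apply: filterS => k ->.
have {}h1 := h1 (fun k => _) (fun k => _) e0.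
have : f (Num.min (u k) 1) @[k --> \oo] --> l.
  by apply: h1 => k; rewrite ?lt_min ?u0 ?ltr01 // ge_min lexx orbT.
move=> h2; apply: cvg_trans h2; apply: near_eq_cvg.
by move: near1; apply: filterS => k ->.
Qed.

Lemma schwartz_dbd0 T n (oT : T -> R) (f : 'rV[R]_n -> C) : (forall t, 1 <= oT t) ->
  schwartz f -> dbd oT (fun _ _ => 1) (fun=> f).
Proof.
move=> oT1 sf; apply: (@dbd_weaken R T n (fun=> 1) oT (fun t x => 1 * om x ^- 0) _ _ 1 0) => //.
  by move=> t x; rewrite !expr0 invr1 !mulr1.
exact: schwartz_sfamT.
Qed.

Variable d : nat.
Implicit Types (b : 'rV[R]_(d + d) -> C) (f : 'rV[R]_d -> C) (x xi s : 'rV[R]_d).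

(** * Removal of the cutoff from the oscillatory integral *)

Section Cutoff.
Variables (b : 'rV[R]_(d + d) -> C) (f : 'rV[R]_d -> C) (L : nat) (x : 'rV[R]_d).
Variables (chi : 'rV[R]_(d + d) -> C) (e : nat -> R).
Hypotheses (sb : symb L b) (sf : schwartz f) (schi : schwartz chi) (chi0 : chi 0 = 1).
Hypotheses (e0 : forall k, 0 < e k) (e1 : forall k, e k <= 1) (ecvg : e k @[k --> \oo] --> 0).

Let cut k xi s : C := chi (e k *: row_mx s xi) * wint b f x xi s.

Let ccut_unc k : ccont (unc (cut k)).
Proof.
apply: ccontM.
  apply: (ccont_lip (h := fun w : 'rV[R]_(d + d) => e k *: row_mx (rsubmx w) (lsubmx w))).
    by apply: lipZ; apply: lip_row_mx; [exact: lip_rsubmx|exact: lip_lsubmx].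
  exact: smooth_ccont (schwartz_smooth schi).
apply: ccontM; last first.
  by apply: ccont_lip; [exact: lip_rsubmx|exact: smooth_ccont (schwartz_smooth sf)].
apply: ccontM.
  apply: ccont_expi_dotv; last exact: lip_lsubmx.
  by apply: lipD; [exact: lip_cst|apply: lipN; exact: lip_rsubmx].
apply: (ccont_lip (h := fun w : 'rV[R]_(d + d) => row_mx (2^-1 *: (x + rsubmx w)) (lsubmx w))).
  apply: lip_row_mx; last exact: lip_lsubmx.
  by apply: lipZ; apply: lipD; [exact: lip_cst|exact: lip_rsubmx].
exact: smooth_ccont (symb_smooth sb).
Qed.

Let ccut k xi : ccont (cut k xi).
Proof.
apply: ccontM; last exact: ccont_wint sb sf.
apply: (ccont_lip (h := fun s => e k *: row_mx s xi)).
  by apply: lipZ; apply: lip_row_mx; [exact: lip_id|exact: lip_cst].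
exact: smooth_ccont (schwartz_smooth schi).
Qed.

Let cut_bound xi : exists2 K : R, 0 <= K &
  forall k s, nc (cut k xi s) <= K * om s ^- (2 * d).
Proof.
have [K K0 hK] := wint_bound (2 * d) sb sf.
have [B B0 hB] := schwartz_bound 0 schi.
exists (B * (K * (om x ^+ L * om xi ^+ L))).
  by rewrite !mulr_ge0 ?exprn_ge0 ?om_ge0.
move=> j s; rewrite ncM -!mulrA; apply: ler_pM; rewrite ?nc_ge0//.
  by have := hB (e j *: row_mx s xi); rewrite expr0 invr1 mulr1.
by have := hK x xi s; rewrite -!mulrA.
Qed.

Let q k xi := integralC (cut k xi).

Let icut k xi : cintg (cut k xi).
Proof.
have [K K0 hK] := cut_bound xi.
apply: (le_cintg (ccont_cmble (ccut k xi)) (hK k)).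
by apply: intgZ; exact: intg_omV.
Qed.

Let qE k xi : q k xi = expi (dotv x xi) *
  ft (fun s => chi (e k *: row_mx s xi) * (b (row_mx (2^-1 *: (x + s)) xi) * f s)) (- xi).
Proof.
have ee s : expi (dotv x xi) * (expi (dotv s (- xi)) * (chi (e k *: row_mx s xi) *
    (b (row_mx (2^-1 *: (x + s)) xi) * f s))) = cut k xi s.
  rewrite /cut /wint dotvDl dotvNl dotvNr expiD; ring.
rewrite /ft -integralCZ; first by apply: eq_integralC => s; rewrite ee.
have := cintgZ (expi (- dotv x xi)) (icut k xi); apply: eq_cintg => s.
by rewrite -ee mulrA -expiD addNr expi0 mul1r.
Qed.

(** The bound is uniform in [k]: since [e k <= 1], the factor [chi (e k *: _)] and its derivatives
    in [s] are bounded independently of [k], and the decay in [xi] is obtained as in [wq_decay]. *)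
Let q_bound : exists2 K : R, 0 <= K & forall k xi, nc (q k xi) <= K * om xi ^- (2 * d).
Proof.
have sb' : dbd (fun _ : unit => 1) (fun _ w => 1 * om w ^+ L) (fun=> b).
  by move: sb; congr dbd; apply/funext => t; apply/funext => w; rewrite mul1r.
have d1 := dbd_reindex (fun p : nat * 'rV[R]_d => (tt, (x, p.2)))
  (wamp_dbd (2 * d) (fun=> lexx 1) (fun=> ler01) sb' sf).
have d2 : dbd (fun _ : nat * 'rV[R]_d => 1) (fun _ _ => 1)
    (fun p s => chi (e p.1 *: row_mx s p.2)).
  have := @dbd_comp _ (nat * 'rV[R]_d) _ _ (fun=> lexx 1) (d + d)
    (fun p s => e p.1 *: row_mx s p.2) (fun p => e p.1) (fun i => lshift d i)
    (fun _ _ => 1) (fun=> chi); apply.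
  - move=> p i s r; apply/rowP => k; rewrite !mxE; case: splitP => l kl; rewrite ?mxE.
      have -> : (k == lshift d i) = (l == i) by rewrite -val_eqE /= kl.
      by rewrite !eqxx /=; ring.
    have -> : (k == lshift d i) = false by rewrite -val_eqE /= kl gtn_eqF// ltn_addr.
    by rewrite andbF mulr0 add0r.
  - move=> p s s'; rewrite -scalerBr opp_row_mx add_row_mx subrr normrZ norm_row_mx normr0.
    rewrite (_ : Num.max `|s' - s| 0 = `|s' - s|); last by apply/max_idPl.
    by rewrite ler_piMl// ger0_norm ?e1// ltW.
  - by move=> p; rewrite ger0_norm ?e1// ltW.
  - by [].
  - exact: schwartz_dbd0.
have dG := dbdM (fun=> lexx 1) (fun _ _ => ler01) _ d2 d1.
have {}dG : dbd (fun _ : nat * 'rV[R]_d => 1)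
   (fun p s => (om x ^+ L * om p.2 ^+ L) * om s ^- (2 * d))
   (fun p s => chi (e p.1 *: row_mx s p.2) * (b (row_mx (2^-1 *: (x + s)) p.2) * f s)).
  have := dG (fun p s => mulr_ge0 (mulr_ge0 (mulr_ge0 ler01 (exprn_ge0 _ (om_ge0 _)))
     (exprn_ge0 _ (om_ge0 _))) (omV_ge0 _ _)).
  by congr dbd; apply/funext => p; apply/funext => s /=; rewrite !mul1r.
have Th0 (p : nat * 'rV[R]_d) : 0 <= om x ^+ L * om p.2 ^+ L.
  by rewrite mulr_ge0 ?exprn_ge0 ?om_ge0.
have [K0 [K [K00 hK]]] := ft_decay (fun=> lexx 1) Th0 (leqnn _) dG (2 * d + L).
exists (K0 * om x ^+ L); first by rewrite mulr_ge0 ?exprn_ge0 ?om_ge0.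
move=> k xi; rewrite qE ncM nc_expi mul1r.
apply: le_trans (hK (k, xi) (- xi)) _.
rewrite expr1n mulr1 /= omN exprD invfM le_eqVlt; apply/orP; left; apply/eqP.
by field; rewrite !gt_eqF ?omX_gt0.
Qed.

Let eto n (w : 'rV[R]_n) : `|e k *: w - 0| @[k --> \oo] --> 0.
Proof.
under eq_fun do rewrite subr0 normrZ gtr0_norm//.
have h : e k * `|w| @[k --> \oo] --> 0 * `|w| by apply: cvgM => //; exact: cvg_cst.
by rewrite mul0r in h.
Qed.

Let q_cvg xi : ccvg (fun k => q k xi) (wq b f x xi).
Proof.
have [K K0 hK] := cut_bound xi.
apply: (@integralC_dct R d (fun k => cut k xi) (wint b f x xi)
  (fun s => K * om s ^- (2 * d)) _ _ _ _).2 => //.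
- by move=> k; exact: ccont_cmble (ccut k xi).
- move=> s; have := ccvgM (ccont_ccvg (smooth_ccont (schwartz_smooth schi)) (eto (row_mx s xi)))
    (ccvg_cst (wint b f x xi s)).
  by rewrite chi0 mul1r.
- by apply: intgZ; exact: intg_omV.
Qed.

(** For fixed [k] the double integral converges absolutely: [chi] supplies the decay in [xi] and [f]
    the decay in [s]. *)
Let cut_int k : integralC (fun w : 'rV[R]_(d + d) => chi (e k *: w) * wint b f x (rsubmx w) (lsubmx w)) =
  integralC (q k).
Proof.
pose g (y xi : 'rV[R]_d) := cut k xi y.
have [K K0 hK] := wint_bound (2 * d) sb sf.
have [B B0 hB] := schwartz_bound (L + 2 * d) schi.
have [E E0 hE] := @om_scaleV R (d + d) (L + 2 * d) _ (e0 k).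
have ug : unc g = fun w : 'rV[R]_(d + d) => chi (e k *: w) * wint b f x (rsubmx w) (lsubmx w).
  by apply/funext => w; rewrite /unc /g /cut hsubmxK.
have mg : cmble (unc g).
  rewrite ug; apply: ccont_cmble; apply: ccontM.
    apply: (ccont_lip (h := fun w => e k *: w)); first by apply: lipZ; exact: lip_id.
    exact: smooth_ccont (schwartz_smooth schi).
  apply: ccontM; last first.
    by apply: ccont_lip; [exact: lip_lsubmx|exact: smooth_ccont (schwartz_smooth sf)].
  apply: ccontM.
    apply: ccont_expi_dotv; last exact: lip_rsubmx.
    by apply: lipD; [exact: lip_cst|apply: lipN; exact: lip_lsubmx].
  apply: (ccont_lip (h := fun w : 'rV[R]_(d + d) => row_mx (2^-1 *: (x + lsubmx w)) (rsubmx w))).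
    apply: lip_row_mx; last exact: lip_rsubmx.
    by apply: lipZ; apply: lipD; [exact: lip_cst|exact: lip_lsubmx].
  exact: smooth_ccont (symb_smooth sb).
have [g0 g1 g2] : [/\ cintg (unc g), forall y, cintg (g y) & forall xi, cintg (g^~ xi)].
  apply: (@cintg_unc_bound R d d g (B * E * (K * om x ^+ L)) (2 * d) (2 * d) (leqnn _) (leqnn _) mg).
  move=> y xi; rewrite /g /cut ncM.
  have b1 : nc (chi (e k *: row_mx y xi)) <= B * (E * om xi ^- (L + 2 * d)).
    apply: le_trans (hB _) _; apply: ler_wpM2l => //; apply: le_trans (hE _) _.
    apply: ler_wpM2l => //; rewrite lef_pV2 ?posrE ?omX_gt0//.
    by apply: lerXn2r; rewrite ?nnegrE ?om_ge0// om_row_r.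
  have := ler_pM (nc_ge0 _) (nc_ge0 _) b1 (hK x xi y) => /le_trans; apply.
  rewrite exprD invfM le_eqVlt; apply/orP; left; apply/eqP.
  by field; rewrite !gt_eqF ?omX_gt0.
have [_ Fub] := integralC_fubini g0 g1 g2.
by rewrite -ug Fub.
Qed.

(** Dominated convergence is used twice: in [s] for fixed [xi], by [q_cvg], and then in [xi] with
    the majorant from [q_bound]. *)
Lemma cutoff_cvg :
  ccvg (fun k => integralC (fun w : 'rV[R]_(d + d) =>
     chi (e k *: w) * wint b f x (rsubmx w) (lsubmx w))) (wj b f x).
Proof.
have [K K0 hK] := q_bound.
have -> : (fun k => integralC (fun w : 'rV[R]_(d + d) =>
     chi (e k *: w) * wint b f x (rsubmx w) (lsubmx w))) = fun k => integralC (q k).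
  by apply/funext => k; exact: cut_int.
apply: (@integralC_dct R d q (wq b f x) (fun xi => K * om xi ^- (2 * d)) _ _ _ _).2 => //.
- by move=> k; exact: cmble_integralC (ccont_cmble (ccut_unc k)).
- by apply: intgZ; exact: intg_omV.
Qed.

End Cutoff.

Lemma osc_integral_wj b f L x : symb L b -> schwartz f ->
  osc_integral (fun w : 'rV[R]_(d + d) => wint b f x (rsubmx w) (lsubmx w)) = wj b f x.
Proof.
move=> sb sf; set F := fun w : 'rV[R]_(d + d) => _.
have lim chi : schwartz chi -> chi 0 = 1 ->
    complex.Re (integralC (fun w => chi (eps *: w) * F w)) @[eps --> 0^'+] --> complex.Re (wj b f x) /\
    complex.Im (integralC (fun w => chi (eps *: w) * F w)) @[eps --> 0^'+] --> complex.Im (wj b f x).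
  move=> schi chi0; split.
    apply: (@cvg_right_seq (fun eps => complex.Re (integralC (fun w => chi (eps *: w) * F w)))).
    by move=> e e0 e1 ecvg; exact: (cutoff_cvg x sb sf schi chi0 e0 e1 ecvg).1.
  apply: (@cvg_right_seq (fun eps => complex.Im (integralC (fun w => chi (eps *: w) * F w)))).
  by move=> e e0 e1 ecvg; exact: (cutoff_cvg x sb sf schi chi0 e0 e1 ecvg).2.
apply: xget_unique => [chi schi chi0 I|l hl]; first exact: lim.
(* Uniqueness of the limit is tested on one admissible cutoff; the condition defining [osc_integral]
   would be vacuous if there were none. *)
pose chi (w : 'rV[R]_(d + d)) : C := (gauss 1 w)%:C%C.
have schi : schwartz chi by apply: schwartz_gauss.
have chi0 : chi 0 = 1.
  by rewrite /chi /gauss (_ : dotv 0 0 = 0) ?mulr0 ?oppr0 ?expR0// /dotv big1// => i _; rewrite mxE mulr0.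
have [l1 l2] := lim chi schi chi0; have [h1 h2] := hl chi schi chi0.
apply: complexP.
  exact: (cvg_unique (F := complex.Re (integralC (fun w => chi (eps *: w) * F w)) @[eps --> 0^'+]) _ h1 l1).
exact: (cvg_unique (F := complex.Im (integralC (fun w => chi (eps *: w) * F w)) @[eps --> 0^'+]) _ h2 l2).
Qed.

Lemma weyl_schwartzE b f L x : symb L b -> schwartz f ->
  weyl_schwartz b f x = @two_pi_pow R d * wj b f x.
Proof. by move=> sb sf; rewrite -(osc_integral_wj x sb sf). Qed.

(** For the symbol 1 the integral over [xi] is Fourier inversion at 0 of the translate
    [s |-> f (s + x)]. *)
Lemma wj_one : exists2 c : C, c <> 0 &
  forall f x, schwartz f -> wj (fun=> 1) f x = c * f x.
Proof.
have [c [c0 hc]] := @fourier_inversion R d; exists c => // f x sf.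
have s1 : symb 0 (fun _ : 'rV[R]_(d + d) => 1 : C).
  apply: (@dbd_cst R unit _ (fun=> 1) (fun=> lexx 1)) => [|t w]; last by rewrite expr0.
  by exists 1, 0%N; split => // t w; rewrite nc1 !expr0 !mulr1.
have sfx : schwartz (fun s => f (s + x)).
  by have := schwartz_shift (- x) sf; congr schwartz; apply/funext => s; rewrite opprK.
have [_ h] := hc _ sfx; rewrite add0r in h; rewrite -h.
apply: eq_integralC => xi; rewrite (wqE x xi s1 sf) (ft_shift x (- xi) sf).
rewrite dotvNr opprK.
by have -> : (fun s => 1 * f s) = f by apply/funext => s; rewrite mul1r.
Qed.

Lemma wj_lin b1 b2 f L (a : C) x : symb L b1 -> symb L b2 -> schwartz f ->
  wj (fun w => b1 w + a * b2 w) f x = wj b1 f x + a * wj b2 f x.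
Proof.
move=> s1 s2 sf.
rewrite -(integralCZ a (cintg_wq x s2 sf)) -(integralCD (cintg_wq x s1 sf) (cintgZ a (cintg_wq x s2 sf))).
apply: eq_integralC => xi.
have i1 := cintg_wint x xi s1 sf; have i2 := cintg_wint x xi s2 sf.
rewrite -(integralCZ a i2) -(integralCD i1 (cintgZ a i2)).
apply: eq_integralC => s; rewrite /wint; ring.
Qed.

(** Substituting [xi + eta] and [s + y] moves the midpoint by [z]. The phase then splits into the
    modulation of the output, the phase for [x - y], and a factor cancelling the modulation of the
    input. *)
Lemma wj_tf b f L (z : 'rV[R]_(d + d)) x : symb L b -> symb L (fun w => b (w + z)) ->
  schwartz f -> wj b (tf_shift z f) x = tf_shift z (wj (fun w => b (w + z)) f) x.
Proof.
move=> sb sbz sf; set b' := fun w => b (w + z).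
have stf := tf_schwartz z sf.
pose y := lsubmx z; pose eta := rsubmx z.
have [_ i2] := integralC_shift eta (cintg_wq x sb stf).
apply: (etrans (esym i2)); rewrite /tf_shift -/y -/eta -(integralCZ _ (cintg_wq (x - y) sbz sf)).
apply: eq_integralC => xi.
have [_ i3] := integralC_shift y (cintg_wint x (xi + eta) sb stf).
apply: (etrans (esym i3)); rewrite -(integralCZ _ (cintg_wint (x - y) xi sbz sf)).
apply: eq_integralC => s; rewrite /wint /tf_shift -/y -/eta addrK.
have -> : row_mx (2^-1 *: (x + (s + y))) (xi + eta) = row_mx (2^-1 *: (x - y + s)) xi + z.
  rewrite -[z in RHS](hsubmxK z) add_row_mx -/y -/eta; congr row_mx.
  rewrite addrA; apply/rowP => i; rewrite !mxE; by field.
have -> : expi (dotv (x - (s + y)) (xi + eta)) = expi (dotv x eta) *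
    expi (dotv (x - y - s) xi) * expi (- dotv (s + y) eta).
  rewrite -!expiD; congr expi.
  rewrite !(dotvDl, dotvDr, dotvNl); ring.
have e1 : expi (- dotv (s + y) eta) * expi (dotv (s + y) eta) = 1 by rewrite -expiD addNr expi0.
rewrite -/(b' _).
set A := expi (dotv x eta); set B := expi (dotv (x - y - s) xi).
set P := expi (- _) in e1 *; set Q := expi (dotv (s + y) eta) in e1 *.
transitivity (A * (B * b' (row_mx (2^-1 *: (x - y + s)) xi) * f s) * (P * Q)); first by rewrite /b'; ring.
by rewrite e1 mulr1.
Qed.

(** Covariance of the transform holds up to a phase, which the modulus removes. *)
Lemma nc_stft_tf (g phi : 'rV[R]_d -> C) (z w : 'rV[R]_(d + d)) : schwartz g -> schwartz phi ->
  nc (stft phi (dist_of (tf_shift z g)) w) = nc (stft phi (dist_of g) (w - z)).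
Proof.
move=> sg sphi; pose y := lsubmx z; pose eta := rsubmx z.
pose G s := g s * conjc (phi (s - lsubmx (w - z))).
have sG : schwartz G := schwartzM sg (schwartz_conjf (schwartz_shift _ sphi)).
rewrite !stft_dist_of -/G.
have -> : ft (fun s => tf_shift z g s * conjc (phi (s - lsubmx w))) (- rsubmx w) =
    ft (fun s => G (s - y)) (- rsubmx (w - z)).
  have El : lsubmx (w - z) = lsubmx w - y by exact: linearB.
  have Er : rsubmx (w - z) = rsubmx w - eta by exact: linearB.
  apply: eq_integralC => s; rewrite /tf_shift -/y -/eta /G El Er.
  have -> : s - y - (lsubmx w - y) = s - lsubmx w by rewrite opprB addrA subrK.
  rewrite opprB dotvDr dotvNr expiD; ring.
by rewrite (ft_shift (- y) _ sG) ncM nc_expi mul1r.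
Qed.

End WeylQuantization.

(** * Shubin symbols and kernel estimates *)

Section Symbols.
Context {R : realType}.
Notation C := R[i].
Notation nc := (@Normc.normc R).

(** Comparability in both directions allows exponents of either sign: for a negative one the roles
    of [x] and [y] are exchanged. *)
Lemma powR_comparable (x y c r : R) : 0 < x -> 0 < y -> 0 < c ->
  x <= c * y -> y <= c * x -> x `^ r <= c `^ `|r| * y `^ r.
Proof.
move=> x0 y0 c0 xy yx.
have homo (u v p : R) : 0 <= p -> 0 < u -> 0 < v -> u <= c * v -> u `^ p <= c `^ p * v `^ p.
  move=> p0 u0 v0 uv; rewrite -(powRM _ (ltW c0) (ltW v0)).
  by apply: (ge0_ler_powR p0) => //; rewrite nnegrE ?mulr_ge0 ?ltW.
have [r0|r0] := leP 0 r; first by rewrite ger0_norm//; exact: homo.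
have nr : 0 <= - r by rewrite oppr_ge0 ltW.
have E (v : R) : v `^ r = (v `^ (- r))^-1 by rewrite powRN invrK.
rewrite ltr0_norm// (E x) (E y).
have h := homo _ _ _ nr y0 x0 yx.
by rewrite ler_pdivlMr ?powR_gt0// mulrC ler_pdivrMr ?powR_gt0.
Qed.

Lemma om_powR_shift n (z w : 'rV[R]_n) r : om (w + z) `^ r <= om w `^ `|r| * om z `^ r.
Proof.
apply: powR_comparable; rewrite ?om_gt0 ?omD//.
by have := omB z (w + z); rewrite opprD addrCA subrr addr0 omN.
Qed.

Lemma om_powR_le n (z : 'rV[R]_n) (r r' : R) : r <= r' -> om z `^ r <= om z `^ r'.
Proof. by move=> rr; apply: ler_powR => //; exact: om_ge1. Qed.

Lemma om_powR_nat n (z : 'rV[R]_n) (r : R) L : r <= L%:R -> om z `^ r <= om z ^+ L.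
Proof. by move=> rL; rewrite -powR_mulrn ?om_ge0//; exact: om_powR_le. Qed.

Lemma om_peetre n (z w : 'rV[R]_n) (r : R) L : `|r| <= L%:R ->
  om (w + z) `^ r <= om z `^ r * om w ^+ L.
Proof.
move=> rL; rewrite (le_trans (om_powR_shift _ _ _))// mulrC.
by rewrite ler_wpM2l ?powR_ge0// om_powR_nat.
Qed.

Lemma bracket_gt0 n (z : 'rV[R]_n) : 0 < bracket z.
Proof. by rewrite sqrtr_gt0 ltr_pwDl// sqr_ge0. Qed.

Lemma le_of_sqr (x y : R) : 0 <= y -> x ^+ 2 <= y ^+ 2 -> x <= y.
Proof.
move=> y0; have [x0|x0] := leP 0 x; first by rewrite ler_sqr ?nnegrE.
by move=> _; exact: le_trans (ltW x0) y0.
Qed.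

Lemma bracket_le n (z : 'rV[R]_n) : bracket z <= n.+1%:R * 2 * om z.
Proof.
apply: le_of_sqr; first by rewrite !mulr_ge0 ?om_ge0.
rewrite sqr_sqrtr ?addr_ge0 ?sqr_ge0// enorm_sqr !exprMn.
have h : dotv z z <= n%:R * om z ^+ 2.
  rewrite (_ : n%:R * _ = \sum_(i < n) om z ^+ 2); last by rewrite sumr_const card_ord mulr_natl.
  apply: ler_sum => i _; rewrite -expr2 -real_normK ?num_real//.
  by apply: lerXn2r; rewrite ?nnegrE ?om_ge0 ?om_coord.
apply: (@le_trans _ _ (n.+1%:R * om z ^+ 2)).
  by rewrite -natr1 addrC mulrDl mul1r lerD// omX_ge1.
rewrite ler_wpM2r ?exprn_ge0 ?om_ge0// expr2 -mulrA ler_peMr// ?ler0n// -natrX -natrM ler1n.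
by rewrite muln_gt0.
Qed.

Lemma om_le_bracket n (z : 'rV[R]_n) : om z <= n.+1%:R * 2 * bracket z.
Proof.
apply: (@le_trans _ _ (2 * bracket z)); last first.
  by apply: ler_wpM2r; [exact: ltW (bracket_gt0 z)|rewrite ler_peMl// ler1n].
apply: le_of_sqr; first by rewrite mulr_ge0// ltW// bracket_gt0.
rewrite exprMn sqr_sqrtr ?addr_ge0 ?sqr_ge0// enorm_sqr /om.
have := norm_sqr_le z; have := sqr_ge0 (1 - `|z|); nra.
Qed.

Lemma bracket_powR_le n (r : R) : exists2 K : R, 0 < K &
  forall z : 'rV[R]_n, bracket z `^ r <= K * om z `^ r /\ om z `^ r <= K * bracket z `^ r.
Proof.
have c0 : 0 < n.+1%:R * 2 :> R by rewrite mulr_gt0 ?ltr0n.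
exists ((n.+1%:R * 2) `^ `|r|) => [|z]; first exact: powR_gt0.
by split; apply: powR_comparable; rewrite ?bracket_gt0 ?om_gt0 ?bracket_le ?om_le_bracket.
Qed.

Lemma shubin_partials d (m : R) (a : 'rV[R]_(d + d) -> C) s : shubin m a ->
  exists2 K : R, 0 <= K & forall z, nc (partials s a z) <= K * om z `^ (m - (size s)%:R).
Proof.
move=> [sa ha]; have [K1 K10 h1] := ha (fun i => count_mem i s).
have [K2 K20 h2] := @bracket_powR_le (d + d) (m - (size s)%:R).
exists (K1 * K2); first by rewrite mulr_ge0 ?ltW.
move=> z; rewrite partials_mpartial//; apply: le_trans (h1 z) _.
by rewrite mlen_count -mulrA ler_wpM2l ?(ltW K10)//; exact: (h2 z).1.
Qed.

(** One order for all derivatives. A Shubin symbol of order [m] has order [m] in this sense and its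
    first derivatives have order [m - 1]; this single gain drives the bootstrap. *)
Definition om_sym n (r : R) (b : 'rV[R]_n -> C) : Prop := smooth b /\
  forall s, exists2 K : R, 0 <= K & forall z, nc (partials s b z) <= K * om z `^ r.

Lemma om_sym_partial n r i (b : 'rV[R]_n -> C) : om_sym r b -> om_sym r (partial i b).
Proof.
move=> [sb h]; split => [|s]; first exact: smooth_partial.
by rewrite -partials_rcons; exact: h.
Qed.

Lemma shubin_om_sym d (m : R) (a : 'rV[R]_(d + d) -> C) : shubin m a -> om_sym m a.
Proof.
move=> ha; split => [|s]; first exact: ha.1.
have [K K0 hK] := shubin_partials s ha; exists K => // z; apply: le_trans (hK z) _.
by rewrite ler_wpM2l// om_powR_le// lerBlDr lerDl ler0n.
Qed.

Lemma shubin_om_sym_partial d (m : R) (a : 'rV[R]_(d + d) -> C) i : shubin m a ->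
  om_sym (m - 1) (partial i a).
Proof.
move=> ha; split => [|s]; first exact: smooth_partial ha.1.
rewrite -partials_rcons.
have [K K0 hK] := shubin_partials (rcons s i) ha; exists K => // z; apply: le_trans (hK z) _.
by rewrite ler_wpM2l// om_powR_le// lerD2l lerN2 size_rcons ler1n.
Qed.

Lemma cid_shift n (b : 'rV[R]_n -> C) (z w : 'rV[R]_n) i : smooth b ->
  cid i (fun w => b (w + z)) w (partial i b (w + z)).
Proof.
move=> sb; have := @cid_affine R n n i i (fun w => w + z) 1 b w _ _ (smooth_cid i (w + z) sb).
by rewrite mul1r; apply => y r; rewrite mulr1 addrA.
Qed.

Lemma bdd_shift n (r : R) L (b : 'rV[R]_n -> C) : `|r| <= L%:R -> om_sym r b ->
  bdd (fun=> 1) (fun z w => om z `^ r * om w ^+ L) (fun z w => b (w + z)).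
Proof.
move=> rL [sb h]; have [K K0 hK] := h [::]; exists K, 0%N; split => // z w.
rewrite expr0 mulr1; apply: le_trans (hK _) _.
by rewrite ler_wpM2l// om_peetre.
Qed.

Lemma ccont_shift n (b : 'rV[R]_n -> C) z : smooth b -> ccont (fun w => b (w + z)).
Proof.
move=> sb; apply: (ccont_lip (h := fun w => w + z)); last exact: smooth_ccont.
by apply: lipD; [exact: lip_id|exact: lip_cst].
Qed.

Lemma om_sym_shift n (r : R) L (a : 'rV[R]_n -> C) : `|r| <= L%:R -> om_sym r a ->
  dbd (fun=> 1) (fun z w => om z `^ r * om w ^+ L) (fun z w => a (w + z)).
Proof.
move=> rL ha.
pose P (F : 'rV[R]_n -> 'rV[R]_n -> C) := exists2 b, om_sym r b & F = fun z w => b (w + z).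
apply: (@fspan_smooth R _ n P); last by apply: fspan_base; exists a.
  by move=> F G; apply: bddD => // z w; rewrite mulr_ge0 ?powR_ge0 ?exprn_ge0 ?om_ge0.
move=> _ [b hb ->]; split.
- by move=> z; exact: ccont_shift hb.1.
- exact: bdd_shift.
- move=> i; exists (fun z w => partial i b (w + z)).
    by apply: fspan_base; exists (partial i b) => //; exact: om_sym_partial.
  by move=> z w; exact: cid_shift hb.1.
Qed.

Lemma MVT_nc n (f : 'rV[R]_n -> C) (x v : 'rV[R]_n) (M : R) : smooth f ->
  (forall i w, `|w| <= `|v| -> nc (partial i f (x + w)) <= M) ->
  nc (f (x + v) - f x) <= 2 * (M * (n%:R * `|v|)).
Proof.
move=> sf hM.
have mvt (g : C -> R) : (forall z, `|g z| <= nc z) ->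
     (forall i z, is_derive z (unitv i) (fun z => g (f z)) (g (partial i f z))) ->
     `|g (f (x + v)) - g (f x)| <= M * (n%:R * `|v|).
  move=> gnc dg; apply: (MVT_norm (f := fun z => g (f z))) => [i z|i w hw].
    by case: (dg i z).
  by rewrite (@derive_val _ _ _ _ _ _ _ (dg i _)) (le_trans (gnc _))// hM.
have c1 := mvt (@complex.Re R) nc_Re (fun i z => (smooth_cid i z sf).1).
have c2 := mvt (@complex.Im R) nc_Im (fun i z => (smooth_cid i z sf).2).
apply: le_trans (nc_le _) _; rewrite ReD ReN ImD ImN mulr_natl mulr2n.
exact: lerD.
Qed.

(** Mean value inequality with first derivatives of order [m - 1]. Peetre's inequality moves the
    weight from the intermediate point to [z] at the cost of [om w ^+ L]; the last power comes from
    the factor [|w|]. *)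
Lemma shubin_sub d (m : R) L (a : 'rV[R]_(d + d) -> C) : shubin m a -> `|m - 1| <= L%:R ->
  exists2 K : R, 0 <= K & forall z w, nc (a (w + z) - a z) <= K * (om z `^ (m - 1) * om w ^+ L.+1).
Proof.
move=> ha mL.
have /choice[K hK] : forall i, exists K : R, 0 <= K /\ forall z,
    nc (partial i a z) <= K * om z `^ (m - 1).
  move=> i; have [K K0 h] := (shubin_om_sym_partial i ha).2 [::].
  by exists K.
have S0 : 0 <= \sum_i K i by apply: sumr_ge0 => i _; exact: (hK i).1.
exists (2 * ((\sum_i K i) * (d + d)%:R)); first by rewrite !mulr_ge0.
move=> z w; rewrite [w + z]addrC.
have bd i (v : 'rV[R]_(d + d)) : `|v| <= `|w| ->
    nc (partial i a (z + v)) <= (\sum_i K i) * (om z `^ (m - 1) * om w ^+ L).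
  move=> vw; apply: le_trans ((hK i).2 _) _.
  apply: (@le_trans _ _ ((\sum_i K i) * om (z + v) `^ (m - 1))).
    rewrite ler_wpM2r ?powR_ge0// (bigD1 i)// lerDl.
    by apply: sumr_ge0 => j _; exact: (hK j).1.
  rewrite ler_wpM2l// addrC; apply: le_trans (om_peetre z v mL) _.
  rewrite ler_wpM2l ?powR_ge0//.
  by apply: lerXn2r; rewrite ?nnegrE ?om_ge0// ler_om_homo.
apply: le_trans (MVT_nc ha.1 bd) _.
rewrite -!mulrA ler_wpM2l// ler_wpM2l// exprS.
have -> : (d + d)%:R * (om z `^ (m - 1) * (om w * om w ^+ L)) =
  om z `^ (m - 1) * (om w ^+ L * ((d + d)%:R * om w)) by ring.
by rewrite ler_wpM2l ?powR_ge0// ler_wpM2l ?exprn_ge0 ?om_ge0// ler_wpM2l// /om lerDr.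
Qed.

(** Differentiation in [w] removes the constant [a z] and leaves a shifted symbol of order [m - 1],
    so the mean value inequality concerns the undifferentiated difference alone. *)
Lemma shubin_shift_sub d (m : R) L (a : 'rV[R]_(d + d) -> C) : shubin m a -> `|m - 1| <= L%:R ->
  dbd (fun=> 1) (fun z w => om z `^ (m - 1) * om w ^+ L.+1) (fun z w => a (w + z) - a z).
Proof.
move=> ha mL.
have mL1 : `|m - 1| <= L.+1%:R by rewrite (le_trans mL)// ler_nat.
pose P (F : 'rV[R]_(d + d) -> 'rV[R]_(d + d) -> C) :=
  (exists2 b, om_sym (m - 1) b & F = fun z w => b (w + z)) \/ F = fun z w => a (w + z) - a z.
apply: (@fspan_smooth R _ (d + d) P); last by apply: fspan_base; right.
  by move=> F G; apply: bddD => // z w; rewrite mulr_ge0 ?powR_ge0 ?exprn_ge0 ?om_ge0.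
move=> _ [[b hb ->]|->].
- split.
  + by move=> z; exact: ccont_shift hb.1.
  + exact: bdd_shift.
  + move=> i; exists (fun z w => partial i b (w + z)).
      by apply: fspan_base; left; exists (partial i b) => //; exact: om_sym_partial.
    by move=> z w; exact: cid_shift hb.1.
- split.
  + by move=> z; apply: ccontD; [exact: ccont_shift ha.1|exact: ccont_cst].
  + have [K K0 hK] := shubin_sub ha mL; exists K, 0%N; split => // z w.
    by rewrite expr0 mulr1.
  + move=> i; exists (fun z w => partial i a (w + z)).
      by apply: fspan_base; left; exists (partial i a) => //; exact: shubin_om_sym_partial.
    move=> z w; apply: (cid_eq (cidD (cid_shift z w i ha.1) (cid_cst i (- a z) w))).
    by rewrite addr0.
Qed.

End Symbols.

(** * Kernel estimates for the two operators *)

Section Estimates.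
Context {R : realType}.
Notation C := R[i].
Notation nc := (@Normc.normc R).

(* Convolution of [U] with a rapidly decreasing kernel. *)
Definition kr n (N : nat) (U : 'rV[R]_n -> R) (z : 'rV[R]_n) : R :=
  rint (fun w => om (w - z) ^- N * U w).

Lemma intg_kr n N k K (U : 'rV[R]_n -> R) (z : 'rV[R]_n) : mble U ->
  (forall w, 0 <= U w <= K * om w ^+ k) -> (2 * n + k <= N)%N ->
  intg (fun w => om (w - z) ^- N * U w).
Proof.
move=> mU hU kN.
have K0 : 0 <= K.
  have /andP[h1 h2] := hU 0; have := le_trans h1 h2.
  by rewrite pmulr_lge0// omX_gt0.
apply: (@le_intg R n _ (fun w => om z ^+ N * K * om w ^- (2 * n))).
- apply: measurable_funM => //.
  have := @affine_mble R n 1 (- z) _ (@mble_omV R n N).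
  by rewrite /mble; under eq_fun do rewrite scale1r.
- move=> w; have /andP[h1 h2] := hU w; rewrite ger0_norm; last by rewrite mulr_ge0 ?omV_ge0.
  apply: (@le_trans _ _ (om z ^+ N * om w ^- N * (K * om w ^+ k))).
    apply: ler_pM => //; first exact: omV_ge0.
    by have := omV_shift w (- z) N; rewrite omN.
  rewrite -!mulrA ler_wpM2l ?exprn_ge0 ?om_ge0// mulrCA ler_wpM2l//.
  apply: (@le_trans _ _ (om w ^- (2 * n + k) * om w ^+ k)).
    by rewrite ler_wpM2r ?exprn_ge0 ?om_ge0// omV_homo.
  by rewrite exprD invfM -mulrA mulVf ?mulr1// gt_eqF// omX_gt0.
- by apply: intgZ; exact: intg_omV.
Qed.

Lemma pairing_lin n (u : ('rV[R]_n -> C) -> C) (f g : 'rV[R]_n -> C) (c : C) :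
  tempered u -> schwartz f -> schwartz g ->
  pairing u (fun x => f x + c * g x) = pairing u f + conjc c * pairing u g.
Proof.
move=> tu sf sg; rewrite /pairing addrC -tu.1; try exact: schwartz_conjf.
by congr u; apply/funext => x; rewrite /conjf rmorphD rmorphM addrC.
Qed.

Lemma pairingZ n (u : ('rV[R]_n -> C) -> C) (g : 'rV[R]_n -> C) (c : C) :
  tempered u -> schwartz g -> pairing u (fun x => c * g x) = conjc c * pairing u g.
Proof.
move=> tu sg; have := pairing_lin c tu (@schwartz0 R n) sg.
have -> : pairing u (fun=> 0) = 0.
  rewrite -[RHS](tempered0 tu); congr u; apply/funext => x; exact: rmorph0.
by rewrite add0r => <-; congr pairing; apply/funext => x; rewrite add0r.
Qed.

(** Moyal's identity moves the pairing to phase space, where an integrable majorant of the integrand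
    bounds it. *)
Lemma pairing_bound d (phi : 'rV[R]_d -> C) : schwartz phi -> (exists x, phi x <> 0) ->
  exists2 A : R, 0 <= A & forall u g H, tempered u -> schwartz g -> intg H ->
    (forall w, nc (stft phi (dist_of g) w) * nc (stft phi u w) <= H w) ->
    nc (pairing u g) <= A * rint H.
Proof.
move=> sphi phi0; have [c c0 hc] := stft_moyal sphi phi0.
have nc0 : 0 < nc c by rewrite lt_neqAle nc_ge0 andbT eq_sym; apply/eqP => /nc_eq0.
exists ((nc c)^-1 * 2) => [|u g H tu sg iH hH]; first by rewrite mulr_ge0// invr_ge0 ltW.
have [i1 i2] := hc u g tu sg.
rewrite -mulrA mulrC ler_pdivlMr// mulrC -ncM -i2.
apply: nc_integralC iH; first exact: i1.1.
by move=> w; rewrite ncM nc_conj.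
Qed.

Variable d : nat.
Implicit Types (phi : 'rV[R]_d -> C) (u : ('rV[R]_d -> C) -> C) (a : 'rV[R]_(d + d) -> C).

Lemma two_pi_pow_neq0 : (@two_pi_pow R d) <> 0.
Proof.
move=> /(congr1 (@complex.Re R)) /= /eqP; rewrite gt_eqF// invr_gt0 exprn_gt0//.
by rewrite mulr_gt0// pi_gt0.
Qed.

Lemma nc_gt0 (c : C) : c <> 0 -> 0 < nc c.
Proof. by move=> c0; rewrite lt_neqAle nc_ge0 andbT eq_sym; apply/eqP => /nc_eq0. Qed.

(** The transform of [tf_shift z (g z)] is, in modulus, that of [g z] moved by [z]. The uniform
    decay of the latter bounds the pairing by a convolution of the transform of [u]. *)
Lemma pairing_tf_bound phi u (g : 'rV[R]_(d + d) -> 'rV[R]_d -> C) (Th : 'rV[R]_(d + d) -> R) :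
  schwartz phi -> (exists x, phi x <> 0) -> tempered u ->
  (forall z, 0 <= Th z) -> sfam (fun=> 1) Th g ->
  forall k Kv N, (forall w, nc (stft phi u w) <= Kv * om w ^+ k) -> (2 * (d + d) + k <= N)%N ->
  exists2 K : R, 0 <= K & forall z,
    nc (pairing u (tf_shift z (g z))) <= K * Th z * kr N (fun w => nc (stft phi u w)) z.
Proof.
move=> sphi phi0 tu Th0 sg k Kv N hv kN.
have [A A0 hA] := pairing_bound sphi phi0.
have [K [j [K0 hK]]] := stft_decay (fun=> lexx 1) Th0 sg sphi N.
have mV : mble (fun w => nc (stft phi u w)) := cmble_nc (ccont_cmble (ccont_stft tu sphi)).
have ik z := intg_kr (N := N) (k := k) (K := Kv) z mV
  (fun w => introT andP (conj (nc_ge0 _) (hv w))) kN.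
exists (A * K) => [|z]; first exact: mulr_ge0.
have sgz : schwartz (g z) := sfam_schwartz z sg.
rewrite -!mulrA; have -> : K * (Th z * kr N (fun w => nc (stft phi u w)) z) =
    rint (fun w => K * Th z * (om (w - z) ^- N * nc (stft phi u w))).
  by rewrite mulrA /kr (rintZ (K * Th z) (ik z)).
apply: (hA _ _ _ tu (tf_schwartz z sgz) (intgZ _ (ik z))) => w.
rewrite (nc_stft_tf z w sgz sphi) mulrA; apply: ler_wpM2r; first exact: nc_ge0.
by have := hK z (w - z); rewrite expr1n mulr1.
Qed.

Lemma weyl_est phi u (m : R) a : schwartz phi -> (exists x, phi x <> 0) -> tempered u ->
  shubin m a -> exists2 c : R, 0 < c &
  forall k Kv N, (forall w, nc (stft phi u w) <= Kv * om w ^+ k) -> (2 * (d + d) + k <= N)%N ->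
  exists2 K : R, 0 <= K & forall z,
    nc (stft phi (weyl a u) z) <= K * om z `^ m * kr N (fun w => nc (stft phi u w)) z /\
    c * nc (a z) * nc (stft phi u z) <= nc (stft phi (weyl a u) z) +
       K * om z `^ (m - 1) * kr N (fun w => nc (stft phi u w)) z.
Proof.
move=> sphi phi0 tu ha.
have [c1 c10 hc1] := @wj_one R d.
(* An integer exponent dominating both [|m|] and [|m - 1|], for Peetre's inequality. *)
pose L := (Num.truncn (`|m| + `|m - 1|)).+1.
have Lb : `|m| + `|m - 1| <= L%:R.
  by rewrite ltW// truncnS_gt.
have L1 : `|m| <= L.+1%:R.
  by rewrite (le_trans _ (_ : L%:R <= _)) ?ler_nat//; apply: le_trans Lb; rewrite lerDl.
have L2 : `|m - 1| <= L%:R by apply: le_trans Lb; rewrite lerDr.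
(* The conjugate symbol as seen from [z]; it is the sum of the constant [conj (a z)] and of [bd z],
   which has order [m - 1] in [z]. Conjugates appear because [weyl] acts through the formal
   adjoint. *)
pose b (z w : 'rV[R]_(d + d)) : C := conjc (a (w + z)).
pose bd (z w : 'rV[R]_(d + d)) : C := conjc (a (w + z) - a z).
have W0 (r : R) z (w : 'rV[R]_(d + d)) : 0 <= om (z : 'rV[R]_(d + d)) `^ r * om w ^+ L.+1.
  by rewrite mulr_ge0 ?powR_ge0 ?exprn_ge0 ?om_ge0.
have db : dbd (fun=> 1) (fun z w => om z `^ m * om w ^+ L.+1) b.
  by apply: dbdJ => //; exact: om_sym_shift L1 (shubin_om_sym ha).
have dbs : dbd (fun=> 1) (fun z w => om z `^ (m - 1) * om w ^+ L.+1) bd.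
  by apply: dbdJ => //; exact: shubin_shift_sub ha L2.
have sb z : symb L.+1 (b z) 
  := @dbd_symb R _ _ (fun=> 1) (fun z => om z `^ m) L.+1 b z (lexx 1) (powR_ge0 _ _) db.
have sbd z : symb L.+1 (bd z) 
  := @dbd_symb R _ _ (fun=> 1) (fun z => om z `^ (m - 1)) L.+1 bd z (lexx 1) (powR_ge0 _ _) dbs.
have s1 : symb L.+1 (fun _ : 'rV[R]_(d + d) => 1 : C).
  apply: (@dbd_cst R unit _ (fun=> 1) (fun=> lexx 1)) => [|t w]; last by rewrite exprn_ge0 ?om_ge0.
  by exists 1, 0%N; split => // t w; rewrite nc1 expr0 !mul1r omX_ge1.
have sa : symb L.+1 (conjf a).
  by have := sb 0; congr symb; apply/funext => w; rewrite /b addr0.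
pose G z := wj (b z) phi; pose D z := wj (bd z) phi.
have sG : sfam (fun=> 1) (fun z => om z `^ m) G.
  exact: wj_sfam (fun=> lexx 1) (fun z => powR_ge0 _ _) db sphi.
have sD : sfam (fun=> 1) (fun z => om z `^ (m - 1)) D.
  exact: wj_sfam (fun=> lexx 1) (fun z => powR_ge0 _ _) dbs sphi.
have sGz z : schwartz (G z) := sfam_schwartz z sG.
have sDz z : schwartz (D z) := sfam_schwartz z sD.
(* Duality and covariance: the transform of [weyl a u] at [z] is a pairing of [u] with a shifted
   member of the family [G], whose size is [om z ^ m]. *)
have WE z : stft phi (weyl a u) z = conjc (@two_pi_pow R d) * pairing u (tf_shift z (G z)).
  rewrite /stft {1}/pairing /weyl -(pairingZ _ tu (tf_schwartz z (sGz z))); congr pairing.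
  apply/funext => x.
  have -> : conjf (conjf (tf_shift z phi)) = tf_shift z phi.
    by apply/funext => y; rewrite /conjf conjcK.
  rewrite (weyl_schwartzE x sa (tf_schwartz z sphi)); congr (_ * _).
  exact: (wj_tf x sa (sb z) sphi).
have GE z x : G z x = D z x + (conjc (a z) * c1) * phi x.
  rewrite -mulrA -(hc1 phi x sphi) -(wj_lin _ x (sbd z) s1 sphi).
  have -> // : (fun w => bd z w + conjc (a z) * 1) = b z.
  by apply/funext => w; rewrite mulr1 /bd /b rmorphB subrK.
(* The constant part of the symbol reproduces [phi] up to the factor [c1], and hence the transform
   of [u] at [z]. *)
have WE2 z : stft phi (weyl a u) z = conjc (@two_pi_pow R d) * pairing u (tf_shift z (D z)) +
    conjc (@two_pi_pow R d) * (a z * conjc c1) * stft phi u z.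
  rewrite WE -mulrA -mulrDr; congr (_ * _).
  have -> : a z * conjc c1 = conjc (conjc (a z) * c1).
    by rewrite [RHS]rmorphM; congr (_ * _); exact: esym (conjcK _).
  rewrite -(pairing_lin _ tu (tf_schwartz z (sDz z)) (tf_schwartz z sphi)); congr pairing.
  by apply/funext => x; rewrite /tf_shift GE mulrDr mulrCA.
have p0 := nc_gt0 two_pi_pow_neq0.
exists (nc (@two_pi_pow R d) * nc c1); first exact: mulr_gt0 p0 (nc_gt0 c10).
move=> k Kv N hv kN.
have [K1 K10 h1] := pairing_tf_bound sphi phi0 tu (fun z => powR_ge0 _ _) sG hv kN.
have [K2 K20 h2] := pairing_tf_bound sphi phi0 tu (fun z => powR_ge0 _ _) sD hv kN.
have kr0 z : 0 <= kr N (fun w => nc (stft phi u w)) z.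
  by apply: rint_ge0 => w; rewrite mulr_ge0 ?omV_ge0 ?nc_ge0.
exists (nc (@two_pi_pow R d) * (K1 + K2)) => [|z]; first exact: mulr_ge0 (ltW p0) (addr_ge0 K10 K20).
split.
  rewrite WE ncM nc_conj -!mulrA; apply: ler_wpM2l; first exact: ltW.
  apply: le_trans (h1 z) _; rewrite -mulrA ler_wpM2r ?lerDl// mulr_ge0 ?powR_ge0//.
have := h2 z; rewrite WE2; set X := pairing u (tf_shift z (D z)); set v := stft phi u z => hX.
have -> : nc (@two_pi_pow R d) * nc c1 * nc (a z) * nc v =
    nc (conjc (@two_pi_pow R d) * X + conjc (@two_pi_pow R d) * (a z * conjc c1) * v - conjc (@two_pi_pow R d) * X).
  by rewrite addrAC subrr add0r !ncM !nc_conj; ring.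
apply: le_trans (ncB _ _) _; apply: lerD => //; rewrite ncM nc_conj -!mulrA.
apply: ler_wpM2l; first exact: ltW.
apply: le_trans hX _; rewrite -mulrA ler_wpM2r ?lerDr// mulr_ge0 ?powR_ge0//.
Qed.

Lemma psi0E : @psi0 R d =
  fun y => ((pi : R) `^ (- (d%:R / 4)))%:C%C * (gauss 2^-1 y)%:C%C.
Proof.
apply/funext => y; rewrite /psi0 rmorphM; congr (_ * (expR (- _))%:C%C).
by rewrite enorm_sqr mulrC.
Qed.

Lemma schwartz_psi0 : schwartz (@psi0 R d).
Proof. by rewrite psi0E; apply: schwartzZ; apply: schwartz_gauss; rewrite invr_gt0. Qed.

Lemma psi0_neq0 : exists x, @psi0 R d x <> 0.
Proof.
exists 0; rewrite /psi0 => /(congr1 (@complex.Re R)) /= /eqP.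
by rewrite gt_eqF// mulr_gt0 ?powR_gt0 ?pi_gt0 ?expR_gt0.
Qed.

(** The constant family [psi] in [pairing_tf_bound]. For [psi = phi] this is the reproducing
    estimate of the transform by itself. *)
Lemma stft_window_est phi psi u : schwartz phi -> (exists x, phi x <> 0) -> schwartz psi ->
  tempered u ->
  forall k Kv N, (forall w, nc (stft phi u w) <= Kv * om w ^+ k) -> (2 * (d + d) + k <= N)%N ->
  exists2 K : R, 0 <= K & forall z,
    nc (stft psi u z) <= K * kr N (fun w => nc (stft phi u w)) z.
Proof.
move=> sphi phi0 spsi tu k Kv N hv kN.
have sp : sfam (fun=> 1) (fun=> 1) (fun _ : 'rV[R]_(d + d) => psi) by exact: schwartz_sfamT.
have [K K0 hK] := pairing_tf_bound sphi phi0 tu (fun=> ler01) sp hv kN.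
by exists K => // z; have := hK z; rewrite mulr1.
Qed.

(** The operator is an integral over phase space from the start. Replacing [a w] by [a z] under it
    leaves [a z] times the integral in Moyal's identity, and the difference has order [m - 1] at
    [z]. The windows mix here: [phi] in the transforms at [z], [psi0] under the integral. *)
Lemma localization_est phi u (m : R) a : schwartz phi -> tempered u -> shubin m a ->
  exists2 c : R, 0 < c &
  forall k Kv N, (forall w, nc (stft psi0 u w) <= Kv * om w ^+ k) -> (2 * (d + d) + k <= N)%N ->
  exists2 K : R, 0 <= K & forall z,
    nc (stft phi (localization a u) z) <= K * om z `^ m * kr N (fun w => nc (stft psi0 u w)) z /\
    c * nc (a z) * nc (stft phi u z) <= nc (stft phi (localization a u) z) +
       K * om z `^ (m - 1) * kr N (fun w => nc (stft psi0 u w)) z.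
Proof.
move=> sphi tu ha.
have spsi := schwartz_psi0.
have [c0 c00 hc0] := stft_moyal spsi psi0_neq0.
have p0 := nc_gt0 two_pi_pow_neq0.
exists (nc (@two_pi_pow R d) * nc c0); first exact: mulr_gt0 p0 (nc_gt0 c00).
move=> k Kv N hv kN.
pose L := (Num.truncn (`|m| + `|m - 1|)).+1.
have Lb : `|m| + `|m - 1| <= L%:R by rewrite ltW// truncnS_gt.
have L1 : `|m| <= L.+1%:R.
  by rewrite (le_trans _ (_ : L%:R <= _)) ?ler_nat//; apply: le_trans Lb; rewrite lerDl.
have L2 : `|m - 1| <= L%:R by apply: le_trans Lb; rewrite lerDr.
have [Ka Ka0 hKa] := (shubin_om_sym ha).2 [::].
have [Kd Kd0 hKd] := shubin_sub ha L2.
(* The extra order [L.+1] absorbs the growth of [a w] and of [a w - a z] away from [z]. *)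
have [Ks Ks0 hKs] := stft_schwartz_decay (N + L.+1) sphi spsi.
pose V0 := stft psi0 u.
have cV0 : ccont V0 := ccont_stft tu spsi.
have mV0 : mble (fun w => nc (V0 w)) := cmble_nc (ccont_cmble cV0).
pose S z := stft psi0 (dist_of (tf_shift z phi)).
have cS z : ccont (S z) := ccont_stft (tempered_dist_of (tf_schwartz z sphi)) spsi.
have ca : ccont a := smooth_ccont ha.1.
have ik z := intg_kr (N := N) (k := k) (K := Kv) z mV0
  (fun w => introT andP (conj (nc_ge0 _) (hv w))) kN.
have bS z w : nc (S z w) * om (w - z) ^+ L.+1 <= Ks * om (w - z) ^- N.
  rewrite /S (nc_stft_tf z w sphi spsi).
  apply: le_trans (ler_wpM2r (exprn_ge0 _ (om_ge0 _)) (hKs _)) _.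
  rewrite exprD invfM -!mulrA mulVf ?mulr1// gt_eqF// omX_gt0 //.
have ba z w : nc (a w) <= Ka * om z `^ m * om (w - z) ^+ L.+1.
  apply: le_trans (hKa w) _; rewrite -mulrA ler_wpM2l//.
  by have := om_peetre z (w - z) L1; rewrite subrK.
have bs z w : nc (a w - a z) <= Kd * om z `^ (m - 1) * om (w - z) ^+ L.+1.
  by have := hKd z (w - z); rewrite subrK mulrA.
(* Applied to [F = a] for the size of the image and to [F w = a w - a z] for the error. *)
have gen z (F : 'rV[R]_(d + d) -> C) B : ccont F -> 0 <= B ->
    (forall w, nc (F w) <= B * om (w - z) ^+ L.+1) ->
    cintg (fun w => F w * V0 w * conjc (S z w)) /\
    nc (integralC (fun w => F w * V0 w * conjc (S z w))) <=
      2 * Ks * B * kr N (fun w => nc (V0 w)) z.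
  move=> cF B0 hF.
  have cc : ccont (fun w => F w * V0 w * conjc (S z w)).
    by apply: ccontM; [exact: ccontM|exact: ccontJ].
  have bb w : nc (F w * V0 w * conjc (S z w)) <= (Ks * B) * (om (w - z) ^- N * nc (V0 w)).
    rewrite !ncM nc_conj mulrAC [leRHS]mulrA; apply: ler_wpM2r; first exact: nc_ge0.
    apply: le_trans (ler_wpM2r (nc_ge0 _) (hF w)) _.
    rewrite [leLHS]mulrC -mulrA mulrCA [leRHS]mulrCA.
    by apply: ler_wpM2l => //; exact: bS.
  have iH := intgZ (Ks * B) (ik z).
  split; first exact: le_cintg (ccont_cmble cc) bb iH.
  apply: le_trans (nc_integralC (ccont_cmble cc) bb iH) _.
  by rewrite (rintZ _ (ik z)) !mulrA.
have B1 (z : 'rV[R]_(d + d)) : 0 <= Ka * om z `^ m by rewrite mulr_ge0 ?powR_ge0.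
have B2 (z : 'rV[R]_(d + d)) : 0 <= Kd * om z `^ (m - 1) by rewrite mulr_ge0 ?powR_ge0.
have WE z : stft phi (localization a u) z = (@two_pi_pow R d) * integralC (fun w => a w * V0 w * conjc (S z w)).
  rewrite /stft {1}/pairing /localization.
  have -> // : conjf (conjf (tf_shift z phi)) = tf_shift z phi.
  by apply/funext => y; rewrite /conjf conjcK.
have cas z : ccont (fun w => a w - a z) by apply: ccontD => //; exact: ccont_cst.
have kr0 z : 0 <= kr N (fun w => nc (V0 w)) z.
  by apply: rint_ge0 => w; rewrite mulr_ge0 ?omV_ge0 ?nc_ge0.
exists (nc (@two_pi_pow R d) * (2 * Ks * (Ka + Kd))).
  by rewrite !mulr_ge0 ?addr_ge0// ltW.
move=> z; have [i1 e1] := gen z a _ ca (B1 z) (ba z).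
have [i2 e2] := gen z _ _ (cas z) (B2 z) (bs z).
split.
  rewrite WE ncM -!mulrA; apply: ler_wpM2l; first exact: ltW.
  apply: le_trans e1 _; rewrite -!mulrA !ler_wpM2l// ler_wpM2r ?lerDl// mulr_ge0 ?powR_ge0//.
have [i3 e3] := hc0 u (tf_shift z phi) tu (tf_schwartz z sphi).
rewrite -/(S z) -/V0 in i3 e3.
have dE : integralC (fun w => (a w - a z) * V0 w * conjc (S z w)) =
    integralC (fun w => a w * V0 w * conjc (S z w)) - a z * (c0 * stft phi u z).
  rewrite -[c0 * _]e3 -(integralCZ (a z) i3) -(integralCN (cintgZ (a z) i3)).
  rewrite -(integralCD i1 (cintgN (cintgZ (a z) i3))).
  by apply: eq_integralC => w; ring.
rewrite dE in e2; rewrite WE; move: e2.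
set I := integralC _; set v := stft phi u z => e2.
have -> : nc (@two_pi_pow R d) * nc c0 * nc (a z) * nc v =
    nc ((@two_pi_pow R d) * I - (@two_pi_pow R d) * (I - a z * (c0 * v))).
  by rewrite -mulrBr opprB addrC subrK !ncM; ring.
apply: le_trans (ncB _ _) _; apply: lerD => //; rewrite ncM -!mulrA.
apply: ler_wpM2l; first exact: ltW.
apply: le_trans e2 _; rewrite -!mulrA !ler_wpM2l// ler_wpM2r ?lerDr// mulr_ge0 ?powR_ge0//.
Qed.

End Estimates.

(** * Regularity on cones and the bootstrap *)

Section Cones.
Context {R : realType}.

Lemma open_normP n (G : set 'rV[R]_n) : open G <->
  forall x, G x -> exists2 e : R, 0 < e & forall y, `|y - x| < e -> G y.
Proof.
split=> [oG x Gx|h].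
  have : nbhs x G by exact: open_nbhs_nbhs.
  move/(@nbhs_ballP R ('rV[R]_n : pseudoMetricType R) x) => [e e0 he]; exists e => // y yx.
  by apply: he; rewrite -ball_normE /= distrC.
rewrite openE => x Gx; apply/(@nbhs_ballP R ('rV[R]_n : pseudoMetricType R) x).
have [e e0 he] := h x Gx; exists e => // y.
by rewrite -ball_normE /= distrC; exact: he.
Qed.

Lemma open_coneI n (G H : set 'rV[R]_n) : open_cone G -> open_cone H -> open_cone (G `&` H).
Proof.
move=> [oG cG nG] [oH cH nH]; split; first exact: openI.
  by move=> t z t0 [Gz Hz]; split; [exact: cG|exact: cH].
by move=> z [/nG].
Qed.

(** [G'] is the cone over a ball around [z0] of half the radius available in [G]. If a scaling
    brings [z] into that ball, it keeps [w] outside the larger one, so the distance of [w] and [z]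
    is at least a fixed multiple of [|z|]. *)
Lemma cone_shrink n (G : set 'rV[R]_n) z0 : open_cone G -> G z0 ->
  exists (G' : set 'rV[R]_n) (K : R), [/\ open_cone G', G' z0, 1 <= K &
    forall z w, G' z -> ~ G w -> om z <= K * om (w - z)].
Proof.
move=> [oG cG nG] Gz0.
have [e0 e00 he0] := (open_normP G).1 oG z0 Gz0.
pose e := e0 / 2; have ee : 0 < e by rewrite divr_gt0.
have e2 : e + e = e0 by rewrite /e -splitr.
pose G' := [set z : 'rV[R]_n | exists2 t : R, 0 < t & `|t *: z - z0| < e].
exists G', (1 + (`|z0| + e) / e); split.
- split.
  + apply/open_normP => z [t t0 hz].
    exists ((e - `|t *: z - z0|) / t); first by rewrite divr_gt0// subr_gt0.
    move=> y; rewrite ltr_pdivlMr// => hy; exists t => //.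
    have -> : t *: y - z0 = t *: (y - z) + (t *: z - z0) by rewrite scalerBr addrA subrK.
    rewrite (le_lt_trans (ler_normD _ _))// normrZ gtr0_norm// mulrC.
    by rewrite -ltrBrDr.
  + move=> s z s0 [t t0 hz]; exists (t / s); first by rewrite divr_gt0.
    by rewrite scalerA -mulrA mulVf ?gt_eqF// mulr1.
  + move=> z [t t0 hz] /= zE; apply: (nG 0) => //.
    by apply: he0; rewrite -(scaler0 _ t) -zE (lt_trans hz)// -e2 ltrDl.
- by exists 1 => //; rewrite scale1r subrr normr0.
- by rewrite lerDl divr_ge0// ?addr_ge0// ltW.
- move=> z w [t t0 hz] nGw.
  have h1 : e0 <= `|t *: w - z0|.
    rewrite leNgt; apply/negP => /he0 h; apply: nGw.
    have := cG t^-1 _ _ h; rewrite scalerA mulVf ?gt_eqF// scale1r; apply.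
    by rewrite invr_gt0.
  have h2 : e <= t * `|w - z|.
    have : `|t *: w - z0| <= `|t *: (w - z)| + `|t *: z - z0|.
      by rewrite (_ : t *: w - z0 = t *: (w - z) + (t *: z - z0)) ?ler_normD// scalerBr addrA subrK.
    rewrite normrZ gtr0_norm// => h3.
    have := le_trans h1 h3; rewrite -e2 => h4.
    have := le_lt_trans h4 (_ : _ < t * `|w - z| + e); rewrite ltrD2l => /(_ hz).
    by rewrite ltrD2r => /ltW.
  have h5 : t * `|z| <= `|z0| + e.
    have := ler_normD (t *: z - z0) z0; rewrite subrK normrZ gtr0_norm// => /le_trans; apply.
    by rewrite addrC lerD2l ltW.
  rewrite /om mulrDl mul1r; set q := `|w - z| in h2 *; set p := `|z| in h5 *.
  have q0 : 0 <= q by exact: normr_ge0.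
  have -> : 1 + p <= 1 + q + (`|z0| + e) / e * (1 + q) = (p <= q + (`|z0| + e) / e * (1 + q)).
    by rewrite -addrA lerD2l.
  apply: (@le_trans _ _ ((`|z0| + e) / e * q)); last first.
    rewrite mulrDr mulr1 addrA ler_wpDl// addr_ge0// divr_ge0 ?addr_ge0// ltW//.
  rewrite mulrAC ler_pdivlMr// -(ler_pM2l t0) mulrA.
  apply: (@le_trans _ _ ((`|z0| + e) * e)); first by rewrite ler_wpM2r// ltW.
  by rewrite [leRHS]mulrCA ler_wpM2l// addr_ge0// ltW.
Qed.

(** Microlocal regularity of order [t] at [z0], the complement of the wave front condition, with
    [om] for [bracket] and an indicator in place of a domain of integration. *)
Definition reg n (F : 'rV[R]_n -> R) (t : R) (z0 : 'rV[R]_n) : Prop :=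
  exists G : set 'rV[R]_n, [/\ open_cone G, G z0 &
    (eint (fun z => (\1_G z * (om z `^ t * F z) ^+ 2)%:E) < +oo)%E].

Lemma indic_ge0 n (G : set 'rV[R]_n) z : 0 <= \1_G z :> R.
Proof. by rewrite indicE. Qed.

Lemma reg_le n (F F' : 'rV[R]_n -> R) t t' z0 : (forall z, 0 <= F z) ->
  (forall z, om z `^ t * F z <= om z `^ t' * F' z) -> reg F' t' z0 -> reg F t z0.
Proof.
move=> F0 FF' [G [oG Gz0 hG]]; exists G; split => //; apply: le_lt_trans hG.
apply: le_eint => z; rewrite lee_fin; first by rewrite mulr_ge0 ?indic_ge0 ?sqr_ge0.
have h0 : 0 <= om z `^ t * F z by rewrite mulr_ge0 ?powR_ge0.
rewrite ler_wpM2l ?indic_ge0//; apply: lerXn2r => //; rewrite ?nnegrE//.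
exact: le_trans (FF' z).
Qed.

Lemma mble_indic n (G : set 'rV[R]_n) : open G -> mble (\1_G : 'rV[R]_n -> R).
Proof.
move=> oG; have h := @measurable_indic _ _ R setT _ (open_mble oG).
rewrite /mble (_ : (fun t => _) = \1_(@row_of R n @^-1` G))//.
Qed.

Lemma mble_om_powR n (t : R) : mble (fun z : 'rV[R]_n => om z `^ t).
Proof. by apply: measurableT_comp (measurable_powR t) _; exact: mble_om. Qed.

Lemma mble_reg n (F : 'rV[R]_n -> R) (t : R) : mble F ->
  mble (fun z => (om z `^ t * F z) ^+ 2).
Proof.
move=> mF; apply: measurable_funX; apply: measurable_funM => //.
exact: mble_om_powR.
Qed.

Lemma regZ n (F : 'rV[R]_n -> R) t z0 (c : R) : mble F -> reg F t z0 ->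
  reg (fun z => c * F z) t z0.
Proof.
move=> mF [G [oG Gz0 hG]]; exists G; split => //.
have -> : (fun z => (\1_G z * (om z `^ t * (c * F z)) ^+ 2)%:E) =
    (fun z => (c ^+ 2)%:E * (\1_G z * (om z `^ t * F z) ^+ 2)%:E)%E.
  by apply/funext => z; rewrite -EFinM; congr _%:E; ring.
rewrite eintZl ?sqr_ge0//.
- case: oG => oG _ _.
  have h0 : (0 <= eint (fun z => (\1_G z * (om z `^ t * F z) ^+ 2)%:E))%E.
    by apply: eint_ge0 => z; rewrite lee_fin mulr_ge0 ?indic_ge0 ?sqr_ge0.
  by move: hG h0; case: (eint _) => // r _ _; rewrite -EFinM ltry.
- apply: mble_emble; apply: measurable_funM; last exact: mble_reg.
  by apply: mble_indic; case: oG.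
- by move=> z; rewrite lee_fin mulr_ge0 ?indic_ge0 ?sqr_ge0.
Qed.

(* [f] need not be measurable: the lemma is applied to the transform of [weyl a u], for
   which measurability is not established. *)
Lemma eint_le_add n (f g h : 'rV[R]_n -> R) : mble g -> mble h ->
  (forall x, 0 <= f x) -> (forall x, 0 <= g x) -> (forall x, h x <= f x + g x) ->
  (eint (fun x => (f x)%:E) < +oo)%E -> (eint (fun x => (g x)%:E) < +oo)%E ->
  (forall x, 0 <= h x) -> (eint (fun x => (h x)%:E) < +oo)%E.
Proof.
move=> mg mh f0 g0 hfg ff gf h0.
pose k x := Num.max (h x - g x) 0.
have mk : mble k.
  apply: measurable_maxr; last exact: measurable_cst.
  exact: measurable_funB.
have k0 x : 0 <= k x by rewrite le_max lexx orbT.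
have kf x : k x <= f x by rewrite ge_max f0 lerBlDr hfg.
have hkg x : h x <= k x + g x by rewrite -lerBlDr le_max lexx.
have lek : (eint (fun x => (k x)%:E) < +oo)%E.
  by apply: le_lt_trans ff; apply: le_eint => x; rewrite lee_fin.
apply: (@le_lt_trans _ _ (eint (fun x => (k x)%:E + (g x)%:E)%E)).
  by apply: le_eint => x; rewrite ?lee_fin// -EFinD lee_fin.
rewrite eintD; [exact: lte_add_pinfty|exact: mble_emble|exact: mble_emble| |];
  by move=> x; rewrite lee_fin.
Qed.

Lemma eint_omV_shift n (z : 'rV[R]_n) N : (2 * n <= N)%N ->
  eint (fun w => (om (w - z) ^- N)%:E) = (rint (fun w : 'rV[R]_n => om w ^- N))%:E.
Proof.
move=> nN; have := @eint_affine R n 1 (- z) (fun w => (om w ^- N)%:E) ltr01.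
rewrite expr1n mul1e => h.
rewrite (rint_EFin (intg_omV nN)) -h.
- by congr eint; apply/funext => w; rewrite scale1r.
- by apply: mble_emble; exact: mble_omV.
- by move=> w; rewrite lee_fin omV_ge0.
Qed.

Lemma mble_omV_shift n N (z : 'rV[R]_n) : mble (fun w => om (w - z) ^- N).
Proof.
have := @affine_mble R n 1 (- z) _ (@mble_omV R n N).
by rewrite /mble; under eq_fun do rewrite scale1r.
Qed.

(** The choice [l = X / J] turns the family of linear inequalities into the quadratic one;
    Cauchy-Schwarz is derived in this form in [kr_sqr]. *)
Lemma amgm_sqr (X J b : R) : 0 <= X -> 0 < J -> 0 <= b ->
  (forall l, 0 < l -> 2 * X <= l * J + l^-1 * b) -> X ^+ 2 <= J * b.
Proof.
move=> X0 J0 b0 h; have [->|Xn0] := eqVneq X 0; first by rewrite expr0n mulr_ge0// ltW.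
have Xp : 0 < X by rewrite lt_neqAle eq_sym Xn0.
have := h (X / J) (divr_gt0 Xp J0).
rewrite mulfVK ?gt_eqF// invf_div => h1.
have h2 : X <= J / X * b by move: h1; lra.
have : X * X <= X * (J / X * b) by rewrite ler_pM2l.
by rewrite mulrA [X * (J / X)]mulrC mulfVK ?gt_eqF// expr2.
Qed.

(** Cauchy-Schwarz for the density [om (w - z) ^- N], from the pointwise inequality
    [2 U <= l + U^2 / l]. The right side is an extended integral and may be infinite. *)
Lemma kr_sqr n N k K (U : 'rV[R]_n -> R) : mble U ->
  (forall w, 0 <= U w <= K * om w ^+ k) -> (2 * n + k <= N)%N ->
  exists2 J : R, 0 < J & forall z, (((kr N U z) ^+ 2)%:E <=
     J%:E * eint (fun w => (om (w - z) ^- N * U w ^+ 2)%:E))%E.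
Proof.
move=> mU hU kN.
have U0 w : 0 <= U w by case/andP: (hU w).
have nN : (2 * n <= N)%N := leq_trans (leq_addr _ _) kN.
pose I := rint (fun w : 'rV[R]_n => om w ^- N).
have I0 : 0 <= I by apply: rint_ge0 => w; exact: omV_ge0.
exists (I + 1); first by rewrite ltr_wpDl.
move=> z; have iU := intg_kr z mU hU kN.
have mU2 : emble (fun w => (om (w - z) ^- N * U w ^+ 2)%:E).
  apply: mble_emble; apply: measurable_funM; first exact: mble_omV_shift.
  exact: measurable_funX.
have U20 w : (0 <= (om (w - z) ^- N * U w ^+ 2)%:E)%E.
  by rewrite lee_fin mulr_ge0 ?omV_ge0 ?sqr_ge0.
have X0 : 0 <= kr N U z by apply: rint_ge0 => w; rewrite mulr_ge0 ?omV_ge0.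
have key (l : R) : 0 < l -> ((2 * kr N U z)%:E <=
    (l * I)%:E + l^-1%:E * eint (fun w => (om (w - z) ^- N * U w ^+ 2)%:E))%E.
  move=> l0.
  rewrite /kr -(rintZ 2 iU) (rint_EFin (intgZ 2 iU)).
  have -> : ((l * I)%:E + l^-1%:E * eint (fun w => (om (w - z) ^- N * U w ^+ 2)%:E))%E =
     eint (fun w => l%:E * (om (w - z) ^- N)%:E + l^-1%:E * (om (w - z) ^- N * U w ^+ 2)%:E)%E.
    rewrite eintD.
    - rewrite eintZl ?(ltW l0)//; first last.
      + by move=> w; rewrite lee_fin omV_ge0.
      + by apply: mble_emble; exact: mble_omV_shift.
      rewrite (eint_omV_shift z nN) -EFinM eintZl// invr_ge0 ltW//.
    - apply: (@mble_emble R n (fun w => l * om (w - z) ^- N)).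
      by apply: measurable_funM; [exact: measurable_cst|exact: mble_omV_shift].
    - apply: (@mble_emble R n (fun w => l^-1 * (om (w - z) ^- N * U w ^+ 2))).
      by apply: measurable_funM; [exact: measurable_cst|exact: (emble_mble mU2)].
    - by move=> w; rewrite -EFinM lee_fin mulr_ge0 ?omV_ge0// ltW.
    - by move=> w; rewrite mule_ge0// lee_fin invr_ge0 ltW.
  apply: le_eint => w; rewrite -?EFinM -?EFinD lee_fin.
    by rewrite mulr_ge0// mulr_ge0 ?omV_ge0.
  have -> : l * om (w - z) ^- N + l^-1 * (om (w - z) ^- N * U w ^+ 2) =
    om (w - z) ^- N * (l + l^-1 * U w ^+ 2) by ring.
  rewrite mulrCA ler_wpM2l ?omV_ge0//.
  rewrite -subr_ge0 (_ : _ - _ = l^-1 * (l - U w) ^+ 2).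
    by rewrite mulr_ge0 ?sqr_ge0// invr_ge0 ltW.
  by field; rewrite gt_eqF.
have B0 : (0 <= eint (fun w => (om (w - z) ^- N * U w ^+ 2)%:E))%E by exact: eint_ge0.
move: key B0; case: (eint _) => [b| |] key // B0; last first.
  by rewrite mulry gtr0_sg ?mul1e ?leey// ltr_wpDl.
rewrite -EFinM lee_fin; apply: amgm_sqr => //; first by rewrite ltr_wpDl.
move=> l l0; have := key l l0; rewrite -EFinM -EFinD lee_fin => /le_trans; apply.
by rewrite lerD2r ler_wpM2l ?lerDl// ltW.
Qed.

Lemma mble_omV_sub n N : mble (unc (fun z w : 'rV[R]_n => om (w - z) ^- N)).
Proof.
have m1 : mble (fun v : 'rV[R]_(n + n) => (1 + `|om (rsubmx v - lsubmx v) - 1|)^-1).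
  apply: continuous_mble.
  apply: (@rcont_comp _ _ (fun v => om (rsubmx v - lsubmx v)) (fun r => (1 + `|r - 1|)^-1)).
    apply: (rcont_lip (h := fun v => rsubmx v - lsubmx v)); last exact: rcont_om.
    by apply: lipD; [exact: lip_rsubmx|apply: lipN; exact: lip_lsubmx].
  move=> r; apply: (@cvgV _ _ _ _ (fun r => 1 + `|r - 1|)).
    by rewrite gt_eqF// ltr_wpDr.
  apply: cvgD; first exact: cvg_cst.
  by apply: cvg_norm; apply: cvgB; [exact: cvg_id|exact: cvg_cst].
have -> : unc (fun z w : 'rV[R]_n => om (w - z) ^- N) =
    (fun v => (1 + `|om (rsubmx v - lsubmx v) - 1|)^-1 ^+ N).
  apply/funext => v; rewrite /unc ger0_norm ?subr_ge0 ?om_ge1//.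
  by rewrite addrCA subrr addr0 exprVn.
exact: measurable_funX.
Qed.

Lemma mble_kr n N (U : 'rV[R]_n -> R) : mble U -> mble (kr N U).
Proof.
move=> mU; apply: (@mble_rint R n n (fun z w => om (w - z) ^- N * U w)).
apply: measurable_funM; first exact: mble_omV_sub.
exact: (mble_comp_rsub mU).
Qed.

(* For [w] in [G], Peetre's inequality moves the weight from [z] to [w]; for [w] outside
   [G], the distance [om (w - z)] dominates both [om z] and [om w]. *)
Lemma cone_kernel_bound n (G G' : set 'rV[R]_n) (C t : R) (T M : nat) : 1 <= C -> `|t| <= T%:R ->
  (forall z w, G' z -> ~ G w -> om z <= C * om (w - z)) ->
  forall z w, \1_G' z * (om z `^ t) ^+ 2 * om (w - z) ^- (2 * T + 4 * M + 2 * n) <=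
    C ^+ (2 * T + 2 * M) * om (w - z) ^- (2 * n) *
     (\1_G w * (om w `^ t) ^+ 2 + om w ^- (2 * M)).
Proof.
move=> C1 tT sep z w; set q := om (w - z).
have q1 : 1 <= q by exact: om_ge1.
have q0 : 0 < q by exact: om_gt0.
have qX j : 0 < q ^+ j by exact: exprn_gt0.
have CX j : 1 <= C ^+ j by exact: exprn_ege1.
have rhs0 : 0 <= C ^+ (2 * T + 2 * M) * q ^- (2 * n) *
     (\1_G w * (om w `^ t) ^+ 2 + om w ^- (2 * M)).
  apply: mulr_ge0; first by rewrite mulr_ge0 ?invr_ge0 ?(ltW (qX _))// (le_trans ler01).
  by rewrite addr_ge0 ?omV_ge0// mulr_ge0 ?indic_ge0 ?sqr_ge0.
have [/mem_set G'z|nG'z] := pselect (G' z); last first.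
  by rewrite [\1_G' z]indicE (negbTE (_ : z \notin G')) ?mul0r// notin_setE.
rewrite [\1_G' z]indicE G'z mul1r exprD invfM mulrA [leRHS]mulrAC.
rewrite ler_wpM2r ?invr_ge0 ?(ltW (qX _))//.
rewrite ler_pdivrMr//.
have tz : om z `^ t <= om w `^ t * q ^+ T.
  by have := om_peetre w (z - w) tT; rewrite subrK -(omN (z - w)) opprB.
have [/mem_set Gw|nGw] := pselect (G w).
  rewrite [\1_G w]indicE Gw mul1r.
  apply: (@le_trans _ _ ((om w `^ t) ^+ 2 * q ^+ (2 * T + 4 * M))).
    apply: (@le_trans _ _ ((om w `^ t * q ^+ T) ^+ 2)).
      by apply: lerXn2r; rewrite ?nnegrE ?mulr_ge0 ?powR_ge0 ?(ltW (qX _)).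
    rewrite exprMn -exprM mulnC ler_wpM2l ?sqr_ge0//.
    by apply: ler_weXn2l => //; rewrite leq_addr.
  rewrite ler_wpM2r ?(ltW (qX _))// -[leLHS]mul1r; apply: ler_pM; rewrite ?sqr_ge0//.
  by rewrite lerDl omV_ge0.
rewrite [\1_G w]indicE (negbTE (_ : w \notin G)) ?notin_setE// mul0r add0r.
have hz : om z <= C * q by exact: sep (set_mem G'z) nGw.
have hw : om w <= C * q ^+ 2.
  have := omB w z; rewrite -/q => /le_trans; apply.
  by rewrite mulrC expr2 mulrA ler_wpM2r// ltW.
have z1 : (om z `^ t) ^+ 2 <= C ^+ (2 * T) * q ^+ (2 * T).
  rewrite mulnC !exprM -exprMn; apply: lerXn2r; rewrite ?nnegrE ?powR_ge0//.
    by rewrite mulr_ge0 ?(ltW (qX _))// (le_trans ler01).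
  apply: le_trans (om_powR_nat _ (le_trans (ler_norm t) tT)) _.
  by rewrite -exprMn; apply: lerXn2r; rewrite ?nnegrE ?om_ge0 ?mulr_ge0 ?(ltW q0)// (le_trans ler01).
have w1 : 1 <= C ^+ (2 * M) * q ^+ (4 * M) * om w ^- (2 * M).
  rewrite ler_pdivlMr ?omX_gt0// mul1r.
  have -> : (4 * M = 2 * (2 * M))%N by rewrite mulnA.
  rewrite [q ^+ _]exprM -exprMn; apply: lerXn2r; rewrite ?nnegrE ?om_ge0//.
  by rewrite mulr_ge0 ?sqr_ge0// (le_trans ler01).
have := ler_pM (sqr_ge0 _) ler01 z1 w1; rewrite mulr1 => /le_trans; apply.
rewrite !exprD le_eqVlt; apply/orP; left; apply/eqP; ring.
Qed.

(** A Schur-type argument: after Cauchy-Schwarz, [cone_kernel_bound] moves weight and indicator from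
    [z] to [w], and Tonelli integrates the remaining kernel in [z]. Outside the cone only polynomial
    growth of [U] is available; the separation of the two cones pays for it. *)
Theorem reg_kr n k K (U : 'rV[R]_n -> R) t z0 : mble U ->
  (forall w, 0 <= U w <= K * om w ^+ k) -> reg U t z0 ->
  exists2 N, (2 * n + k <= N)%N & reg (kr N U) t z0.
Proof.
move=> mU hU [G [oG Gz0 hG]].
have U0 w : 0 <= U w by case/andP: (hU w).
have [G' [C [oG' G'z0 C1 sep]]] := cone_shrink oG Gz0.
pose T := (Num.truncn `|t|).+1.
have tT : `|t| <= T%:R by rewrite ltW// truncnS_gt.
(* [M] makes [om w ^- (2 * M) * U w ^+ 2] integrable. In [N], the part [2 * T] moves the weight,
   [4 * M] pays for [w] outside [G], where [om w <= C * om (w - z) ^+ 2], and [2 * n] is left for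
   integration. *)
pose M := (k + n)%N; pose N := (2 * T + 4 * M + 2 * n)%N.
have kN : (2 * n + k <= N)%N.
  by rewrite /N /M addnC leq_add2r (leq_trans _ (leq_addl _ _))// mulnDr (leq_trans _ (leq_addr _ _))// leq_pmull.
exists N => //.
have [J J0 hJ] := kr_sqr mU hU kN.
pose Cc := C ^+ (2 * T + 2 * M).
have Cc0 : 0 <= Cc by rewrite exprn_ge0// (le_trans ler01).
pose g w := \1_G w * (om w `^ t * U w) ^+ 2 + K ^+ 2 * om w ^- (2 * n).
have g0 w : 0 <= g w.
  by rewrite addr_ge0// mulr_ge0 ?indic_ge0 ?sqr_ge0 ?omV_ge0.
have oGG : open G by case: oG.
have mg1 : mble (fun w => \1_G w * (om w `^ t * U w) ^+ 2).
  by apply: measurable_funM; [exact: mble_indic|exact: mble_reg].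
have mg2 : mble (fun w : 'rV[R]_n => K ^+ 2 * om w ^- (2 * n)).
  by apply: measurable_funM; [exact: measurable_cst|exact: mble_omV].
have mg : mble g by exact: measurable_funD.
have fg : (eint (fun w => (g w)%:E) < +oo)%E.
  have -> : (fun w => (g w)%:E) = (fun w => (\1_G w * (om w `^ t * U w) ^+ 2)%:E +
      (K ^+ 2 * om w ^- (2 * n))%:E)%E by [].
  rewrite eintD.
  - apply: lte_add_pinfty => //.
    by rewrite -(rint_EFin (intgZ (K ^+ 2) (intg_omV (leqnn _)))) ltry.
  - exact: mble_emble.
  - exact: mble_emble.
  - by move=> w; rewrite lee_fin mulr_ge0 ?indic_ge0 ?sqr_ge0.
  - by move=> w; rewrite lee_fin mulr_ge0 ?omV_ge0 ?sqr_ge0.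
have kb z w : \1_G' z * (om z `^ t) ^+ 2 * (om (w - z) ^- N * U w ^+ 2) <=
    Cc * (om (w - z) ^- (2 * n) * g w).
  have := cone_kernel_bound M C1 tT sep z w; rewrite -/N -/Cc => h.
  rewrite mulrA; apply: le_trans (ler_wpM2r (sqr_ge0 _) h) _.
  rewrite -!mulrA; apply: ler_wpM2l => //; rewrite ler_wpM2l ?omV_ge0//.
  rewrite mulrDl /g; apply: lerD.
    by rewrite le_eqVlt; apply/orP; left; apply/eqP; ring.
  have /andP[_ h2] := hU w.
  apply: (@le_trans _ _ (om w ^- (2 * M) * (K * om w ^+ k) ^+ 2)).
    by rewrite ler_wpM2l ?omV_ge0//; apply: lerXn2r; rewrite ?nnegrE ?(le_trans (U0 w) h2).
  rewrite exprMn mulrCA ler_wpM2l ?sqr_ge0// /M mulnDr exprD invfM -exprM mulnC.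
  by rewrite mulrAC mulVf ?mul1r// gt_eqF// omX_gt0.
exists G'; split => //.
pose F (z w : 'rV[R]_n) := J * Cc * (om (w - z) ^- (2 * n) * g w).
have F0 z w : 0 <= F z w by rewrite !mulr_ge0 ?omV_ge0// ltW.
apply: (@le_lt_trans _ _ (eint (fun z => eint (fun w => (F z w)%:E)))).
  apply: le_eint => z; first by rewrite lee_fin mulr_ge0 ?indic_ge0 ?sqr_ge0.
  have c0 : 0 <= \1_G' z * (om z `^ t) ^+ 2 by rewrite mulr_ge0 ?indic_ge0 ?sqr_ge0.
  rewrite exprMn mulrA EFinM.
  apply: le_trans (lee_wpmul2l _ (hJ z)) _; first by rewrite lee_fin.
  rewrite muleA -EFinM -eintZl; first last.
  - by rewrite mulr_ge0// ltW.
  - by move=> w; rewrite lee_fin mulr_ge0 ?omV_ge0 ?sqr_ge0.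
  - apply: mble_emble; apply: measurable_funM; first exact: mble_omV_shift.
    exact: measurable_funX.
  apply: le_eint => w; rewrite -EFinM lee_fin.
    apply: mulr_ge0; first exact: mulr_ge0 c0 (ltW J0).
    by rewrite mulr_ge0 ?omV_ge0 ?sqr_ge0.
  by rewrite [_ * J]mulrC -[J * _ * _]mulrA -[leRHS]mulrA ler_pM2l.
have mF : mble (unc F).
  apply: measurable_funM; first exact: measurable_cst.
  by apply: measurable_funM; [exact: mble_omV_sub|exact: (mble_comp_rsub mg)].
rewrite (eint_swap (mble_emble mF)); last by move=> z w; rewrite lee_fin.
pose I := rint (fun z : 'rV[R]_n => om z ^- (2 * n)).
have I0 : 0 <= I by apply: rint_ge0 => z; exact: omV_ge0.
have -> : (fun w => eint (fun z => (F z w)%:E)) = (fun w => (J * Cc * I)%:E * (g w)%:E)%E.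
  apply/funext => w.
  have -> : (fun z => (F z w)%:E) = (fun z => (J * Cc * g w)%:E * (om (z - w) ^- (2 * n))%:E)%E.
    apply/funext => z; rewrite -EFinM /F -(omN (z - w)) opprB; congr _%:E; ring.
  rewrite eintZl; first by rewrite (eint_omV_shift w (leqnn _)) -/I -!EFinM; congr _%:E; ring.
  - by apply: mble_emble; exact: mble_omV_shift.
  - by move=> z; rewrite lee_fin omV_ge0.
  - by rewrite !mulr_ge0// ltW.
rewrite eintZl.
- have gge : (0 <= eint (fun w => (g w)%:E))%E by apply: eint_ge0 => w; rewrite lee_fin.
  by move: fg gge; case: (eint _) => // r _ _; rewrite -EFinM ltry.
- exact: mble_emble.
- by move=> w; rewrite lee_fin.
- by rewrite !mulr_ge0// ltW.
Qed.

End Cones.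

(** * Transfer of regularity and the bootstrap *)

Section Bootstrap.
Context {R : realType}.
Variables (n : nat) (V U W A : 'rV[R]_n -> R) (kV kU : nat) (KV KU m s : R).
Hypotheses (mV : mble V) (hV : forall w, 0 <= V w <= KV * om w ^+ kV).
Hypotheses (mU : mble U) (hU : forall w, 0 <= U w <= KU * om w ^+ kU).
Hypothesis W0 : forall w, 0 <= W w.
Hypothesis est0 : forall N, (2 * n + kV <= N)%N ->
  exists2 K : R, 0 <= K & forall z, U z <= K * kr N V z.

Let V0 w : 0 <= V w. Proof. by case/andP: (hV w). Qed.
Let U0 w : 0 <= U w. Proof. by case/andP: (hU w). Qed.

Lemma om_powRD (z : 'rV[R]_n) (r r' : R) : om z `^ r * om z `^ r' = om z `^ (r + r').
Proof. by rewrite powRD//; apply/implyP => _; rewrite gt_eqF ?om_gt0. Qed.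

Lemma kr_ge0 N (F : 'rV[R]_n -> R) z : (forall w, 0 <= F w) -> 0 <= kr N F z.
Proof. by move=> F0; apply: rint_ge0 => w; rewrite mulr_ge0 ?omV_ge0. Qed.

(** Two convolutions occur: [est0] bounds [U] by a convolution of [V], and the operator estimates
    involve a convolution of [U]. *)
Lemma reg_kr_kr t z0 : reg V t z0 ->
  exists2 N, (2 * n + kU <= N)%N & reg (kr N U) t z0.
Proof.
move=> rV; have [N1 hN1 r1] := reg_kr mV hV rV.
have [K K0 hK] := est0 hN1.
have rU : reg U t z0.
  apply: (@reg_le R n U (fun z => K * kr N1 V z) t t) => //.
    by move=> z; rewrite ler_wpM2l ?powR_ge0.
  by apply: regZ r1; exact: mble_kr.
exact: reg_kr mU hU rU.
Qed.

Lemma reg_forward z0 (c : R) : (forall N, (2 * n + kU <= N)%N ->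
    exists2 K : R, 0 <= K & forall z, W z <= K * om z `^ m * kr N U z) ->
  0 <= c -> reg V s z0 -> reg (fun z => c * W z) (s - m) z0.
Proof.
move=> est1 c0 rV; have [N hN r] := reg_kr_kr rV.
have [K K0 hK] := est1 N hN.
apply: (@reg_le R n _ (fun z => (c * K) * kr N U z) (s - m) s).
- by move=> z; rewrite mulr_ge0.
- move=> z; apply: (@le_trans _ _ (om z `^ (s - m) * (c * (K * om z `^ m * kr N U z)))).
    by rewrite ler_wpM2l ?powR_ge0// ler_wpM2l.
  have -> : om z `^ s = om z `^ (s - m) * om z `^ m.
    by rewrite om_powRD subrK.
  by rewrite le_eqVlt; apply/orP; left; apply/eqP; ring.
- by apply: regZ r; exact: mble_kr.
Qed.

(** Against growth of exponent [kV], the weight leaves [om z ^- n], which is square integrable on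
    the whole punctured space. This is the start of the induction. *)
Lemma reg_low t z0 : z0 <> 0 -> t <= - (kV + n)%:R -> reg V t z0.
Proof.
move=> z00 tk; exists [set z | z <> 0]; split => //.
  split => //.
    apply/open_normP => x /= x0; exists `|x|; first by rewrite normr_gt0; apply/eqP.
    by move=> y; case: (eqVneq y 0) => [->|/eqP//]; rewrite sub0r normrN ltxx.
  move=> l z l0 /= z0'; apply/eqP; rewrite scaler_eq0 negb_or gt_eqF//; exact/eqP.
apply: (@le_lt_trans _ _ (eint (fun z : 'rV[R]_n => (KV ^+ 2 * om z ^- (2 * n))%:E))).
  apply: le_eint => z; rewrite lee_fin; first by rewrite mulr_ge0 ?indic_ge0 ?sqr_ge0.
  have h : om z `^ t * V z <= KV * om z ^- n.
    have /andP[_ h2] := hV z.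
    apply: (@le_trans _ _ (om z ^- (kV + n) * (KV * om z ^+ kV))).
      apply: ler_pM; rewrite ?powR_ge0//.
      by rewrite (le_trans (om_powR_le z tk))// powRN powR_mulrn ?om_ge0.
    rewrite mulrCA exprD invfM mulrAC mulVf ?mul1r// gt_eqF ?omX_gt0//.
  apply: (@le_trans _ _ ((om z `^ t * V z) ^+ 2)).
    by rewrite ler_piMl ?sqr_ge0// indicE; case: (_ \in _).
  have -> : KV ^+ 2 * om z ^- (2 * n) = (KV * om z ^- n) ^+ 2.
    by rewrite exprMn exprVn -exprM mulnC.
  have p0 : 0 <= om z `^ t * V z by rewrite mulr_ge0 ?powR_ge0.
  by apply: lerXn2r => //; rewrite nnegrE // (le_trans p0 h).
by rewrite -(rint_EFin (intgZ (KV ^+ 2) (intg_omV (leqnn _)))) ltry.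
Qed.

Hypothesis est2 : forall N, (2 * n + kU <= N)%N ->
  exists2 K : R, 0 <= K & forall z, A z * V z <= K * (W z + om z `^ (m - 1) * kr N U z).

(* The error term has order [m - 1], hence a gain of one order. *)
Lemma reg_step t t' z0 (G : set 'rV[R]_n) (C0 A0 : R) :
  open_cone G -> G z0 -> 0 < C0 ->
  (forall z, G z -> A0 <= `|z| -> C0 * om z `^ m <= A z) ->
  reg W (s - m) z0 -> t' <= s -> t' <= t + 1 -> reg V t z0 -> reg V t' z0.
Proof.
move=> oG Gz0 C00 ell [GW [oGW GWz0 fW]] ts tt rV.
have [N hN [Gk [oGk Gkz0 fk]]] := reg_kr_kr rV.
have [K K0 hK] := est2 hN.
(* The cone on which ellipticity, the regularity of [W] and that of the error term hold together. *)
pose H := G `&` (GW `&` Gk).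
have oH : open_cone H by apply: open_coneI => //; exact: open_coneI.
have HG z : H z -> G z by case.
have HW z : H z -> GW z by case=> _ [].
have Hk z : H z -> Gk z by case=> _ [].
exists H; split => //.
pose X z := om z `^ (s - m) * W z; pose Y z := om z `^ t * kr N U z.
have X0 z : 0 <= X z by rewrite mulr_ge0 ?powR_ge0.
have Y0 z : 0 <= Y z by rewrite mulr_ge0 ?powR_ge0 ?kr_ge0.
pose K1 := K / C0.
have K10 : 0 <= K1 by rewrite divr_ge0// ltW.
(* Multiplied by [om z ^ (t' - m)], the estimate has its error term at the order [t' - 1 <= t],
   where regularity is already known. *)
have big z : H z -> A0 <= `|z| -> om z `^ t' * V z <= K1 * (X z + Y z).
  move=> Hz zA; have := ell z (HG z Hz) zA => h1.
  have h2 : C0 * om z `^ m * V z <= K * (W z + om z `^ (m - 1) * kr N U z).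
    by apply: le_trans (hK z); rewrite ler_wpM2r.
  have e1 (r r' : R) : om z `^ r * om z `^ r' = om z `^ (r + r') := om_powRD z r r'.
  have h3 : C0 * (om z `^ t' * V z) <= K * (om z `^ (t' - m) * W z + om z `^ (t' - 1) * kr N U z).
    have -> : om z `^ t' = om z `^ (t' - m) * om z `^ m by rewrite e1 subrK.
    have -> : om z `^ (t' - 1) = om z `^ (t' - m) * om z `^ (m - 1) by rewrite e1 addrA subrK.
    have := ler_wpM2l (powR_ge0 (om z) (t' - m)) h2.
    by congr (_ <= _); ring.
  rewrite -(ler_pM2l C00).
  have -> : C0 * (K1 * (X z + Y z)) = K * (X z + Y z) by rewrite /K1; field; rewrite gt_eqF.
  apply: le_trans h3 _; rewrite ler_wpM2l//; apply: lerD.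
    by rewrite ler_wpM2r// om_powR_le// lerD2r.
  by rewrite ler_wpM2r ?kr_ge0// om_powR_le// lerBlDr.
pose A1 := 1 + `|A0|.
have A11 : 1 <= A1 by rewrite lerDl.
pose T := (Num.truncn `|t'|).+1.
have tT : t' <= T%:R by rewrite (le_trans (ler_norm _))// ltW// truncnS_gt.
have KV0 : 0 <= KV.
  by have /andP[h1 h2] := hV 0; have := le_trans h1 h2; rewrite pmulr_lge0// omX_gt0.
pose B := (A1 ^+ T * (KV * A1 ^+ kV)) ^+ 2 * A1 ^+ (2 * n).
have A1X j : 0 <= A1 ^+ j by rewrite exprn_ge0// (le_trans ler01).
have B0 : 0 <= B by rewrite mulr_ge0 ?sqr_ge0.
(* Ellipticity says nothing for [|z| < A0]. There all weights are bounded by powers of [A1], and the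
   decaying factor is inserted to obtain a majorant integrable on all of R^n. *)
have small z : `|z| < A0 -> (om z `^ t' * V z) ^+ 2 <= B * om z ^- (2 * n).
  move=> zA; have oA : om z <= A1 by rewrite /om /A1 lerD2l (le_trans (ltW zA))// ler_norm.
  have oX j : om z ^+ j <= A1 ^+ j by apply: lerXn2r; rewrite ?nnegrE ?om_ge0 ?(le_trans ler01).
  rewrite ler_pdivlMr ?omX_gt0//; apply: ler_pM; rewrite ?sqr_ge0 ?exprn_ge0 ?om_ge0//.
  apply: lerXn2r; rewrite ?nnegrE ?mulr_ge0 ?powR_ge0//.
  apply: ler_pM; rewrite ?powR_ge0//; first exact: le_trans (om_powR_nat z tT) (oX T).
  by have /andP[_ h2] := hV z; apply: le_trans h2 _; rewrite ler_wpM2l.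
(* The constant is put on [h] and not on [f]: rescaling an integral requires measurability, which is
   not known for [W] and hence not for [f]. *)
pose c := (2 * K1 ^+ 2 + 1)^-1.
have c'0 : 0 < 2 * K1 ^+ 2 + 1 by rewrite ltr_wpDl// mulr_ge0 ?sqr_ge0.
have c0 : 0 < c by rewrite invr_gt0.
pose f z := \1_GW z * X z ^+ 2.
pose g z := \1_Gk z * Y z ^+ 2 + B * om z ^- (2 * n).
pose h z := \1_H z * (om z `^ t' * V z) ^+ 2.
have mh : mble h.
  by apply: measurable_funM; [apply: mble_indic; case: oH|exact: mble_reg].
have h0 z : 0 <= h z by rewrite mulr_ge0 ?indic_ge0 ?sqr_ge0.
have mg1 : mble (fun z => \1_Gk z * Y z ^+ 2).
  apply: measurable_funM; first by apply: mble_indic; case: oGk.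
  by apply: mble_reg; exact: mble_kr.
have mg2 : mble (fun z : 'rV[R]_n => B * om z ^- (2 * n)).
  by apply: measurable_funM; [exact: measurable_cst|exact: mble_omV].
have mg : mble g by exact: measurable_funD.
have g10 z : 0 <= \1_Gk z * Y z ^+ 2 by rewrite mulr_ge0 ?indic_ge0 ?sqr_ge0.
have g20 (z : 'rV[R]_n) : 0 <= B * om z ^- (2 * n) by rewrite mulr_ge0 ?omV_ge0.
have fg : (eint (fun z => (g z)%:E) < +oo)%E.
  have -> : (fun z => (g z)%:E) = (fun z => (\1_Gk z * Y z ^+ 2)%:E + (B * om z ^- (2 * n))%:E)%E by [].
  rewrite eintD; [|exact: mble_emble|exact: mble_emble|by move=> z; rewrite lee_fin|by move=> z; rewrite lee_fin].
  apply: lte_add_pinfty => //.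
  by rewrite -(rint_EFin (intgZ B (intg_omV (leqnn _)))) ltry.
have key z : c * h z <= f z + g z.
  have f0 : 0 <= f z by rewrite mulr_ge0 ?indic_ge0 ?sqr_ge0.
  rewrite mulrC ler_pdivrMr// /h; have [Hz|nHz] := pselect (H z); last first.
    rewrite [\1_H z]indicE (negbTE (_ : z \notin H)) ?notin_setE// mul0r.
    by rewrite mulr_ge0 ?(ltW c'0)// addr_ge0// addr_ge0.
  rewrite [\1_H z]indicE (mem_set Hz) mul1r.
  have fE : f z = X z ^+ 2 by rewrite /f indicE (mem_set (HW z Hz)) mul1r.
  have gE : g z = Y z ^+ 2 + B * om z ^- (2 * n) by rewrite /g indicE (mem_set (Hk z Hz)) mul1r.
  rewrite fE gE; have [zA|zA] := leP A0 `|z|; last first.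
    apply: le_trans (small z zA) _.
    have := g20 z; set b := B * _ => b0; have := sqr_ge0 (X z); have := sqr_ge0 (Y z); have := sqr_ge0 K1.
    nra.
  have b1 := big z Hz zA.
  have : (om z `^ t' * V z) ^+ 2 <= (K1 * (X z + Y z)) ^+ 2.
    apply: lerXn2r => //; rewrite nnegrE; first by rewrite mulr_ge0 ?powR_ge0.
    by rewrite mulr_ge0// addr_ge0.
  move=> /le_trans; apply; rewrite exprMn.
  have := g20 z; set b := B * _ => b0.
  apply: (@le_trans _ _ (K1 ^+ 2 * (2 * (X z ^+ 2 + Y z ^+ 2)))).
    by rewrite ler_wpM2l ?sqr_ge0//; have := sqr_ge0 (X z - Y z); nra.
  have := sqr_ge0 (X z); have := sqr_ge0 (Y z); have := sqr_ge0 K1; nra.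
have fin : (eint (fun z => (c * h z)%:E) < +oo)%E.
  apply: (@eint_le_add R n f g) => //.
  - by apply: measurable_funM; [exact: measurable_cst|].
  - by move=> z; rewrite mulr_ge0 ?indic_ge0 ?sqr_ge0.
  - by move=> z; rewrite addr_ge0.
  - by move=> z; rewrite mulr_ge0// ltW.
have hE : eint (fun z => (h z)%:E) = (c^-1%:E * eint (fun z => (c * h z)%:E))%E.
  rewrite -eintZl.
  - by congr eint; apply/funext => z; rewrite -EFinM mulrA mulVf ?mul1r// gt_eqF.
  - by apply: mble_emble; apply: measurable_funM; [exact: measurable_cst|].
  - by move=> z; rewrite lee_fin mulr_ge0// ltW.
  - by rewrite invr_ge0 ltW.
rewrite hE; have : (0 <= eint (fun z => (c * h z)%:E))%E.
  by apply: eint_ge0 => z; rewrite lee_fin mulr_ge0// ltW.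
by move: fin; case: (eint _) => // r _ _; rewrite -EFinM ltry.
Qed.

Theorem reg_backward z0 (G : set 'rV[R]_n) (C0 A0 : R) :
  open_cone G -> G z0 -> 0 < C0 ->
  (forall z, G z -> A0 <= `|z| -> C0 * om z `^ m <= A z) ->
  reg W (s - m) z0 -> reg V s z0.
Proof.
move=> oG Gz0 C00 ell rW.
have z00 : z0 <> 0 by case: oG => _ _; apply.
pose t0 : R := - (kV + n)%:R.
(* Each step gains one order, truncated at [s] because the regularity of [W] is given at the
   matching order [s - m] only. *)
have all j : reg V (Num.min s (t0 + j%:R)) z0.
  elim: j => [|j IH]; first by apply: reg_low => //; rewrite addr0 ge_min lexx orbT.
  apply: (reg_step oG Gz0 C00 ell rW _ _ IH); first by rewrite ge_min lexx.
  rewrite -natr1 addrA addr_minl le_min !ge_min lexx orbT andbT.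
  by rewrite lerDl ler01.
have := all (Num.truncn (s - t0)).+1.
rewrite (_ : Num.min _ _ = s)//; apply/min_idPl.
by rewrite -lerBlDl ltW// truncnS_gt.
Qed.

End Bootstrap.

(** * Wave front sets *)

Section WaveFront.
Context {R : realType}.
Notation C := R[i].
Notation nc := (@Normc.normc R).

Lemma integralV_indic n (G : set 'rV[R]_n) (f : 'rV[R]_n -> R) :
  integralV G (fun z => (f z)%:E) = eint (fun z => (\1_G z * f z)%:E).
Proof.
rewrite /integralV integral_mkcond; apply: eq_integral => t _.
rewrite /patch indicE; have -> : (t \in @row_of R n @^-1` G) = (row_of t \in G).
  by apply/idP/idP => /set_mem/mem_set.
case: (_ \in _); first by rewrite mul1r.
by rewrite mul0r.
Qed.

Definition l2_cone n (F : 'rV[R]_n -> R) (s : R) (z0 : 'rV[R]_n) : Prop :=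
  exists G : set 'rV[R]_n, [/\ open_cone G, G z0 &
    (integralV G (fun z => (bracket z `^ (2 * s) * F z ^+ 2)%:E) < +oo)%E].

Lemma bracket_sqr n (z : 'rV[R]_n) s (y : R) :
  bracket z `^ (2 * s) * y ^+ 2 = (bracket z `^ s * y) ^+ 2.
Proof. by rewrite exprMn mulrC [2 * s]mulrC powRrM powR_mulrn ?powR_ge0// mulrC. Qed.

(** The constant comparing [bracket] with [om] stays inside the function, since integrals of a
    possibly nonmeasurable [F] are compared by monotonicity alone. For the same reason the converse
    [reg_l2_cone] asks for all nonnegative multiples. *)
Lemma l2_cone_reg n (F : 'rV[R]_n -> R) s z0 : (forall z, 0 <= F z) ->
  l2_cone F s z0 -> exists2 c : R, 0 < c & reg (fun z => c * F z) s z0.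
Proof.
move=> F0 [G [oG Gz0 hG]]; have [K K0 hK] := @bracket_powR_le R n s.
exists K^-1; first by rewrite invr_gt0.
exists G; split => //; apply: le_lt_trans hG; rewrite integralV_indic.
apply: le_eint => z; rewrite lee_fin; first by rewrite mulr_ge0 ?indic_ge0 ?sqr_ge0.
rewrite bracket_sqr ler_wpM2l ?indic_ge0//.
apply: lerXn2r; rewrite ?nnegrE ?mulr_ge0 ?powR_ge0 ?invr_ge0 ?(ltW K0)//.
rewrite mulrCA mulrA ler_wpM2r// mulrC ler_pdivrMr// mulrC.
exact: (hK z).2.
Qed.

Lemma reg_l2_cone n (F : 'rV[R]_n -> R) s z0 : (forall z, 0 <= F z) ->
  (forall c, 0 <= c -> reg (fun z => c * F z) s z0) -> l2_cone F s z0.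
Proof.
move=> F0 h; have [K K0 hK] := @bracket_powR_le R n s.
have [G [oG Gz0 hG]] := h K (ltW K0); exists G; split => //.
apply: le_lt_trans hG; rewrite integralV_indic.
apply: le_eint => z; rewrite lee_fin bracket_sqr; first by rewrite mulr_ge0 ?indic_ge0 ?sqr_ge0.
rewrite ler_wpM2l ?indic_ge0//.
apply: lerXn2r; rewrite ?nnegrE ?mulr_ge0 ?powR_ge0 ?(ltW K0)//.
by rewrite mulrCA mulrA ler_wpM2r//; exact: (hK z).1.
Qed.

(** The sup norm is at most the Euclidean norm, so the threshold [A0] carries over; the factor [K]
    converts [bracket] to [om]. *)
Lemma noncharacteristic_bound d (m : R) (a : 'rV[R]_(d + d) -> C) z0 :
  noncharacteristic m a z0 -> exists (G : set 'rV[R]_(d + d)) (C0 A0 : R),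
  [/\ open_cone G, G z0, 0 < C0 & forall z, G z -> A0 <= `|z| -> C0 * om z `^ m <= nc (a z)].
Proof.
move=> [G [C0 [A0 [Cd [oG Gz0 C00 A00 [_ h]]]]]].
have [K K0 hK] := @bracket_powR_le R (d + d) m.
exists G, (C0 / K), A0; split => //; first by rewrite divr_gt0.
move=> z Gz Az; have zA : A0 <= enorm z.
  apply: le_trans Az _; apply: le_of_sqr; first exact: sqrtr_ge0.
  by rewrite enorm_sqr norm_sqr_le.
have [h1 _] := h z Gz zA; apply: le_trans h1.
by rewrite -mulrA ler_wpM2l ?(ltW C00)// mulrC ler_pdivrMr// mulrC; exact: (hK z).2.
Qed.

Variables (n k kU : nat) (V U W A : 'rV[R]_n -> R) (KV KU m s c : R).

(** [V] and [W] stand for the transforms of [u] and of its image, [A] for the modulus of the symbol.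
    [U] is [V] itself for the Weyl quantization and the transform of [u] with window [psi0] for the
    localization operator. *)
Theorem microlocal_transfer z0 : mble V -> (forall w, 0 <= V w <= KV * om w ^+ k) ->
  mble U -> (forall w, 0 <= U w <= KU * om w ^+ kU) -> (forall w, 0 <= W w) -> 0 < c ->
  (forall N, (2 * n + k <= N)%N -> exists2 K : R, 0 <= K & forall z, U z <= K * kr N V z) ->
  (forall N, (2 * n + kU <= N)%N -> exists2 K : R, 0 <= K & forall z,
     W z <= K * om z `^ m * kr N U z /\
     c * A z * V z <= W z + K * om z `^ (m - 1) * kr N U z) ->
  (l2_cone V s z0 -> l2_cone W (s - m) z0) /\
  ((exists (G : set 'rV[R]_n) (C0 A0 : R), [/\ open_cone G, G z0, 0 < C0 &
      forall z, G z -> A0 <= `|z| -> C0 * om z `^ m <= A z]) ->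
   l2_cone W (s - m) z0 -> l2_cone V s z0).
Proof.
move=> mV hV mU hU W0 c0 est0 est.
have V0 w : 0 <= V w by case/andP: (hV w).
have U0 w : 0 <= U w by case/andP: (hU w).
split.
  move=> /(l2_cone_reg V0)[e e0 r].
  have {}r : reg V s z0.
    have := regZ e^-1 (_ : mble (fun z => e * V z)) r => h.
    have {}h := h (measurable_funM (measurable_cst e) mV).
    have E : (fun z => e^-1 * (e * V z)) = V.
      by apply/funext => z; rewrite mulrA mulVf ?mul1r// gt_eqF.
    by rewrite E in h.
  apply: reg_l2_cone => // e' e'0.
  apply: (reg_forward mV hV mU hU W0 est0 _ e'0 r) => N hN.
  by have [K K0 hK] := est N hN; exists K => // z; exact: (hK z).1.
move=> [G [C0 [A0 [oG Gz0 C00 ell]]]] /(l2_cone_reg W0)[e e0 r].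
apply: reg_l2_cone => // e' e'0; apply: regZ => //.
(* [W] enters with the factor [e] left by [l2_cone_reg]; the summand [e^-1] in the constant below
   compensates it. *)
apply: (reg_backward (W := fun z => e * W z) mV hV mU hU _ est0 _ oG Gz0 C00 ell r).
  by move=> w; rewrite mulr_ge0// ltW.
move=> N hN; have [K K0 hK] := est N hN.
have ei : 0 <= e^-1 by rewrite invr_ge0 ltW.
exists ((e^-1 + K) / c); first by rewrite divr_ge0 ?addr_ge0// ltW.
move=> z; have [_ h] := hK z.
have kr0 : 0 <= om z `^ (m - 1) * kr N U z by rewrite mulr_ge0 ?powR_ge0 ?kr_ge0.
rewrite mulrAC ler_pdivlMr// mulrC mulrA; apply: le_trans h _.
rewrite mulrDr; apply: lerD.
  by rewrite mulrDl mulrA mulVf ?gt_eqF// mul1r lerDl !mulr_ge0 ?W0 // ltW.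
by rewrite -mulrA ler_wpM2r// lerDr invr_ge0 ltW.
Qed.

End WaveFront.

Unset Implicit Arguments.

Theorem corollary4p3 (R : realType) (d : nat)
    (phi : 'rV[R]_d -> R[i]) (phi_schwartz : schwartz phi)
    (phi_neq0 : exists x, phi x <> 0)
    (u : ('rV[R]_d -> R[i]) -> R[i]) (u_tempered : tempered u)
    (m s : R) (a : 'rV[R]_(d + d) -> R[i]) (a_shubin : shubin m a) :
  (WF phi (s - m) (weyl a u) `<=` WF phi s u /\
   WF phi s u `<=` WF phi (s - m) (weyl a u) `|` char_set m a) /\
  (WF phi (s - m) (localization a u) `<=` WF phi s u /\
   WF phi s u `<=` WF phi (s - m) (localization a u) `|` char_set m a).
Proof.
(* Passage to complements: the two inclusions for an image [v] of [u] are two implications between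
   regularity statements at each point. *)
have transfer v : (forall z0, (l2_cone (fun z => Normc.normc (stft phi u z)) s z0 ->
      l2_cone (fun z => Normc.normc (stft phi v z)) (s - m) z0) /\
    (noncharacteristic m a z0 -> l2_cone (fun z => Normc.normc (stft phi v z)) (s - m) z0 ->
      l2_cone (fun z => Normc.normc (stft phi u z)) s z0)) ->
    WF phi (s - m) v `<=` WF phi s u /\
    WF phi s u `<=` WF phi (s - m) v `|` char_set m a.
  move=> h; split => z0 [z00 hz].
    by split => // hu; apply: hz; exact: (h z0).1 hu.
  have [nch|] := pselect (noncharacteristic m a z0); last by right.
  by left; split => // hv; apply: hz; exact: (h z0).2 nch hv.
have mV := cmble_nc (ccont_cmble (ccont_stft u_tempered phi_schwartz)).
have [KV _ [k hk]] := stft_bound u_tempered phi_schwartz.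
have hV w : 0 <= Normc.normc (stft phi u w) <= KV * om w ^+ k by rewrite nc_ge0 hk.
split; apply: transfer => z0.
- have [c c0 est] := weyl_est phi_schwartz phi_neq0 u_tempered a_shubin.
  have [h1 h2] := @microlocal_transfer R (d + d) k k _ _
    (fun z => Normc.normc (stft phi (weyl a u) z)) (fun z => Normc.normc (a z)) KV KV m s c z0
    mV hV mV hV (fun=> nc_ge0 _) c0
    (fun N hN => stft_window_est phi_schwartz phi_neq0 phi_schwartz u_tempered hk hN)
    (fun N hN => est k KV N hk hN).
  by split => // /noncharacteristic_bound.
- have [c c0 est] := localization_est phi_schwartz u_tempered a_shubin.
  have mU := cmble_nc (ccont_cmble (ccont_stft u_tempered (@schwartz_psi0 R d))).
  have [KU _ [kU hkU]] := stft_bound u_tempered (@schwartz_psi0 R d).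
  have hU w : 0 <= Normc.normc (stft psi0 u w) <= KU * om w ^+ kU by rewrite nc_ge0 hkU.
  have [h1 h2] := @microlocal_transfer R (d + d) k kU _ _
    (fun z => Normc.normc (stft phi (localization a u) z)) (fun z => Normc.normc (a z)) KV KU m s c z0
    mV hV mU hU (fun=> nc_ge0 _) c0
    (fun N hN => stft_window_est phi_schwartz phi_neq0 (@schwartz_psi0 R d) u_tempered hk hN)
    (fun N hN => est kU KU N hkU hN).
  by split => // /noncharacteristic_bound.
Qed.
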